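(* Let $f=(f(n,m,k))_{(n,m,k)}\in\prod_{(n,m,k)\in HSP}\mathbb{Z}$. Then $ST(f):=ZPT\oplus UFM(f)$ is a spectral triple for $C(SP)$; the metric it induces on $SP$ is the geodesic distance, and the element of $K^1(C(SP))\cong\prod_{(n,m,k)\in HSP}\mathbb{Z}$ it induces is $(f(n,m,k))_{(n,m,k)}$.
   Context: Pyramid. Let $P_0$ be a solid regular tetrahedron of side length $2\pi/3$ in $\mathbb{R}^3$ with one horizontal face and one vertex pointing upwards. $P_n$ is obtained from $P_{n-1}$ by replacing each of its $4^{n-1}$ solid tetrahedra $P_{n-1,m}$ ($1\le m\le 4^{n-1}$, side length $2^{-(n-1)}$ times that of $P_0$) by the four corner tetrahedra of half the side length, i.e. by cutting out an octahedron. The Sierpinski pyramid is $SP=\bigcap_n P_n$. The boundaries of the four faces of $P_0$ (perimeter $2\pi$) are $\Delta_{0,k}$, $1\le k\le4$. For $n\ge1$, $1\le m\le4^{n-1}$, the boundaries of the eight faces of the octahedron cut out of $P_{n-1,m}$ are $\Delta_{n,m,k}$, $1\le k\le 8$ (perimeter $2^{1-n}\pi$): $k=1,2,3$ are the boundaries of the holes created in the oblique (non-horizontal) faces of $P_{n-1,m}$, $k=4$ that of the hole in the horizontal face, $k=5,\dots,8$ those of the remaining faces of the octahedron. The triangles $\Delta_{0,k}$ are oriented as boundaries of the faces of $P_0$ oriented by the outer normal of $P_0$; the triangles $\Delta_{n,m,k}$ as boundaries of the faces of the octahedron oriented by the outer normal of the octahedron. $HSP=\{(n,m,k):n\in\mathbb{N},\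 m=1,\dots,4^{n-1},\ k=1,2,3\}$. The geodesic distance on $SP$ is the infimum of lengths of rectifiable curves in $SP$ joining two points. Unbounded Fredholm modules. An unbounded Fredholm module over a unital C*-algebra $\mathcal{A}$ is a Hilbert space $H$ with a unital representation $\pi$ of $\mathcal{A}$ and an unbounded selfadjoint operator $D$ on $H$ with $(I+D^2)^{-1}$ compact and such that the set of $a\in \mathcal{A}$ for which $[D,\pi(a)]$ is densely defined and extends to a bounded operator is dense in $\mathcal{A}$. It is called a spectral triple if $\pi$ is faithful. For $\mathcal{A}=C(X)$ the induced metric is $d(x,y)=\sup\{|a(x)-a(y)| : a\in C(X),\ \|[D,\pi(a)]\|\le 1\}$. For an oriented triangle $T\subset SP$ of perimeter $2\pi r$, let $\rho:[-\pi r,\pi r]\to T$ be its closed arc-length parametrization in the given orientation. $UFM(T)$ is the module over $C(SP)$ with $H=L^2([-\pi r,\pi r],\tfrac{dx}{2\pi r})$, $\pi(a)\xi(x)=a(\rho(x))\xi(x)$, and $D$ the selfadjoint operator with $D e^{ilx/r}=\tfrac{1}{r}(l+\tfrac12)e^{ilx/r}$, $l\in\mathbb{Z}$. $\overline{UFM(T)}$ is the same with reversed orientation. Direct sums. $ZPT:=\bigoplus_{k=1}^4UFM(\Delta_{0,k})\oplus\bigoplus_{n=1}^\infty\bigoplus_{m=1}^{4^{n-1}}\bigoplus_{k=1}^8UFM(\Delta_{n,m,k})$. $UFM(f)$ is the direct sum over all $(n,m,k)\in HSP$ with $f(n,m,k)\neq0$ of $f(n,m,k)$ copies of $UFM(\Delta_{n,m,k})$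 if $f(n,m,k)>0$, and of $-f(n,m,k)$ copies of $\overline{UFM(\Delta_{n,m,k})}$ if $f(n,m,k)<0$. K-homology. An unbounded Fredholm module $(H,D)$ defines the bounded Fredholm module $(H,F)$, $F=2P-I$, $P$ the spectral projection of $D$ for $[0,\infty)$. Its class in $K^1(C(SP))$ is identified, via the isomorphism $K^1(C(SP))\cong\mathrm{Hom}(K_1(C(SP)),\mathbb{Z})$, with the index map $[u]\mapsto-\mathrm{Index}(P\pi(u)P|_{PH})$, $u$ unitary in $C(SP)$ (every class in $K_1(C(SP))$ has such a representative). $K_1(C(SP))$ is identified with $\bigoplus_{HSP}\mathbb{Z}$ by sending $[u]$ to the winding numbers of $u$ around the oriented triangles $\Delta_{n,m,k}$, $(n,m,k)\in HSP$, and accordingly $\mathrm{Hom}(K_1(C(SP)),\mathbb{Z})=\prod_{HSP}\mathbb{Z}$. *)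

(* Defs.v *)
From HB Require Import structures.
From mathcomp Require Import all_boot all_order all_algebra.
From mathcomp Require Import all_classical all_reals all_analysis.
From mathcomp Require Import measurable_realfun ring lra.

Set Implicit Arguments.
Unset Strict Implicit.
Unset Printing Implicit Defensive.

Import Order.TTheory GRing.Theory Num.Theory.
Import numFieldNormedType.Exports.
(* Required last so that Re and Im denote the R-valued projections of R[i]. *)
From mathcomp Require Import complex.

Local Open Scope classical_set_scope.
Local Open Scope ring_scope.
Local Open Scope quotient_scope.

(* A complex inner product space; the product is linear in its first argument.
   Completeness is not bundled: it is a clause of unbounded_fredholm_module. *)
Record preHilbert (R : realType) := PreHilbert {
  hsort :> lmodType R[i];
  dot : {dot hsort for @conjc R} }.

Definition vnorm (R : realType) (H : preHilbert R) (x : H) : R :=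
  Num.sqrt (Re (dot H x x)).

Section rsum.
Variables (R : realType) (I : choiceType).
Implicit Types f g : I -> R.

(* Unordered sums; meaningful for absolutely summable families. *)
Definition rsum f : R :=
  fine (\esum_(i in [set: I]) (EFin \o f)^\+ i
        - \esum_(i in [set: I]) (EFin \o f)^\- i)%E.

Definition csum (f : I -> R[i]) : R[i] :=
  (rsum (fun i => Re (f i)) +i* rsum (fun i => Im (f i)))%C.

Definition rsummable f := summable [set: I] (EFin \o f).

Lemma esum_scale c f : 0 <= c -> (forall i, 0 <= f i) ->
  (\esum_(i in [set: I]) (c * f i)%:E = c%:E * \esum_(i in [set: I]) (f i)%:E)%E.
Proof.
move=> c0 f0; rewrite /esum -ereal_supZl //; last first.
  by apply/set0P; exists 0%E; exists set0; [exact: fsets_set0|rewrite fsbig_set0].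
congr ereal_sup; apply/seteqP; split => x /=.
- move=> [A fA <-]; exists (\sum_(i \in A) (f i)%:E)%E; first by exists A.
  by rewrite ge0_mule_fsumr // => i; rewrite lee_fin.
- move=> [_ [A fA <-] <-]; exists A => //.
  by rewrite ge0_mule_fsumr // => i; rewrite lee_fin.
Qed.

Lemma rsumE g h : (forall i, 0 <= g i) -> (forall i, 0 <= h i) ->
  rsummable g -> rsummable h ->
  rsum (fun i => g i - h i) = fine (\esum_(i in [set: I]) (g i)%:E)
                              - fine (\esum_(i in [set: I]) (h i)%:E).
Proof.
move=> g0 h0 sg sh; rewrite /rsum.
have -> : EFin \o (fun i => g i - h i) = ((EFin \o g) \- (EFin \o h))%E by [].
rewrite esumB // => [|i _|i _]; rewrite ?lee_fin //.
have fn f : (forall i, 0 <= f i) -> rsummable f ->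
    (\esum_(i in [set: I]) (EFin \o f) i)%E \is a fin_num.
  move=> f0 sf; move: sf; rewrite /rsummable summableE.
  by congr (_ \is a fin_num); apply: eq_esum => i _ /=; rewrite ger0_norm.
by rewrite fineB //; exact: fn.
Qed.

Definition fpos f i := Num.max (f i) 0.
Definition fneg f i := Num.max (- f i) 0.

Lemma fposneg f i : f i = fpos f i - fneg f i.
Proof. by rewrite /fpos /fneg; case: (leP (f i) 0); case: (leP (- f i) 0); lra. Qed.
Lemma fpos_ge0 f i : 0 <= fpos f i. Proof. by rewrite le_max lexx orbT. Qed.
Lemma fneg_ge0 f i : 0 <= fneg f i. Proof. by rewrite le_max lexx orbT. Qed.

Lemma le_rsummable f g : (forall i, `|f i| <= g i) -> rsummable g -> rsummable f.
Proof.
move=> fg; apply: le_lt_trans; apply: le_esum => i _ /=.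
by rewrite lee_fin (le_trans (fg i)) // ler_norm.
Qed.

Lemma rsummable_norm f : rsummable f -> rsummable (fun i => `|f i|).
Proof.
move=> sf; rewrite /rsummable /summable.
by under eq_esum do rewrite /= normr_id.
Qed.

Lemma rsummable_fpos f : rsummable f -> rsummable (fpos f).
Proof.
move/rsummable_norm; apply: le_rsummable => i.
rewrite ger0_norm ?fpos_ge0 // /fpos ge_max normr_ge0 andbT; exact: ler_norm.
Qed.
Lemma rsummable_fneg f : rsummable f -> rsummable (fneg f).
Proof.
move/rsummable_norm; apply: le_rsummable => i.
rewrite ger0_norm ?fneg_ge0 // /fneg ge_max normr_ge0 andbT -normrN.
exact: ler_norm.
Qed.

Lemma rsummableD f g : rsummable f -> rsummable g -> rsummable (fun i => f i + g i).
Proof. exact: summableD. Qed.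

Lemma rsummableZ c f : rsummable f -> rsummable (fun i => c * f i).
Proof.
move=> /rsummable_norm sf; apply: (@le_rsummable _ (fun i => `|c| * `|f i|)).
  by move=> i; rewrite normrM.
move: sf; rewrite /rsummable /summable /=.
under eq_esum do rewrite normr_id.
under [X in _ -> (X < _)%E]eq_esum do rewrite normrM !normr_id.
by move=> sf; rewrite esum_scale // lte_mul_pinfty // lee_fin.
Qed.

Lemma fin_esum f : (forall i, 0 <= f i) -> rsummable f ->
  (\esum_(i in [set: I]) (f i)%:E)%E \is a fin_num.
Proof.
move=> f0; rewrite /rsummable summableE.
by congr (_ \is a fin_num); apply: eq_esum => i _ /=; rewrite ger0_norm.
Qed.

Lemma rsumpn f : rsummable f ->
  rsum f = fine (\esum_(i in [set: I]) (fpos f i)%:E)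
           - fine (\esum_(i in [set: I]) (fneg f i)%:E).
Proof.
move=> sf; rewrite -rsumE; first by congr rsum; apply/funext => i; exact: fposneg.
- exact: fpos_ge0.
- exact: fneg_ge0.
- exact: rsummable_fpos.
- exact: rsummable_fneg.
Qed.

Lemma rsumD f g : rsummable f -> rsummable g ->
  rsum (fun i => f i + g i) = rsum f + rsum g.
Proof.
move=> sf sg.
transitivity (rsum (fun i => (fpos f i + fpos g i) - (fneg f i + fneg g i))).
  congr rsum; apply/funext => i; rewrite {1}(fposneg f) {1}(fposneg g); ring.
have pf := rsummable_fpos sf; have nf := rsummable_fneg sf.
have pg := rsummable_fpos sg; have ng := rsummable_fneg sg.
rewrite rsumE; last 4 first.
- by move=> i; rewrite addr_ge0 ?fpos_ge0.
- by move=> i; rewrite addr_ge0 ?fneg_ge0.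
- exact: rsummableD.
- exact: rsummableD.
rewrite !rsumpn //.
have E (a b : I -> R) : (forall i, 0 <= a i) -> (forall i, 0 <= b i) ->
   rsummable a -> rsummable b ->
   fine (\esum_(i in [set: I]) (a i + b i)%:E)%E =
   fine (\esum_(i in [set: I]) (a i)%:E)%E + fine (\esum_(i in [set: I]) (b i)%:E)%E.
  move=> a0 b0 sa sb; rewrite -fineD ?fin_esum //.
  by rewrite -esumD // => i _; rewrite lee_fin.
rewrite !E //; try exact: fpos_ge0; try exact: fneg_ge0.
ring.
Qed.

Lemma rsumN f : rsummable f -> rsum (fun i => - f i) = - rsum f.
Proof.
move=> sf; have pf := rsummable_fpos sf; have nf := rsummable_fneg sf.
transitivity (rsum (fun i => fneg f i - fpos f i)).
  by congr rsum; apply/funext => i; rewrite {1}(fposneg f); ring.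
rewrite rsumE // ?rsumpn //; try exact: fpos_ge0; try exact: fneg_ge0.
by rewrite opprB.
Qed.

Lemma rsumZ c f : rsummable f -> rsum (fun i => c * f i) = c * rsum f.
Proof.
move=> sf.
have P d g : 0 <= d -> rsummable g -> rsum (fun i => d * g i) = d * rsum g.
  move=> d0 sg; have pg := rsummable_fpos sg; have ng := rsummable_fneg sg.
  transitivity (rsum (fun i => d * fpos g i - d * fneg g i)).
    by congr rsum; apply/funext => i; rewrite {1}(fposneg g); ring.
  rewrite rsumE.
  - rewrite !esum_scale //; try exact: fpos_ge0; try exact: fneg_ge0.
    rewrite !fineM ?fin_esum //; try exact: fpos_ge0; try exact: fneg_ge0.
    by rewrite rsumpn // mulrBr.
  - by move=> i; rewrite mulr_ge0 ?fpos_ge0.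
  - by move=> i; rewrite mulr_ge0 ?fneg_ge0.
  - exact: rsummableZ.
  - exact: rsummableZ.
have [c0|c0] := leP 0 c; first exact: P.
transitivity (rsum (fun i => - (- c * f i))).
  by congr rsum; apply/funext => i; ring.
rewrite rsumN; last exact: rsummableZ.
by rewrite P // ?oppr_ge0 ?ltW //; ring.
Qed.

Lemma rsum_lin a b f g h : rsummable f -> rsummable g -> rsummable h ->
  rsum (fun i => a * f i + b * g i + h i) = a * rsum f + b * rsum g + rsum h.
Proof.
move=> sf sg sh.
have saf := rsummableZ a sf; have sbg := rsummableZ b sg.
rewrite (rsumD (rsummableD saf sbg) sh) (rsumD saf sbg).
by rewrite (rsumZ a sf) (rsumZ b sg).
Qed.

Lemma rsum_gt0 f i : rsummable f -> (forall i, 0 <= f i) -> 0 < f i -> 0 < rsum f.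
Proof.
move=> sf f0 fi.
have -> : rsum f = fine (\esum_(i in [set: I]) (f i)%:E)%E.
  transitivity (rsum (fun i => f i - 0)).
    by congr rsum; apply/funext => j; rewrite subr0.
  rewrite (@rsumE f (fun=> 0)) //; last first.
    by rewrite /rsummable /summable esum1 // => j _ /=; rewrite normr0.
  by rewrite [in X in _ - X]esum1 //= subr0.
rewrite -lte_fin fineK ?fin_esum //.
apply: (@lt_le_trans _ _ (f i)%:E); first by rewrite lte_fin.
rewrite (esumID [set i]) => [|j _]; last by rewrite lee_fin.
rewrite setTI esum_set1 ?lee_fin // leeDl //.
by apply: esum_ge0 => j _; rewrite lee_fin.
Qed.

End rsum.


Section mkdot.
Variables (R : realType) (V : lmodType R[i]) (f : V -> V -> R[i]).
Context (fl : forall z x y c, f (c *: x + y) z = c * f x z + f y z)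
        (fh : forall x y, f x y = conjc (f y x))
        (fp : forall x, x != 0 -> 0 < f x x).

Definition dotf of (forall z x y c, f (c *: x + y) z = c * f x z + f y z)
  & (forall x y, f x y = conjc (f y x)) & (forall x, x != 0 -> 0 < f x x) := f.

Let g := dotf fl fh fp.

Let gl0 z : f 0 z = 0.
Proof.
have := fl z 0 0 1; rewrite scale1r addr0 mul1r => /eqP.
by rewrite -subr_eq0 opprD addNKr oppr_eq0 => /eqP.
Qed.
Let glD z : zmod_morphism (g ^~ z).
Proof. by move=> x y; rewrite -scaleN1r addrC /g /dotf fl mulN1r addrC. Qed.
Let glZ z : scalable_for *%R (g ^~ z).
Proof. by move=> c x; rewrite -[c *: x]addr0 /g /dotf fl gl0 addr0. Qed.
Let grD z : zmod_morphism (g z).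
Proof. by move=> x y; rewrite /g /dotf fh [LHS](congr1 _ (glD z x y)) rmorphB /= -!fh. Qed.
Let grZ z : scalable_for (@conjc R \; *%R) (g z).
Proof. by move=> c x; rewrite /g /dotf fh [LHS](congr1 _ (glZ z c x)) rmorphM /= -fh. Qed.
Let gh x y : g x y = (-1) ^+ false * conjc (g y x).
Proof. by rewrite expr0 mul1r /g /dotf -fh. Qed.

HB.instance Definition _ := isBilinear.Build R[i] V V R[i] *%R (@conjc R \; *%R)
  g glD grD glZ grZ.
HB.instance Definition _ :=
  isHermitianSesquilinear.Build R[i] V false (@conjc R) g gh.
HB.instance Definition _ := isDotProduct.Build R[i] V g fp.

Definition mkPreHilbert : preHilbert R := @PreHilbert R V g.

End mkdot.

Section preHilbert_lemmas.
Variables (R : realType) (H : preHilbert R).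
Implicit Types x y : H.

Lemma dotC x y : dot H x y = conjc (dot H y x).
Proof. by rewrite hermC expr0 mul1r. Qed.

Lemma dot_ge0 x : 0 <= dot H x x.
Proof.
have [->|x0] := eqVneq x 0; first by rewrite linear0l.
exact/ltW/neq0_dnorm_gt0.
Qed.

Lemma Re_dot_ge0 x : 0 <= Re (dot H x x).
Proof. by have := dot_ge0 x; rewrite lecE => /andP[]. Qed.

Lemma dotxx x : dot H x x = ((vnorm x ^+ 2)%:C)%C.
Proof.
rewrite /vnorm sqr_sqrtr ?Re_dot_ge0 //.
have := dot_ge0 x; rewrite lecE => /andP[/eqP i0 _].
by case: (dot H x x) i0 => a b /= ->.
Qed.

Lemma Re_dotC x y : Re (dot H y x) = Re (dot H x y).
Proof. by rewrite dotC; case: (dot _ _ _). Qed.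

Lemma Re_dotD x y : Re (dot H (x + y) (x + y)) =
  Re (dot H x x) + Re (dot H y y) + 2 * Re (dot H x y).
Proof.
rewrite linearDl !linearDr !(raddfD (@Re R)) /= (Re_dotC x y); ring.
Qed.

Lemma Re_dotB x y : Re (dot H (x - y) (x - y)) =
  Re (dot H x x) + Re (dot H y y) - 2 * Re (dot H x y).
Proof.
rewrite Re_dotD linearNl !linearNr opprK raddfN /=; ring.
Qed.

Lemma vnorm2D x y : vnorm (x + y) ^+ 2 <= 2 * vnorm x ^+ 2 + 2 * vnorm y ^+ 2.
Proof.
rewrite /vnorm !sqr_sqrtr ?Re_dot_ge0 //.
have := Re_dot_ge0 (x - y); rewrite Re_dotB Re_dotD.
by lra.
Qed.

Lemma vnorm2Z c x : vnorm (c *: x) ^+ 2 = (Re c ^+ 2 + Im c ^+ 2) * vnorm x ^+ 2.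
Proof.
have E : dot H (c *: x) (c *: x) = c * (conjc c * dot H x x).
  by rewrite linearZl_LR linearZr_LR.
rewrite {1}/vnorm sqr_sqrtr ?Re_dot_ge0 // E dotxx.
by case: c {E} => a b /=; ring.
Qed.

Lemma normRe_dot x y : `|Re (dot H x y)| <= vnorm x ^+ 2 + vnorm y ^+ 2.
Proof.
rewrite /vnorm !sqr_sqrtr ?Re_dot_ge0 //.
have := Re_dot_ge0 x; have := Re_dot_ge0 y.
have := Re_dot_ge0 (x - y); have := Re_dot_ge0 (x + y); rewrite Re_dotB Re_dotD.
by rewrite ler_norml => *; apply/andP; split; lra.
Qed.

Lemma normIm_dot x y : `|Im (dot H x y)| <= vnorm x ^+ 2 + vnorm y ^+ 2.
Proof.
have -> : Im (dot H x y) = - Re (dot H ('i%C *: x) y).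
  by rewrite linearZl_LR /= mulrC ReiNIm opprK.
rewrite normrN (le_trans (normRe_dot _ _)) // lerD2r vnorm2Z /=.
by rewrite expr0n expr1n add0r mul1r.
Qed.

End preHilbert_lemmas.

Section dprod.
Variables (R : realType) (I : Type) (H : I -> preHilbert R).
Definition dprod := forall i, H i.
HB.instance Definition _ := Choice.on dprod.
Implicit Types x y z : dprod.
Let add x y : dprod := fun i => x i + y i.
Let zero : dprod := fun=> 0.
Let opp x : dprod := fun i => - x i.
Let scale (c : R[i]) x : dprod := fun i => c *: x i.
Let addA : associative add.
Proof. by move=> x y z; apply/functional_extensionality_dep => i; exact: addrA. Qed.
Let addC : commutative add.
Proof. by move=> x y; apply/functional_extensionality_dep => i; exact: addrC. Qed.
Let add0 : left_id zero add.
Proof. by move=> x; apply/functional_extensionality_dep => i; exact: add0r. Qed.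
Let addN : left_inverse zero opp add.
Proof. by move=> x; apply/functional_extensionality_dep => i; exact: addNr. Qed.
HB.instance Definition _ := GRing.isZmodule.Build dprod addA addC add0 addN.
Let scaleA a b x : scale a (scale b x) = scale (a * b) x.
Proof. by apply/functional_extensionality_dep => i; exact: scalerA. Qed.
Let scale1 x : scale 1 x = x.
Proof. by apply/functional_extensionality_dep => i; exact: scale1r. Qed.
Let scaleDr : right_distributive scale +%R.
Proof. by move=> a x y; apply/functional_extensionality_dep => i; exact: scalerDr. Qed.
Let scaleDl x : {morph scale^~ x : a b / a + b}.
Proof. by move=> a b; apply/functional_extensionality_dep => i; exact: scalerDl. Qed.
HB.instance Definition _ := GRing.Zmodule_isLmodule.Build R[i] dprod
  scaleA scale1 scaleDr scaleDl.
End dprod.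

Section dsum.
Variables (R : realType) (I : choiceType) (H : I -> preHilbert R).

Definition square_summable : {pred dprod H} :=
  [pred x : dprod H | `[< rsummable (fun i => vnorm (x i) ^+ 2) >]].

Lemma square_summableP (x : dprod H) :
  reflect (rsummable (fun i => vnorm (x i) ^+ 2)) (x \in square_summable).
Proof. exact: asboolP. Qed.

Lemma square_summable_submod : submod_closed square_summable.
Proof.
split.
  apply/square_summableP; rewrite /rsummable /summable esum1 // => i _ /=.
  by rewrite /vnorm [dot _ _ _](linear0l (dot (H i))) sqrtr0 expr0n normr0.
move=> c x y /square_summableP sx /square_summableP sy; apply/square_summableP.
apply: (@le_rsummable _ _ _ (fun i => 2 * (Re c ^+ 2 + Im c ^+ 2) * vnorm (x i) ^+ 2
    + 2 * vnorm (y i) ^+ 2)).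
  move=> i; rewrite ger0_norm ?sqr_ge0 // (le_trans (vnorm2D _ _)) // vnorm2Z.
  by rewrite mulrA.
by apply: rsummableD; apply: rsummableZ.
Qed.

HB.instance Definition _ :=
  GRing.isSubmodClosed.Build R[i] (dprod H) square_summable square_summable_submod.

Record dsumType := DSum { dsum_val : dprod H; _ : dsum_val \in square_summable }.
HB.instance Definition _ := [isSub for dsum_val].
HB.instance Definition _ := [Choice of dsumType by <:].
HB.instance Definition _ := [SubChoice_isSubLmodule of dsumType by <:].

Definition dsum_fun (x : dsumType) : forall i, H i := dsum_val x.
Coercion dsum_fun : dsumType >-> Funclass.

Definition dsum_dot (x y : dsumType) : R[i] := csum (fun i => dot (H i) (x i) (y i)).

Lemma dsum_summable (x : dsumType) : rsummable (fun i => vnorm (x i) ^+ 2).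
Proof. exact/square_summableP/(valP x). Qed.

Lemma sRe (x y : dsumType) : rsummable (fun i => Re (dot (H i) (x i) (y i))).
Proof.
apply: le_rsummable (fun i => normRe_dot _ _) _.
by apply: rsummableD; exact: dsum_summable.
Qed.
Lemma sIm (x y : dsumType) : rsummable (fun i => Im (dot (H i) (x i) (y i))).
Proof.
apply: le_rsummable (fun i => normIm_dot _ _) _.
by apply: rsummableD; exact: dsum_summable.
Qed.

Lemma dsum_funP c (x y : dsumType) i : (c *: x + y) i = c *: x i + y i.
Proof.
rewrite /dsum_fun; have -> : dsum_val (c *: x + y) = c *: dsum_val x + dsum_val y.
  exact: (linearP (val : {linear dsumType -> dprod H})).
by [].
Qed.

Lemma dsum_dot_lin z x y c : dsum_dot (c *: x + y) z = c * dsum_dot x z + dsum_dot y z.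
Proof.
have E i : dot (H i) ((c *: x + y) i) (z i) =
           c * dot (H i) (x i) (z i) + dot (H i) (y i) (z i).
  by rewrite dsum_funP linearDl linearZl_LR.
case: c E => a b E.
rewrite /dsum_dot /csum; apply/eqP; rewrite eq_complex; apply/andP; split; apply/eqP.
- transitivity (a * rsum (fun i => Re (dot (H i) (x i) (z i)))
     + - b * rsum (fun i => Im (dot (H i) (x i) (z i)))
     + rsum (fun i => Re (dot (H i) (y i) (z i)))); last by rewrite /=; ring.
  rewrite -rsum_lin; [|exact: sRe|exact: sIm|exact: sRe].
  congr rsum; apply/funext => i; rewrite E.
  by case: (dot _ (x i) _) => ? ?; case: (dot _ (y i) _) => ? ? /=; ring.
- transitivity (a * rsum (fun i => Im (dot (H i) (x i) (z i)))
     + b * rsum (fun i => Re (dot (H i) (x i) (z i)))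
     + rsum (fun i => Im (dot (H i) (y i) (z i)))); last by rewrite /=; ring.
  rewrite -rsum_lin; [|exact: sIm|exact: sRe|exact: sIm].
  congr rsum; apply/funext => i; rewrite E.
  by case: (dot _ (x i) _) => ? ?; case: (dot _ (y i) _) => ? ? /=; ring.
Qed.

Lemma dsum_dotC x y : dsum_dot x y = conjc (dsum_dot y x).
Proof.
apply/eqP; rewrite eq_complex /=; apply/andP; split; apply/eqP.
- by congr rsum; apply/funext => i; rewrite (Re_dotC (y i)).
- rewrite -rsumN; last exact: sIm.
  congr rsum; apply/funext => i; rewrite dotC; by case: (dot _ _ _).
Qed.

Lemma dsum_dot_gt0 x : x != 0 -> 0 < dsum_dot x x.
Proof.
move=> x0; have [i xi] : exists i, x i != 0.
  apply: contrapT => /forallNP h; case/eqP: x0; apply/val_inj => /=.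
  apply/functional_extensionality_dep => i; apply/eqP/negPn/negP; exact: h.
rewrite ltcE /=; apply/andP; split.
  rewrite (_ : (fun _ => _) = fun i => 0 * Im (dot (H i) (x i) (x i))).
    by rewrite rsumZ ?mul0r //; exact: sIm.
  by apply/funext => j; rewrite dotxx /= mul0r.
apply: (@rsum_gt0 _ _ _ i); first exact: sRe.
- by move=> j; exact: Re_dot_ge0.
- have : 0 < dot (H i) (x i) (x i) by exact: neq0_dnorm_gt0.
  by rewrite ltcE => /andP[].
Qed.

Definition dsum : preHilbert R := mkPreHilbert dsum_dot_lin dsum_dotC dsum_dot_gt0.

End dsum.


Section L2.
Context {d : measure_display} {T : measurableType d} {R : realType}.
Variable mu : {measure set T -> \bar R}.

Definition cint (f : T -> R[i]) : R[i] :=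
  ((\int[mu]_x Re (f x)) +i* (\int[mu]_x Im (f x)))%C.


Definition square_integrable : {pred T -> R[i]^o} :=
  [pred f : T -> R[i]^o | ((fun x => Re (f x)) \in Lfun mu 2%:E)
                       && ((fun x => Im (f x)) \in Lfun mu 2%:E)].

Lemma Lfun2_lin (a b : R) (u v w : T -> R) :
  u \in Lfun mu 2%:E -> v \in Lfun mu 2%:E -> w \in Lfun mu 2%:E ->
  (fun x => a * u x + b * v x + w x) \in Lfun mu 2%:E.
Proof.
move=> uL vL wL.
have [_ cl] := Lfun_submod_closed mu (lee1n 2).
have -> : (fun x => a * u x + b * v x + w x) = a *: u + (b *: v + w).
  by apply/funext => x; rewrite -addrA.
by apply: (cl) => //; apply: (cl).
Qed.

Lemma square_integrable_submod : submod_closed square_integrable.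
Proof.
have [L0 _] := Lfun_submod_closed mu (lee1n 2).
split; first by apply/andP; split; exact: L0.
move=> [a b] f g /andP[f1 f2] /andP[g1 g2]; apply/andP; split.
- have -> : (fun x => Re (((a +i* b)%C *: f + g) x)) =
    (fun x => a * Re (f x) + - b * Im (f x) + Re (g x)).
    apply/funext => x; have -> : ((a +i* b)%C *: f + g) x = (a +i* b)%C * f x + g x by [].
    by case: (f x) => ? ?; case: (g x) => ? ? /=; ring.
  exact: Lfun2_lin.
- have -> : (fun x => Im (((a +i* b)%C *: f + g) x)) =
    (fun x => a * Im (f x) + b * Re (f x) + Im (g x)).
    apply/funext => x; have -> : ((a +i* b)%C *: f + g) x = (a +i* b)%C * f x + g x by [].
    by case: (f x) => ? ?; case: (g x) => ? ? /=; ring.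
  exact: Lfun2_lin.
Qed.

HB.instance Definition _ := GRing.isSubmodClosed.Build R[i] (T -> R[i]^o)
  square_integrable square_integrable_submod.

Record L2fun := L2Fun { L2fun_val : T -> R[i]^o; _ : L2fun_val \in square_integrable }.
HB.instance Definition _ := [isSub for L2fun_val].
HB.instance Definition _ := [Choice of L2fun by <:].
HB.instance Definition _ := [SubChoice_isSubLmodule of L2fun by <:].

Definition L2fun_fun (f : L2fun) : T -> R[i] := L2fun_val f.
Coercion L2fun_fun : L2fun >-> Funclass.

Definition null_fun : {pred L2fun} := [pred f : L2fun | `[< \forall x \ae mu, f x = 0 >]].

Lemma L2funP c (f g : L2fun) x : (c *: f + g) x = c * f x + g x.
Proof. by []. Qed.

Lemma null_fun_submod : submod_closed null_fun.
Proof.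
split; first by apply/asboolP; exact: aeW.
move=> c f g /asboolP f0 /asboolP g0; apply/asboolP.
by apply: filterS2 f0 g0 => x f0 g0; rewrite L2funP f0 g0 mulr0 addr0.
Qed.

HB.instance Definition _ :=
  GRing.isSubmodClosed.Build R[i] L2fun null_fun null_fun_submod.

(* L^2(mu; C): square integrable functions modulo equality mu-a.e. *)
Definition L2type : Type := Quotient.quot (null_fun : zmodClosed L2fun).
HB.instance Definition _ := GRing.Zmodule.on L2type.
HB.instance Definition _ := Quotient.on L2type.

Lemma L2_eqP (f g : L2fun) :
  reflect (\forall x \ae mu, f x = g x) (\pi_L2type f == \pi_L2type g).
Proof.
rewrite (_ : (_ == _) = (f - g \in null_fun)); last first.
  exact: esym (Quotient.idealrBE (null_fun : zmodClosed L2fun) f g).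
have E x : (f - g) x = f x - g x by [].
apply: (iffP (asboolP _)) => h; apply: filterS h => x.
  by rewrite E => /eqP; rewrite subr_eq0 => /eqP.
by rewrite E => ->; rewrite subrr.
Qed.

Definition L2scale (c : R[i]) (q : L2type) : L2type := \pi_L2type (c *: repr q).

Lemma repr_pi (f : L2fun) : \forall x \ae mu, repr (\pi_L2type f) x = f x.
Proof. by apply/L2_eqP; rewrite reprK. Qed.

Lemma L2scale_pi c f : L2scale c (\pi_L2type f) = \pi_L2type (c *: f).
Proof.
apply/eqP/L2_eqP; apply: filterS (repr_pi f) => x h.
by have E (k : L2fun) : (c *: k) x = c * k x by []; rewrite !E h.
Qed.

Lemma L2_addE (f g : L2fun) : \pi_L2type f + \pi_L2type g = \pi_L2type (f + g).
Proof. exact: esym (@Quotient.pi_add _ (null_fun : zmodClosed L2fun) f g). Qed.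

Lemma L2_ind (P : L2type -> Prop) : (forall f, P (\pi_L2type f)) -> forall q, P q.
Proof. by move=> h q; rewrite -[q]reprK. Qed.

Let scaleA a b q : L2scale a (L2scale b q) = L2scale (a * b) q.
Proof. by elim/L2_ind: q => f; rewrite !L2scale_pi scalerA. Qed.
Let scale1 : left_id 1 L2scale.
Proof. by elim/L2_ind => f; rewrite L2scale_pi scale1r. Qed.
Let scaleDr : right_distributive L2scale +%R.
Proof.
by move=> a; elim/L2_ind => f; elim/L2_ind => g; rewrite L2_addE !L2scale_pi L2_addE scalerDr.
Qed.
Let scaleDl q : {morph L2scale^~ q : a b / a + b}.
Proof. by move=> a b; elim/L2_ind: q => f; rewrite !L2scale_pi L2_addE scalerDl. Qed.
HB.instance Definition _ := GRing.Zmodule_isLmodule.Build R[i] L2type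
  scaleA scale1 scaleDr scaleDl.

Definition L2_dot (p q : L2type) : R[i] :=
  cint (fun x => repr p x * conjc (repr q x)).

Lemma L2linE c (p q : L2type) :
  \forall x \ae mu, repr (c *: p + q) x = c * repr p x + repr q x.
Proof.
have -> : c *: p + q = \pi_L2type (c *: repr p + repr q).
  by rewrite -L2_addE reprK.
exact: repr_pi.
Qed.

Lemma Lfun2_mul_int (u v : T -> R) : u \in Lfun mu 2%:E -> v \in Lfun mu 2%:E ->
  mu.-integrable [set: T] (fun x => (u x * v x)%:E).
Proof. by move=> uL vL; apply/Lfun1_integrable; exact: Lfun2_mul_Lfun1. Qed.

Lemma L2fun_re (f : L2fun) : (fun x => Re (f x)) \in Lfun mu 2%:E.
Proof. by have /andP[] := valP f. Qed.
Lemma L2fun_im (f : L2fun) : (fun x => Im (f x)) \in Lfun mu 2%:E.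
Proof. by have /andP[] := valP f. Qed.

Lemma Rint_lin a b (u v w : T -> R) :
  mu.-integrable [set: T] (EFin \o u) -> mu.-integrable [set: T] (EFin \o v) ->
  mu.-integrable [set: T] (EFin \o w) ->
  \int[mu]_x (a * u x + b * v x + w x) =
  a * \int[mu]_x u x + b * \int[mu]_x v x + \int[mu]_x w x.
Proof.
move=> ui vi wi.
have aui : mu.-integrable [set: T] (EFin \o (fun x => a * u x)).
  exact: (integrableZl measurableT a ui).
have bvi : mu.-integrable [set: T] (EFin \o (fun x => b * v x)).
  exact: (integrableZl measurableT b vi).
have abi : mu.-integrable [set: T] (EFin \o (fun x => a * u x + b * v x)).
  exact: (integrableD measurableT aui bvi).
rewrite (RintegralD measurableT abi wi) (RintegralD measurableT aui bvi).
by rewrite (RintegralZl a measurableT ui) (RintegralZl b measurableT vi).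
Qed.

Lemma ae_Rintegral (u v : T -> R) :
  measurable_fun [set: T] u -> measurable_fun [set: T] v ->
  (\forall x \ae mu, u x = v x) -> \int[mu]_x u x = \int[mu]_x v x.
Proof.
move=> mu' mv uv; rewrite /Rintegral; congr fine; apply: ae_eq_integral => //.
- exact/measurable_EFinP.
- exact/measurable_EFinP.
- by apply: filterS uv => x -> _.
Qed.

Lemma Lfun_meas p (u : T -> R) : u \in Lfun mu p -> measurable_fun [set: T] u.
Proof. by move=> /andP[/[!inE]]. Qed.

Lemma L2_mul_meas (f g : L2fun) :
  measurable_fun [set: T] (fun x => Re (f x * conjc (g x))) /\
  measurable_fun [set: T] (fun x => Im (f x * conjc (g x))).
Proof.
split.
- rewrite (_ : (fun _ => _) =
    (fun x => Re (f x) * Re (g x) + Im (f x) * Im (g x))); last first.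
    by apply/funext => x; case: (f x) => ? ?; case: (g x) => ? ? /=; ring.
  apply: measurable_funD; apply: measurable_funM; apply: Lfun_meas;
    by [exact: L2fun_re|exact: L2fun_im].
- rewrite (_ : (fun _ => _) =
    (fun x => Im (f x) * Re (g x) - Re (f x) * Im (g x))); last first.
    by apply/funext => x; case: (f x) => ? ?; case: (g x) => ? ? /=; ring.
  apply: measurable_funB; apply: measurable_funM; apply: Lfun_meas;
    by [exact: L2fun_re|exact: L2fun_im].
Qed.

Lemma L2_mul_int (f g : L2fun) :
  mu.-integrable [set: T] (EFin \o (fun x => Re (f x * conjc (g x)))) /\
  mu.-integrable [set: T] (EFin \o (fun x => Im (f x * conjc (g x)))).
Proof.
have := Lfun2_mul_int (L2fun_re f) (L2fun_re g).
have := Lfun2_mul_int (L2fun_im f) (L2fun_im g).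
have := Lfun2_mul_int (L2fun_im f) (L2fun_re g).
have := Lfun2_mul_int (L2fun_re f) (L2fun_im g).
move=> i1 i2 i3 i4; split.
- rewrite (_ : (fun _ => _) =
    (fun x => Re (f x) * Re (g x) + Im (f x) * Im (g x))); last first.
    by apply/funext => x; case: (f x) => ? ?; case: (g x) => ? ? /=; ring.
  exact: (integrableD measurableT i4 i3).
- rewrite (_ : (fun _ => _) =
    (fun x => Im (f x) * Re (g x) - Re (f x) * Im (g x))); last first.
    by apply/funext => x; case: (f x) => ? ?; case: (g x) => ? ? /=; ring.
  exact: (integrableB measurableT i2 i1).
Qed.

Lemma L2_dot_lin r p q c : L2_dot (c *: p + q) r = c * L2_dot p r + L2_dot q r.
Proof.
have [mR mI] := L2_mul_meas (c *: repr p + repr q) (repr r).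
have [mR' mI'] := L2_mul_meas (repr (c *: p + q)) (repr r).
have [pR pI] := L2_mul_int (repr p) (repr r).
have [qR qI] := L2_mul_int (repr q) (repr r).
have E := L2linE c p q.
transitivity (cint (fun x => (c * repr p x + repr q x) * conjc (repr r x))).
  rewrite /L2_dot /cint; congr (_ +i* _)%C; apply: ae_Rintegral => //;
    by apply: filterS E => x ->.
rewrite /L2_dot /cint; case: c {mR mI mR' mI' E} => a b.
apply/eqP; rewrite eq_complex; apply/andP; split; apply/eqP.
- set u := fun x => Re (repr p x * conjc (repr r x)) in pR *.
  set v := fun x => Im (repr p x * conjc (repr r x)) in pI *.
  set w := fun x => Re (repr q x * conjc (repr r x)) in qR *.
  transitivity (a * \int[mu]_x u x + - b * \int[mu]_x v x + \int[mu]_x w x);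
    last by rewrite /=; ring.
  rewrite -Rint_lin //; apply: eq_Rintegral => x _.
  rewrite /u /v /w; case: (repr p x) => ? ?; case: (repr q x) => ? ?.
  by case: (repr r x) => ? ? /=; ring.
- set u := fun x => Im (repr p x * conjc (repr r x)) in pI *.
  set v := fun x => Re (repr p x * conjc (repr r x)) in pR *.
  set w := fun x => Im (repr q x * conjc (repr r x)) in qI *.
  transitivity (a * \int[mu]_x u x + b * \int[mu]_x v x + \int[mu]_x w x);
    last by rewrite /=; ring.
  rewrite -Rint_lin //; apply: eq_Rintegral => x _.
  rewrite /u /v /w; case: (repr p x) => ? ?; case: (repr q x) => ? ?.
  by case: (repr r x) => ? ? /=; ring.
Qed.

Lemma L2_dotC p q : L2_dot p q = conjc (L2_dot q p).
Proof.
have [_ qI] := L2_mul_int (repr q) (repr p).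
rewrite /L2_dot /cint; apply/eqP; rewrite eq_complex; apply/andP; split; apply/eqP.
- apply: eq_Rintegral => x _.
  by case: (repr p x) => ? ?; case: (repr q x) => ? ? /=; ring.
- rewrite /= -mulN1r -(RintegralZl (-1) measurableT qI); apply: eq_Rintegral => x _.
  by case: (repr p x) => ? ?; case: (repr q x) => ? ? /=; ring.
Qed.

Lemma L2_dot_gt0 p : p != 0 -> 0 < L2_dot p p.
Proof.
move=> p0.
have [mR _] := L2_mul_meas (repr p) (repr p).
have [pR _] := L2_mul_int (repr p) (repr p).
have E x : repr p x * conjc (repr p x) = ((Re (repr p x) ^+ 2 + Im (repr p x) ^+ 2)%:C)%C.
  by case: (repr p x) => a b /=; apply/eqP; rewrite eq_complex /=; apply/andP;
    split; apply/eqP; ring.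
have ge0 x : 0 <= Re (repr p x * conjc (repr p x)).
  by rewrite E /= addr_ge0 // sqr_ge0.
rewrite ltcE; apply/andP; split.
  rewrite /L2_dot /cint /= (_ : (fun _ => _) = cst 0) ?Rintegral_cst // ?mul0r //.
  by apply/funext => x; rewrite E.
rewrite lt_neqAle; apply/andP; split; last first.
  by rewrite /L2_dot /cint /=; apply: Rintegral_ge0 => x _.
apply: contra p0 => /eqP I0; rewrite -[p]reprK.
have -> : 0 = \pi_L2type (0 : L2fun) by rewrite -[LHS](scale0r 0) -[X in 0 *: X]reprK;
   rewrite [LHS]L2scale_pi scale0r.
apply/L2_eqP.
have mE : measurable_fun [set: T] (fun x => (Re (repr p x * conjc (repr p x)))%:E).
  exact/measurable_EFinP.
have [+ _] := ae_eq_integral_abs mu measurableT mE.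
move=> H; have {}H := H _.
have : (\int[mu]_x `|(Re (repr p x * conjc (repr p x)))%:E| = 0)%E.
  under eq_integral do rewrite gee0_abs ?lee_fin //.
  have := I0; rewrite /L2_dot /cint /= /Rintegral => /esym I0'.
  rewrite -[LHS]fineK ?I0' //.
  exact: (integrable_fin_num measurableT pR).
move=> /H; apply: filterS => x /(_ Logic.I) /= [].
rewrite E /= => /eqP; rewrite paddr_eq0 ?sqr_ge0 // !sqrf_eq0 => /andP[/eqP a /eqP b].
by case: (repr p x) a b => ? ? /= -> ->.
Qed.

Definition L2 : preHilbert R := mkPreHilbert L2_dot_lin L2_dotC L2_dot_gt0.

(* The class of f; by convention 0 if f is not square integrable. *)
Definition L2class (f : T -> R[i]) : L2 := \pi_L2type (insubd (0 : L2fun) (f : T -> R[i]^o)).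

End L2.


(* R[i] as a numClosedFieldType, whose norm topology is then inferred. *)
Definition cplx (R : realType) : numClosedFieldType := R[i].

(* A possibly unbounded operator D is given by its graph: D x y means that x is
   in the domain of D and D x = y. *)
Section operators.
Variables (R : realType) (H : preHilbert R).
Implicit Types (x y z : H) (D : H -> H -> Prop) (P T : H -> H) (S W : set H).

Definition hilbert_complete := forall u : nat -> H,
  (forall e : R, 0 < e -> exists N, forall m n, (N <= m)%N -> (N <= n)%N ->
     vnorm (u m - u n) < e) ->
  exists l : H, vnorm (u n - l) @[n --> \oo] --> (0 : R).

Definition bounded_op T :=
  linear T /\ exists K : R, forall x, vnorm (T x) <= K * vnorm x.

Definition densely_defined D :=
  forall x (e : R), 0 < e -> exists2 y, (exists z, D y z) & vnorm (x - y) < e.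

Definition adjoint D y z := forall x w, D x w -> dot H w y = dot H x z.

(* adjoint D is single-valued once D is densely defined. *)
Definition selfadjoint D :=
  densely_defined D /\ forall x y, D x y <-> adjoint D x y.

(* The graph of (I + D^2)^-1. *)
Definition resolvent D y x := exists z w, [/\ D x z, D z w & x + w = y].

Definition compact_op (G : H -> H -> Prop) :=
  exists2 T, linear T &
  (forall x y, G x y <-> T x = y) /\
  forall u : nat -> H, (exists K : R, forall n, vnorm (u n) <= K) ->
    exists (phi : nat -> nat) (l : H), {homo phi : m n / (m < n)%N} /\
      vnorm (T (u (phi n)) - l) @[n --> \oo] --> (0 : R).

Definition orthogonal_projection P :=
  forall x y, P (P x) = P x /\ dot H (P x) y = dot H x (P y).

(* E is the projection-valued measure with D = \int t dE(t): dom D consists of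
   the x with \int t^2 d<E(t)x,x> < +oo, and <Dx,x> = \int t d<E(t)x,x>. *)
Definition spectral_resolution D (E : set R -> H -> H) :=
  [/\ forall B, measurable B -> orthogonal_projection (E B),
      forall x, E [set: R] x = x
    & forall x, exists mu : {measure set (measurableTypeR R) -> \bar R},
      [/\ forall B, measurable B -> mu B = (Re (dot H (E B x) x))%:E,
          (exists y, D x y) <-> (\int[mu]_t (t ^+ 2)%:E < +oo)%E
        & forall y, D x y -> Re (dot H y x) = \int[mu]_t t]].

(* dim (S / W) = n, for subspaces W of S. *)
Definition dim_quot S W n := exists2 v : 'I_n -> H, (forall i, S (v i)) &
  forall x, S x -> exists! c : {ffun 'I_n -> R[i]}, W (x - \sum_i c i *: v i).

(* For T mapping S to S: the kernel and the cokernel of T|_S are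
   finite-dimensional, and z is the difference of their dimensions. *)
Definition fredholm_index S T (z : int) := exists m n : nat,
  [/\ dim_quot (S `&` [set x | T x = 0]) [set 0] m,
      dim_quot S (T @` S) n & z = m%:Z - n%:Z].

End operators.

(* The raw data (H, pi, D); the axioms are unbounded_fredholm_module below. *)
Record moduleData (R : realType) (E : Type) := ModuleData {
  hilb : preHilbert R;
  rep : (E -> R[i]) -> hilb -> hilb;
  dirac : hilb -> hilb -> Prop }.
Arguments rep {R E} m a x.
Arguments dirac {R E} m x y.

Section modules.
Variables (R : realType) (E : topologicalType) (X : set E).
Implicit Types (M : moduleData R E) (a b : E -> R[i]).

(* C(X) is represented by functions on the ambient space E which are continuous
   on X; unital_representation requires that rep only depends on a|_X. *)
Definition CX a := {within X, continuous (a : E -> cplx R)}.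

Definition unital_representation M :=
  [/\ forall a b, CX a -> CX b -> (forall x, X x -> a x = b x) -> rep M a = rep M b,
      forall a, CX a -> bounded_op (rep M a),
      forall a b c xi, CX a -> CX b ->
        rep M (fun x => c * a x + b x) xi = c *: rep M a xi + rep M b xi,
      forall a b xi, CX a -> CX b ->
        rep M (fun x => a x * b x) xi = rep M a (rep M b xi)
    & (forall a xi eta, CX a -> dot (hilb M) (rep M a xi) eta =
         dot (hilb M) xi (rep M (fun x => conjc (a x)) eta))
      /\ forall xi, rep M (fun=> 1) xi = xi].

Definition faithful M :=
  forall a, CX a -> (forall xi, rep M a xi = 0) -> forall x, X x -> a x = 0.

(* pi(a) preserves dom D and ||[D, pi(a)]|| <= K on dom D. Density of
   {x in dom D | pi(a) x in dom D} would not be enough: a function such as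
   Cantor's on a circle has a null commutator on the dense subspace of the
   H^1 functions vanishing on the Cantor set. *)
Definition commutator_le M a (K : R) :=
  forall xi eta, dirac M xi eta -> exists2 zeta,
    dirac M (rep M a xi) zeta & vnorm (zeta - rep M a eta) <= K * vnorm xi.

Definition unbounded_fredholm_module M :=
  [/\ hilbert_complete (hilb M), unital_representation M,
      selfadjoint (dirac M), compact_op (resolvent (dirac M))
    & forall a (e : R), CX a -> 0 < e -> exists b, [/\ CX b,
        exists K, commutator_le M b K
      & forall x, X x -> `|a x - b x| <= e%:C%C]].

Definition spectral_triple M := unbounded_fredholm_module M /\ faithful M.

Definition spectral_dist M (x y : E) : \bar R :=
  ereal_sup [set (Re `|a x - a y|)%:E | a in [set a | CX a /\ commutator_le M a 1]].

End modules.

Section direct_sum.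
Variables (R : realType) (E : Type) (I : choiceType) (M : I -> moduleData R E).

Definition dsum_family (v : forall i, hilb (M i)) : dsum (fun i => hilb (M i)) :=
  insubd (0 : dsumType (fun i => hilb (M i))) (v : dprod (fun i => hilb (M i))).

Definition module_sum : moduleData R E := {|
  hilb := dsum (fun i => hilb (M i));
  rep := fun a (x : dsumType (fun i => hilb (M i))) =>
    dsum_family (fun i => rep (M i) a (x i));
  dirac := fun x y : dsumType (fun i => hilb (M i)) =>
    forall i, dirac (M i) (x i) (y i) |}.

End direct_sum.

Definition module_add (R : realType) (E : Type) (M N : moduleData R E) :=
  module_sum (fun b : bool => if b then M else N).

Section circle.
Variables (R : realType).
Definition expi (t : R) : R[i] := (cos t +i* sin t)%C.

(* dx / (2 pi r) on [- pi r, pi r]; only used for r > 0. *)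
Definition arc_measure (r : R) : {measure set (measurableTypeR R) -> \bar R} :=
  mscale `|(2 * pi * r)^-1|%:nng
    (mrestr lebesgue_measure (measurable_itv `[- (pi * r), pi * r])).

(* The vector e^{ilx/r}. *)
Definition exp_mode (r : R) (l : int) : L2 (arc_measure r) :=
  L2class (arc_measure r) (fun x => expi (l%:~R * x / r)).

(* The Dirac operator is diagonal in the orthonormal basis exp_mode r l, with
   eigenvalues (l + 1/2) / r; its domain is maximal. *)
Definition circle_module (E : Type) (r : R) (rho : R -> E) : moduleData R E := {|
  hilb := L2 (arc_measure r);
  rep := fun a (xi : L2type (arc_measure r)) =>
    L2class (arc_measure r) (fun x => a (rho x) * repr xi x);
  dirac := fun xi eta => forall l : int,
    dot (L2 (arc_measure r)) eta (exp_mode r l) =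
    (((l%:~R + 2^-1) / r)%:C)%C * dot (L2 (arc_measure r)) xi (exp_mode r l) |}.
End circle.

Section geometry.
Variable R : realType.
Local Notation E := 'rV[R]_3.

Definition edist (x y : E) : R := Num.sqrt (\sum_i (x 0 i - y 0 i) ^+ 2).

(* Curves are parametrized by [0, 1]. *)
Definition curve_length (g : R -> E) : \bar R :=
  ereal_sup [set (\sum_(i < p.1) edist (g (p.2 i)) (g (p.2 i.+1)))%:E
            | p in [set p : nat * (nat -> R) | (forall i, 0 <= p.2 i <= 1)
                      /\ {homo p.2 : i j / (i <= j)%N >-> i <= j}]].

Definition geodesic_dist (X : set E) (x y : E) : \bar R :=
  ereal_inf [set curve_length g | g in [set g : R -> E |
    [/\ {within `[0, 1], continuous g}, g @` `[0, 1] `<=` X,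
        g 0 = x, g 1 = y & (curve_length g < +oo)%E]]].

(* Oriented triangles: the boundary is run through as vtx1, vtx2, vtx3, vtx1. *)
Record triangle := Triangle { vtx1 : E; vtx2 : E; vtx3 : E }.

Definition reverse T := Triangle (vtx1 T) (vtx3 T) (vtx2 T).

Definition perimeter T :=
  edist (vtx1 T) (vtx2 T) + edist (vtx2 T) (vtx3 T) + edist (vtx3 T) (vtx1 T).

Definition segment_at (a b : E) (t : R) : E := a + (t / edist a b) *: (b - a).

(* The perimeter-periodic arc-length parametrization with arclength T 0 = vtx1. *)
Definition arclength T (t : R) : E :=
  let d1 := edist (vtx1 T) (vtx2 T) in
  let d2 := edist (vtx2 T) (vtx3 T) in
  let s := t - perimeter T * (Num.floor (t / perimeter T))%:~R in
  if s <= d1 then segment_at (vtx1 T) (vtx2 T) s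
  else if s <= d1 + d2 then segment_at (vtx2 T) (vtx3 T) (s - d1)
  else segment_at (vtx3 T) (vtx1 T) (s - d1 - d2).

(* The base point of the closed parametrization is arbitrary: s is its position
   (that of the parameter value 0) along the triangle. *)
Definition UFM (s : R) T : moduleData R E :=
  circle_module (perimeter T / (2 * pi)) (fun x => arclength T (s + x)).

(* u is unimodular along T in all uses. *)
Definition winding (u : E -> R[i]) T : int :=
  xget 0 [set n : int | exists theta : R -> R,
    [/\ {within `[0, perimeter T], continuous theta},
        forall t, t \in `[0, perimeter T] -> u (arclength T t) = expi (theta t)
      & theta (perimeter T) - theta 0 = 2 * pi * n%:~R]].

(* Orientation of T as the boundary of a face, with outer normal, of a convex
   body that contains c in its interior: (vtx2 - vtx1) x (vtx3 - vtx1) has to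
   point away from c. *)
Definition outward (c : E) T :=
  if 0 < \det (col_mx (vtx2 T - vtx1 T)
                (col_mx (vtx3 T - vtx1 T) (vtx1 T - c)) : 'M[R]_3)
  then T else reverse T.

Definition tetra := 'I_4 -> E.
Implicit Types t v : tetra.

Definition solid t : set E := [set x | exists c : 'I_4 -> R,
  [/\ forall i, 0 <= c i, \sum_i c i = 1 & x = \sum_i c i *: t i]].

Definition midpoint (x y : E) : E := 2^-1 *: (x + y).
Definition corner t (j : 'I_4) : tetra := fun i => midpoint (t j) (t i).
Definition barycenter t : E := 4^-1 *: \sum_i t i.

(* The face opposite to the vertex k. *)
Definition face t (k : 'I_4) : triangle :=
  let a i := t (lift k (inord i)) in
  outward (barycenter t) (Triangle (a 0%N) (a 1%N) (a 2%N)).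

(* The faces of the octahedron cut out of t, whose center is the barycenter of
   t: inl k is the hole in the face of t opposite to the vertex k, and inr k is
   the face along which the corner at the vertex k is attached. *)
Definition octa_face t (k : 'I_4 + 'I_4) : triangle :=
  outward (barycenter t)
    match k with
    | inl k => let a i := t (lift k (inord i)) in
        Triangle (midpoint (a 0%N) (a 1%N)) (midpoint (a 1%N) (a 2%N))
                 (midpoint (a 2%N) (a 0%N))
    | inr k => let a i := t (lift k (inord i)) in
        Triangle (midpoint (t k) (a 0%N)) (midpoint (t k) (a 1%N))
                 (midpoint (t k) (a 2%N))
    end.

(* Vertex 3 points upwards; vertices 0, 1, 2 span the horizontal face. *)
Definition pyramid v :=
  [/\ forall i j, i != j -> edist (v i) (v j) = 2 * pi / 3,
      forall i j, i != ord_max -> j != ord_max -> v i 0 ord_max = v j 0 ord_max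
    & forall i, i != ord_max -> v i 0 ord_max < v ord_max 0 ord_max].

(* The 4^n tetrahedra of P_n are indexed by the words of length n, the i-th
   letter telling which corner is taken at step i; vertex labels, hence the
   top vertex 3, are inherited. *)
Definition subtetra v (w : seq 'I_4) : tetra := foldl corner v w.

Definition SP v : set E :=
  \bigcap_n \bigcup_(w in [set w | size w = n]) solid (subtetra v w).

(* inl k stands for Delta_{0,k+1}; inr (w, k), with w of length n - 1 encoding
   m, for Delta_{n,m,k}: the octahedron faces inl 0, inl 1, inl 2 are the ones
   numbered 1, 2, 3, the horizontal one inl 3 is number 4. *)
Definition ZPT_index := ('I_4 + seq 'I_4 * ('I_4 + 'I_4))%type.

Definition Delta v (d : ZPT_index) : triangle :=
  match d with
  | inl k => face v k
  | inr (w, k) => octa_face (subtetra v w) k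
  end.

Definition HSP := (seq 'I_4 * 'I_3)%type.
(* lift ord_max embeds 'I_3 as {0, 1, 2}: the holes in the oblique faces. *)
Definition HSP_index (h : HSP) : ZPT_index := inr (h.1, inl (lift ord_max h.2)).
Definition DeltaH v h := Delta v (HSP_index h).

Definition ZPT v (s : ZPT_index -> R) :=
  module_sum (fun d : ZPT_index => UFM (s d) (Delta v d)).

Definition UFMf v (s : ZPT_index -> R) (f : HSP -> int) :=
  module_sum (fun p : {h : HSP & 'I_`|f h|%N} =>
    let h := tag p in
    UFM (s (HSP_index h)) (if 0 < f h then DeltaH v h else reverse (DeltaH v h))).

Definition ST v s f := module_add (ZPT v s) (UFMf v s f).

(* The class of (H, 2P - I) in K^1(C(SP)) = Hom(K_1(C(SP)), Z) is its index map
   [u] |-> - Index(P pi(u) P), u unitary in C(SP). It is the element f of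
   prod_HSP Z if it is the pairing of f with the winding numbers of u, the
   coordinates of [u] in K_1(C(SP)) = bigoplus_HSP Z. *)
Definition K1_class v (M : moduleData R E) (f : HSP -> int) :=
  exists2 P, spectral_resolution (dirac M) P &
  let P0 := P `[0, +oo[%classic in
  forall u : E -> R[i], CX (SP v) u -> (forall x, SP v x -> `|u x| = 1) ->
    finite_set [set h | winding u (DeltaH v h) != 0] /\
    fredholm_index (range P0) (P0 \o rep M u)
      (- \sum_(h \in [set: HSP]) f h * winding u (DeltaH v h)).

End geometry.

(* Main.v *)
(* The exponentials diagonalize D on each UFM(T), so D has an orthonormal basis of
   eigenvectors on the whole direct sum, with finitely many eigenvalues in every bounded
   interval: this gives selfadjointness, the compact resolvent and the spectral projections.

   The commutator with a is bounded by K on UFM(T) iff a is K-Lipschitz along T. The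
   triangles cover the edges of all tetrahedra of all levels. If a is 1-Lipschitz along them,
   its values at the vertices of level n extend, by McShane's formula on each cell of level n,
   to a function that is 1-Lipschitz on each cell; cells meet only in vertices, so the
   variation of the extension along a curve in SP is at most the length of the curve, and the
   extension is uniformly close to a. Conversely the intrinsic distance to a point, defined by
   1-Lipschitz curves, is itself 1-Lipschitz along every triangle.

   For the index, a unimodular function of winding number w on a circle is z^w h, where the
   Toeplitz operator of h is invertible, so its Toeplitz operator has index -w. By uniform
   continuity the small triangles have winding number 0 and uniformly invertible Toeplitz
   operators, so the indices of the summands add up. The winding numbers along the faces of
   each octahedron, and along those of P_0, cancel edge by edge: ZPT contributes 0, and only
   UFM(f) is seen by the index map. *)

From HB Require Import structures.
From mathcomp Require Import all_boot all_order all_algebra.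
From mathcomp Require Import all_classical all_reals all_analysis.
From mathcomp Require Import measurable_realfun ring lra.
Require Import Defs.

Set Implicit Arguments.
Unset Strict Implicit.
Unset Printing Implicit Defensive.

Import Order.TTheory GRing.Theory Num.Theory.
Import numFieldNormedType.Exports.
From mathcomp Require Import complex.

Local Open Scope classical_set_scope.
Local Open Scope ring_scope.

(** Two obstacles shape the proof. Boundedness of a commutator concerns operators, while the metric
    needs a pointwise Lipschitz bound along each triangle. The bridge is translation: the matrix
    coefficients of multiplication by [g(x + t)] in the exponentials are pure exponentials in [t],
    whose derivative at 0 is, up to the factor i, the form of the commutator. Differentiation gives
    one direction and the mean value inequality the other; vectors that concentrate at a point turn
    operator norms into values.

    Fredholm properties pass to infinite direct sums only with a common bound on solutions. They are
    therefore carried with explicit bases of kernel and cokernel and an explicit constant; on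
    triangles where [u] is within 1/2 of a constant this constant is 2, and only finitely many
    triangles remain.

    Trigonometric approximation is made explicit by a sampled Fejer kernel, because the
    factorization uses the roots of a polynomial. The factor [h] keeps a continuous argument besides
    its invertible Toeplitz operator, so one factorization yields the index, the winding number and
    the lift of the argument. *)

Section cmod.
Variable R : realType.
Implicit Types z w : R[i].

(** The norm of [R[i]] takes its values in [R[i]]; [cmod] is the same number as an element of [R],
    ready to be compared with [vnorm]. *)
Definition cmod z : R := Re `|z|.

Lemma cmodE z : (cmod z)%:C%C = `|z|.
Proof. by rewrite /cmod RRe_real // ger0_real. Qed.

Lemma cmod_ge0 z : 0 <= cmod z.
Proof. by rewrite -ler0c cmodE. Qed.

Lemma cmod_sqrt z : cmod z = Num.sqrt (Re z ^+ 2 + Im z ^+ 2).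
Proof. by rewrite /cmod normc_def. Qed.

Lemma cmod_sqr z : cmod z ^+ 2 = Re z ^+ 2 + Im z ^+ 2.
Proof. by rewrite cmod_sqrt sqr_sqrtr // addr_ge0 // sqr_ge0. Qed.

Lemma cmodM z w : cmod (z * w) = cmod z * cmod w.
Proof. by apply: (@complexI R); rewrite rmorphM /= !cmodE normrM. Qed.

Lemma cmodD z w : cmod (z + w) <= cmod z + cmod w.
Proof. by rewrite -lecR rmorphD /= !cmodE ler_normD. Qed.

Lemma cmod0 : cmod 0 = 0.
Proof. by rewrite /cmod normr0. Qed.

Lemma cmod1 : cmod 1 = 1.
Proof. by rewrite /cmod normr1. Qed.

Lemma cmodN z : cmod (- z) = cmod z.
Proof. by rewrite /cmod normrN. Qed.

Lemma cmodB z w : cmod (z - w) = cmod (w - z).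
Proof. by rewrite -cmodN opprB. Qed.

Lemma cmodJ z : cmod (conjc z) = cmod z.
Proof. by rewrite /cmod normcJ. Qed.

Lemma cmodV z : cmod z^-1 = (cmod z)^-1.
Proof. 
have [->|z0] := eqVneq z 0; first by rewrite invr0 cmod0 invr0.
apply: (@complexI R); rewrite cmodE normfV -cmodE fmorphV //.
Qed.

Lemma cmod_eq0 z : (cmod z == 0) = (z == 0).
Proof. by rewrite -(inj_eq (@complexI R)) cmodE normr_eq0. Qed.

Lemma cmod_real (x : R) : cmod (x%:C)%C = `|x|.
Proof. by rewrite cmod_sqrt /= expr0n addr0 sqrtr_sqr. Qed.

Lemma Re_le_cmod z : `|Re z| <= cmod z.
Proof. by rewrite cmod_sqrt -sqrtr_sqr ler_wsqrtr // lerDl sqr_ge0. Qed.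

Lemma Im_le_cmod z : `|Im z| <= cmod z.
Proof. by rewrite cmod_sqrt -sqrtr_sqr ler_wsqrtr // lerDr sqr_ge0. Qed.

Lemma mulJc z : z * conjc z = ((cmod z ^+ 2)%:C)%C.
Proof. by rewrite rmorphXn /= cmodE sqr_normc. Qed.

Lemma conjcM z w : conjc (z * w) = conjc z * conjc w.
Proof. exact: rmorphM. Qed.

Lemma conjcB z w : conjc (z - w) = conjc z - conjc w.
Proof. exact: rmorphB. Qed.

Lemma real_complexM (a b : R) : ((a * b)%:C = a%:C * b%:C)%C.
Proof. exact: rmorphM. Qed.

Lemma real_complexD (a b : R) : ((a + b)%:C = a%:C + b%:C)%C.
Proof. exact: rmorphD. Qed.

Lemma real_complexB (a b : R) : ((a - b)%:C = a%:C - b%:C)%C.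
Proof. exact: rmorphB. Qed.

Lemma conjcX z n : conjc (z ^+ n) = conjc z ^+ n.
Proof. exact: rmorphXn. Qed.

Lemma conjc_sum (I : Type) (s : seq I) (P : pred I) (F : I -> R[i]) :
  conjc (\sum_(i <- s | P i) F i) = \sum_(i <- s | P i) conjc (F i).
Proof. exact: rmorph_sum. Qed.

Lemma cmodX z n : cmod (z ^+ n) = cmod z ^+ n.
Proof. by elim: n => [|n IH]; rewrite ?expr0 ?cmod1 // !exprS cmodM IH. Qed.

Lemma cmod_sum (I : Type) (s : seq I) (P : pred I) (F : I -> R[i]) :
  cmod (\sum_(i <- s | P i) F i) <= \sum_(i <- s | P i) cmod (F i).
Proof.
elim/big_ind2 : _ => //; first by rewrite cmod0.
by move=> a b c d ab cd; rewrite (le_trans (cmodD _ _)) // lerD.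
Qed.

Lemma cmod_le z : cmod z <= `|Re z| + `|Im z|.
Proof.
rewrite -(@ler_pXn2r _ 2) ?nnegrE ?cmod_ge0 ?addr_ge0 //.
rewrite cmod_sqr sqrrD !real_normK ?num_real // lerD2r lerDl mulrn_wge0 //.

Qed.

End cmod.

(** * Orthonormal bases *)

Section hilbert.
Variables (R : realType) (H : preHilbert R).
Implicit Types x y z w : H.

Lemma dotDl x y z : dot H (x + y) z = dot H x z + dot H y z.
Proof. exact: linearDl. Qed.
Lemma dotDr x y z : dot H x (y + z) = dot H x y + dot H x z.
Proof. exact: linearDr. Qed.
Lemma dotZl c x y : dot H (c *: x) y = c * dot H x y.
Proof. exact: linearZl_LR. Qed.
Lemma dotZr c x y : dot H x (c *: y) = conjc c * dot H x y.
Proof. exact: linearZr_LR. Qed.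
Lemma dotNl x y : dot H (- x) y = - dot H x y.
Proof. exact: linearNl. Qed.
Lemma dotBl x y z : dot H (x - y) z = dot H x z - dot H y z.
Proof. exact: linearBl. Qed.
Lemma dotBr x y z : dot H x (y - z) = dot H x y - dot H x z.
Proof. exact: linearBr. Qed.
Lemma dot0l x : dot H 0 x = 0.
Proof. exact: linear0l. Qed.
Lemma dot0r x : dot H x 0 = 0.
Proof. exact: linear0r. Qed.

Lemma dot_suml (J : Type) (s : seq J) (P : pred J) (F : J -> H) y :
  dot H (\sum_(i <- s | P i) F i) y = \sum_(i <- s | P i) dot H (F i) y.
Proof.
elim/big_rec2 : _ => [|i a b _ <-]; [exact: dot0l|exact: dotDl].
Qed.
Lemma dot_sumr (J : Type) (s : seq J) (P : pred J) (F : J -> H) y :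
  dot H y (\sum_(i <- s | P i) F i) = \sum_(i <- s | P i) dot H y (F i).
Proof.
elim/big_rec2 : _ => [|i a b _ <-]; [exact: dot0r|exact: dotDr].
Qed.

Lemma vnorm_ge0 x : 0 <= vnorm x.
Proof. exact: sqrtr_ge0. Qed.

Lemma vnorm_sqr x : vnorm x ^+ 2 = Re (dot H x x).
Proof. by rewrite /vnorm sqr_sqrtr // Re_dot_ge0. Qed.

Lemma vnorm0 : vnorm (0 : H) = 0.
Proof. by rewrite /vnorm dot0l sqrtr0. Qed.

Lemma vnorm_eq0 x : vnorm x = 0 -> x = 0.
Proof.
move=> x0; apply/eqP/negPn/negP => xn0.
have : 0 < dot H x x by exact: neq0_dnorm_gt0.
by rewrite dotxx x0 expr0n ltxx.
Qed.

Lemma vnormZ c x : vnorm (c *: x) = cmod c * vnorm x.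
Proof.
apply/eqP; rewrite -(@eqrXn2 _ 2) ?vnorm_ge0 ?mulr_ge0 ?vnorm_ge0 ?cmod_ge0 //.
by rewrite vnorm2Z exprMn cmod_sqr.
Qed.

Lemma vnormN x : vnorm (- x) = vnorm x.
Proof. by rewrite -scaleN1r vnormZ cmodN cmod1 mul1r. Qed.

Lemma vnormB x y : vnorm (x - y) = vnorm (y - x).
Proof. by rewrite -vnormN opprB. Qed.

Lemma cauchy_schwarz x y : cmod (dot H x y) <= vnorm x * vnorm y.
Proof.
have [->|y0] := eqVneq y 0; first by rewrite dot0r cmod0 vnorm0 mulr0.
have ny : 0 < vnorm y.
  by rewrite lt_neqAle vnorm_ge0 andbT eq_sym; apply: contra y0 => /eqP/vnorm_eq0 ->.
rewrite -(@ler_pXn2r _ 2) ?nnegrE ?cmod_ge0 ?mulr_ge0 ?vnorm_ge0 //.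
(* The vector [|y|^2 x - <x, y> y] has square norm [|y|^2 (|x|^2 |y|^2 - |<x, y>|^2)]. *)
have := Re_dot_ge0 ((vnorm y ^+ 2)%:C%C *: x - dot H x y *: y).
rewrite dotBl !dotBr !dotZl !dotZr (dotC y x) !dotxx cmod_sqr exprMn.
case: (dot H x y) => a b /=.
rewrite !(mulr0, mul0r, subr0, addr0, oppr0, sub0r) => h.
have : 0 <= vnorm y ^+ 2 * (vnorm x ^+ 2 * vnorm y ^+ 2 - (a ^+ 2 + b ^+ 2)).
  by apply: (le_trans h); rewrite le_eqVlt; apply/orP; left; apply/eqP; ring.
by rewrite pmulr_rge0 ?exprn_gt0 // subr_ge0.
Qed.

Lemma vnormD x y : vnorm (x + y) <= vnorm x + vnorm y.
Proof.
rewrite -(@ler_pXn2r _ 2) ?nnegrE ?addr_ge0 ?vnorm_ge0 //.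
rewrite vnorm_sqr Re_dotD -!vnorm_sqr sqrrD.
have := le_trans (ler_norm _) (le_trans (Re_le_cmod _) (cauchy_schwarz x y)).
lra.
Qed.

Lemma vnorm_triB x y z : vnorm (x - z) <= vnorm (x - y) + vnorm (y - z).
Proof. by rewrite (le_trans _ (vnormD _ _)) // addrA subrK. Qed.

Lemma ler_vnormB x y : vnorm x <= vnorm y + vnorm (x - y).
Proof. by rewrite (le_trans _ (vnormD _ _)) // addrCA subrr addr0. Qed.

Lemma vnorm_le0 x : (forall e : R, 0 < e -> vnorm x <= e) -> x = 0.
Proof.
move=> h; apply: vnorm_eq0; apply/eqP; rewrite eq_le vnorm_ge0 andbT.
by apply/ler_addgt0Pr => e /h; rewrite add0r.
Qed.

Section orthonormal.
Variables (I : countType) (e : I -> H).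
Hypothesis e_on : forall i j, dot H (e i) (e j) = (i == j)%:R.
Implicit Types (c : I -> R[i]) (s : seq I).

Definition psum c s : H := \sum_(i <- s) c i *: e i.
Definition coord x i := dot H x (e i).
Definition sumsq c s : R := \sum_(i <- s) cmod (c i) ^+ 2.

Lemma vnorm_on i : vnorm (e i) = 1.
Proof. by rewrite /vnorm e_on eqxx sqrtr1. Qed.

Lemma coord_psum c s i : uniq s -> coord (psum c s) i = if i \in s then c i else 0.
Proof.
move=> us; rewrite /coord /psum dot_suml; have [is_|is_] := boolP (i \in s).
  rewrite (bigD1_seq i) //= dotZl e_on eqxx mulr1 big1 ?addr0 // => j ji.
  by rewrite dotZl e_on (negbTE ji) mulr0.
rewrite big1_seq // => j /= js; rewrite dotZl e_on.
by case: eqP => [ji|]; rewrite ?mulr0 //; rewrite -ji js in is_.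
Qed.

Lemma dot_psum c s y : dot H (psum c s) y = \sum_(i <- s) c i * conjc (coord y i).
Proof.
by rewrite /psum dot_suml; apply: eq_bigr => i _; rewrite dotZl /coord -dotC.
Qed.

Lemma vnorm_psum c s : uniq s -> vnorm (psum c s) ^+ 2 = sumsq c s.
Proof.
move=> us; rewrite vnorm_sqr dot_psum raddf_sum; apply: eq_big_seq => i si.
by rewrite coord_psum // si mulJc.
Qed.

Lemma sumsq_ge0 c s : 0 <= sumsq c s.
Proof. by apply: sumr_ge0 => i _; exact: sqr_ge0. Qed.

Lemma bessel_eq x s : uniq s ->
  vnorm (x - psum (coord x) s) ^+ 2 = vnorm x ^+ 2 - sumsq (coord x) s.
Proof.
move=> us; rewrite vnorm_sqr Re_dotB -!vnorm_sqr vnorm_psum //.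
have -> : Re (dot H x (psum (coord x) s)) = sumsq (coord x) s.
  rewrite dotC dot_psum raddf_sum /= raddf_sum; apply: eq_bigr => i _.
  by rewrite mulJc /= .
by rewrite -addrA mulr_natl mulr2n opprD addrA [in RHS]addrC addrA; ring.
Qed.

Lemma bessel x s : uniq s -> sumsq (coord x) s <= vnorm x ^+ 2.
Proof. by move=> us; rewrite -subr_ge0 -bessel_eq // sqr_ge0. Qed.

Lemma sumsq_sub c s t : uniq s -> uniq t -> {subset s <= t} -> sumsq c s <= sumsq c t.
Proof.
move=> us ut st; rewrite /sumsq [leRHS](bigID (mem s)) /= -[leRHS]addrC.
rewrite -[X in _ <= _ + X]big_filter.
have pst : perm_eq [seq i <- t | i \in s] s.
  apply: uniq_perm => //; first exact: filter_uniq.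
  by move=> i; rewrite mem_filter andb_idr // => /st.
by rewrite (perm_big _ pst) /= lerDr sumr_ge0 // => i _; exact: sqr_ge0.
Qed.

Lemma bessel_sub x s t : uniq s -> uniq t -> {subset s <= t} ->
  vnorm (x - psum (coord x) t) <= vnorm (x - psum (coord x) s).
Proof.
move=> us ut st; rewrite -(@ler_pXn2r _ 2) ?nnegrE ?vnorm_ge0 //.
by rewrite !bessel_eq // lerD2l lerN2 sumsq_sub.
Qed.

Lemma psum_sub c s t : uniq s -> uniq t -> {subset s <= t} ->
  vnorm (psum c t - psum c s) ^+ 2 = sumsq c t - sumsq c s.
Proof.
move=> us ut st.
have -> : psum c s = psum (coord (psum c t)) s.
  by apply: eq_big_seq => i /st si; rewrite coord_psum // si.
rewrite bessel_eq // vnorm_psum //; congr (_ - _).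
by apply: eq_big_seq => i /st si; rewrite coord_psum // si.
Qed.

(** An exhaustion of the countable index set by finite lists: completeness is stated for sequences,
    while sums over [I] are unordered. *)
Definition enum_lt n : seq I := pmap pickle_inv (iota 0 n).

Lemma mem_enum_lt n i : (i \in enum_lt n) = (pickle i < n)%N.
Proof.
rewrite /enum_lt mem_pmap; apply/mapP/idP => [[k]|ni].
  rewrite mem_iota add0n /= => kn h.
  by have := @pickle_invK I k; rewrite -h /= => ->.
by exists (pickle i); rewrite ?mem_iota // pickleK_inv.
Qed.

Lemma enum_lt_uniq n : uniq (enum_lt n).
Proof. by apply: (@pmap_uniq _ _ _ (@pickle I)); [exact: pickle_invK|exact: iota_uniq]. Qed.

Lemma enum_lt_sub m n : (m <= n)%N -> {subset enum_lt m <= enum_lt n}.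
Proof. by move=> mn i; rewrite !mem_enum_lt => /leq_trans; apply. Qed.

Lemma enum_lt_cover s : exists N, {subset s <= enum_lt N}.
Proof.
elim: s => [|i s [N sN]]; first by exists 0.
exists (maxn (pickle i).+1 N) => j; rewrite inE => /predU1P[->|/sN].
  by rewrite mem_enum_lt leq_max leqnn.
by apply: enum_lt_sub; rewrite leq_maxr.
Qed.

Hypothesis H_complete : hilbert_complete H.

(** The partial sums along [enum_lt] are Cauchy because the square of their distance is an increment
    of the bounded monotone sequence [a]. Convergence over all finite sets, the last clause, follows
    since a larger set gives a better approximation ([bessel_sub]). *)
Lemma riesz_fischer c (B : R) : (forall s, uniq s -> sumsq c s <= B) ->
  exists x, [/\ forall i, coord x i = c i, vnorm x ^+ 2 <= B &
    forall d : R, 0 < d -> exists2 s, uniq s & forall t, uniq t ->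
      {subset s <= t} -> vnorm (x - psum c t) < d].
Proof.
move=> cB; pose a n := sumsq c (enum_lt n).
have a_nd : nondecreasing_seq a.
  by move=> m n mn; apply: sumsq_sub; rewrite ?enum_lt_uniq //; exact: enum_lt_sub.
have a_cvg : cvgn a.
  apply: nondecreasing_is_cvgn => //; exists B => _ [n _ <-].
  by apply: cB; exact: enum_lt_uniq.
pose u n := psum c (enum_lt n).
have u_cauchy : forall d : R, 0 < d -> exists N, forall m n,
    (N <= m)%N -> (N <= n)%N -> vnorm (u m - u n) < d.
  move=> d d0; have d2 : 0 < d ^+ 2 / 2 by rewrite divr_gt0 ?exprn_gt0.
  have /cvgrPdist_lt/(_ _ d2) [N _ hN] := a_cvg.
  exists N; suff W m n : (N <= m)%N -> (m <= n)%N -> vnorm (u n - u m) < d.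
    move=> m n Nm Nn; have [mn|/ltnW nm] := leqP m n; last exact: W.
    by rewrite vnormB; apply: W.
  move=> Nm mn; rewrite -(@ltr_pXn2r _ 2) ?nnegrE ?vnorm_ge0 ?ltW //.
  rewrite psum_sub ?enum_lt_uniq //; last exact: enum_lt_sub.
  rewrite -/(a n) -/(a m).
  have := hN m Nm; have := hN n (leq_trans Nm mn); rewrite /=.
  by rewrite !ltr_norml => /andP[? ?] /andP[? ?]; lra.
have [x ux] := H_complete u_cauchy.
have ux' (d : R) : 0 < d -> exists N, forall n, (N <= n)%N -> vnorm (x - u n) < d.
  move=> d0; have /cvgrPdist_lt/(_ _ d0) [N _ hN] := ux.
  exists N => n /hN /=; rewrite sub0r normrN ger0_norm ?vnorm_ge0 //.
  by rewrite vnormB.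
have xc i : coord x i = c i.
  apply/eqP; rewrite -subr_eq0 -cmod_eq0 eq_le cmod_ge0 andbT.
  apply/ler_addgt0Pr => d d0; rewrite add0r.
  have [N hN] := ux' _ d0; pose n := maxn (pickle i).+1 N.
  have -> : coord x i - c i = coord (x - u n) i.
    rewrite {2}/coord dotBl -!/(coord _ i) coord_psum ?enum_lt_uniq //.
    by rewrite mem_enum_lt leq_maxl.
  apply: (le_trans (cauchy_schwarz _ _)); rewrite vnorm_on mulr1.
  by apply/ltW/hN; exact: leq_maxr.
exists x; split => //.
  have B0 : 0 <= B by apply: le_trans (cB [::] _); rewrite ?sumsq_ge0.
  rewrite -(sqr_sqrtr B0) ler_pXn2r ?nnegrE ?vnorm_ge0 ?sqrtr_ge0 //.
  apply/ler_addgt0Pr => d d0; have [N hN] := ux' _ d0.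
  apply: (le_trans (ler_vnormB x (u N))); apply: lerD; last exact/ltW/hN.
  rewrite -(@ler_pXn2r _ 2) ?nnegrE ?vnorm_ge0 ?sqrtr_ge0 //.
  rewrite [leRHS]sqr_sqrtr //.
  by rewrite vnorm_psum ?enum_lt_uniq //; apply: cB; exact: enum_lt_uniq.
move=> d d0; have [N hN] := ux' _ d0; exists (enum_lt N); first exact: enum_lt_uniq.
move=> t ut st; have E s : psum c s = psum (coord x) s.
  by apply: eq_bigr => i _; rewrite xc.
have := hN N (leqnn _); rewrite /u !E; apply: le_lt_trans.
by apply: bessel_sub => //; exact: enum_lt_uniq.
Qed.

Hypothesis e_total : forall x, (forall i, coord x i = 0) -> x = 0.

Lemma coord_inj x y : (forall i, coord x i = coord y i) -> x = y.
Proof.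
move=> h; apply/eqP; rewrite -subr_eq0; apply/eqP/e_total => i.
by rewrite /coord dotBl -!/(coord _ i) h subrr.
Qed.

Lemma coord_approx x (d : R) : 0 < d -> exists2 s, uniq s &
  forall t, uniq t -> {subset s <= t} -> vnorm (x - psum (coord x) t) < d.
Proof.
move=> d0; have [y [yc _ h]] := riesz_fischer (bessel x).
have yx : y = x by apply: coord_inj => i; rewrite yc.
by rewrite yx in h; exact: h.
Qed.

Lemma vnorm_le_sumsq x (B : R) : 0 <= B ->
  (forall s, uniq s -> sumsq (coord x) s <= B ^+ 2) -> vnorm x <= B.
Proof.
move=> B0 h; rewrite -(@ler_pXn2r _ 2) ?nnegrE ?vnorm_ge0 //.
have [y [yc + _]] := riesz_fischer h.
by have -> : x = y by apply: coord_inj => i; rewrite yc.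
Qed.

Lemma le_vnorm_coord x y (K : R) : 0 <= K ->
  (forall i, cmod (coord x i) <= K * cmod (coord y i)) -> vnorm x <= K * vnorm y.
Proof.
move=> K0 h; apply: vnorm_le_sumsq => [|s us]; first by rewrite mulr_ge0 ?vnorm_ge0.
rewrite exprMn; apply: (le_trans _ (ler_wpM2l (sqr_ge0 K) (bessel y us))).
rewrite /sumsq mulr_sumr; apply: ler_sum => i _.
by rewrite -exprMn ler_pXn2r ?nnegrE ?mulr_ge0 ?cmod_ge0.
Qed.

Lemma exists_coord c y (K : R) : (forall i, cmod (c i) <= K * cmod (coord y i)) ->
  exists x, forall i, coord x i = c i.
Proof.
move=> h; have [|x [xc _ _]] := @riesz_fischer c (K ^+ 2 * vnorm y ^+ 2).
  move=> s us; apply: (le_trans _ (ler_wpM2l (sqr_ge0 K) (bessel y us))).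
  rewrite /sumsq mulr_sumr; apply: ler_sum => i _.
  rewrite -exprMn -[leRHS]real_normK ?num_real // ler_pXn2r ?nnegrE ?cmod_ge0 //.
  by rewrite (le_trans (h i)) // ler_norm.
by exists x.
Qed.

(** Equality of two inner products from equality of their terms, without series: [y] and [z] are
    truncated to a common finite set [r], where both sides agree exactly, and the tails are small by
    Cauchy-Schwarz. *)
Lemma parseval_dot w x y z :
  (forall i, coord w i * conjc (coord y i) = coord x i * conjc (coord z i)) ->
  dot H w y = dot H x z.
Proof.
move=> h; apply/eqP; rewrite -subr_eq0 -cmod_eq0 eq_le cmod_ge0 andbT.
apply/ler_addgt0Pr => d d0; rewrite add0r.
pose k := vnorm w + vnorm x + 1.
have k0 : 0 < k by rewrite ltr_wpDl // addr_ge0 ?vnorm_ge0.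
have dk : 0 < d / k by rewrite divr_gt0.
have [s us hs] := coord_approx y dk; have [t ut ht] := coord_approx z dk.
pose r := undup (s ++ t); have ur : uniq r by exact: undup_uniq.
have yr : vnorm (y - psum (coord y) r) < d / k.
  by apply: hs => // i si; rewrite mem_undup mem_cat si.
have zr : vnorm (z - psum (coord z) r) < d / k.
  by apply: ht => // i si; rewrite mem_undup mem_cat si orbT.
have -> : dot H w y - dot H x z =
    dot H w (y - psum (coord y) r) - dot H x (z - psum (coord z) r).
  have E : dot H w (psum (coord y) r) = dot H x (psum (coord z) r).
    rewrite dotC [RHS]dotC !dot_psum !rmorph_sum /=; apply: eq_bigr => i _.
    by rewrite !rmorphM /= !conjcK mulrC h mulrC.
  by rewrite !dotBr E; ring.
apply: (le_trans (cmodD _ _)); rewrite cmodN.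
apply: (@le_trans _ _ (vnorm w * (d / k) + vnorm x * (d / k))).
  apply: lerD; apply: (le_trans (cauchy_schwarz _ _)); rewrite ler_wpM2l ?vnorm_ge0 //;
  exact: ltW.
rewrite -mulrDl mulrA ler_pdivrMr // mulrC ler_pM2l // /k lerDl ler01 //.
Qed.

End orthonormal.
End hilbert.

(** * Diagonal operators *)

(** The limit along an ultrafilter is the supremum of the lower bounds valid on some set of the
    ultrafilter. Such limits exist for all coordinates at once, which replaces a diagonal extraction
    of subsequences. *)
Lemma ultra_cvg_bounded (R : realType) (U : set_system nat) (a : nat -> R) (K : R) :
  UltraFilter U -> (forall n, `|a n| <= K) ->
  exists l, forall e : R, 0 < e -> U [set n | `|a n - l| < e].
Proof.
move=> UU aK; have PU : ProperFilter U by exact: ultra_proper.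
pose S := [set t | U [set n | t <= a n]].
have S0 : S !=set0.
  exists (- K); rewrite /S /=; apply: filterS filterT => n _ /=.
  by have := aK n; rewrite ler_norml => /andP[].
have Sub : has_ubound S.
  exists K => t /= /filter_ex [n /= tn]; apply: (le_trans tn).
  exact: (le_trans (ler_norm _) (aK n)).
have hS : has_sup S by [].
exists (sup S) => e e0.
have [t St lt] := sup_adherent e0 hS.
have U1 : U [set n | sup S - e < a n].
  by apply: filterS St => n /=; apply: lt_le_trans.
have U2 : U [set n | a n < sup S + e].
  have [h|h] := in_ultra_setVsetC [set n | sup S + e <= a n] UU.
    have : sup S + e <= sup S by apply: ub_le_sup.
    by rewrite gerDl leNgt e0.
  by apply: filterS h => n /= /negP; rewrite -ltNge.
apply: filterS2 U1 U2 => n /= u1 u2.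
by rewrite ltr_distl u1 u2.
Qed.

Lemma ultra_cvg_complex (R : realType) (U : set_system nat) (a : nat -> R[i]) (K : R) :
  UltraFilter U -> (forall n, cmod (a n) <= K) ->
  exists l, forall e : R, 0 < e -> U [set n | cmod (a n - l) < e].
Proof.
move=> UU aK; have PU : ProperFilter U by exact: ultra_proper.
have [n|p hp] := @ultra_cvg_bounded _ _ (fun n => Re (a n)) K UU.
  exact: le_trans (Re_le_cmod _) (aK n).
have [n|q hq] := @ultra_cvg_bounded _ _ (fun n => Im (a n)) K UU.
  exact: le_trans (Im_le_cmod _) (aK n).
exists (p +i* q)%C => e e0; have e2 : 0 < e / 2 by rewrite divr_gt0.
apply: filterS2 (hp _ e2) (hq _ e2) => n /= h1 h2.
apply: (le_lt_trans (cmod_le _)); move: h1 h2.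
case: (a n) => x y /= ? ?; rewrite [ltRHS](splitr e).
exact: ltrD.
Qed.

Section diagonal.
Variables (R : realType) (H : preHilbert R) (I : countType) (e : I -> H).
Hypothesis e_on : forall i j, dot H (e i) (e j) = (i == j)%:R.
Hypothesis H_complete : hilbert_complete H.
Hypothesis e_total : forall x, (forall i, coord e x i = 0) -> x = 0.
Variables (lam : I -> R) (D : H -> H -> Prop).
Hypothesis DE : forall x y,
  D x y <-> forall i, coord e y i = (lam i)%:C%C * coord e x i.
Implicit Types x y z : H.

Let cinj := coord_inj e_total.

Lemma coordD x y i : coord e (x + y) i = coord e x i + coord e y i.
Proof. exact: dotDl. Qed.
Lemma coordB x y i : coord e (x - y) i = coord e x i - coord e y i.
Proof. exact: dotBl. Qed.
Lemma coordZ c x i : coord e (c *: x) i = c * coord e x i.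
Proof. exact: dotZl. Qed.

Lemma diag_psum (c : I -> R[i]) s : uniq s ->
  D (psum e c s) (psum e (fun i => (lam i)%:C%C * c i) s).
Proof.
move=> us; apply/DE => i; rewrite !coord_psum //.
by case: ifP; rewrite ?mulr0.
Qed.

Lemma diag_densely_defined : densely_defined D.
Proof.
move=> x d d0; have [s us hs] := coord_approx e_on H_complete e_total x d0.
exists (psum e (coord e x) s); last exact: hs.
by eexists; exact: diag_psum.
Qed.

Lemma diag_selfadjoint : selfadjoint D.
Proof.
split; first exact: diag_densely_defined.
move=> x y; split => [/DE Dxy z w /DE Dzw|h].
  apply: (parseval_dot e_on H_complete e_total) => i.
  by rewrite Dzw Dxy conjcM conjc_real mulrCA mulrA.
apply/DE => i; have := h (e i) ((lam i)%:C%C *: e i).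
rewrite dotZl => E; rewrite /coord dotC -E ?conjcM ?conjc_real -?dotC //.
apply/DE => j; rewrite coordZ /coord e_on.
by case: eqP => [->|]; rewrite ?mulr0.
Qed.

Lemma coord_scale_ex (c : I -> R[i]) (K : R) (y : H) : 0 <= K ->
  (forall i, cmod (c i) <= K) ->
  exists x, (forall i, coord e x i = c i * coord e y i) /\ vnorm x <= K * vnorm y.
Proof.
move=> K0 cK.
have [i|x xc] := @exists_coord _ _ _ _ e_on H_complete (fun i => c i * coord e y i) y K.
  by rewrite cmodM ler_wpM2r ?cmod_ge0.
exists x; split => //; apply: (le_vnorm_coord e_on H_complete e_total) => // i.
by rewrite xc cmodM ler_wpM2r ?cmod_ge0.
Qed.

(** The diagonal operator with entries [c]. For bounded [c] the choice is harmless: the vector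
    exists by Riesz-Fischer and is unique by totality. *)
Definition coord_scale (c : I -> R[i]) (y : H) : H :=
  xget 0 [set x | forall i, coord e x i = c i * coord e y i].

Lemma coord_scaleE (c : I -> R[i]) (K : R) y i : 0 <= K ->
  (forall i, cmod (c i) <= K) -> coord e (coord_scale c y) i = c i * coord e y i.
Proof.
move=> K0 cK; rewrite /coord_scale; case: xgetP => [x _ -> //|h].
by have [x [xc _]] := coord_scale_ex y K0 cK; have := h x.
Qed.

Hypothesis lam_finite : forall K : R, exists s : seq I, forall i, `|lam i| <= K -> i \in s.

Let rho i : R[i] := ((1 + lam i ^+ 2)^-1)%:C%C.

Let rho_gt0 i : 0 < 1 + lam i ^+ 2.
Proof. by rewrite ltr_pwDl // sqr_ge0. Qed.

Let rho_le1 i : cmod (rho i) <= 1.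
Proof.
rewrite cmod_real ger0_norm ?invr_ge0 ?(ltW (rho_gt0 i)) //.
by rewrite invf_le1 ?lerDl ?sqr_ge0.
Qed.

Let T := coord_scale rho.
Let TE y i : coord e (T y) i = rho i * coord e y i.
Proof. exact: coord_scaleE ler01 rho_le1. Qed.

Let T_linear : linear T.
Proof.
move=> c x y; apply: cinj => i.
by rewrite coordD coordZ !TE coordD coordZ mulrDr mulrCA.
Qed.

Lemma diag_resolvent x y : resolvent D x y <-> T x = y.
Proof.
split => [[z [w [/DE Dyz /DE Dzw <-]]]|<-].
  apply: cinj => i; rewrite TE coordD Dzw Dyz /rho.
  rewrite mulrA -real_complexM -[X in _ * (X + _)]mul1r -mulrDl -real_complexD mulrA.
  by rewrite -real_complexM -expr2 mulVf ?mul1r // gt_eqF.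
(* Solving [(I + D^2) y = x] requires [D y] and [D^2 y] as vectors; their coordinates are those of
   [x] times [lam / (1 + lam^2)] and [lam^2 / (1 + lam^2)], both of modulus at most 1. *)
have lr i : `|lam i| / (1 + lam i ^+ 2) <= 1.
  rewrite ler_pdivrMr // mul1r; have := sqr_ge0 (`|lam i| - 1).
  rewrite sqrrB1 real_normK ?num_real // => h.
  have := normr_ge0 (lam i); lra.
have l2r i : lam i ^+ 2 / (1 + lam i ^+ 2) <= 1.
  by rewrite ler_pdivrMr // mul1r lerDr.
have [|z [zc _]] := @coord_scale_ex (fun i => (lam i / (1 + lam i ^+ 2))%:C%C) 1 x ler01.
  by move=> i; rewrite cmod_real normrM normfV (ger0_norm (ltW (rho_gt0 i))).
have [|w [wc _]] := @coord_scale_ex (fun i => (lam i ^+ 2 / (1 + lam i ^+ 2))%:C%C) 1 x ler01.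
  move=> i; rewrite cmod_real ger0_norm ?divr_ge0 ?sqr_ge0 // ?ltW //.
exists z, w; split.
- by apply/DE => i; rewrite zc TE /rho mulrA -real_complexM.
- by apply/DE => i; rewrite zc wc mulrA -real_complexM mulrA expr2.
apply: cinj => i; rewrite coordD TE wc /rho -mulrDl -real_complexD.
by rewrite -[X in X + _]mul1r -mulrDl divff ?mul1r // gt_eqF.
Qed.

(** Along an ultrafilter [u] converges coordinatewise to some [l], and [T] turns this into norm
    convergence: finitely many coordinates are handled one by one, and on the others [rho] is
    uniformly small. A subsequence is extracted only at the end. *)
Lemma diag_compact_resolvent : compact_op (resolvent D).
Proof.
exists T => //; split; first exact: diag_resolvent.
move=> u [K uK].
have [U [UU ooU]] := ultraFilterLemma (eventually_filter : ProperFilter \oo).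
have PU : ProperFilter U by exact: ultra_proper.
have K0 : 0 <= K by apply: le_trans (uK 0%N); exact: vnorm_ge0.
have cK n i : cmod (coord e (u n) i) <= K.
  by rewrite (le_trans _ (uK n)) // (le_trans (cauchy_schwarz _ _)) // (vnorm_on e_on) mulr1.
have /choice [c hc] : forall i, exists l, forall d : R, 0 < d ->
    U [set n | cmod (coord e (u n) i - l) < d].
  by move=> i; apply: (@ultra_cvg_complex _ _ _ K).
have near_s (s : seq I) (d : R) : 0 < d ->
    U [set n | forall i, i \in s -> cmod (coord e (u n) i - c i) < d].
  move=> d0; elim: s => [|i s IH]; first by apply: filterS filterT => n _ i.
  apply: filterS2 IH (hc i _ d0) => n h1 h2 j; rewrite inE => /predU1P[->//|].
  exact: h1.
have [l [lc _ _]] : exists x, [/\ forall i, coord e x i = c i, vnorm x ^+ 2 <= K ^+ 2 &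
    forall d : R, 0 < d -> exists2 s, uniq s & forall t, uniq t ->
      {subset s <= t} -> vnorm (x - psum e c t) < d].
  apply: riesz_fischer => // s us; apply/ler_addgt0Pr => d d0.
  (* For [0 <= m <= 1] and [a <= K] one has [(a + m)^2 <= a^2 + (2 K + 1) m]; the second entry of
     the minimum makes these errors sum to at most [d] over [s]. *)
  have sd : 0 < Num.min 1 (d / ((2 * K + 1 ) * (size s)%:R + 1)).
    by rewrite lt_min ltr01 divr_gt0 // ltr_wpDl // mulr_ge0 // addr_ge0 // mulr_ge0.
  have [n hn] := filter_ex (near_s s _ sd).
  apply: (@le_trans _ _ (\sum_(i <- s) (cmod (coord e (u n) i) ^+ 2
       + (2 * K + 1) * Num.min 1 (d / ((2 * K + 1 ) * (size s)%:R + 1))))).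
    rewrite /sumsq !big_seq; apply: ler_sum => i si.
    have := hn _ si; set m := Num.min _ _ => cm.
    have m1 : m <= 1 by rewrite ge_min lexx.
    have h1 : cmod (c i) <= cmod (coord e (u n) i) + m.
      rewrite -[c i](subrK (coord e (u n) i)) addrC (le_trans (cmodD _ _)) // lerD2l.
      by rewrite cmodB ltW.
    apply: (@le_trans _ _ ((cmod (coord e (u n) i) + m) ^+ 2)).
      by rewrite ler_pXn2r ?nnegrE ?cmod_ge0 // (le_trans (cmod_ge0 _) h1).
    have := cK n i; have := cmod_ge0 (coord e (u n) i) => a0 aK.
    rewrite sqrrD -addrA lerD2l; have : 0 <= m by rewrite ltW.
    by move=> m0; nra.
  rewrite big_split /= -/(sumsq _ _) lerD //.
    apply: (le_trans (bessel e_on _ us)).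
    by rewrite ler_pXn2r ?nnegrE ?vnorm_ge0.
  rewrite big_const_seq count_predT iter_addr_0 -[_ *+ size s]mulr_natr.
  set A := 2 * K + 1; have A0 : 0 < A by rewrite /A ltr_wpDl // mulr_ge0.
  apply: (@le_trans _ _ (A * (d / (A * (size s)%:R + 1)) * (size s)%:R)).
    by rewrite ler_wpM2r // ler_wpM2l ?(ltW A0) // ge_min lexx orbT.
  rewrite mulrAC mulrA ler_pdivrMr ?ltr_wpDl ?mulr_ge0 ?(ltW A0) //.
  by rewrite mulrC ler_pM2l // lerDl.
have near_l (d : R) : 0 < d -> U [set n | vnorm (T (u n) - T l) < d].
  move=> d0.
  pose B := K + vnorm l + 1.
  have B0 : 0 < B by rewrite /B ltr_wpDl // addr_ge0 ?vnorm_ge0.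
  (* Outside [s0], [|lam| > 1] gives [rho <= 1 / |lam|], hence [rho <= d / (2 B)]. On [s] each
     coordinate of [u n - l] is within [m], which sums to less than [d / 2]. *)
  have [s0 hs0] := lam_finite (Num.max 1 (2 * B / d)).
  pose s := undup s0.
  pose m := d / (2 * ((size s)%:R + 1)).
  have m0 : 0 < m by rewrite divr_gt0 // mulr_gt0 // ltr_wpDl.
  apply: filterS (near_s s _ m0) => n /= hn.
  have hl : coord e (T (u n) - T l) =1 fun i => rho i * coord e (u n - l) i.
    by move=> i; rewrite !coordB !TE mulrBr.
  (* split off the finitely many coordinates with small eigenvalue *)
  pose y := psum e (coord e (u n - l)) s.
  have us : uniq s by exact: undup_uniq.
  have -> : T (u n) - T l = T y + T (u n - l - y).
    by apply: cinj => i; rewrite hl [RHS]coordD !TE [in RHS]coordB; ring.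
  apply: (le_lt_trans (vnormD _ _)); rewrite (splitr d).
  apply: ltr_leD.
    apply: (@le_lt_trans _ _ (1 * vnorm y)).
      apply: (le_vnorm_coord e_on H_complete e_total) => // i.
      by rewrite TE cmodM ler_wpM2r ?cmod_ge0.
    rewrite mul1r /y /psum.
    apply: (@le_lt_trans _ _ (\sum_(i <- s) m)).
      apply: (@le_trans _ _ (\sum_(i <- s) vnorm (coord e (u n - l) i *: e i))).
        elim/big_ind2 : _ => [|a a' b b' h1 h2|//]; first by rewrite vnorm0.
        by apply: (le_trans (vnormD _ _)); apply: lerD.
      rewrite !big_seq; apply: ler_sum => i si; rewrite vnormZ (vnorm_on e_on) mulr1.
      by rewrite coordB lc ltW // hn.
    rewrite big_const_seq count_predT iter_addr_0 -[_ *+ size s]mulr_natr /m.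
    rewrite invfM mulrA mulrAC ltr_pdivrMr ?ltr_wpDl // ltr_pM2l ?divr_gt0 //.
    by rewrite ltrDl.
  apply: (@le_trans _ _ (d / (2 * B) * vnorm (u n - l))).
    apply: (le_vnorm_coord e_on H_complete e_total); first by rewrite divr_ge0 ?mulr_ge0 ?ltW.
    move=> i; rewrite TE cmodM coordB coord_psum //; case: ifPn => is_.
      by rewrite subrr cmod0 mulr0 !mulr_ge0 ?cmod_ge0 ?invr_ge0 ?mulr_ge0 ?ltW.
    rewrite subr0 ler_wpM2r ?cmod_ge0 //.
    have : ~~ (`|lam i| <= Num.max 1 (2 * B / d)).
      by apply: contra is_ => /hs0; rewrite /s mem_undup.
    rewrite -ltNge gt_max => /andP[l1 lB].
    rewrite cmod_real ger0_norm ?invr_ge0 ?(ltW (rho_gt0 i)) //.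
    rewrite -[leRHS]invrK lef_pV2 ?posrE ?invr_gt0 ?divr_gt0 ?mulr_gt0 //.
    rewrite invf_div (le_trans (ltW lB)) // -[X in _ <= _ + X]real_normK ?num_real //.
    by rewrite ler_wpDl // expr2 ler_peMl // ltW.
  rewrite mulrC mulrA ler_pdivrMr ?mulr_gt0 // mulrC.
  have -> : d / 2 * (2 * B) = d * B by field.
  rewrite ler_wpM2l ?(ltW d0) //.
  by rewrite (le_trans (vnormD _ _)) // vnormN /B -addrA lerD // lerDl ler01.
have ex_next (p : nat * nat) : exists n, (p.1 < n)%N /\
    vnorm (T (u n) - T l) < (p.2.+1)%:R^-1.
  have d0 : 0 < (p.2.+1)%:R^-1 :> R by rewrite invr_gt0.
  have a : U [set n | (p.1 < n)%N] by apply: ooU; exists p.1.+1.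
  by have [n [? ?]] := filter_ex (filterI a (near_l _ d0)); exists n.
have [g hg] := choice ex_next.
(* Every set of the ultrafilter meets every final segment, so each index can be taken beyond the
   previous one. *)
pose phi := fix phi n := if n is n'.+1 then g (phi n', n) else g (0%N, 0%N).
exists phi, (T l); split.
  apply: homo_ltn => [a b c'|n]; first exact: ltn_trans.
  by have [] := hg (phi n, n.+1).
have phiT n : vnorm (T (u (phi n)) - T l) < (n.+1)%:R^-1.
  by case: n => [|n] /=; [have [] := hg (0%N,0%N)|have [] := hg (phi n, n.+1)].
apply/cvgrPdist_lt => d d0; near=> n.
rewrite sub0r normrN ger0_norm ?vnorm_ge0 //.
apply: (lt_trans (phiT n)).
by near: n; exact: near_infty_natSinv_lt (PosNum d0).
Unshelve. all: by end_near. Qed.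

(** Turns sums over [enum_lt] into sums over [nat], with the value 0 at numbers that code no index:
    the form that extended series and [mseries] require. *)
Lemma sum_pickle_inv (V : nmodType) (c : I -> V) n :
  \sum_(0 <= k < n) oapp c 0 (pickle_inv k) = \sum_(i <- enum_lt I n) c i.
Proof.
rewrite /enum_lt /index_iota subn0; elim: (iota 0 n) => [|k s IH]; first by rewrite !big_nil.
by rewrite big_cons IH /=; case: (pickle_inv k) => [i|] /=; rewrite ?big_cons ?add0r.
Qed.

Lemma dot_series_cvg u x :
  \sum_(i <- enum_lt I n) Re (coord e u i * conjc (coord e x i)) @[n --> \oo]
    --> Re (dot H u x).
Proof.
apply/cvgrPdist_lt => d d0.
pose k := vnorm u + 1; have k0 : 0 < k by rewrite ltr_wpDl ?vnorm_ge0.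
have [s us hs] := coord_approx e_on H_complete e_total x (divr_gt0 d0 k0).
have [N hN] := enum_lt_cover s.
exists N => // n /= Nn.
have -> : \sum_(i <- enum_lt I n) Re (coord e u i * conjc (coord e x i)) =
    Re (dot H u (psum e (coord e x) (enum_lt I n))).
  rewrite dotC dot_psum rmorph_sum /= raddf_sum; apply: eq_bigr => i _.
  by rewrite conjcM conjcK mulrC.
rewrite -raddfB -dotBr (le_lt_trans (Re_le_cmod _)) //.
rewrite (le_lt_trans (cauchy_schwarz _ _)) //.
apply: (@le_lt_trans _ _ (k * vnorm (x - psum e (coord e x) (enum_lt I n)))).
  by rewrite ler_wpM2r ?vnorm_ge0 // lerDl.
rewrite mulrC -ltr_pdivlMr //; apply: hs; first exact: enum_lt_uniq.
by move=> i /hN; apply: enum_lt_sub.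
Qed.

Lemma dot_eseries u x : (forall i, 0 <= Re (coord e u i * conjc (coord e x i))) ->
  (\sum_(0 <= k <oo)
     (oapp (fun i => Re (coord e u i * conjc (coord e x i))) 0 (pickle_inv k))%:E)%E
  = (Re (dot H u x))%:E.
Proof.
move=> h; apply/cvg_lim => //.
under eq_fun do rewrite sumEFin sum_pickle_inv.
by apply: cvg_EFin; [exact: nearW|exact: dot_series_cvg].
Qed.

Definition spectral_proj (B : set R) : H -> H :=
  coord_scale (fun i => (\1_B (lam i))%:C%C).

Let indic_le1 B i : cmod ((\1_B (lam i))%:C%C : R[i]) <= 1.
Proof. by rewrite cmod_real indicE normr_nat lern1; case: (_ \in _). Qed.

Lemma spectral_projE B x i :
  coord e (spectral_proj B x) i = (\1_B (lam i))%:C%C * coord e x i.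
Proof. exact: coord_scaleE ler01 (indic_le1 B). Qed.

Lemma spectral_projP B : orthogonal_projection (spectral_proj B).
Proof.
move=> x y; split.
  apply: cinj => i; rewrite !spectral_projE mulrA -real_complexM.
  by rewrite indicE; case: (_ \in _); rewrite ?mul1r ?mul0r.
apply: (parseval_dot e_on H_complete e_total) => i.
by rewrite !spectral_projE conjcM conjc_real mulrCA mulrA.
Qed.

Section spectral_measure.
Variable x : H.

Let w (k : nat) : {nonneg R} :=
  `|oapp (fun i => cmod (coord e x i) ^+ 2) 0 (pickle_inv k : option I)|%:nng.
Let a (k : nat) : measurableTypeR R := oapp lam 0 (pickle_inv k : option I).

(** The sum of the point masses [|<x, e i>|^2] at [lam i]. The absolute value in [w] only supplies
    the type of nonnegative numbers. *)
Definition spectral_measure : {measure set (measurableTypeR R) -> \bar R} :=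
  mseries (fun k => mscale (w k) (\d_(a k))) 0.

Let wE k : (w k)%:num = oapp (fun i => cmod (coord e x i) ^+ 2) 0 (pickle_inv k : option I).
Proof. by rewrite /= ger0_norm //; case: pickle_inv => //= i; exact: sqr_ge0. Qed.

Lemma integral_spectral_measure (f : measurableTypeR R -> \bar R) :
  (forall t, 0 <= f t)%E -> measurable_fun [set: measurableTypeR R] f ->
  (\int[spectral_measure]_t f t)%E = (\sum_(0 <= k <oo)
    oapp (fun i => (cmod (coord e x i) ^+ 2)%:E * f (lam i)) 0 (pickle_inv k))%E.
Proof.
move=> f0 mf; rewrite ge0_integral_measure_series //.
apply: eq_eseriesr => k _; rewrite ge0_integral_mscale // integral_dirac // diracT mul1e.
rewrite wE /a; case: pickle_inv => //=; by rewrite mul0e.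
Qed.

(** Here [u] is [g(D) x]: the integral of [g] against the spectral measure of [x] is [<g(D) x, x>].
    Taking for [g] an indicator identifies the measure itself. *)
Lemma integral_spectral_measure_dot (g : R -> R) u :
  (forall t, 0 <= g t) -> measurable_fun [set: measurableTypeR R] g ->
  (forall i, coord e u i = (g (lam i))%:C%C * coord e x i) ->
  (\int[spectral_measure]_t (g t)%:E)%E = (Re (dot H u x))%:E.
Proof.
move=> g0 mg uE.
have E i : Re (coord e u i * conjc (coord e x i)) = cmod (coord e x i) ^+ 2 * g (lam i).
  by rewrite uE -mulrA mulJc /= ; ring.
rewrite integral_spectral_measure //; last exact/measurable_EFinP.
rewrite -dot_eseries; last by move=> i; rewrite E mulr_ge0 // sqr_ge0.
by apply: eq_eseriesr => k _; case: pickle_inv => //= i; rewrite E.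
Qed.

End spectral_measure.

Lemma diag_spectral_resolution : spectral_resolution D spectral_proj.
Proof.
split=> [B _|x|x]; first exact: spectral_projP.
  by apply: cinj => i; rewrite spectral_projE indicT mul1r.
exists (spectral_measure x); split.
- move=> B mB; have -> : spectral_measure x B = (\int[spectral_measure x]_t (\1_B t)%:E)%E.
    by rewrite integral_indic // setIT.
  apply: integral_spectral_measure_dot => //; last exact: spectral_projE.
- have m2 : measurable_fun [set: measurableTypeR R] (fun t : R => (t ^+ 2)%:E).
    by apply/measurable_EFinP; exact: measurable_funX.
  split=> [[y /DE yE]|].
    have [|u [uE _]] := @coord_scale_ex (fun i => (lam i ^+ 2 / (1 + lam i ^+ 2))%:C%C) 1 x ler01.
      move=> i; rewrite cmod_real ger0_norm ?divr_ge0 ?sqr_ge0 ?(ltW (rho_gt0 i)) //.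
      by rewrite ler_pdivrMr // mul1r lerDr.
    rewrite integral_spectral_measure //; last by move=> t; rewrite lee_fin sqr_ge0.
    apply: (@le_lt_trans _ _ (vnorm y ^+ 2)%:E); last exact: ltry.
    apply: lime_le => [|].
      apply: is_cvg_nneseries => k _ _; case: pickle_inv => //= i.
      by rewrite mule_ge0 ?lee_fin ?sqr_ge0.
    apply: nearW => n.
    have -> : (\sum_(0 <= k < n) oapp (fun i => (cmod (coord e x i) ^+ 2)%:E * (lam i ^+ 2)%:E)
        0 (pickle_inv k))%E = (\sum_(0 <= k < n) oapp (fun i => cmod (coord e y i) ^+ 2)
        0 (pickle_inv k))%:E.
      rewrite -sumEFin; apply: eq_bigr => k _; case: pickle_inv => //= i.
      by rewrite yE cmodM cmod_real exprMn real_normK ?num_real // -EFinM mulrC.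
    by rewrite sum_pickle_inv lee_fin; apply: bessel => //; exact: enum_lt_uniq.
  rewrite integral_spectral_measure //; last by move=> t; rewrite lee_fin sqr_ge0.
  set S := (\sum_(_ <= _ <oo) _)%E => Soo.
  have S0 : (0 <= S)%E.
    apply: nneseries_ge0 => k _ _; case: pickle_inv => //= i.
    by rewrite mule_ge0 ?lee_fin ?sqr_ge0.
  (* A finite second moment bounds the square sums of [lam i * <x, e i>], so these are the
     coordinates of a vector, namely [D x]. *)
  have [|y [yc _ _]] := @riesz_fischer _ _ _ _ e_on H_complete
      (fun i => (lam i)%:C%C * coord e x i) (fine S).
    move=> s us; have [N hN] := enum_lt_cover s.
    apply: (le_trans (sumsq_sub _ us (enum_lt_uniq I N) hN)).
    rewrite -lee_fin fineK ?ge0_fin_numE // /sumsq -sum_pickle_inv.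
    have E : (\sum_(0 <= k < N) oapp (fun i => (cmod (coord e x i) ^+ 2)%:E * (lam i ^+ 2)%:E)
        0 (pickle_inv k))%E = (\sum_(0 <= k < N) oapp (fun i =>
          cmod ((lam i)%:C%C * coord e x i) ^+ 2) 0 (pickle_inv k))%:E.
      rewrite -sumEFin; apply: eq_bigr => k _; case: pickle_inv => //= i.
      by rewrite cmodM cmod_real exprMn real_normK ?num_real // -EFinM mulrC.
    rewrite -E; apply: nneseries_lim_ge => k _ _; case: pickle_inv => //= i.
    by rewrite mule_ge0 ?lee_fin ?sqr_ge0.
  by exists y; apply/DE.
move=> y /DE yE; rewrite /Rintegral integralE.
have mid : measurable_fun [set: measurableTypeR R] (fun t : R => t) by exact: measurable_id.
(* The integral of [t] is split into its positive and negative parts. Each is dominated by [|t|], so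
   [g(D) x] exists by comparison with the coordinates of [y = D x]. *)
have ex_part (g : R -> R) : (forall t, 0 <= g t) -> (forall t, g t <= `|t|) ->
    measurable_fun [set: measurableTypeR R] g ->
    exists u, [/\ forall i, coord e u i = (g (lam i))%:C%C * coord e x i &
     (\int[spectral_measure x]_t (g t)%:E)%E = (Re (dot H u x))%:E].
  move=> g0 gle mg.
  have [i|u uc] := @exists_coord _ _ _ _ e_on H_complete
    (fun i => (g (lam i))%:C%C * coord e x i) y 1.
    rewrite mul1r yE !cmodM ler_wpM2r ?cmod_ge0 // !cmod_real ger0_norm //.
  by exists u; split => //; exact: integral_spectral_measure_dot.
have [| | |up [upc Ep]] := ex_part (fun t => Num.max t 0).
- by move=> t; rewrite le_max lexx orbT.
- by move=> t; rewrite ge_max normr_ge0 ler_norm.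
- by apply: measurable_maxr => //; exact: measurable_cst.
have [| | |un [unc En]] := ex_part (fun t => Num.max (- t) 0).
- by move=> t; rewrite le_max lexx orbT.
- by move=> t; rewrite ge_max normr_ge0 -normrN ler_norm.
- by apply: measurable_maxr; [exact: oppr_measurable|exact: measurable_cst].
have -> : (\int[spectral_measure x]_t (fun t : R => t%:E)^\+ t)%E = (Re (dot H up x))%:E.
  by rewrite -Ep; apply: eq_integral => t _; rewrite funeposE EFin_max.
have -> : (\int[spectral_measure x]_t (fun t : R => t%:E)^\- t)%E = (Re (dot H un x))%:E.
  by rewrite -En; apply: eq_integral => t _; rewrite funenegE EFin_max.
rewrite -EFinB /= -raddfB -dotBl; congr (Re (dot H _ x)); apply: cinj => i.
rewrite coordB upc unc yE -mulrBl; congr (_ * _).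
rewrite -real_complexB; congr (_%:C)%C.
by case: (leP (lam i) 0); case: (leP (- lam i) 0); lra.
Qed.

End diagonal.

(** * Hilbert sums *)

Lemma rsummable_sup (R : realType) (K : choiceType) (f : K -> R) (B : R) :
  (forall k, 0 <= f k) -> (forall s : seq K, uniq s -> \sum_(k <- s) f k <= B) ->
  rsummable f /\ rsum f <= B.
Proof.
move=> f0 fB.
have le : (\esum_(k in [set: K]) (f k)%:E <= B%:E)%E.
  apply: ub_ereal_sup => _ [A [fA _] <-].
  rewrite fsbig_finite //= sumEFin lee_fin; apply: fB; exact: finmap.fset_uniq.
have sf : rsummable f.
  rewrite /rsummable /summable; under eq_esum do rewrite /= ger0_norm //.
  exact: (le_lt_trans le (ltry _)).
split => //; have -> : rsum f = rsum (fun k => f k - 0).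
  by congr rsum; apply/funext => k; rewrite subr0.
rewrite rsumE //; last by rewrite /rsummable /summable esum1 // => k _ /=; rewrite normr0.
rewrite [X in _ - fine X]esum1 // subr0 -lee_fin fineK //; exact: fin_esum.
Qed.

Lemma rsum_ge (R : realType) (K : choiceType) (f : K -> R) (s : seq K) :
  (forall k, 0 <= f k) -> rsummable f -> uniq s -> \sum_(k <- s) f k <= rsum f.
Proof.
move=> f0 sf us; have -> : rsum f = rsum (fun k => f k - 0).
  by congr rsum; apply/funext => k; rewrite subr0.
rewrite rsumE //; last by rewrite /rsummable /summable esum1 // => k _ /=; rewrite normr0.
rewrite [X in _ - fine X]esum1 // subr0 -lee_fin fineK; last exact: fin_esum.
apply: esum_ge; exists [set` s]; first by split.
by rewrite -fsbig_seq // sumEFin.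
Qed.

Lemma rsum_single (R : realType) (K : choiceType) (f : K -> R) k :
  (forall j, j != k -> f j = 0) -> rsum f = f k.
Proof.
move=> f0; rewrite /rsum.
have E (g : K -> \bar R) : (forall j, 0 <= g j)%E -> (forall j, j != k -> g j = 0%E) ->
    (\esum_(i in [set: K]) g i = g k)%E.
  move=> g0 gk; rewrite (esumID [set k]) // setTI esum_set1 // [X in (_ + X)%E]esum1 ?adde0 //.
  by move=> j [_ /= /eqP/gk].
rewrite !E; first by rewrite funeposE funenegE /= -!EFin_max /= -fposneg.
- by move=> j; exact: funeneg_ge0.
- by move=> j /f0 fj; rewrite funenegE /= fj oppr0 maxxx.
- by move=> j; exact: funepos_ge0.
- by move=> j /f0 fj; rewrite funeposE /= fj maxxx.
Qed.

Section dsum_theory.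
Variables (R : realType) (K : choiceType) (H : K -> preHilbert R).
Local Notation DS := (dsum H).
Implicit Types x y : dsumType H.

Lemma dsum_ext x y : (forall k, x k = y k) -> x = y.
Proof. by move=> h; apply/val_inj/functional_extensionality_dep. Qed.

Lemma dsumDE x y k : (x + y) k = x k + y k.
Proof. by have := dsum_funP 1 x y k; rewrite !scale1r. Qed.

Lemma dsum0E k : (0 : dsumType H) k = 0.
Proof. by have := dsumDE 0 0 k; rewrite addr0 => /eqP; rewrite eq_sym -subr_eq0 addrK => /eqP. Qed.

Lemma dsumZE c x k : (c *: x) k = c *: x k.
Proof. by have := dsum_funP c x 0 k; rewrite dsum0E !addr0. Qed.

Lemma dsumBE x y k : (x - y) k = x k - y k.
Proof. by rewrite -(scaleN1r y) dsumDE dsumZE scaleN1r. Qed.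

Lemma dsum_sumE (J : Type) (s : seq J) (P : pred J) (F : J -> dsumType H) k :
  (\sum_(j <- s | P j) F j) k = \sum_(j <- s | P j) F j k.
Proof. by elim/big_rec2 : _ => [|j a b _ <-]; [exact: dsum0E|exact: dsumDE]. Qed.

Lemma dsum_vnorm_sqr x : vnorm (x : DS) ^+ 2 = rsum (fun k => vnorm (x k) ^+ 2).
Proof.
rewrite vnorm_sqr [dot DS x x]/(dsum_dot x x) /dsum_dot /csum /=.
by congr rsum; apply/funext => k; rewrite vnorm_sqr.
Qed.

Lemma dsum_vnorm_ge x s : uniq s -> \sum_(k <- s) vnorm (x k) ^+ 2 <= vnorm (x : DS) ^+ 2.
Proof.
move=> us; rewrite dsum_vnorm_sqr; apply: rsum_ge => //; first by move=> k; exact: sqr_ge0.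
exact: dsum_summable.
Qed.

Lemma dsum_vnorm_comp x k : vnorm (x k) <= vnorm (x : DS).
Proof.
rewrite -(@ler_pXn2r _ 2) ?nnegrE ?vnorm_ge0 //.
by have := @dsum_vnorm_ge x [:: k] isT; rewrite big_seq1.
Qed.

(** Convertible to [dsum_family] for the spaces of a family of modules, so that the lemmas below
    apply to [rep] of a [module_sum]. A bound on finite square sums excludes the default value 0
    ([dsum_family_le]). *)
Definition family (v : forall k, H k) : dsumType H := insubd (0 : dsumType H) (v : dprod H).

Lemma dsum_family_le (v : forall k, H k) (B : R) :
  (forall s, uniq s -> \sum_(k <- s) vnorm (v k) ^+ 2 <= B) ->
  (forall k, family v k = v k) /\ vnorm (family v : DS) ^+ 2 <= B.
Proof.
move=> vB; have [|sv vle] := @rsummable_sup _ K (fun k => vnorm (v k) ^+ 2) B _ vB.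
  by move=> k; exact: sqr_ge0.
have E : dsum_val (family v) = v.
  by rewrite /family [LHS](insubdK (0 : dsumType H)) //; apply/square_summableP.
have Ek k : family v k = v k by rewrite /dsum_fun E.
by split => //; rewrite dsum_vnorm_sqr (_ : rsum _ = rsum (fun k => vnorm (v k) ^+ 2)) //;
  congr rsum; apply/funext => k; rewrite Ek.
Qed.

Lemma dsum_family_bound (v : forall k, H k) x (C : R) : 0 <= C ->
  (forall k, vnorm (v k) <= C * vnorm (x k)) ->
  (forall k, family v k = v k) /\
  vnorm (family v : DS) <= C * vnorm (x : DS).
Proof.
move=> C0 vx; have [s us|E le] := @dsum_family_le v ((C * vnorm (x : DS)) ^+ 2).
  rewrite exprMn (le_trans _ (ler_wpM2l (sqr_ge0 C) (dsum_vnorm_ge x us))) //.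
  rewrite mulr_sumr; apply: ler_sum => k _.
  by rewrite -exprMn ler_pXn2r ?nnegrE ?mulr_ge0 ?vnorm_ge0.
split => //; move: le; rewrite ler_pXn2r ?nnegrE ?mulr_ge0 ?vnorm_ge0 //.
Qed.

Lemma dsum_le_bound x y (C : R) : 0 <= C ->
  (forall k, vnorm (x k) <= C * vnorm (y k)) -> vnorm (x : DS) <= C * vnorm (y : DS).
Proof.
move=> C0 xy; have [E] := dsum_family_bound C0 xy.
by have -> : family (x : forall k, H k) = x by apply: dsum_ext.
Qed.

Definition embed k (h : H k) : dsumType H :=
  family (eqtype.dfwith (fun j => 0 : H j) h : forall j, H j).

Lemma embed_in k (h : H k) : embed h k = h.
Proof.
have [s us|E _] := @dsum_family_le (eqtype.dfwith (fun j => 0 : H j) h) (vnorm h ^+ 2).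
  have [ks|ks] := boolP (k \in s).
    rewrite (bigD1_seq k) //= dfwith_in big1 ?addr0 // => j jk.
    by rewrite dfwith_out ?vnorm0 ?expr0n // eq_sym.
  rewrite big1_seq ?sqr_ge0 // => j /= js; rewrite dfwith_out ?vnorm0 ?expr0n //.
  by apply: contra ks => /eqP ->.
by rewrite E dfwith_in.
Qed.

Lemma embed_out k (h : H k) j : j != k -> embed h j = 0.
Proof.
move=> jk; have [s us|E _] := @dsum_family_le (eqtype.dfwith (fun j => 0 : H j) h) (vnorm h ^+ 2).
  have [ks|ks] := boolP (k \in s).
    rewrite (bigD1_seq k) //= dfwith_in big1 ?addr0 // => i ik.
    by rewrite dfwith_out ?vnorm0 ?expr0n // eq_sym.
  rewrite big1_seq ?sqr_ge0 // => i /= si; rewrite dfwith_out ?vnorm0 ?expr0n //.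
  by apply: contra ks => /eqP ->.
by rewrite E dfwith_out // eq_sym.
Qed.

Lemma dot_embed k (h : H k) y : dot DS (embed h) y = dot (H k) h (y k).
Proof.
rewrite [dot DS (embed h) y]/(dsum_dot (embed h) y) /dsum_dot /csum.
rewrite !(@rsum_single _ _ _ k) ?embed_in; first by case: (dot _ _ _).
- by move=> j jk; rewrite embed_out // dot0l.
- by move=> j jk; rewrite embed_out // dot0l.
Qed.

Lemma vnorm_embed k (h : H k) : vnorm (embed h : DS) = vnorm h.
Proof. by rewrite /vnorm dot_embed embed_in. Qed.

Lemma dsum_complete : (forall k, hilbert_complete (H k)) -> hilbert_complete DS.
Proof.
move=> Hc u uC.
have /(_ _)/cid-/all_sig [l hl] : forall k, exists l : H k,
    vnorm ((u n : dsumType H) k - l) @[n --> \oo] --> (0 : R).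
  move=> k; apply: Hc => d d0; have [N hN] := uC _ d0.
  exists N => m n Nm Nn; apply: le_lt_trans (hN _ _ Nm Nn).
  by rewrite -dsumBE dsum_vnorm_comp.
have near_l k (d : R) : 0 < d -> \forall m \near \oo, vnorm ((u m : dsumType H) k - l k) < d.
  move=> d0; have /cvgrPdist_lt/(_ _ d0) := hl k; apply: filterS => m.
  by rewrite sub0r normrN ger0_norm ?vnorm_ge0.
(* The Cauchy bound holds on finite sets of components, passes there to the limit in [m], and bounds
   the whole family because [s] is arbitrary. *)
have bound (d : R) N : 0 < d ->
    (forall m n, (N <= m)%N -> (N <= n)%N -> vnorm (u m - u n) < d) ->
    forall n, (N <= n)%N -> forall s, uniq s ->
      \sum_(k <- s) vnorm ((u n : dsumType H) k - l k) ^+ 2 <= d ^+ 2.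
  move=> d0 hN n Nn s us; apply/ler_addgt0Pr => c c0.
  have /cvgrPdist_lt/(_ _ c0)[M _ hM] :
      \sum_(k <- s) vnorm ((u n : dsumType H) k - (u m : dsumType H) k) ^+ 2 @[m --> \oo]
      --> \sum_(k <- s) vnorm ((u n : dsumType H) k - l k) ^+ 2.
    elim: s {us} => [|k s IH]; first by under eq_fun do rewrite big_nil; rewrite big_nil; exact: cvg_cst.
    under eq_fun do rewrite big_cons; rewrite big_cons; apply: cvgD => //.
    have h : vnorm ((u n : dsumType H) k - (u m : dsumType H) k) @[m --> \oo] -->
        vnorm ((u n : dsumType H) k - l k).
      apply/cvgrPdist_lt => b b0; apply: filterS (near_l k _ b0) => m hm.
      apply: le_lt_trans hm; rewrite ler_norml.
      have t1 := vnorm_triB ((u n : dsumType H) k) ((u m : dsumType H) k) (l k).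
      have t2 := vnorm_triB ((u n : dsumType H) k) (l k) ((u m : dsumType H) k).
      by rewrite (vnormB (l k)) in t2; apply/andP; split; lra.
    by under eq_fun do rewrite expr2; rewrite expr2; apply: cvgM.
  have := hM (maxn M N) (leq_maxl _ _); rewrite /= ltr_distlC => /andP[h1 _].
  apply: ltW; apply: (lt_le_trans (_ : _ < \sum_(k <- s) vnorm ((u n : dsumType H) k -
     (u (maxn M N) : dsumType H) k) ^+ 2 + c)); first by rewrite -ltrBlDr.
  rewrite lerD2r; have := dsum_vnorm_ge (u n - u (maxn M N) : dsumType H) us.
  under eq_bigr do rewrite dsumBE; move=> /le_trans; apply.
  by rewrite ler_pXn2r ?nnegrE ?vnorm_ge0 ?(ltW d0) // ltW // hN // leq_maxr.
have [N0 hN0] := uC 1 ltr01.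
have [fE _] := dsum_family_le (bound _ _ ltr01 hN0 _ (leqnn _)).
(* The family [l] itself is not known to be square summable, but its difference from [u N0] is. *)
pose y : dsumType H := u N0 - family (fun k => (u N0 : dsumType H) k - l k).
have yE k : y k = l k by rewrite /y dsumBE fE opprB addrCA subrr addr0.
exists y; apply/cvgrPdist_lt => d d0; have d2 : 0 < d / 2 by rewrite divr_gt0.
have [N hN] := uC _ d2; exists N => // n /= Nn.
rewrite sub0r normrN ger0_norm ?vnorm_ge0 //.
have [gE gle] := dsum_family_le (bound _ _ d2 hN _ Nn).
have -> : u n - y = family (fun k => (u n : dsumType H) k - l k).
  by apply: dsum_ext => k; rewrite gE dsumBE yE.
move: gle; rewrite ler_pXn2r ?nnegrE ?vnorm_ge0 ?(ltW d2) // => /le_lt_trans; apply.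
by rewrite ltr_pdivrMr // ltr_pMr // ltr1n.
Qed.

End dsum_theory.

(** * Fredholm modules with a basis of eigenvectors *)

Section continuous_functions.
Variables (R : realType) (E : topologicalType) (X : set E).
Implicit Types a b : E -> R[i].

(** Continuity with real tolerances: in the topology of [cplx R] the radii are elements of
    [R[i]]. *)
Lemma CXP a : CX X a <-> forall x, X x -> forall d : R, 0 < d ->
  \forall y \near x, X y -> cmod (a y - a x) < d.
Proof.
split => [/subspace_continuousP aX x Xx d d0|h].
  have d0' : 0 < (d%:C%C : cplx R) by rewrite -(ltcR 0 d) in d0.
  have /cvgrPdist_lt/(_ _ d0') := aX x Xx.
  rewrite near_withinE; apply: filterS => y h Xy.
  have : `|a x - a y : R[i]| < (d%:C)%C := h Xy.
  by rewrite -cmodE ltcR cmodB.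
apply/subspace_continuousP => x Xx; apply/cvgrPdist_lt => d d0.
have [d1 d2] : Im (d : R[i]) = 0 /\ 0 < Re (d : R[i]).
  by move: (d0 : (0 : R[i]) < d); rewrite ltcE => /andP[/eqP -> ].
rewrite near_withinE; apply: filterS (h x Xx _ d2) => y hy /hy.
rewrite -ltcR cmodE distrC.
by case: d d1 {d0 d2 hy} => p q /= ->.
Qed.

Lemma CX_cst (c : R[i]) : CX X (fun=> c).
Proof. by apply/CXP => x Xx d d0; apply: nearW => y _; rewrite subrr cmod0. Qed.

Lemma CX_conj a : CX X a -> CX X (fun x => conjc (a x)).
Proof.
move=> /CXP aX; apply/CXP => x Xx d d0; apply: filterS (aX x Xx d d0) => y h /h.
by rewrite -conjcB cmodJ.
Qed.

Lemma CX_add a b : CX X a -> CX X b -> CX X (fun x => a x + b x).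
Proof.
move=> /CXP aX /CXP bX; apply/CXP => x Xx d d0.
have d2 : 0 < d / 2 by rewrite divr_gt0.
apply: filterS2 (aX x Xx _ d2) (bX x Xx _ d2) => y h1 h2 Xy.
rewrite opprD addrACA (le_lt_trans (cmodD _ _)) // (splitr d) ltrD //; [exact: h1|exact: h2].
Qed.

Lemma CX_mul a b : CX X a -> CX X b -> CX X (fun x => a x * b x).
Proof.
move=> /CXP aX /CXP bX; apply/CXP => x Xx d d0.
pose k := cmod (a x) + cmod (b x) + 1.
have k0 : 0 < k by rewrite ltr_wpDl // addr_ge0 ?cmod_ge0.
have k2 : 0 < Num.min 1 (d / k) by rewrite lt_min ltr01 divr_gt0.
apply: filterS2 (aX x Xx _ k2) (bX x Xx _ k2) => y h1 h2 Xy.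
have {}h1 := h1 Xy; have {}h2 := h2 Xy.
set m := Num.min 1 (d / k) in h1 h2 k2.
have m1 : m <= 1 by rewrite ge_min lexx.
have mk : m * k <= d by rewrite -ler_pdivlMr // ge_min lexx orbT.
have -> : a y * b y - a x * b x =
  (a y - a x) * (b y - b x) + ((a y - a x) * b x + a x * (b y - b x)) by ring.
apply: (le_lt_trans (cmodD _ _)); rewrite !cmodM.
apply: (@le_lt_trans _ _ (cmod (a y - a x) * cmod (b y - b x) +
   (cmod (a y - a x) * cmod (b x) + cmod (a x) * cmod (b y - b x)))).
  by rewrite lerD2l (le_trans (cmodD _ _)) // !cmodM.
apply: lt_le_trans mk; rewrite /k.
have := cmod_ge0 (a x); have := cmod_ge0 (b x).
have := cmod_ge0 (a y - a x); have := cmod_ge0 (b y - b x).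
move: h1 h2; set p := cmod (a y - a x); set q := cmod (b y - b x).
set A := cmod (a x); set B := cmod (b x) => pm qm q0 p0 B0 A0.
have pB : p * B <= m * B by rewrite ler_wpM2r // ltW.
have qA : A * q <= A * m by rewrite ler_wpM2l // ltW.
have pq : p * q < m.
  apply: (@le_lt_trans _ _ p) => //; rewrite ler_piMr //.
  by rewrite (le_trans _ m1) // ltW.
lra.
Qed.

End continuous_functions.

(** * Fredholm operators with explicit bases and constants *)

Section index.
Variables (R : realType) (H : preHilbert R).
Implicit Types (S : set H) (T : H -> H).

(** [kb] is a basis of the kernel of [T] on [S], [cb] a basis of a complement of the image, and [C]
    bounds a solution modulo [cb]. A common [C] is what lets solutions on infinitely many summands
    be assembled. The finite types [I] and [J] are arbitrary because the bases of a sum are indexed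
    by dependent pairs. *)
Definition Fred S T (C : R) (I J : finType) := exists (kb : I -> H) (cb : J -> H),
  [/\ (forall i, S (kb i) /\ T (kb i) = 0) /\ (forall j, S (cb j)),
      forall c : I -> R[i], \sum_i c i *: kb i = 0 -> forall i, c i = 0,
      forall (c : J -> R[i]) x, S x -> T x = \sum_j c j *: cb j -> forall j, c j = 0,
      forall x, S x -> T x = 0 -> exists c : I -> R[i], x = \sum_i c i *: kb i
    & forall y, S y -> exists x (c : J -> R[i]),
        [/\ S x, y = T x + \sum_j c j *: cb j & vnorm x <= C * vnorm y]].

Lemma FredW S T C C' I J : C <= C' -> Fred S T C I J -> Fred S T C' I J.
Proof.
move=> CC [kb [cb [h1 h2 h3 h4 h5]]]; exists kb, cb; split => // y /h5[x [c [Sx yE xC]]].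
by exists x, c; split => //; rewrite (le_trans xC) // ler_wpM2r // vnorm_ge0.
Qed.

Lemma Fred_ord S T (C : R) (I J : finType) :
  Fred S T C I J -> Fred S T C 'I_#|I| 'I_#|J|.
Proof.
move=> [kb [cb [[kbS cbS] kbI cbI kbG cbG]]].
have sumE (K : finType) (c : 'I_#|K| -> R[i]) (b : K -> H) :
    \sum_(i < #|K|) c i *: b (enum_val i) = \sum_k c (enum_rank k) *: b k.
  rewrite [RHS](reindex_onto (enum_val : 'I_#|K| -> K) enum_rank) /=.
    by apply: eq_big => [i|i _]; rewrite enum_valK ?eqxx.
  by move=> k _; rewrite enum_rankK.
have sumE' (K : finType) (c : K -> R[i]) (b : K -> H) :
    \sum_(i < #|K|) c (enum_val i) *: b (enum_val i) = \sum_k c k *: b k.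
  by rewrite (sumE K (c \o enum_val)); apply: eq_bigr => k _; rewrite /= enum_rankK.
exists (kb \o enum_val), (cb \o enum_val); split.
- by split => i; [exact: kbS|exact: cbS].
- move=> c; rewrite (sumE _ c kb) => c0 i.
  by have := kbI (c \o enum_rank) c0 (enum_val i); rewrite /= enum_valK.
- move=> c x Sx; rewrite (sumE _ c cb) => c0 j.
  by have := cbI (c \o enum_rank) x Sx c0 (enum_val j); rewrite /= enum_valK.
- by move=> x Sx /(kbG x Sx)[c ->]; exists (c \o enum_val); rewrite (sumE' _ c kb).
- move=> y /cbG[x [c [Sx yE xC]]]; exists x, (c \o enum_val); split => //.
  by rewrite (sumE' _ c cb).
Qed.

Lemma Fred_index S T C m n : S 0 -> (forall c x y, S x -> S y -> S (c *: x + y)) ->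
  linear T -> Fred S T C 'I_m 'I_n -> fredholm_index S T (m%:Z - n%:Z).
Proof.
move=> S0 Sl Tl [kb [cb [[kbS cbS] kbI cbI kbG cbG]]].
have TN x y : T (x - y) = T x - T y by rewrite addrC -scaleN1r Tl scaleN1r addrC.
have SB x y : S x -> S y -> S (x - y) by move=> Sx Sy; rewrite addrC -scaleN1r; exact: Sl.
exists m, n; split => //.
- exists kb => [i|x [Sx Tx]]; first exact: kbS.
  have [c xE] := kbG _ Sx Tx; exists [ffun i => c i]; split.
    under eq_bigr do rewrite ffunE.
    by rewrite -xE subrr.
  move=> c' /= /eqP; rewrite subr_eq0 => /eqP xE'.
  apply/ffunP => i; rewrite ffunE; apply/eqP; rewrite -subr_eq0; apply/eqP.
  apply: (kbI (fun i => c i - c' i)); under eq_bigr do rewrite scalerBl.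
  by rewrite sumrB -xE xE' subrr.
- exists cb => [j|y Sy]; first exact: cbS.
  have [x [c [Sx yE _]]] := cbG _ Sy; exists [ffun j => c j]; split.
    under eq_bigr do rewrite ffunE.
    by exists x => //; rewrite yE addrK.
  move=> c' /= [x' Sx'] /eqP; rewrite eq_sym subr_eq => /eqP yE'.
  apply/ffunP => j; rewrite ffunE; apply/eqP; rewrite -subr_eq0; apply/eqP.
  apply: (cbI (fun j => c j - c' j) (x' - x) (SB _ _ Sx' Sx)); under eq_bigr do rewrite scalerBl.
  rewrite sumrB TN.
  have -> : T x = y - \sum_i c i *: cb i by rewrite [X in _ = X - _]yE addrK.
  have -> : T x' = y - \sum_i c' i *: cb i by rewrite [X in _ = X - _]yE' addrK.
  by rewrite opprB addrC addrA subrK.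
Qed.

End index.

Lemma sum_tagged (V : nmodType) (I : finType) (T : I -> finType) (F : {i : I & T i} -> V) :
  \sum_p F p = \sum_i \sum_(j : T i) F (Tagged T j).
Proof.
rewrite (sig_big_dep xpredT (fun _ => xpredT) (fun i j => F (Tagged T j))) /=.
by apply: eq_bigr => -[i j].
Qed.

Lemma sum_only (V : nmodType) (I : finType) (F : I -> V) k :
  (forall j, j != k -> F j = 0) -> \sum_j F j = F k.
Proof. by move=> h; rewrite (bigD1 k) //= big1 ?addr0. Qed.

(** * Eigenbases and direct sums of modules *)

Section modules.
Variables (R : realType) (E : topologicalType) (X : set E).
Hypothesis X_bounded : forall a, CX X a ->
  exists2 C : R, 0 <= C & forall x, X x -> cmod (a x) <= C.

(** The analysis of [D] goes through this record: [e_dirac] says that [D] is the maximal diagonal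
    operator for [elam]. The record passes to arbitrary countable direct sums ([sum_eigenbasis]). *)
Record eigenbasis (M : moduleData R E) := Eigenbasis {
  eI : countType;
  ev : eI -> hilb M;
  elam : eI -> R;
  e_complete : hilbert_complete (hilb M);
  e_on : forall i j, dot (hilb M) (ev i) (ev j) = (i == j)%:R;
  e_total : forall x, (forall i, coord ev x i = 0) -> x = 0;
  e_dirac : forall x y,
    dirac M x y <-> forall i, coord ev y i = (elam i)%:C%C * coord ev x i }.

Arguments ev {M} e _.
Arguments elam {M} e _.

(** [bounded_op] allows a bound that depends on the summand. The supremum of [a] is a uniform one,
    so that acting componentwise keeps square summability and [rep] of a sum does not fall back to
    its default value 0. *)
Definition contractive (M : moduleData R E) := forall a (C : R), CX X a -> 0 <= C ->
  (forall x, X x -> cmod (a x) <= C) -> forall xi, vnorm (rep M a xi) <= C * vnorm xi.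

Definition good_rep (M : moduleData R E) := unital_representation X M /\ contractive M.

Definition pos_space M (B : eigenbasis M) : set (hilb M) :=
  [set x | forall i, elam B i < 0 -> coord (ev B) x i = 0].

Definition pos_proj M (B : eigenbasis M) := spectral_proj (ev B) (elam B) `[0, +oo[%classic.

Definition toeplitz M (B : eigenbasis M) a (x : hilb M) := pos_proj B (rep M a x).

Lemma pos_projE M (B : eigenbasis M) x i : coord (ev B) (pos_proj B x) i =
  if 0 <= elam B i then coord (ev B) x i else 0.
Proof.
rewrite spectral_projE; [|exact: e_on|exact: e_complete|exact: e_total].
rewrite indicE mem_setE in_itv /= andbT; case: leP; by rewrite ?mul1r ?mul0r.
Qed.

Lemma pos_proj_space M (B : eigenbasis M) x : pos_space B (pos_proj B x).
Proof. by move=> i l0; rewrite pos_projE leNgt l0. Qed.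

Lemma pos_proj_id M (B : eigenbasis M) x : pos_space B x -> pos_proj B x = x.
Proof.
move=> Sx; apply: (coord_inj (@e_total _ B)) => i; rewrite pos_projE.
by case: leP => // /Sx ->.
Qed.

Lemma range_pos_proj M (B : eigenbasis M) : range (pos_proj B) = pos_space B.
Proof.
apply/seteqP; split => [_ [x _ <-]|x Sx]; first exact: pos_proj_space.
by exists x => //; exact: pos_proj_id.
Qed.

Lemma pos_proj_linear M (B : eigenbasis M) : linear (pos_proj B).
Proof.
move=> c x y; apply: (coord_inj (@e_total _ B)) => i.
rewrite coordD coordZ !pos_projE coordD coordZ.
by case: ifP; rewrite ?mulr0 ?addr0.
Qed.

Lemma pos_space0 M (B : eigenbasis M) : pos_space B 0.
Proof. by move=> i _; rewrite /coord dot0l. Qed.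

Lemma pos_space_lin M (B : eigenbasis M) c x y :
  pos_space B x -> pos_space B y -> pos_space B (c *: x + y).
Proof. by move=> Sx Sy i l; rewrite coordD coordZ Sx // Sy // mulr0 addr0. Qed.

Section sum.
Variables (K : countType) (M : K -> moduleData R E).
Local Notation SM := (module_sum M).
Local Notation HK := (fun k => hilb (M k)).

Section basis.
Variable B : forall k, eigenbasis (M k).

Definition sum_ev (p : {k : K & eI (B k)}) : hilb SM := embed (ev (B (tag p)) (tagged p)).
Definition sum_elam (p : {k : K & eI (B k)}) : R := elam (B (tag p)) (tagged p).

Lemma sum_coord (x : hilb SM) p :
  coord sum_ev x p = coord (ev (B (tag p))) ((x : dsumType HK) (tag p)) (tagged p).
Proof. by rewrite /coord dotC dot_embed -dotC. Qed.

Lemma sum_on p q : dot (hilb SM) (sum_ev p) (sum_ev q) = (p == q)%:R.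
Proof.
rewrite [LHS]dot_embed; case: p q => k i [l j] /=.
have [kl|kl] := eqVneq k l.
  by subst l; rewrite embed_in e_on eq_Tagged.
rewrite embed_out // dot0r; case: eqP => // -[kl' _].
by rewrite kl' eqxx in kl.
Qed.

Lemma sum_total (x : hilb SM) : (forall p, coord sum_ev x p = 0) -> x = 0.
Proof.
move=> h; apply: dsum_ext => k; rewrite dsum0E; apply: (@e_total _ (B k)) => i.
by have := h (Tagged (fun k => eI (B k)) i); rewrite sum_coord.
Qed.

Lemma sum_dirac (x y : hilb SM) : dirac SM x y <->
  forall p, coord sum_ev y p = (sum_elam p)%:C%C * coord sum_ev x p.
Proof.
split => [h p|h k].
  by rewrite !sum_coord; exact: (proj1 (e_dirac (B (tag p)) _ _) (h (tag p))).
apply: (proj2 (e_dirac (B k) _ _)) => i.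
by have := h (Tagged (fun k => eI (B k)) i); rewrite !sum_coord.
Qed.

Definition sum_eigenbasis : eigenbasis SM :=
  @Eigenbasis SM _ sum_ev sum_elam (dsum_complete (fun k => e_complete (B k))) sum_on sum_total sum_dirac.

Lemma sum_pos_space (x : hilb SM) :
  pos_space sum_eigenbasis x <-> forall k, pos_space (B k) ((x : dsumType HK) k).
Proof.
split => [h k i li|h [k i] li]; last by rewrite sum_coord; exact: h.
by have := h (Tagged (fun k => eI (B k)) i) li; rewrite sum_coord.
Qed.

Lemma sum_pos_proj (x : hilb SM) k :
  (pos_proj sum_eigenbasis x : dsumType HK) k = pos_proj (B k) ((x : dsumType HK) k).
Proof.
apply: (coord_inj (@e_total _ (B k))) => i; rewrite pos_projE.
have := @pos_projE SM sum_eigenbasis x (Tagged (fun k => eI (B k)) i).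
by rewrite !sum_coord.
Qed.

End basis.

Hypothesis M_good : forall k, good_rep (M k).

Lemma sum_rep a (xi : hilb SM) k : CX X a ->
  (rep SM a xi : dsumType HK) k = rep (M k) a ((xi : dsumType HK) k).
Proof.
move=> aX; have [C C0 aC] := X_bounded aX.
have [] := @dsum_family_bound _ _ HK (fun k => rep (M k) a ((xi : dsumType HK) k)) xi C C0.
  by move=> j; apply: (M_good j).2.
by move=> h _; rewrite -h.
Qed.

Lemma sum_good_rep : good_rep SM.
Proof.
have ctr : contractive SM.
  move=> a C aX C0 aC xi; apply: dsum_le_bound => // k.
  by rewrite sum_rep //; apply: (M_good k).2.
split; last exact: ctr.
split.
- move=> a b aX bX ab; apply/funext => xi; apply: dsum_ext => k.
  rewrite !sum_rep //; have [h _ _ _ _] := (M_good k).1.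
  by rewrite (h a b).
- move=> a aX; split.
    move=> c x y; apply: dsum_ext => k.
    rewrite sum_rep // !dsumDE !dsumZE !sum_rep //.
    by have [_ h _ _ _] := (M_good k).1; have [-> _] := h a aX.
  have [C C0 aC] := X_bounded aX; exists C => xi; exact: ctr.
- move=> a b c xi aX bX; apply: dsum_ext => k.
  have cX : CX X (fun x => c * a x + b x).
    by apply: CX_add; [apply: CX_mul; [exact: CX_cst|exact: aX]|exact: bX].
  rewrite [RHS]dsumDE [X in _ = X + _]dsumZE (sum_rep _ _ aX) (sum_rep _ _ bX) (sum_rep _ _ cX).
  by have [_ _ h _ _] := (M_good k).1; exact: h.
- move=> a b xi aX bX; apply: dsum_ext => k.
  rewrite (sum_rep _ _ (CX_mul aX bX)) (sum_rep _ _ aX) (sum_rep _ _ bX).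
  by have [_ _ _ h _] := (M_good k).1; exact: h.
split.
- move=> a xi eta aX.
  rewrite [LHS]/(dsum_dot _ _) [RHS]/(dsum_dot _ _) /dsum_dot.
  congr csum; apply/funext => k; rewrite (sum_rep _ _ aX) (sum_rep _ _ (CX_conj aX)).
  by have [_ _ _ _ [h _]] := (M_good k).1; exact: h.
- move=> xi; apply: dsum_ext => k; rewrite sum_rep; last exact: CX_cst.
  by have [_ _ _ _ [_ h]] := (M_good k).1; exact: h.
Qed.

Lemma sum_commutator_le a (C : R) : CX X a -> 0 <= C ->
  (forall k, commutator_le (M k) a C) -> commutator_le SM a C.
Proof.
move=> aX C0 h xi eta Dxe.
have /(_ _)/cid-/all_sig [z hz] : forall k, exists zeta : hilb (M k),
    dirac (M k) (rep (M k) a ((xi : dsumType HK) k)) zeta /\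
    vnorm (zeta - rep (M k) a ((eta : dsumType HK) k)) <= C * vnorm ((xi : dsumType HK) k).
  by move=> k; have [zeta] := h k _ _ (Dxe k); exists zeta.
(* Only the differences [z k - a eta_k] are bounded in terms of [xi], so they are assembled first;
   [zeta] is recovered by adding [a eta]. *)
have [fE fle] := @dsum_family_bound _ _ HK
  (fun k => z k - rep (M k) a ((eta : dsumType HK) k)) xi C C0 (fun k => (hz k).2).
exists (family (fun k => z k - rep (M k) a ((eta : dsumType HK) k)) + (rep SM a eta : dsumType HK)).
  by move=> k; rewrite dsumDE fE !sum_rep // subrK; exact: (hz k).1.
by rewrite addrK.
Qed.

(** The bound is tested on vectors supported in one component; [D0] puts the zero components of such
    vectors in the domain. *)
Lemma commutator_le_sum a (C : R) : (forall k, dirac (M k) 0 0) -> CX X a ->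
  commutator_le SM a C -> forall k, commutator_le (M k) a C.
Proof.
move=> D0 aX h k xi eta Dxe.
have De : dirac SM (embed xi) (embed eta).
  move=> j; have [jk|jk] := eqVneq j k; first by subst j; rewrite !embed_in.
  by rewrite !embed_out.
have [zeta Dz zle] := h _ _ De.
exists ((zeta : dsumType HK) k); first by have := Dz k; rewrite sum_rep // embed_in.
rewrite (vnorm_embed xi) in zle; apply: le_trans zle.
apply: (le_trans _ (dsum_vnorm_comp _ k)).
by rewrite dsumBE sum_rep // embed_in.
Qed.

Lemma sum_rep_embed a k (xi : hilb (M k)) : CX X a ->
  rep SM a (embed xi) = 0 -> rep (M k) a xi = 0.
Proof.
move=> aX h; have := congr1 (fun x : dsumType HK => x k) h.
by rewrite sum_rep // embed_in dsum0E.
Qed.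

(** Outside [s] the components are bijective on their positive spaces. The common [C] makes the
    componentwise solutions square summable, and the two bases of the sum are those of the
    components in [s]. *)
Lemma sum_Fred (B : forall k, eigenbasis (M k)) a (C : R) (m n : K -> nat) (s : seq K) :
  CX X a -> 0 <= C -> (forall k, k \notin s -> m k = 0%N /\ n k = 0%N) ->
  (forall k, Fred (pos_space (B k)) (toeplitz (B k) a) C 'I_(m k) 'I_(n k)) ->
  Fred (pos_space (sum_eigenbasis B)) (toeplitz (sum_eigenbasis B) a) C
    {k : seq_sub s & 'I_(m (val k))} {k : seq_sub s & 'I_(n (val k))}.
Proof.
move=> aX C0 mn_s F.
have TE (x : hilb SM) k : (toeplitz (sum_eigenbasis B) a x : dsumType HK) k =
    toeplitz (B k) a ((x : dsumType HK) k).
  by rewrite /toeplitz sum_pos_proj sum_rep.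
have /all_sig [kb] := fun k => cid (F k).
move=> /(_ _)/cid-/all_sig[cb] hF.
pose KB (p : {k : seq_sub s & 'I_(m (val k))}) : hilb SM := embed (kb (val (tag p)) (tagged p)).
pose CB (p : {k : seq_sub s & 'I_(n (val k))}) : hilb SM := embed (cb (val (tag p)) (tagged p)).
have sumE (r : K -> nat) (b : forall k, 'I_(r k) -> hilb (M k)) c (k : seq_sub s) :
    ((\sum_(p : {k : seq_sub s & 'I_(r (val k))}) c p *:
       (embed (b (val (tag p)) (tagged p)) : hilb SM)) : dsumType HK) (val k) =
    \sum_i c (Tagged (fun k : seq_sub s => 'I_(r (val k))) i) *: b (val k) i.
  rewrite dsum_sumE sum_tagged (@sum_only _ _ _ k) => [|j jk].
    by apply: eq_bigr => i _; rewrite dsumZE embed_in.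
  by apply: big1 => i _; rewrite dsumZE embed_out ?scaler0 // eq_sym.
have sumE0 (r : K -> nat) (b : forall k, 'I_(r k) -> hilb (M k)) c k : k \notin s ->
    ((\sum_(p : {k : seq_sub s & 'I_(r (val k))}) c p *:
       (embed (b (val (tag p)) (tagged p)) : hilb SM)) : dsumType HK) k = 0.
  move=> ks; rewrite dsum_sumE big1 // => p _; rewrite dsumZE embed_out ?scaler0 //.
  by apply: contra ks => /eqP ->; exact: (valP (tag p)).
have S_embed k (x : hilb (M k)) : pos_space (B k) x -> pos_space (sum_eigenbasis B) (embed x).
  move=> Sx; apply/sum_pos_space => j; have [jk|jk] := eqVneq j k.
    by subst j; rewrite embed_in.
  by rewrite embed_out //; exact: pos_space0.
have out k : k \notin s -> forall (c : 'I_(n k) -> R[i]) (b : 'I_(n k) -> hilb (M k)),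
    \sum_i c i *: b i = 0.
  by move=> /mn_s[_ nk] c b; rewrite big1 // => i; have := ltn_ord i; rewrite [X in (_ < X)%N]nk.
exists KB, CB; split.
- split; last by move=> p; apply: S_embed; have [[_ h] _ _ _ _] := hF (val (tag p)); exact: h.
  move=> p; have [[h _] _ _ _ _] := hF (val (tag p)).
  split; first by apply: S_embed; exact: (h _).1.
  apply: dsum_ext => j; rewrite TE dsum0E; have [jk|jk] := eqVneq j (val (tag p)).
    by subst j; rewrite embed_in; exact: (h _).2.
  rewrite embed_out // /toeplitz.
  have [[_ hb _ _ _] _] := M_good j; have [l _] := hb _ aX.
  have -> : rep (M j) a 0 = 0.
    have := l 1 0 0; rewrite scaler0 addr0 scale1r => /eqP.
    by rewrite eq_sym -subr_eq0 addrK => /eqP.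
  by apply: pos_proj_id; exact: pos_space0.
- move=> c c0 [k i]; have [_ h _ _ _] := hF (val k).
  apply: (h (fun i => c (Tagged (fun k : seq_sub s => 'I_(m (val k))) i))).
  by rewrite -sumE c0 dsum0E.
- move=> c x Sx Tx [k i]; have [_ _ h _ _] := hF (val k).
  apply: (h (fun i => c (Tagged (fun k : seq_sub s => 'I_(n (val k))) i)) ((x : dsumType HK) (val k))).
    exact: (sum_pos_space B x).1.
  by rewrite -sumE -TE Tx.
- move=> x Sx Tx.
  have /(_ _)/cid-/all_sig[c hc] : forall k, exists c : 'I_(m k) -> R[i],
      (x : dsumType HK) k = \sum_i c i *: kb k i.
    move=> k; have [_ _ _ h _] := hF k; apply: h; first exact: (sum_pos_space B x).1.
    by rewrite -TE Tx dsum0E.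
  exists (fun p => c (val (tag p)) (tagged p)); apply: dsum_ext => k.
  have [ks|ks] := boolP (k \in s).
    by rewrite hc (sumE _ kb _ (SeqSub ks)).
  rewrite (sumE0 _ kb) // hc big1 // => i; have := ltn_ord i.
  by rewrite [X in (_ < X)%N](mn_s _ ks).1.
move=> y Sy.
have /(_ _)/cid-/all_sig[x /(_ _)/cid-/all_sig[c hc]] : forall k, exists x (c : 'I_(n k) -> R[i]),
   [/\ pos_space (B k) x, (y : dsumType HK) k = toeplitz (B k) a x + \sum_j c j *: cb k j
     & vnorm x <= C * vnorm ((y : dsumType HK) k)].
  by move=> k; have [_ _ _ _ h] := hF k; apply: h; exact: (sum_pos_space B y).1.
have [|fE fle] := @dsum_family_bound _ _ HK x y C C0; first by move=> k; have [] := hc k.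
exists (family x), (fun p => c (val (tag p)) (tagged p)); split => //.
  by apply/sum_pos_space => k; rewrite fE; have [] := hc k.
apply: dsum_ext => k; rewrite dsumDE TE fE; have [_ -> _] := hc k.
congr (_ + _); have [ks|ks] := boolP (k \in s).
  by rewrite (sumE _ cb _ (SeqSub ks)).
by rewrite (sumE0 _ cb) // out.
Qed.

End sum.
End modules.

(** * Trigonometric approximation *)

Lemma compact_unif_continuous (R : realType) (E : pseudoMetricType R) (X : set E)
  (a : E -> R[i]) : compact X -> CX X a -> forall d : R, 0 < d ->
  exists2 e : R, 0 < e & forall x y, X x -> X y -> ball x e y -> cmod (a y - a x) < d.
Proof.
move=> cX /CXP aX d d0; have d2 : 0 < d / 2 by rewrite divr_gt0.
pose P (e : R) (x : E) := X x -> forall y, X y -> ball x e y -> cmod (a y - a x) < d.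
have : \forall e \near (0 : R)^'+, X `<=` P e.
  have /compact_near_coveringP cov := cX; apply: cov => x Xx.
  have /nbhs_ballP[e /= e0 he] := aX x Xx _ d2.
  have e2 : 0 < e / 2 by rewrite divr_gt0.
  exists (ball x (e / 2), [set t : R | t < e / 2]) => /=.
    by split; [exact: nbhsx_ballx|exact: nbhs_right_lt].
  move=> [x' t] /= [xx' te] Xx' y Xy x'y.
  have h1 : cmod (a x' - a x) < d / 2.
    by apply: he => //; apply: le_ball xx'; rewrite ler_pdivrMr // ler_pMr // ler1n.
  have h2 : cmod (a y - a x) < d / 2.
    apply: he => //; rewrite (splitr e); apply: ball_triangle xx' _.
    by apply: le_ball x'y; exact: ltW.
  rewrite (_ : a y - a x' = (a y - a x) - (a x' - a x)); last by ring.
  by rewrite (le_lt_trans (cmodD _ _)) // cmodN (splitr d) ltrD.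
move=> /(filterI (@nbhs_right_gt R 0)) /filter_ex [e [/= e0 he]].
by exists e => // x y Xx Xy; exact: (he x Xx Xx y Xy).
Qed.

Lemma compact_bounded_cmod (R : realType) (E : topologicalType) (X : set E)
  (a : E -> R[i]) : compact X -> CX X a ->
  exists2 C : R, 0 <= C & forall x, X x -> cmod (a x) <= C.
Proof.
move=> cX /CXP aX.
pose P (C : R) (x : E) := X x -> cmod (a x) <= C.
have : \forall C \near (+oo : set_system R), X `<=` P C.
  have /compact_near_coveringP cov := cX; apply: cov => x Xx.
  exists ([set y | X y -> cmod (a y - a x) < 1], [set t : R | cmod (a x) + 1 < t]) => /=.
    split; first exact: aX.
    by apply: nbhs_pinfty_gt; exact: num_real.
  move=> [x' t] /= [h ht] Xx'; apply: ltW; apply: le_lt_trans ht.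
  by rewrite -[a x'](subrK (a x)) addrC (le_trans (cmodD _ _)) // lerD2l ltW // h.
move=> /(filterI (nbhs_pinfty_gt (num_real 0))) /filter_ex [C [/= C0 hC]].
by exists C; [exact: ltW|move=> x Xx; exact: hC].
Qed.

Section expi.
Variable R : realType.
Implicit Types x y t : R.
Local Notation expi := (@expi R).

Lemma expiD x y : expi (x + y) = expi x * expi y.
Proof.
rewrite /expi cosD sinD; apply/eqP; rewrite eq_complex /=.
by apply/andP; split; apply/eqP; ring.
Qed.

Lemma expi0 : expi 0 = 1.
Proof. by rewrite /expi cos0 sin0. Qed.

Lemma expiN x : expi (- x) = conjc (expi x).
Proof. by rewrite /expi cosN sinN. Qed.

Lemma cmod_expi x : cmod (expi x) = 1.
Proof. by rewrite cmod_sqrt /= cos2Dsin2 sqrtr1. Qed.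

Lemma expi_mulJ x : expi x * conjc (expi x) = 1.
Proof. by rewrite -expiN -expiD subrr expi0. Qed.

Lemma expiMn x n : expi (x *+ n) = expi x ^+ n.
Proof. by elim: n => [|n IH]; rewrite ?mulr0n ?expi0 // mulrS exprS expiD IH. Qed.

Lemma expi2pi : expi (2 * pi) = 1.
Proof. by rewrite /expi mulr_natl cos2pi sin2pi. Qed.

Lemma expi2piz (n : int) : expi (2 * pi * n%:~R) = 1.
Proof.
case: n => n; first by rewrite -pmulrn mulr_natr expiMn expi2pi expr1n.
rewrite NegzE rmorphN /= mulrN expiN -pmulrn mulr_natr expiMn expi2pi expr1n.
exact: conjc1.
Qed.

Lemma cmod_expiB x y : cmod (expi x - expi y) ^+ 2 = 2 - 2 * cos (x - y).
Proof.
rewrite cmod_sqr /= cosB; have := cos2Dsin2 x; have := cos2Dsin2 y.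
by move=> h1 h2; nra.
Qed.

Lemma expi_eq1 t : 0 < t < 2 * pi -> expi t != 1.
Proof.
move=> /andP[t0 t2]; apply/eqP => -[c1 _].
have : 0 < sin (t / 2) by apply: sin_gt0_pi; rewrite divr_gt0 //= ltr_pdivrMr // mulrC.
have := cos_mulr2n (t / 2); rewrite -[t / 2 *+ 2]mulr_natr divfK ?pnatr_eq0 // c1 cos2sin2 mulr2n.
set s := sin _ => h s0; have : s ^+ 2 = 0 by lra.
by move/eqP; rewrite sqrf_eq0 => /eqP s00; rewrite s00 ltxx in s0.
Qed.

Lemma cmod_expiB_ge x y (d : R) : 0 < d <= pi -> d <= `|x - y| <= pi ->
  2 - 2 * cos d <= cmod (expi x - expi y) ^+ 2 /\ 0 < 2 - 2 * cos d.
Proof.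
move=> /andP[d0 dpi] /andP[xy1 xy2].
have dI : d \in `[0, pi] by rewrite in_itv /= (ltW d0) dpi.
split.
  rewrite cmod_expiB lerD2l lerN2 ler_pM2l // -(cos_norm (x - y)).
  by rewrite leNgt ltr_cos // ?in_itv /= ?normr_ge0 // -leNgt.
have : cos d < cos 0 by rewrite ltr_cos // in_itv /= lexx pi_ge0.
by rewrite cos0; lra.
Qed.

End expi.

(** * Periodic functions and Fejer approximation *)

Section periodic.
Variables (R : realType) (r : R).
Hypothesis r0 : 0 < r.
Local Notation per := (2 * pi * r).

Let per0 : 0 < per. Proof. by rewrite !mulr_gt0 // pi_gt0. Qed.

Lemma periodicz (V : Type) (g : R -> V) : (forall x, g (x + per) = g x) ->
  forall (n : int) x, g (x + n%:~R * per) = g x.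
Proof.
move=> gp; have gpn (n : nat) x : g (x + n%:R * per) = g x.
  elim: n x => [|n IH] x; first by rewrite mul0r addr0.
  by rewrite -natr1 mulrDl mul1r addrA gp IH.
move=> [n|n] x; first by rewrite -pmulrn gpn.
by rewrite NegzE rmorphN /= -pmulrn -(gpn n.+1 (x + _)) mulNr subrK.
Qed.

(** Close points are covered by uniform continuity; for the others the squared chord is at least
    [2 - 2 cos d'], which fixes [C]. The square is the form in which chords are summed against the
    Fejer kernel. *)
Lemma periodic_modulus (g : R -> R[i]) : CX [set: R] g ->
  (forall x, g (x + per) = g x) -> forall e : R, 0 < e ->
  exists2 C : R, 0 <= C & forall x y,
    cmod (g y - g x) <= e + C * cmod (expi (y / r) - expi (x / r)) ^+ 2.
Proof.
move=> gc gp e e0.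
have subX (A : set R) : CX A g.
  by move/CXP: gc => gc; apply/CXP => x Ax d d0; apply: filterS (gc x I d d0) => y h _; exact: h.
have [d d0 hd] := compact_unif_continuous (@segment_compact R (- (2 * per)) (2 * per)) (subX _) e0.
have [M M0 hM] := compact_bounded_cmod (@segment_compact R (- (2 * per)) (2 * per)) (subX _).
pose d' := Num.min (d / r) pi.
have d'0 : 0 < d' by rewrite lt_min divr_gt0 // pi_gt0.
have dpi : 0 < d' <= pi by rewrite d'0 ge_min lexx orbT.
have c0 : 0 < 2 - 2 * cos d'.
  have [] := @cmod_expiB_ge R d' 0 d' dpi; last by [].
  by rewrite subr0 gtr0_norm // lexx; case/andP: dpi.
exists (2 * M / (2 - 2 * cos d')); first by rewrite divr_ge0 ?mulr_ge0 // ltW.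
move=> x y.
(* [x] is reduced to one period and [y] to the period centred at [x'], so that their angles differ
   by at most [pi], where the chord is monotone. *)
pose n := Num.floor (x / per); pose x' := x - n%:~R * per.
pose k := Num.floor ((y - x') / per + 2^-1); pose y' := y - k%:~R * per.
have x'I : 0 <= x' < per.
  have /andP[h1 h2] := floor_itv (x / per).
  rewrite /x' subr_ge0 -ler_pdivlMr // h1 ltrBlDl -[X in _ + X]mul1r -mulrDl.
  by rewrite -ltr_pdivrMr // -[1]/(1%:~R) -rmorphD.
have y'I : `|y' - x'| <= per / 2.
  have /andP[h1 h2] := floor_itv ((y - x') / per + 2^-1).
  rewrite -/k in h1 h2.
  have -> : y' - x' = ((y - x') / per - k%:~R) * per.
    by rewrite /y' mulrBl divfK ?gt_eqF //; ring.
  rewrite normrM (gtr0_norm per0) mulrC ler_pM2l // ler_norml.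
  rewrite rmorphD /= in h2.
  by apply/andP; split; lra.
have gx : g x' = g x by rewrite -(periodicz gp n) /x' subrK.
have gy : g y' = g y by rewrite -(periodicz gp k) /y' subrK.
have ex (z : R) (m : int) : expi ((z - m%:~R * per) / r) = expi (z / r).
  rewrite mulrBl (_ : m%:~R * per / r = 2 * pi * m%:~R); last by field; rewrite gt_eqF.
  by rewrite expiD expiN expi2piz conjc1 mulr1.
have exx : expi (x' / r) = expi (x / r) by exact: ex.
have exy : expi (y' / r) = expi (y / r) by exact: ex.
rewrite -gx -gy -exx -exy.
have x'J : x' \in `[- (2 * per), 2 * per].
  by rewrite in_itv /=; case/andP: x'I => ? ?; apply/andP; split; lra.
have y'J : y' \in `[- (2 * per), 2 * per].
  rewrite in_itv /=; case/andP: x'I => ? ?; move: y'I; rewrite ler_norml => /andP[? ?].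
  by apply/andP; split; lra.
have [lt|ge] := ltP `|y' - x'| d.
  rewrite (le_trans (ltW (hd x' y' _ _ _))) //.
    by rewrite /ball /= distrC.
  by rewrite lerDl mulr_ge0 ?sqr_ge0 // divr_ge0 ?mulr_ge0 // ltW.
have [|h _] := @cmod_expiB_ge R (y' / r) (x' / r) d' dpi.
  rewrite -mulrBl normrM normfV (gtr0_norm r0); apply/andP; split.
    by rewrite ge_min; apply/orP; left; rewrite ler_pM2r // invr_gt0.
  rewrite ler_pdivrMr // (le_trans y'I) // ler_pdivrMr //.
  by rewrite le_eqVlt; apply/orP; left; apply/eqP; ring.
apply: (@le_trans _ _ (2 * M)).
  rewrite (le_trans (cmodD _ _)) // cmodN mulr_natl mulr2n lerD //; exact: hM.
apply: (@le_trans _ _ (2 * M / (2 - 2 * cos d') * (2 - 2 * cos d'))).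
  by rewrite divfK ?gt_eqF.
rewrite -[leLHS]add0r lerD ?(ltW e0) // ler_wpM2l // divr_ge0 ?mulr_ge0 // ltW.
Qed.

Lemma root_unity_sum (N : nat) (w : R[i]) : w ^+ N = 1 -> w != 1 ->
  \sum_(j < N) w ^+ j = 0.
Proof.
move=> wN w1; have := subrX1 w N; rewrite wN subrr => /esym/eqP.
by rewrite mulf_eq0 subr_eq0 (negbTE w1) /= => /eqP.
Qed.

(** Fejer approximation with the integral replaced by a mean over the [m]-th roots of unity, which
    is exact since all exponents [k - l] lie strictly between [- m] and [m]. A power [m - 1] of the
    exponential clears the negative exponents: a true polynomial is wanted, whose roots are used
    later. *)
Lemma trig_weierstrass (g : R -> R[i]) : CX [set: R] g ->
  (forall x, g (x + per) = g x) -> forall e : R, 0 < e ->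
  exists (n : nat) (q : {poly R[i]}), forall x,
    cmod (g x - expi (- (n%:R * x / r)) * q.[expi (x / r)]) < e.
Proof.
move=> gc gp e e0; have e2 : 0 < e / 2 by rewrite divr_gt0.
have [C C0 gC] := periodic_modulus gc gp e2.
(* The part of the error that comes from distant nodes is at most [C * 4 m / m^2 = 4 C / m]. *)
have [m mn0 mC] : exists2 m : nat, (0 < m)%N & 4 * C / m%:R < e / 2.
  exists (Num.truncn (8 * C / e)).+1 => //.
  have : 8 * C / e < (Num.truncn (8 * C / e)).+1%:R by exact: truncnS_gt.
  rewrite !ltr_pdivrMr ?ltr0n // => h.
  by move: h; set mm := _%:R; lra.
have m0 : 0 < m%:R :> R by rewrite ltr0n.
have mC0 : m%:R != 0 :> R[i] by rewrite pnatr_eq0 -lt0n.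
pose w (j : nat) : R[i] := expi (2 * pi * j%:R / m%:R).
have ww j : w j * conjc (w j) = 1 by exact: expi_mulJ.
have wm j : w j ^+ m = 1.
  rewrite -expiMn -[_ *+ m]mulr_natr divfK ?gt_eqF //.
  by have := expi2piz R j; rewrite -pmulrn.
pose P (t : R[i]) := \sum_(k < m) t ^+ k.
pose gj (j : 'I_m) := g (2 * pi * j%:R / m%:R * r).
(* the Fejer kernel is |P|^2 / m *)
pose Q := \sum_(j < m) \sum_(k < m) \sum_(l < m)
   ((m%:R * m%:R)^-1 * gj j * conjc (w j) ^+ k * w j ^+ l) *: 'X^(k + (m.-1 - l)) : {poly R[i]}.
exists m.-1, Q => x.
set z := expi (x / r).
have zz : z * conjc z = 1 by exact: expi_mulJ.
have PE (j : 'I_m) : P (z * conjc (w j)) * conjc (P (z * conjc (w j))) =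
    \sum_(k < m) \sum_(l < m) (z * conjc (w j)) ^+ k * (conjc z * w j) ^+ l.
  rewrite /P conjc_sum mulr_suml; apply: eq_bigr => k _.
  rewrite mulr_sumr; apply: eq_bigr => l _; congr (_ * _).
  by rewrite conjcX conjcM conjcK.
have QE : expi (- (m.-1%:R * x / r)) * Q.[z] =
    (m%:R * m%:R)^-1 * \sum_(j < m) gj j * (P (z * conjc (w j)) * conjc (P (z * conjc (w j)))).
  have -> : expi (- (m.-1%:R * x / r)) = conjc z ^+ m.-1.
    by rewrite -mulrA mulr_natl -mulNrn expiMn expiN.
  rewrite /Q !horner_sum !mulr_sumr; apply: eq_bigr => j _.
  rewrite PE !horner_sum !mulr_sumr; apply: eq_bigr => k _.
  rewrite !horner_sum !mulr_sumr; apply: eq_bigr => l _.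
  rewrite hornerZ hornerXn exprD.
  have lm : (l <= m.-1)%N by rewrite -ltnS prednK // ltn_ord.
  have -> : conjc z ^+ m.-1 = conjc z ^+ l * conjc z ^+ (m.-1 - l) by rewrite -exprD subnKC.
  have zzn (i : nat) : conjc z ^+ i * z ^+ i = 1 by rewrite -exprMn mulrC zz expr1n.
  rewrite !exprMn -[RHS]mulr1 -(zzn (m.-1 - l)%N); ring.
have sumP : \sum_(j < m) P (z * conjc (w j)) * conjc (P (z * conjc (w j))) = m%:R * m%:R.
  under eq_bigr do rewrite PE.
  rewrite exchange_big; under eq_bigr do rewrite exchange_big.
  rewrite (eq_bigr (fun _ => m%:R)) => [|k _].
    by rewrite sumr_const card_ord mulr_natr.
  rewrite (@sum_only _ _ _ k) => [|l lk].
    rewrite (eq_bigr (fun=> 1)) ?sumr_const ?card_ord // => j _.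
    rewrite -exprMn (_ : _ * _ = 1) ?expr1n //.
    by rewrite mulrACA zz mul1r mulrC ww.
  pose om : R[i] := expi (2 * pi * (l%:R - k%:R) / m%:R).
  rewrite (eq_bigr (fun j : 'I_m => z ^+ k * conjc z ^+ l * om ^+ j)) => [|j _]; last first.
    rewrite !exprMn.
      rewrite -!expiMn -expiN -!expiMn mulrACA; congr (_ * _); rewrite -expiD; congr expi.
      rewrite -(mulr_natr _ k) -(mulr_natr _ l) -(mulr_natr _ j); move: (m%:R : R) => M; ring.
  rewrite -mulr_sumr root_unity_sum ?mulr0 //.
    rewrite -expiMn -[_ *+ m]mulr_natr divfK ?gt_eqF //.
    have := expi2piz R (l%:Z - k%:Z); by rewrite rmorphB /= -!pmulrn.
  have lm := ltn_ord l; have km := ltn_ord k.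
  have [kl|lk'|lk'] := ltngtP k l; last by rewrite -val_eqE /= lk' eqxx in lk.
    apply: expi_eq1; rewrite -natrB; last exact: ltnW.
    rewrite ltr_pdivrMr // divr_gt0 ?mulr_gt0 ?pi_gt0 ?ltr0n ?subn_gt0 //=.
    rewrite ltr_pM2l ?mulr_gt0 ?pi_gt0 // ltr_nat.
    by apply: leq_ltn_trans lm; exact: leq_subr.
  rewrite /om -opprB mulrN mulNr expiN.
  apply: contra_neq (@expi_eq1 R (2 * pi * (k%:R - l%:R) / m%:R) _) => [h|].
    by rewrite -[LHS]conjcK h conjc1.
  rewrite -natrB; last exact: ltnW.
  rewrite ltr_pdivrMr // divr_gt0 ?mulr_gt0 ?pi_gt0 ?ltr0n ?subn_gt0 //=.
  rewrite ltr_pM2l ?mulr_gt0 ?pi_gt0 // ltr_nat.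
  by apply: leq_ltn_trans km; exact: leq_subr.
pose p j := cmod (P (z * conjc (w j))) ^+ 2.
have pE j : P (z * conjc (w j)) * conjc (P (z * conjc (w j))) = ((p j)%:C)%C by exact: mulJc.
have sump : \sum_(j < m) p j = m%:R * m%:R.
  apply: (@complexI R); rewrite real_complexM (rmorph_nat (real_complex R)) -sumP.
  by rewrite (rmorph_sum (real_complex R)); apply: eq_bigr => j _; rewrite pE.
have p0 j : 0 <= p j by exact: sqr_ge0.
(* [(1 - t) P(t) = 1 - t^m] has modulus at most 2 on the circle; this is the gain over the trivial
   bound [4 m^2]. *)
have bsum : \sum_(j < m) cmod (w j - z) ^+ 2 * p j <= 4 * m%:R.
  apply: (@le_trans _ _ (\sum_(j < m) 4)); last by rewrite sumr_const card_ord mulr_natr.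
  apply: ler_sum => j _; rewrite /p -exprMn -cmodM.
  have -> : cmod ((w j - z) * P (z * conjc (w j))) =
      cmod ((1 - z * conjc (w j)) * P (z * conjc (w j))).
    have -> : w j - z = w j * (1 - z * conjc (w j)).
      by rewrite mulrBr mulr1 mulrCA ww mulr1.
    by rewrite -mulrA [LHS]cmodM cmod_expi mul1r.
  rewrite -cmodN -mulNr opprB /P -subrX1.
  apply: (@le_trans _ _ (2 ^+ 2)); last by rewrite -natrX.
  rewrite ler_pXn2r ?nnegrE ?cmod_ge0 // (le_trans (cmodD _ _)) // cmodN cmod1.
  by rewrite cmodX cmodM cmodJ !cmod_expi mulr1 expr1n.
rewrite QE.
have -> : g x - (m%:R * m%:R)^-1 *
    \sum_(j < m) gj j * (P (z * conjc (w j)) * conjc (P (z * conjc (w j)))) =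
    (m%:R * m%:R)^-1 * \sum_(j < m) (g x - gj j) * ((p j)%:C)%C.
  under [in RHS]eq_bigr do rewrite mulrBl -pE.
  rewrite sumrB -mulr_sumr sumP mulrBr; congr (_ - _).
  by rewrite mulrCA mulVf ?mulr1 // mulf_neq0.
have cm : cmod ((m%:R * m%:R)^-1 : R[i]) = (m%:R * m%:R)^-1 :> R.
  rewrite cmodV cmodM; have -> : cmod (m%:R : R[i]) = m%:R; last by [].
  by rewrite -(rmorph_nat (real_complex R)) cmod_real ger0_norm.
rewrite cmodM cm mulrC ltr_pdivrMr ?mulr_gt0 //.
apply: (le_lt_trans (cmod_sum _ _ _)).
apply: (@le_lt_trans _ _ (\sum_(j < m) (e / 2 * p j + C * (cmod (w j - z) ^+ 2 * p j)))).
  apply: ler_sum => j _; rewrite cmodM cmod_real (ger0_norm (p0 _)) mulrA -mulrDl.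
  rewrite ler_wpM2r // cmodB (le_trans (gC x _)) //.
  by rewrite mulfK ?gt_eqF.
rewrite big_split /= -!mulr_sumr sump.
apply: (@le_lt_trans _ _ (e / 2 * (m%:R * m%:R) + C * (4 * m%:R))).
  by rewrite lerD2l ler_wpM2l.
have -> : C * (4 * m%:R) = 4 * C / m%:R * (m%:R * m%:R) by field; rewrite gt_eqF.
have : 4 * C / m%:R * (m%:R * m%:R) < e / 2 * (m%:R * m%:R) by rewrite ltr_pM2r // mulr_gt0.
by move: (m%:R * m%:R) (4 * C / m%:R * _) => M2 X; lra.
Qed.

End periodic.

(** * Square integrable functions on an arc *)

Section L2_theory.
Context {d : measure_display} {T : measurableType d} {R : realType}.
Variable mu : {measure set T -> \bar R}.
Hypothesis muT : mu [set: T] = 1%E.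
Local Notation LL := (L2 mu).
Implicit Types (f g h : T -> R[i]) (p q : L2type mu).

Definition cmeas f := measurable_fun [set: T] (fun x => Re (f x)) /\
  measurable_fun [set: T] (fun x => Im (f x)).

Lemma cmeas_repr p : cmeas (repr p).
Proof. by split; apply: Lfun_meas; [exact: L2fun_re|exact: L2fun_im]. Qed.

Lemma cmeas_cst c : cmeas (fun=> c).
Proof. by split; exact: measurable_cst. Qed.

Lemma cmeasD f g : cmeas f -> cmeas g -> cmeas (fun x => f x + g x).
Proof.
move=> [f1 f2] [g1 g2]; split.
  by under eq_fun do rewrite raddfD; exact: measurable_funD.
by under eq_fun do rewrite raddfD; exact: measurable_funD.
Qed.

Lemma cmeasM f g : cmeas f -> cmeas g -> cmeas (fun x => f x * g x).
Proof.
move=> [f1 f2] [g1 g2]; split.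
- rewrite (_ : (fun _ => _) = (fun x => Re (f x) * Re (g x) - Im (f x) * Im (g x))).
    by apply: measurable_funB; exact: measurable_funM.
  by apply/funext => x; case: (f x) => ? ?; case: (g x).
- rewrite (_ : (fun _ => _) = (fun x => Re (f x) * Im (g x) + Im (f x) * Re (g x))).
    by apply: measurable_funD; exact: measurable_funM.
  by apply/funext => x; case: (f x) => ? ?; case: (g x).
Qed.

Lemma cmeasJ f : cmeas f -> cmeas (fun x => conjc (f x)).
Proof.
move=> [f1 f2]; split.
- rewrite (_ : (fun _ => _) = (fun x => Re (f x))) //.
  by apply/funext => x; case: (f x).
- rewrite (_ : (fun _ => _) = (fun x => - Im (f x))); first exact: measurable_funN.
  by apply/funext => x; case: (f x).
Qed.

Lemma cmeasB f g : cmeas f -> cmeas g -> cmeas (fun x => f x - g x).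
Proof.
move=> mf mg; have -> : (fun x => f x - g x) = (fun x => f x + (-1) * g x).
  by apply/funext => x; rewrite mulN1r.
by apply: cmeasD => //; apply: cmeasM => //; exact: cmeas_cst.
Qed.

Lemma cmeas_sqr f : cmeas f ->
  measurable_fun [set: T] (fun x => (cmod (f x) ^+ 2)%:E).
Proof.
move=> [f1 f2]; apply/measurable_EFinP; under eq_fun do rewrite cmod_sqr.
by apply: measurable_funD; exact: measurable_funX.
Qed.

Lemma cmeas_cmod f : cmeas f -> measurable_fun [set: T] (fun x => (cmod (f x))%:E).
Proof.
move=> mf; apply/measurable_EFinP.
rewrite (_ : (fun _ => _) = (fun x => (cmod (f x) ^+ 2) `^ (2^-1))).
  apply: (@measurableT_comp _ _ _ _ _ _ (fun t : R => t `^ 2^-1)); first exact: measurable_powR.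
  by apply/measurable_EFinP; exact: cmeas_sqr.
by apply/funext => x; rewrite -powR_mulrn ?cmod_ge0 // -powRrM mulfV // powRr1 ?cmod_ge0.
Qed.

Local Notation sq f := (\int[mu]_x (cmod (f x) ^+ 2)%:E)%E.

Lemma Lfun2P (u : T -> R) : measurable_fun [set: T] u ->
  (\int[mu]_x (u x ^+ 2)%:E < +oo)%E -> u \in Lfun mu 2%:E.
Proof.
move=> mu' ui; rewrite inE; apply/andP; split; rewrite inE //=.
rewrite /finite_norm unlock /=; apply: poweR_lty.
rewrite (_ : (\int[mu]_x _)%E = (\int[mu]_x (u x ^+ 2)%:E)%E) //.
apply: eq_integral => x _ /=.
by rewrite powR_mulrn // real_normK ?num_real.
Qed.

Lemma sq_lty_square_integrable f : cmeas f -> (sq f < +oo)%E ->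
  (f : T -> R[i]^o) \in square_integrable mu.
Proof.
move=> mf fi; have [f1 f2] := mf.
by apply/andP; split; apply: Lfun2P => //; apply: le_lt_trans fi;
   apply: ge0_le_integral => //; rewrite ?lee_fin ?sqr_ge0 //;
   try (by move=> x _; rewrite lee_fin sqr_ge0);
   try (by apply/measurable_EFinP; exact: measurable_funX);
   try (exact: cmeas_sqr);
   by move=> x _; rewrite lee_fin cmod_sqr ?lerDl ?lerDr sqr_ge0.
Qed.

Lemma repr_L2class f : cmeas f -> (sq f < +oo)%E ->
  \forall x \ae mu, repr (L2class mu f : L2type mu) x = f x.
Proof.
move=> mf fi; rewrite /L2class.
have h := repr_pi (insubd (0 : L2fun mu) (f : T -> R[i]^o)).
apply: filterS h => x ->.
rewrite /L2fun_fun [L2fun_val _](insubdK (0 : L2fun mu)) //.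
exact: sq_lty_square_integrable.
Qed.

Lemma L2_eqae p q : (\forall x \ae mu, repr p x = repr q x) -> p = q.
Proof. by move=> h; rewrite -[p]reprK -[q]reprK; apply/eqP/L2_eqP. Qed.

Lemma sq_repr p : sq (repr p) = (vnorm (p : LL) ^+ 2)%:E.
Proof.
rewrite vnorm_sqr [dot _ _ _]/(L2_dot p p) /L2_dot /cint /=.
have [pR _] := L2_mul_int (repr p) (repr p).
rewrite /Rintegral fineK; last exact: (integrable_fin_num measurableT pR).
by apply: eq_integral => x _; rewrite mulJc.
Qed.

Lemma sq_repr_lty p : (sq (repr p) < +oo)%E.
Proof. by rewrite sq_repr ltry. Qed.

Lemma sq_ae f g : cmeas f -> cmeas g -> (\forall x \ae mu, f x = g x) -> sq f = sq g.
Proof.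
move=> mf mg fg; apply: ae_eq_integral => //; [exact: cmeas_sqr|exact: cmeas_sqr|].
by apply: filterS fg => x -> _.
Qed.

Lemma reprD p q : \forall x \ae mu, repr (p + q) x = repr p x + repr q x.
Proof. by have := L2linE 1 p q; rewrite scale1r; apply: filterS => x ->; rewrite mul1r. Qed.

Lemma reprZ c p : \forall x \ae mu, repr (c *: p) x = c * repr p x.
Proof.
have h0 := L2linE c p 0; rewrite addr0 in h0.
have h1 := L2linE 0 (0 : L2type mu) 0; rewrite scale0r addr0 in h1.
(* A representative of 0 vanishes only almost everywhere, which is read off from [0 + 0 = 0]. *)
have h2 := reprD 0 (0 : L2type mu); rewrite addr0 in h2.
apply: filterS2 h0 h2 => x -> h; rewrite [repr (0 : L2type mu) x](_ : _ = 0) ?addr0 //.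
by apply/eqP; rewrite -(inj_eq (addrI (repr (0 : L2type mu) x))) addr0 -h.
Qed.

Lemma reprB p q : \forall x \ae mu, repr (p - q) x = repr p x - repr q x.
Proof.
rewrite -scaleN1r; apply: filterS2 (reprD p (-1 *: q)) (reprZ (-1) q) => x -> ->.
by rewrite mulN1r.
Qed.

Lemma dot_ae p q f g : cmeas f -> cmeas g ->
  (\forall x \ae mu, repr p x = f x) -> (\forall x \ae mu, repr q x = g x) ->
  dot LL p q = cint mu (fun x => f x * conjc (g x)).
Proof.
move=> mf mg pf qg; rewrite [LHS]/(L2_dot p q) /L2_dot /cint.
have [m1 m2] := cmeasM mf (cmeasJ mg).
have [m3 m4] := cmeasM (cmeas_repr p) (cmeasJ (cmeas_repr q)).
congr (_ +i* _)%C; apply: ae_Rintegral => //; by apply: filterS2 pf qg => x -> ->.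
Qed.

Lemma cint_integrable p q : mu.-integrable [set: T] (EFin \o (fun x => Re (repr p x * conjc (repr q x)))) /\
  mu.-integrable [set: T] (EFin \o (fun x => Im (repr p x * conjc (repr q x)))).
Proof. exact: L2_mul_int. Qed.

Definition L2mul g p : L2type mu := L2class mu (fun x => g x * repr p x).

Lemma sq_bound_lty g p (C : R) : cmeas g -> (\forall x \ae mu, cmod (g x) <= C) ->
  (sq (fun x => g x * repr p x) < +oo)%E.
Proof.
move=> mg gC.
apply: (@le_lt_trans _ _ (\int[mu]_x ((C ^+ 2)%:E * (cmod (repr p x) ^+ 2)%:E))%E).
  apply: ae_ge0_le_integral => //.
  - by move=> x _; rewrite lee_fin sqr_ge0.
  - by apply: cmeas_sqr; apply: cmeasM => //; exact: cmeas_repr.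
  - by move=> x _; rewrite -EFinM lee_fin mulr_ge0 ?sqr_ge0.
  - by apply: measurable_funeM; apply: cmeas_sqr; exact: cmeas_repr.
  - apply: filterS gC => x gC _; rewrite -EFinM lee_fin cmodM exprMn ler_wpM2r ?sqr_ge0 //.
    by rewrite ler_pXn2r ?nnegrE ?cmod_ge0 // (le_trans (cmod_ge0 _) gC).
rewrite ge0_integralZl ?lee_fin ?sqr_ge0 //.
- by rewrite sq_repr -EFinM ltry.
- by apply: cmeas_sqr; exact: cmeas_repr.
- by move=> x _; rewrite lee_fin sqr_ge0.
Qed.

Lemma repr_L2mul g p (C : R) : cmeas g -> (\forall x \ae mu, cmod (g x) <= C) ->
  \forall x \ae mu, repr (L2mul g p) x = g x * repr p x.
Proof.
move=> mg gC; apply: repr_L2class; last exact: sq_bound_lty gC.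
by apply: cmeasM => //; exact: cmeas_repr.
Qed.

(** A pointwise bound with two terms passes to multiplication operators. With [b = 0] it bounds the
    norm of an operator; with [b > 0] it controls [h] on vectors that concentrate where [k] is
    small. *)
Lemma L2mul_le h (k : T -> R[i]) p (a b C : R) : cmeas h -> cmeas k -> 0 <= a -> 0 <= b ->
  (\forall x \ae mu, cmod (h x) <= C) -> (\forall x \ae mu, cmod (k x) <= C) ->
  (\forall x \ae mu, cmod (h x) ^+ 2 <= a + b * cmod (k x) ^+ 2) ->
  vnorm (L2mul h p : LL) ^+ 2 <= a * vnorm (p : LL) ^+ 2 + b * vnorm (L2mul k p : LL) ^+ 2.
Proof.
move=> mh mk a0 b0 hC kC hk; rewrite -lee_fin EFinD (EFinM a) (EFinM b).
rewrite -(sq_repr (L2mul h p)) -(sq_repr p) -(sq_repr (L2mul k p)).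
have mhp : cmeas (fun x => h x * repr p x) by apply: cmeasM => //; exact: cmeas_repr.
have mkp : cmeas (fun x => k x * repr p x) by apply: cmeasM => //; exact: cmeas_repr.
rewrite (sq_ae _ mhp (repr_L2mul p mh hC)); last exact: cmeas_repr.
rewrite (sq_ae _ mkp (repr_L2mul p mk kC)); last exact: cmeas_repr.
have ms f : cmeas f -> measurable_fun [set: T] (fun x => (cmod (f x) ^+ 2)%:E) by exact: cmeas_sqr.
rewrite -!ge0_integralZl ?lee_fin //; try (by move=> x _; rewrite lee_fin sqr_ge0);
  try (by apply: ms => //; exact: cmeas_repr).
rewrite -ge0_integralD //;
  try (by move=> x _; rewrite -EFinM lee_fin mulr_ge0 // sqr_ge0);
  try (by apply: measurable_funeM; apply: ms => //; exact: cmeas_repr).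
apply: ae_ge0_le_integral => //.
- by move=> x _; rewrite lee_fin sqr_ge0.
- exact: ms.
- by move=> x _; rewrite -!EFinM -EFinD lee_fin addr_ge0 // mulr_ge0 // sqr_ge0.
- by apply: emeasurable_funD; apply: measurable_funeM; apply: ms => //; exact: cmeas_repr.
apply: filterS hk => x hk _; rewrite -!EFinM -EFinD lee_fin !cmodM !exprMn.
by rewrite [X in _ <= _ + X]mulrA -[X in _ <= X]mulrDl ler_wpM2r // sqr_ge0.
Qed.

Lemma cvg_of_summable (z : R^nat) : (\sum_(0 <= k <oo) `|z k.+1 - z k|%:E < +oo)%E ->
  cvgn z.
Proof.
move=> zs; have cz : cvgn (series (fun k => z k.+1 - z k)).
  apply: normed_cvg; apply: nondecreasing_is_cvgn.
    by apply: nondecreasing_series => k _ _; exact: normr_ge0.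
  exists (fine (\sum_(0 <= k <oo) `|z k.+1 - z k|%:E)%E) => _ [n _ <-].
  rewrite -lee_fin fineK.
    rewrite /series /= -sumEFin; apply: nneseries_lim_ge => k _ _.
    by rewrite lee_fin.
  by rewrite ge0_fin_numE // nneseries_ge0 // => k _ _; rewrite lee_fin.
have E n : z n = series (fun k => z k.+1 - z k) n + z 0%N.
  by rewrite /series /= telescope_sumr // subrK.
have -> : z = (fun n => series (fun k => z k.+1 - z k) n + z 0%N) by apply/funext.
by apply: is_cvgD => //; exact: is_cvg_cst.
Qed.

Lemma int_cmod_le f (c : R) : cmeas f -> 0 < c -> (sq f <= (c ^+ 2)%:E)%E ->
  (\int[mu]_x (cmod (f x))%:E <= c%:E)%E.
Proof.
move=> mf c0 fc.
(* AM-GM: [t <= c / 2 + t^2 / (2 c)] *)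
apply: (@le_trans _ _ (\int[mu]_x ((c / 2)%:E + (2 * c)^-1%:E * (cmod (f x) ^+ 2)%:E))%E).
  apply: ge0_le_integral => //.
  - by move=> x _; rewrite lee_fin cmod_ge0.
  - exact: cmeas_cmod.
  - by apply: emeasurable_funD => //; apply: measurable_funeM; exact: cmeas_sqr.
  move=> x _; rewrite -EFinM -EFinD lee_fin.
  rewrite -subr_ge0 (_ : _ - _ = (2 * c)^-1 * (c - cmod (f x)) ^+ 2).
    by rewrite mulr_ge0 ?sqr_ge0 // invr_ge0 mulr_ge0 // ltW.
  by field; rewrite gt_eqF.
have i0 : 0 <= (2 * c)^-1 by rewrite invr_ge0 mulr_ge0 // ltW.
rewrite ge0_integralD //; last 3 first.
- by move=> x _; rewrite lee_fin divr_ge0 // ltW.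
- by move=> x _; rewrite -EFinM lee_fin mulr_ge0 // sqr_ge0.
- by apply: measurable_funeM; exact: cmeas_sqr.
rewrite integral_cst // [X in (_ * X)%E]muT mule1 ge0_integralZl ?lee_fin //; last 2 first.
- exact: cmeas_sqr.
- by move=> x _; rewrite lee_fin sqr_ge0.
apply: (@le_trans _ _ ((c / 2)%:E + (2 * c)^-1%:E * (c ^+ 2)%:E)%E).
  by rewrite leeD2l // lee_wpmul2l // lee_fin.
by rewrite -EFinM -EFinD lee_fin le_eqVlt; apply/orP; left; apply/eqP; field; rewrite gt_eqF.
Qed.

(** A subsequence with steps below [2^-k] converges almost everywhere, because the sum of its steps
    has finite integral; Fatou's lemma then bounds the distance to the limit. *)
Lemma L2_complete : hilbert_complete LL.
Proof.
move=> u uC.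
have e0 n : 0 < 2^-1 ^+ n :> R by rewrite exprn_gt0.
have /(_ _)/cid-/all_sig[N hN] := fun n => uC _ (e0 n).
pose nk := fix nk k := if k is k'.+1 then maxn (nk k').+1 (N k) else N 0%N.
have nkN k : (N k <= nk k)%N by case: k => //= k; exact: leq_maxr.
have nk_mono k m : (k <= m)%N -> (nk k <= nk m)%N.
  move=> /subnK <-; elim: (m - k)%N => [|n IH]; first by rewrite add0n.
  by rewrite addSn /=; apply: (leq_trans IH); apply: (leq_trans (leqnSn _)); exact: leq_maxl.
pose F k := repr (u (nk k) : L2type mu) : T -> R[i].
have mF k : cmeas (F k) by exact: cmeas_repr.
have sqF k m : (k <= m)%N -> (sq (fun x => (F m x - F k x)%R) <= ((2^-1 ^+ k) ^+ 2)%:E)%E.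
  move=> km; rewrite -(sq_ae (cmeas_repr (u (nk m) - u (nk k))) _ (reprB _ _)).
    rewrite sq_repr lee_fin ler_pXn2r ?nnegrE ?vnorm_ge0 ?(ltW (e0 _)) //.
    by apply: ltW; apply: hN => //; apply: (leq_trans (nkN k)); exact: nk_mono.
  by apply: cmeasB; exact: cmeas_repr.
pose G k x := (cmod (F k.+1 x - F k x))%:E.
have mG k : measurable_fun [set: T] (G k) by apply: cmeas_cmod; exact: cmeasB.
have G0 k x : (0 <= G k x)%E by rewrite lee_fin cmod_ge0.
have sumG : (\int[mu]_x (\sum_(0 <= k <oo) G k x) < +oo)%E.
  rewrite integral_nneseries //.
  apply: (@le_lt_trans _ _ (\sum_(0 <= k <oo) (2^-1 ^+ k)%:E)%E).
    apply: lee_nneseries => k _ //; first by move=> _; exact: integral_ge0.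
    by apply: int_cmod_le => //; [exact: cmeasB|exact: sqF].
  rewrite (_ : (\sum_(0 <= k <oo) (2^-1 ^+ k)%:E)%E = (2%:E : \bar R)) ?ltry //.
  apply/cvg_lim => //.
  under eq_fun do rewrite sumEFin.
  apply: cvg_EFin; first exact: nearW.
  have := @cvg_geometric_series R 1 2^-1.
  rewrite ger0_norm // invf_lt1 // ltr1n => /(_ isT).
  rewrite (_ : 1 / (1 - 2^-1) = 2); last by field.
  by apply: cvg_trans; apply: near_eq_cvg; apply: nearW => n /=; apply: eq_bigr => k _; rewrite /geometric /= mul1r.
have good : \forall x \ae mu, (\sum_(0 <= k <oo) G k x < +oo)%E.
  have mS : measurable_fun [set: T] (fun x => \sum_(0 <= k <oo) G k x)%E.
    exact: ge0_emeasurable_sum.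
  have : mu.-integrable [set: T] (fun x => \sum_(0 <= k <oo) G k x)%E.
    apply/integrableP; split => //; apply: le_lt_trans sumG.
    by under eq_integral do rewrite gee0_abs ?nneseries_ge0 //.
  move/(integrable_ae measurableT); apply: filterS => x /(_ I).
  by rewrite ge0_fin_numE // nneseries_ge0.
(* Upper limits are measurable on the whole space, and wherever [good] holds they are the limits of
   the real and imaginary parts. *)
pose lre x := fine (limn_esup (fun k => (Re (F k x))%:E)).
pose lim_ x := fine (limn_esup (fun k => (Im (F k x))%:E)).
pose L x : R[i] := (lre x +i* lim_ x)%C.
have mL : cmeas L.
  split => /=.
  - apply: (@measurableT_comp _ _ _ _ _ _ (@fine R)); first exact: (fine_measurable measurableT).
    by apply: measurable_fun_limn_esup => k; apply/measurable_EFinP; have [] := mF k.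
  - apply: (@measurableT_comp _ _ _ _ _ _ (@fine R)); first exact: (fine_measurable measurableT).
    by apply: measurable_fun_limn_esup => k; apply/measurable_EFinP; have [] := mF k.
have cvgF x : (\sum_(0 <= k <oo) G k x < +oo)%E ->
    (fun m => cmod (F m x - L x)) @ \oo --> (0 : R).
  move=> gx.
  have part (P : R[i] -> R) : (forall z w, P (z - w) = P z - P w) -> (forall z, `|P z| <= cmod z) ->
      (fun k => P (F k x)) @ \oo --> fine (limn_esup (fun k => (P (F k x))%:E)).
    move=> PB Pc; have cP : cvgn (fun k => P (F k x)).
      apply: cvg_of_summable; apply: le_lt_trans gx; apply: lee_nneseries => k _ //.
      by rewrite lee_fin -PB.
    rewrite (_ : limn_esup _ = (limn (fun k => P (F k x)))%:E) //=.
    have /cvg_limn_einf_sup[_ ->] // : (P (F k x))%:E @[k --> \oo] --> (limn (fun k => P (F k x)))%:E.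
    by apply: cvg_EFin; [exact: nearW|exact: cP].
  have cR := part (@Re R) (raddfB _) (@Re_le_cmod R).
  have cI := part (@Im R) (raddfB _) (@Im_le_cmod R).
  apply/cvgrPdist_lt => e e1; have e2 : 0 < e / 2 by rewrite divr_gt0.
  have /cvgrPdist_lt/(_ _ e2) h1 := cR; have /cvgrPdist_lt/(_ _ e2) h2 := cI.
  apply: filterS2 h1 h2 => m h1 h2; rewrite sub0r normrN ger0_norm ?cmod_ge0 //.
  rewrite (le_lt_trans (cmod_le _)) // (splitr e) !raddfB /=.
  by rewrite distrC in h1; rewrite distrC in h2; apply: ltrD.
have sqL k : (sq (fun x => (L x - F k x)%R) <= ((2^-1 ^+ k) ^+ 2)%:E)%E.
  have E : \forall x \ae mu, (cmod (L x - F k x) ^+ 2)%:E =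
      limn_einf (fun m => (cmod (F (k + m)%N x - F k x) ^+ 2)%:E).
    apply: filterS good => x gx; apply/esym.
    have /cvg_limn_einf_sup[-> _] // : (cmod (F (k + m)%N x - F k x) ^+ 2)%:E @[m --> \oo] -->
      (cmod (L x - F k x) ^+ 2)%:E.
    apply: cvg_EFin; first exact: nearW.
    have c1 : cmod (F (k + m)%N x - F k x) @[m --> \oo] --> cmod (L x - F k x).
      have c0 : cmod (F (m + k)%N x - L x) @[m --> \oo] --> (0 : R).
        by have := cvgF x gx; rewrite -(cvg_shiftn k).
      apply/cvgrPdist_lt => e e1; have /cvgrPdist_lt/(_ _ e1) := c0.
      apply: filterS => m; rewrite sub0r normrN ger0_norm ?cmod_ge0 // addnC => h.
      apply: le_lt_trans h; rewrite ler_norml.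
      have t1 := cmodD (F (k + m)%N x - L x) (L x - F k x).
      have t2 := cmodD (L x - F (k + m)%N x) (F (k + m)%N x - F k x).
      rewrite !addrA !subrK in t1 t2; rewrite (cmodB (L x) (F (k + m)%N x)) in t2.
      by apply/andP; split; lra.
    by under eq_fun do rewrite expr2 /=; rewrite expr2; apply: cvgM.
  rewrite (@ae_eq_integral _ _ _ mu _ (fun x =>
     limn_einf (fun m => (cmod (F (k + m)%N x - F k x) ^+ 2)%:E))) //; last 3 first.
  - by apply: cmeas_sqr; exact: cmeasB.
  - rewrite (_ : (fun x => limn_einf _) = (fun x =>
        - limn_esup (fun m => - (cmod (F (k + m)%N x - F k x) ^+ 2)%:E))%E).
      apply: measurableT_comp => //; apply: measurable_fun_limn_esup => m.
      by apply: measurableT_comp => //; apply: cmeas_sqr; exact: cmeasB.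
    by apply/funext => x; rewrite -limn_einfN; congr limn_einf; apply/funext => m; rewrite /comp oppeK.
  - by apply: filterS E => x -> _.
  apply: (le_trans (fatou mu measurableT _ _)) => [m|m x _|].
  - by apply: cmeas_sqr; exact: cmeasB.
  - by rewrite lee_fin sqr_ge0.
  rewrite limn_einf_lim; apply: lime_le; first exact: is_cvg_einfs.
  apply: nearW => m; apply: ereal_inf_le; exists (\int[mu]_x (cmod (F (k + m)%N x - F k x) ^+ 2)%:E)%E.
    by exists m => //=.
  by apply: sqF; exact: leq_addr.
have sqLl : (sq L < +oo)%E.
  have m1 := cmeasB mL (mF 0%N).
  apply: (@le_lt_trans _ _ (\int[mu]_x (2%:E * (cmod (L x - F 0%N x) ^+ 2)%:E + 2%:E * (cmod (F 0%N x) ^+ 2)%:E))%E).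
    apply: ge0_le_integral => //.
    - by move=> x _; rewrite lee_fin sqr_ge0.
    - exact: cmeas_sqr.
    - by apply: emeasurable_funD; apply: measurable_funeM; exact: cmeas_sqr.
    move=> x _; rewrite -!EFinM -EFinD lee_fin.
    have := cmodD (L x - F 0%N x) (F 0%N x); rewrite subrK => h.
    have := cmod_ge0 (L x).
    move: (cmod (L x)) (cmod (F 0%N x)) (cmod (L x - F 0%N x)) h => a b c h a0.
    have h2 : a ^+ 2 <= (c + b) ^+ 2 by rewrite ler_pXn2r ?nnegrE // (le_trans a0 h).
    by have := sqr_ge0 (c - b); nra.
  rewrite ge0_integralD //; last 4 first.
  - by move=> x _; rewrite -EFinM lee_fin mulr_ge0 // sqr_ge0.
  - by apply: measurable_funeM; exact: cmeas_sqr.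
  - by move=> x _; rewrite -EFinM lee_fin mulr_ge0 // sqr_ge0.
  - by apply: measurable_funeM; exact: cmeas_sqr.
  rewrite !ge0_integralZl ?lee_fin //; try (by move=> x _; rewrite lee_fin sqr_ge0);
    try exact: cmeas_sqr.
  rewrite lte_add_pinfty // lte_mul_pinfty ?lee_fin //; last exact: sq_repr_lty.
  exact: (le_lt_trans (sqL 0%N) (ltry _)).
pose l : LL := L2class mu L; exists l.
have near_l k : vnorm (l - u (nk k)) <= 2^-1 ^+ k.
  rewrite -(@ler_pXn2r _ 2) ?nnegrE ?vnorm_ge0 ?(ltW (e0 _)) // -lee_fin -sq_repr.
  rewrite (@sq_ae _ (fun x => L x - F k x)); first exact: sqL.
  - exact: cmeas_repr.
  - exact: cmeasB.
  by apply: filterS2 (reprB l (u (nk k))) (repr_L2class mL sqLl) => x -> ->.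
apply/cvgrPdist_lt => e e1.
have [k ek] : exists k, 2^-1 ^+ k < e / 2 :> R.
  have := @cvg_expr R 2^-1; rewrite ger0_norm // invf_lt1 // ltr1n => /(_ isT).
  have e2 : 0 < e / 2 by rewrite divr_gt0.
  move=> /cvgrPdist_lt/(_ _ e2)[k _ /(_ k (leqnn k))] /=.
  by rewrite sub0r normrN ger0_norm ?(ltW (e0 _)) //; exists k.
exists (nk k) => // n /= nkn; rewrite sub0r normrN ger0_norm ?vnorm_ge0 //.
apply: (le_lt_trans (vnorm_triB _ (u (nk k)) _)); rewrite (splitr e); apply: ltr_leD.
  apply: lt_trans ek; apply: hN => //; apply: leq_trans nkn; exact: nkN.
by rewrite vnormB (le_trans (near_l k)) // ltW.
Qed.

End L2_theory.

Section continuous_parts.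
Variables (R : realType).
Implicit Types g : R -> R[i].

Lemma CXT_Re g : CX [set: R] g -> continuous (fun x => Re (g x)).
Proof.
move=> /CXP gc x; apply/cvgrPdist_lt => e e0; apply: filterS (gc x I e e0) => y /(_ I).
by rewrite cmodB; apply: le_lt_trans; rewrite -raddfB; exact: Re_le_cmod.
Qed.

Lemma CXT_Im g : CX [set: R] g -> continuous (fun x => Im (g x)).
Proof.
move=> /CXP gc x; apply/cvgrPdist_lt => e e0; apply: filterS (gc x I e e0) => y /(_ I).
by rewrite cmodB; apply: le_lt_trans; rewrite -raddfB; exact: Im_le_cmod.
Qed.

Lemma CXT_ReIm g : continuous (fun x => Re (g x)) -> continuous (fun x => Im (g x)) ->
  CX [set: R] g.
Proof.
move=> cR cI; apply/CXP => x _ e e0; have e2 : 0 < e / 2 by rewrite divr_gt0.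
have /cvgrPdist_lt/(_ _ e2) h1 := cR x; have /cvgrPdist_lt/(_ _ e2) h2 := cI x.
apply: filterS2 h1 h2 => y h1 h2 _; rewrite cmodB (le_lt_trans (cmod_le _)) // (splitr e).
by rewrite !raddfB ltrD.
Qed.

Lemma CXT_cmeas g : CX [set: R] g -> cmeas (g : measurableTypeR R -> R[i]).
Proof.
by move=> gc; split; apply: continuous_measurable_fun; [exact: CXT_Re|exact: CXT_Im].
Qed.

Lemma CXT_shift g t : CX [set: R] g -> CX [set: R] (fun x => g (x + t)).
Proof.
move=> gc; apply: CXT_ReIm => x.
  apply: (@continuous_comp _ _ _ (fun x => x + t) (fun x => Re (g x))).
    by apply: cvgD; [exact: cvg_id|exact: cvg_cst].
  exact: CXT_Re.
apply: (@continuous_comp _ _ _ (fun x => x + t) (fun x => Im (g x))).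
  by apply: cvgD; [exact: cvg_id|exact: cvg_cst].
exact: CXT_Im.
Qed.

Lemma CXT_expi (c : R) : CX [set: R] (fun x => expi (c * x)).
Proof.
have cc : continuous (fun x : R => c * x).
  by move=> x; apply: cvgM; [exact: cvg_cst|exact: cvg_id].
by apply: CXT_ReIm => x; apply: (continuous_comp (cc x));
  [exact: continuous_cos|exact: continuous_sin].
Qed.

End continuous_parts.

(** * Translation invariance of the integral over a period *)

Section period_integral.
Variables (R : realType) (f : R -> R) (a b : R).
Hypotheses (ab : a < b) (fc : continuous f) (fp : forall x, f (x + (b - a)) = f x).
Local Notation leb := (@lebesgue_measure R).

(** The primitive starts at [a - 1], so that it is differentiable at [a] itself. *)
Let Phi x := \int[leb]_(u in `[a - 1, x]) f u.

Let Phi_derive x : a - 1 < x -> is_derive x 1 Phi (f x).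
Proof.
move=> ax; have [||||d1 d2] := @continuous_FTC1_closed R f (a - 1) x (x + 1).
- by rewrite ltrDl.
- apply: continuous_compact_integrable; first exact: segment_compact.
  exact: continuous_subspaceT.
- exact: ax.
- exact: fc.
by apply: DeriveDef; [exact: d1|rewrite -derive1E; exact: d2].
Qed.

Let Phi_shift_derive t x : a - 1 < x + t -> is_derive x 1 (fun y => Phi (y + t)) (f (x + t)).
Proof.
move=> h; have d := Phi_derive h.
have -> : f (x + t) = f (x + t) * (1 + 0) by rewrite addr0 mulr1.
have := @is_derive1_comp R Phi (fun y => y + t) x (f (x + t)) (1 + 0).
by apply.
Qed.

Let int_shift t : 0 <= t ->
  (\int[leb]_(x in `[a, b]) (f (x + t))%:E = (Phi (b + t) - Phi (a + t))%:E)%E.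
Proof.
move=> t0.
have dl x : a <= x -> is_derive x 1 (fun y => Phi (y + t)) (f (x + t)).
  by move=> ax; apply: Phi_shift_derive; lra.
have ct x : a <= x -> {for x, continuous (fun y => Phi (y + t))}.
  by move=> /dl[d _]; apply: differentiable_continuous; apply/derivable1_diffP.
rewrite (@continuous_FTC2 R (fun x => f (x + t)) (fun x => Phi (x + t)) a b ab) ?EFinB //.
- apply: continuous_subspaceT => x; apply: (@continuous_comp _ _ _ (fun x => x + t)).
    by apply: cvgD; [exact: cvg_id|exact: cvg_cst].
  exact: fc.
- split.
  + by move=> x; rewrite in_itv /= => /andP[ax _]; have [] := dl x (ltW ax).
  + by apply: cvg_at_right_filter; apply: ct.
  + by apply: cvg_at_left_filter; apply: ct; exact: ltW.
- move=> x; rewrite in_itv /= => /andP[ax _]; have [d1 d2] := dl x (ltW ax).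
  by rewrite derive1E d2.
Qed.

(** The shifted integral is the increment of the primitive over a period, and its derivative in the
    shift is [f (b + s) - f (a + s) = 0]. *)
Lemma period_integral_shift_ge0 t : 0 <= t ->
  (\int[leb]_(x in `[a, b]) (f (x + t))%:E = \int[leb]_(x in `[a, b]) (f x)%:E)%E.
Proof.
move=> t0; rewrite int_shift //.
have := int_shift (lexx 0); rewrite !addr0; under eq_integral do rewrite addr0.
move=> ->; congr (_%:E).
pose h s := Phi (b + s) - Phi (a + s).
have dh (x : R) : 0 <= x -> is_derive x 1 h 0.
  move=> x0.
  have h1 : is_derive x 1 (fun s => Phi (s + b)) (f (x + b)).
    by apply: Phi_shift_derive; move: ab; lra.
  have h2 : is_derive x 1 (fun s => Phi (s + a)) (f (x + a)).
    by apply: Phi_shift_derive; lra.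
  have -> : h = (fun s => Phi (s + b)) - (fun s => Phi (s + a)).
    by apply/funext => s; rewrite /h [b + s]addrC [a + s]addrC.
  have -> : 0 = f (x + b) - f (x + a).
    by rewrite -(fp (x + a)) (_ : x + a + (b - a) = x + b) ?subrr //; ring.
  exact: is_deriveB.
have [||c _] := @MVT_segment R h (fun=> 0) 0 t t0.
- by move=> x; rewrite in_itv /= => /andP[x0 _]; exact/dh/ltW.
- apply: derivable_within_continuous => x; rewrite in_itv /= => /andP[x0 _].
  by have [] := dh x x0.
by rewrite mul0r => /eqP; rewrite subr_eq0 /h !addr0 => /eqP.
Qed.

End period_integral.

(** * The Hilbert space of a circle and its exponentials *)

Section arc.
Variables (R : realType) (r : R).
Hypothesis r0 : 0 < r.
Local Notation per := (2 * pi * r).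
Local Notation mu := (arc_measure r).
Local Notation leb := (@lebesgue_measure R).
Local Notation J := `[- (pi * r), pi * r]%classic.
Local Notation LL := (L2 mu).

Let pr0 : 0 < pi * r. Proof. by rewrite mulr_gt0 // pi_gt0. Qed.
Let per0 : 0 < per. Proof. by rewrite -mulrA mulr_gt0. Qed.
Let c := per^-1.
Let c0 : 0 < c. Proof. by rewrite invr_gt0. Qed.

Lemma arc_measureE (A : set (measurableTypeR R)) : mu A = (c%:E * leb (A `&` J))%E.
Proof. by rewrite /arc_measure /= /mscale /= /mrestr ger0_norm // ltW. Qed.

Lemma arc_measureT : mu [set: measurableTypeR R] = 1%E.
Proof.
rewrite arc_measureE setTI lebesgue_measure_itv /= lte_fin gtrN //.
rewrite -EFinD -EFinM opprK /c; apply: (congr1 EFin).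
by rewrite mulrC -mulr2n -[_ *+ 2]mulr_natl mulrA divff // gt_eqF.
Qed.

Lemma arc_ae_itv : \forall x \ae mu, J x.
Proof.
exists (~` J); split => //; first by apply: measurableC; exact: measurable_itv.
by rewrite arc_measureE setICl measure0 mule0.
Qed.

#[local] Instance arc_ae_filter : Filter (nbhs (almost_everywhere mu)) :=
  ae_filter_ringOfSetsType mu.

Lemma arc_integral (f : measurableTypeR R -> \bar R) :
  measurable_fun [set: measurableTypeR R] f -> (forall x, (0 <= f x)%E) ->
  (\int[mu]_x f x = c%:E * \int[leb]_(x in J) f x)%E.
Proof.
move=> mf f0.
have mJ : measurable (J : set (measurableTypeR R)) by exact: measurable_itv.
rewrite -(setUv (J : set (measurableTypeR R))) ge0_integral_setU //; last 3 first.
- exact: measurableC.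
- by rewrite setUv.
- by apply/disj_setPS; rewrite setICr.
rewrite [X in (_ + X)%E]null_set_integral ?adde0; last 3 first.
- exact: measurableC.
- exact: measurable_funTS.
- by rewrite arc_measureE setICl measure0 mule0.
rewrite (@eq_measure_integral _ _ _ _ (mscale (NngNum (ltW c0)) leb)).
  by rewrite ge0_integral_mscale //; exact: measurable_funTS.
by move=> A mA AJ; rewrite arc_measureE setIidl.
Qed.

Lemma arc_integral_shift (f : R -> R) (t : R) : continuous f -> (forall x, 0 <= f x) ->
  (forall x, f (x + per) = f x) ->
  (\int[mu]_x (f (x + t))%:E = \int[mu]_x (f x)%:E)%E.
Proof.
move=> fc f0 fp.
have sc u : continuous (fun x => f (x + u)).
  move=> x; apply: (@continuous_comp _ _ _ (fun x => x + u)); last exact: fc.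
  by apply: cvgD; [exact: cvg_id|exact: cvg_cst].
have mf u : measurable_fun [set: measurableTypeR R] (fun x : R => (f (x + u))%:E).
  by apply/measurable_EFinP; exact: continuous_measurable_fun.
have mf0 : measurable_fun [set: measurableTypeR R] (fun x : R => (f x)%:E).
  by apply/measurable_EFinP; exact: continuous_measurable_fun.
rewrite !arc_integral //; try by move=> x; rewrite lee_fin.
congr (_ * _)%E.
have ab : - (pi * r) < pi * r by rewrite gtrN.
have bE : pi * r - (- (pi * r)) = per by ring.
have [t0|t0] := leP 0 t.
  by apply: period_integral_shift_ge0 => // x; rewrite bE.
(* A negative shift is undone by the positive shift [- t] of the translated function. *)
have t0' : 0 <= - t by rewrite oppr_ge0 ltW.
have := @period_integral_shift_ge0 R (fun x => f (x + t)) _ _ ab (sc t) _ _ t0'.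
under eq_integral do rewrite subrK.
move=> <- // x.
by rewrite bE addrAC fp.
Qed.

Lemma CXT_arc_bounded (g : R -> R[i]) : CX [set: R] g ->
  exists2 C : R, 0 <= C & \forall x \ae mu, cmod (g x) <= C.
Proof.
move=> gc; have gJ : CX J g.
  by move/CXP: gc => gc; apply/CXP => x Ax e e0; apply: filterS (gc x I e e0) => y h _; exact: h.
have [C C0 hC] := compact_bounded_cmod (@segment_compact _ _ _) gJ.
by exists C => //; apply: filterS arc_ae_itv => x Jx; apply: hC.
Qed.

Definition cl (g : R -> R[i]) : L2type mu := L2class mu g.

Lemma CXT_sq_lty (g : R -> R[i]) : CX [set: R] g ->
  (\int[mu]_x (cmod (g x) ^+ 2)%:E < +oo)%E.
Proof.
move=> gc; have [C C0 gC] := CXT_arc_bounded gc.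
apply: (@le_lt_trans _ _ (\int[mu]_x (cst (C ^+ 2)%:E) x)%E).
  apply: ae_ge0_le_integral => //.
  - by move=> x _; rewrite lee_fin sqr_ge0.
  - by apply: cmeas_sqr; exact: CXT_cmeas.
  - by move=> x _; rewrite lee_fin sqr_ge0.
  - by apply: filterS gC => x gC _; rewrite lee_fin ler_pXn2r ?nnegrE ?cmod_ge0.
by rewrite integral_cst // arc_measureT mule1 ltry.
Qed.

Lemma repr_cl (g : R -> R[i]) : CX [set: R] g -> \forall x \ae mu, repr (cl g) x = g x.
Proof. by move=> gc; apply: repr_L2class; [exact: CXT_cmeas|exact: CXT_sq_lty]. Qed.

Lemma dot_cl (f g : R -> R[i]) : CX [set: R] f -> CX [set: R] g ->
  dot LL (cl f) (cl g) = cint mu (fun x => f x * conjc (g x)).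
Proof. by move=> fc gc; apply: dot_ae; try exact: CXT_cmeas; exact: repr_cl. Qed.

Lemma clD (f g : R -> R[i]) k : CX [set: R] f -> CX [set: R] g ->
  cl (fun x => k * f x + g x) = k *: cl f + cl g.
Proof.
move=> fc gc; apply: L2_eqae.
have h := repr_cl (CX_add (CX_mul (@CX_cst _ _ _ k) fc) gc).
apply: (filterS3 _ _ h (L2linE k (cl f) (cl g)) (filterI (repr_cl fc) (repr_cl gc))).
by move=> x -> -> [-> ->].
Qed.

Lemma clB (f g : R -> R[i]) : CX [set: R] f -> CX [set: R] g ->
  cl (fun x => f x - g x) = cl f - cl g.
Proof.
move=> fc gc; rewrite -[RHS]addrC -[- cl g]scaleN1r -clD //.
by congr cl; apply/funext => x; rewrite mulN1r addrC.
Qed.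

(** For a curve [rho], [rep a] of [circle_module] is [amul] of [a] along [rho], by conversion. *)
Definition amul (g : R -> R[i]) (p : L2type mu) : L2type mu :=
  L2class mu (fun x : measurableTypeR R => g x * repr p x).

Lemma amulE (g : R -> R[i]) (p : L2type mu) : CX [set: R] g ->
  \forall x \ae mu, repr (amul g p) x = g x * repr p x.
Proof.
by move=> gc; have [C _ gC] := CXT_arc_bounded gc; apply: repr_L2mul gC; exact: CXT_cmeas.
Qed.

Lemma amul_cl (g f : R -> R[i]) : CX [set: R] g -> CX [set: R] f ->
  amul g (cl f) = cl (fun x => g x * f x).
Proof.
move=> gc fc; apply: L2_eqae.
apply: (filterS3 _ _ (amulE (cl f) gc) (repr_cl fc) (repr_cl (CX_mul gc fc))).
by move=> x -> -> ->.
Qed.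

Lemma amul_lin (g : R -> R[i]) k (p q : L2type mu) : CX [set: R] g ->
  amul g (k *: p + q) = k *: amul g p + amul g q.
Proof.
move=> gc; apply: L2_eqae.
apply: (filterS3 _ _ (amulE (k *: p + q) gc) (L2linE k (amul g p) (amul g q))
  (filterI (filterI (amulE p gc) (amulE q gc)) (L2linE k p q))).
by move=> x -> -> [[-> ->] ->]; ring.
Qed.

Lemma amul_linl (f g : R -> R[i]) k (p : L2type mu) : CX [set: R] f -> CX [set: R] g ->
  amul (fun x => k * f x + g x) p = k *: amul f p + amul g p.
Proof.
move=> fc gc; apply: L2_eqae.
apply: (filterS3 _ _ (amulE p (CX_add (CX_mul (@CX_cst _ _ _ k) fc) gc))
  (L2linE k (amul f p) (amul g p)) (filterI (amulE p fc) (amulE p gc))).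
by move=> x -> -> [-> ->]; ring.
Qed.

Lemma amulM (f g : R -> R[i]) (p : L2type mu) : CX [set: R] f -> CX [set: R] g ->
  amul (fun x => f x * g x) p = amul f (amul g p).
Proof.
move=> fc gc; apply: L2_eqae.
apply: (filterS3 _ _ (amulE p (CX_mul fc gc)) (amulE (amul g p) fc) (amulE p gc)).
by move=> x -> -> ->; rewrite mulrA.
Qed.

Lemma amul1 (p : L2type mu) : amul (fun=> 1) p = p.
Proof.
apply: L2_eqae; apply: filterS (amulE p (@CX_cst _ _ _ 1)) => x ->.
by rewrite mul1r.
Qed.

Lemma amulJ (g : R -> R[i]) (p q : L2type mu) : CX [set: R] g ->
  dot LL (amul g p) q = dot LL p (amul (fun x => conjc (g x)) q).
Proof.
move=> gc; have mg := CXT_cmeas gc.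
rewrite (@dot_ae _ _ _ _ _ q (fun x => g x * repr p x) (repr q)); last 4 first.
- by apply: cmeasM => //; exact: cmeas_repr.
- exact: cmeas_repr.
- exact: amulE.
- exact: nearW.
rewrite (@dot_ae _ _ _ _ p _ (repr p) (fun x => conjc (g x) * repr q x)); last 4 first.
- exact: cmeas_repr.
- by apply: cmeasM; [exact: cmeasJ|exact: cmeas_repr].
- exact: nearW.
- by apply: amulE; exact: CX_conj.
congr cint; apply/funext => x; rewrite conjcM conjcK; ring.
Qed.

Lemma amul_bound (h k : R -> R[i]) (p : L2type mu) (a b : R) :
  CX [set: R] h -> CX [set: R] k -> 0 <= a -> 0 <= b ->
  (forall x, cmod (h x) ^+ 2 <= a + b * cmod (k x) ^+ 2) ->
  vnorm (amul h p : LL) ^+ 2 <= a * vnorm (p : LL) ^+ 2 + b * vnorm (amul k p : LL) ^+ 2.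
Proof.
move=> hc kc a0 b0 hk; have [C C0 hC] := CXT_arc_bounded hc.
have [C' C'0 kC] := CXT_arc_bounded kc.
apply: (@L2mul_le _ _ _ _ _ _ _ _ _ (Num.max C C')) => //; try exact: CXT_cmeas.
- by apply: filterS hC => x /le_trans; apply; rewrite le_max lexx.
- by apply: filterS kC => x /le_trans; apply; rewrite le_max lexx orbT.
- by apply: filterS filterT => x _.
Qed.

Lemma amul_norm (h : R -> R[i]) (p : L2type mu) (C : R) : CX [set: R] h -> 0 <= C ->
  (forall x, cmod (h x) <= C) -> vnorm (amul h p : LL) <= C * vnorm (p : LL).
Proof.
move=> hc C0 hC; rewrite -(@ler_pXn2r _ 2) ?nnegrE ?mulr_ge0 ?vnorm_ge0 // exprMn.
have := @amul_bound h (fun=> 0) p (C ^+ 2) 0 hc (@CX_cst _ _ _ 0) (sqr_ge0 _) (lexx _) => H.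
apply: (le_trans (H _)) => [x|]; rewrite mul0r addr0 //.
by rewrite ler_pXn2r ?nnegrE ?cmod_ge0.
Qed.

Lemma bounded_arc_integrable (f : R -> R) (C : R) :
  measurable_fun [set: measurableTypeR R] f -> (\forall x \ae mu, `|f x| <= C) ->
  mu.-integrable [set: measurableTypeR R] (EFin \o f).
Proof.
move=> mf fC; apply/integrableP; split; first exact/measurable_EFinP.
apply: (@le_lt_trans _ _ (\int[mu]_x (cst `|C|%:E) x)%E).
  apply: ae_ge0_le_integral => //.
  - by apply: measurableT_comp => //; exact/measurable_EFinP.
  - by move=> x _; rewrite lee_fin.
  - apply: (filterS _ fC) => x h _; by rewrite /= lee_fin (le_trans h) // ler_norm.
by rewrite integral_cst // arc_measureT mule1 ltry.
Qed.

Lemma arc_Rintegral_shift (f : R -> R) (t : R) : continuous f ->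
  (exists C : R, forall x, `|f x| <= C) -> (forall x, f (x + per) = f x) ->
  \int[mu]_x f (x + t) = \int[mu]_x f x.
Proof.
move=> fc [C fC] fp.
have sc u : continuous (fun x => f (x + u)).
  move=> x; apply: (@continuous_comp _ _ _ (fun x => x + u)); last exact: fc.
  by apply: cvgD; [exact: cvg_id|exact: cvg_cst].
have mf u : measurable_fun [set: measurableTypeR R] (fun x : R => f (x + u)).
  exact: continuous_measurable_fun.
have int1 u : mu.-integrable [set: measurableTypeR R] (EFin \o (fun x : R => f (x + u))).
  by apply: (@bounded_arc_integrable _ C) => //; apply: (filterS _ filterT) => x _.
have int2 : mu.-integrable [set: measurableTypeR R] (EFin \o (fun x : R => f x)).
  by have := int1 0; under eq_fun do rewrite addr0.
have intC : mu.-integrable [set: measurableTypeR R] (EFin \o (fun=> C)).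
  by apply: (@bounded_arc_integrable _ `|C|) => //; apply: (filterS _ filterT).
(* Adding the bound [C] makes the integrand nonnegative, which is the case already settled. *)
have E (g : R -> R) : mu.-integrable [set: measurableTypeR R] (EFin \o g) ->
    \int[mu]_x g x = \int[mu]_x (g x + C) - \int[mu]_x C.
  by move=> gi; rewrite (RintegralD measurableT gi intC) addrK.
rewrite (E (fun x => f (x + t))) // (E f) //; congr (_ - _).
rewrite /Rintegral; congr fine.
apply: (@arc_integral_shift (fun x => f x + C)).
- by move=> x; apply: cvgD; [exact: fc|exact: cvg_cst].
- by move=> x; have := fC x; rewrite ler_norml => /andP[]; lra.
- by move=> x; rewrite fp.
Qed.

Lemma clZ (f : R -> R[i]) k : CX [set: R] f -> cl (fun x => k * f x) = k *: cl f.
Proof.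
move=> fc; have := clD k fc (@CX_cst _ _ _ 0).
have -> : cl (fun=> 0) = 0.
  have := @clB (fun=> 0) (fun=> 0) (@CX_cst _ _ _ 0) (@CX_cst _ _ _ 0).
  by rewrite [in RHS]subrr => <-; congr cl; apply/funext => x; rewrite subr0.
by rewrite addr0; under eq_fun do rewrite addr0.
Qed.

Definition circle_fun (g : R -> R[i]) := CX [set: R] g /\ forall x, g (x + per) = g x.

Lemma circle_fun_bounded g : circle_fun g -> exists2 C : R, 0 <= C & forall x, cmod (g x) <= C.
Proof.
move=> [gc gp]; have [K K0 hK] := periodic_modulus r0 gc gp ltr01.
exists (cmod (g 0) + (1 + K * 4)).
  by rewrite !addr_ge0 ?cmod_ge0 // mulr_ge0.
move=> x; rewrite -[g x](subrK (g 0)) addrC (le_trans (cmodD _ _)) // lerD2l.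
rewrite (le_trans (hK 0 x)) // lerD2l ler_wpM2l // cmod_expiB.
by have := cos_geN1 (x / r - 0 / r); lra.
Qed.

Lemma circle_funM f g : circle_fun f -> circle_fun g -> circle_fun (fun x => f x * g x).
Proof. by move=> [fc fp] [gc gp]; split; [exact: CX_mul|move=> x; rewrite fp gp]. Qed.

Lemma circle_funD f g : circle_fun f -> circle_fun g -> circle_fun (fun x => f x + g x).
Proof. by move=> [fc fp] [gc gp]; split; [exact: CX_add|move=> x; rewrite fp gp]. Qed.

Lemma circle_fun_cst k : circle_fun (fun=> k).
Proof. by split => //; exact: CX_cst. Qed.

Lemma circle_funB f g : circle_fun f -> circle_fun g -> circle_fun (fun x => f x - g x).
Proof.
move=> fc gc; have -> : (fun x => f x - g x) = (fun x => f x + (-1) * g x).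
  by apply/funext => x; rewrite mulN1r.
by apply: circle_funD => //; apply: circle_funM => //; exact: circle_fun_cst.
Qed.

Lemma circle_funJ f : circle_fun f -> circle_fun (fun x => conjc (f x)).
Proof. by move=> [fc fp]; split; [exact: CX_conj|move=> x; rewrite fp]. Qed.

Lemma circle_fun_shift f t : circle_fun f -> circle_fun (fun x => f (x + t)).
Proof. by move=> [fc fp]; split; [exact: CXT_shift|move=> x; rewrite addrAC fp]. Qed.

Lemma cint_shift (g : R -> R[i]) t : circle_fun g ->
  cint mu (fun x => g (x + t)) = cint mu g.
Proof.
move=> gC; have [K K0 gK] := circle_fun_bounded gC; have [gc gp] := gC.
rewrite /cint; congr (_ +i* _)%C.
  apply: (@arc_Rintegral_shift (fun x => Re (g x))); first exact: CXT_Re.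
    by exists K => x; exact: le_trans (Re_le_cmod _) (gK x).
  by move=> x; rewrite gp.
apply: (@arc_Rintegral_shift (fun x => Im (g x))); first exact: CXT_Im.
  by exists K => x; exact: le_trans (Im_le_cmod _) (gK x).
by move=> x; rewrite gp.
Qed.

Definition emode (l : int) (x : R) : R[i] := expi (l%:~R * x / r).

Lemma emodeE l x : emode l x = expi (l%:~R / r * x).
Proof. by rewrite /emode mulrAC. Qed.

Lemma emode_circle l : circle_fun (emode l).
Proof.
split; first by rewrite (_ : emode l = fun x => expi (l%:~R / r * x));
  [exact: CXT_expi|apply/funext => x; exact: emodeE].
move=> x; rewrite !emodeE mulrDr expiD.
rewrite (_ : l%:~R / r * per = 2 * pi * l%:~R); last by field; rewrite gt_eqF.
by rewrite expi2piz mulr1.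
Qed.

Lemma emodeD k l x : emode (k + l) x = emode k x * emode l x.
Proof. by rewrite !emodeE -expiD rmorphD /= mulrDl mulrDl. Qed.

Lemma emode0 x : emode 0 x = 1.
Proof. by rewrite emodeE mul0r mul0r expi0. Qed.

Lemma emodeN l x : emode (- l) x = conjc (emode l x).
Proof. by rewrite !emodeE rmorphN /= !mulNr expiN. Qed.

Lemma emode_shift l x t : emode l (x + t) = emode l t * emode l x.
Proof. by rewrite !emodeE mulrDr expiD mulrC. Qed.

Lemma cmod_emode l x : cmod (emode l x) = 1.
Proof. exact: cmod_expi. Qed.

Lemma exp_modeE l : exp_mode r l = cl (emode l).
Proof. by []. Qed.

Lemma dot_cl_shift (f g : R -> R[i]) t : circle_fun f -> circle_fun g ->
  dot LL (cl (fun x => f (x + t))) (cl (fun x => g (x + t))) = dot LL (cl f) (cl g).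
Proof.
move=> fC gC; rewrite (dot_cl fC.1 gC.1).
rewrite (dot_cl (@CXT_shift R f t fC.1) (@CXT_shift R g t gC.1)).
exact: (@cint_shift (fun x => f x * conjc (g x)) t (circle_funM fC (circle_funJ gC))).
Qed.

(** For [k != l] no integral is computed: the shift by [pi r / (k - l)] preserves the inner product
    and also multiplies it by [expi pi = -1]. *)
Lemma exp_mode_orthonormal k l : dot LL (exp_mode r k) (exp_mode r l) = (k == l)%:R.
Proof.
rewrite !exp_modeE; have [kc lc] := (emode_circle k, emode_circle l).
have [<-|kl] := eqVneq k l.
  rewrite (dot_cl kc.1 kc.1).
  rewrite (_ : (fun _ => _) = fun=> 1); last by apply/funext => x; exact: expi_mulJ.
  rewrite /cint !Rintegral_cst // arc_measureT /= mul1r mul0r.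
  by [].
pose t := pi * r / (k - l)%:~R.
have klR : (k - l)%:~R != 0 :> R by rewrite intr_eq0 subr_eq0.
have := dot_cl_shift t kc lc.
have sh m : (fun x => emode m (x + t)) = (fun x => emode m t * emode m x).
  by apply/funext => x; rewrite emode_shift.
rewrite (sh k) (sh l) (clZ _ kc.1) (clZ _ lc.1).
rewrite dotZl dotZr mulrA -emodeN -emodeD.
rewrite emodeE /t (_ : _ / r * _ = pi); last first.
    rewrite (_ : _ / r * _ = pi * (r / r) * ((k - l)%:~R / (k - l)%:~R)); last by ring.
    by rewrite (mulfV klR) mulfV ?gt_eqF // !mulr1.
rewrite /expi cospi sinpi => /eqP.
rewrite -subr_eq0 -{2}[dot _ _ _]mul1r -mulrBl mulf_eq0 => /orP[|/eqP //].
by rewrite eq_complex /= => /andP[/eqP h _]; exfalso; lra.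
Qed.

End arc.

(** * Totality of the exponentials *)

Section ae_zero.
Variable R : realType.
Local Notation leb := (@lebesgue_measure R).

(** Lebesgue differentiation: the primitive [F] is constant on the interval, and its derivative is
    [f] almost everywhere. *)
Lemma ae_zero_itv_integral (f : R -> R) (a b : R) :
  leb.-integrable [set: R] (EFin \o f) ->
  (forall x y, a < x -> x <= y -> y < b -> \int[leb]_(t in `]x, y]) f t = 0) ->
  \forall x \ae leb, a < x < b -> f x = 0.
Proof.
move=> fi f0.
have fiS (A : set R) : measurable A -> leb.-integrable A (EFin \o f).
  by move=> mA; apply: (@integrableS _ _ R leb [set: R] A).
have := @FTC1 R f (BLeft a) (fun y => fiS _ (measurable_itv _))
  (open_integrable_locally openT fi).
set F := fun x => _ => /=.
have aef : Filter (nbhs (almost_everywhere leb)) by exact: ae_filter_ringOfSetsType.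
apply: (@filterS _ _ aef) => x H /andP[ax xb].
have [] := H; first by rewrite lte_fin.
move=> _ <-; rewrite derive1E.
have -> : 'D_1 F x = 'D_1 (cst (F x)) x; last by rewrite derive_cst.
apply: near_eq_derive.
have := near_in_itvoo; move=> /(_ R a b x); rewrite in_itv /= ax xb => /(_ isT).
apply: filterS => y; rewrite in_itv /= => /andP[ay yb].
have E u w : a < u -> u <= w -> w < b -> F w = F u.
  move=> au uw wb; apply/eqP; rewrite -subr_eq0 /F Rintegral_itvB ?f0 //.
  - exact: fiS.
  - by rewrite bnd_simp ltW.
by have [xy|/ltW yx] := leP x y; rewrite /cst; [apply: E|apply/esym/E].
Qed.

End ae_zero.

Section totality.
Variables (R : realType) (r : R).
Hypothesis r0 : 0 < r.
Local Notation per := (2 * pi * r).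
Local Notation mu := (arc_measure r).
Local Notation leb := (@lebesgue_measure R).
Local Notation J := `[- (pi * r), pi * r]%classic.
Local Notation LL := (L2 mu).

#[local] Instance arc_ae_filter' : Filter (nbhs (almost_everywhere mu)) :=
  ae_filter_ringOfSetsType mu.

Let pr0 : 0 < pi * r. Proof. by rewrite mulr_gt0 // pi_gt0. Qed.
Let c := per^-1.
Let c0 : 0 < c. Proof. by rewrite invr_gt0 -mulrA mulr_gt0. Qed.

(** Continuous periodic functions that tend, on [J], to the indicator of the interval with midpoint
    [m] and half-length [d * r]: inside it the cosine exceeds [cos d]. *)
Let bump (m d : R) (n : nat) (x : R) :=
  Num.min 1 (n%:R * Num.max 0 (cos ((x - m) / r) - cos d)).

Let bump_cont m d n : continuous (bump m d n).
Proof.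
move=> x; apply: (@continuous_min R R (fun=> 1) (fun x => n%:R * Num.max 0 (cos ((x - m) / r) - cos d)) x); first exact: cvg_cst.
apply: (@cvgM R R _ _ (fun=> n%:R)); first exact: cvg_cst.
apply: (@continuous_max R R (fun=> 0) (fun x => cos ((x - m) / r) - cos d) x); first exact: cvg_cst.
apply: cvgB; last exact: cvg_cst.
apply: (@continuous_comp _ _ _ (fun x => (x - m) / r)); last exact: continuous_cos.
by apply: cvgM; [apply: cvgB; [exact: cvg_id|exact: cvg_cst]|exact: cvg_cst].
Qed.

Let bump_per m d n x : bump m d n (x + per) = bump m d n x.
Proof.
rewrite /bump; congr (Num.min _ (_ * Num.max _ (_ - _))).
rewrite (_ : (x + per - m) / r = (x - m) / r + pi *+ 2).
  exact: cosD2pi.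
by rewrite -[pi *+ 2]mulr_natl; field; rewrite gt_eqF.
Qed.

Let bump_ge0 m d n x : 0 <= bump m d n x <= 1.
Proof.
rewrite /bump ge_min lexx le_min ler01 /= mulr_ge0 //.
Qed.

Let cos_norm (t : R) : cos `|t| = cos t.
Proof. by case: (ger0P t) => _; rewrite ?cosN. Qed.

Let cos_le (a b : R) : 0 <= a -> a <= b -> b <= pi -> cos b <= cos a.
Proof.
move=> a0; rewrite le_eqVlt => /orP[/eqP-> //|ab] bp; rewrite ltW // ltr_cos //.
  by rewrite in_itv /= a0 (le_trans (ltW ab)).
by rewrite in_itv /= bp (le_trans a0) // ltW.
Qed.

Let bump_cvg (al be x : R) : - (pi * r) < al -> al < be -> be < pi * r -> J x ->
  bump ((al + be) / 2) ((be - al) / (2 * r)) n x @[n --> \oo] --> (\1_(`]al, be[%classic) x : R).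
Proof.
move=> h1 h2 h3; rewrite /= in_itv /= => /andP[h4 h5].
set m := (al + be) / 2; set d := (be - al) / (2 * r).
have d0 : 0 < d by rewrite divr_gt0 ?subr_gt0 // mulr_gt0.
have dr : d * r = (be - al) / 2 by rewrite /d; field; rewrite gt_eqF.
have dpi : d < pi by rewrite -(ltr_pM2r r0) dr; lra.
set th := (x - m) / r.
have thr : th * r = x - m by rewrite /th; field; rewrite gt_eqF.
have [xI|xI] := boolP (x \in (`]al, be[%classic : set R)).
  rewrite indicE xI; move: xI; rewrite inE /= in_itv /= => /andP[ax xb].
  have cp : 0 < cos th - cos d.
    rewrite subr_gt0.
    rewrite -(cos_norm th).
    have td : `|th| < d.
      by rewrite ltr_norml; apply/andP; split; rewrite -(ltr_pM2r r0) ?mulNr thr dr /m; lra.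
    by rewrite ltr_cos // in_itv /= ?normr_ge0 ?(ltW d0) ?(ltW dpi) // ltW // (lt_trans td).
  set e := cos th - cos d in cp *.
  apply: cvg_near_cst.
  exists (Num.truncn e^-1).+1 => // n /= hn.
  rewrite /bump -/th -/e max_r ?(ltW cp) //; apply/eqP; rewrite eq_minl.
  rewrite -ler_pdivrMr // div1r (le_trans (ltW (truncnS_gt _))) // ler_nat //.
rewrite indicE (negbTE xI).
apply: cvg_near_cst; apply: nearW => n.
rewrite /bump -/th max_l ?mulr0; first by apply/eqP; rewrite min_r.
rewrite subr_le0.
(* [J] has the length of a period, so outside the interval the angle also stays at distance [d] from
   [2 pi], where the cosine returns to 1. *)
have [td tp] : d <= `|th| /\ `|th| <= 2 * pi - d.
  split.
    move: xI; rewrite notin_setE /= in_itv /= => /negP; rewrite negb_and -!leNgt.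
    rewrite ler_normr => /orP[h|h]; apply/orP; [right|left];
      rewrite -(ler_pM2r r0) ?mulNr thr dr /m; lra.
  rewrite ler_norml; apply/andP; split; rewrite -(ler_pM2r r0) ?mulNr mulrBl thr dr /m;
    by move: h1 h2 h3 h4 h5; rewrite -[2 * pi * r]mulrA; set q := pi * r; lra.
rewrite -(cos_norm th).
move: `|th| td tp => u ud up.
have [ul|ul] := leP u pi.
  by apply: cos_le => //; exact: ltW.
have -> : cos u = cos (2 * pi - u).
  by rewrite -[RHS]cosN opprB mulr_natl -(cosD2pi (u - pi *+ 2)) subrK.
by apply: cos_le; [exact: ltW|lra|lra].
Qed.

Let arc_integral_sub (A : set (measurableTypeR R)) (f : measurableTypeR R -> \bar R) :
  measurable A -> A `<=` J -> measurable_fun A f -> (forall x, (0 <= f x)%E) ->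
  (\int[mu]_(x in A) f x = c%:E * \int[leb]_(x in A) f x)%E.
Proof.
move=> mA AJ mf f0.
rewrite (@eq_measure_integral _ _ _ _ (mscale (NngNum (ltW c0)) leb)).
  by rewrite ge0_integral_mscale.
by move=> B mB BA; rewrite arc_measureE // setIidl //; exact: subset_trans AJ.
Qed.

Let arc_integrable_sub (A : set (measurableTypeR R)) (h : R -> R) :
  measurable A -> A `<=` J -> mu.-integrable A (EFin \o h) ->
  leb.-integrable A (EFin \o h).
Proof.
move=> mA AJ /integrableP[mh]; rewrite arc_integral_sub //; last first.
  by apply: measurableT_comp.
move=> hlt; apply/integrableP; split => //.
rewrite ltey; apply/negP => /eqP hE; move: hlt; rewrite hE gt0_muley ?lte_fin //.
Qed.

Let arc_integral_eq0 (A : set (measurableTypeR R)) (h : R -> R) :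
  measurable A -> A `<=` J -> mu.-integrable A (EFin \o h) ->
  (\int[mu]_(x in A) (h x)%:E = 0 -> \int[leb]_(x in A) (h x)%:E = 0)%E.
Proof.
move=> mA AJ hi; have li := arc_integrable_sub mA AJ hi.
have mh := measurable_int _ hi.
rewrite integralE [in X in _ -> X]integralE.
have pf := integrable_pos_fin_num mA li; have nf := integrable_neg_fin_num mA li.
rewrite !arc_integral_sub //; last 2 first.
  exact: measurable_funeneg.
  exact: measurable_funepos.
rewrite -(fineK pf) -(fineK nf) -!EFinM -!EFinB => -[/eqP].
by rewrite -mulrBr mulf_eq0 gt_eqF //= => /eqP ->.
Qed.

(** Dominated convergence along [bump], with [|h|] as majorant. *)
Let h_itv_zero (h : R -> R) : mu.-integrable [set: measurableTypeR R] (EFin \o h) ->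
  (forall phi : R -> R, continuous phi -> (forall x, phi (x + per) = phi x) ->
    \int[mu]_x (h x * phi x) = 0) -> forall al be : R,
  - (pi * r) < al -> al < be -> be < pi * r ->
  (\int[mu]_(x in `]al, be[%classic) (h x)%:E)%E = 0%E.
Proof.
move=> hi h0; have mh : measurable_fun [set: measurableTypeR R] h.
  by apply/measurable_EFinP; exact: measurable_int hi.
move=> al be h1 h2 h3; set I := `]al, be[%classic.
pose f_ (n : nat) (x : measurableTypeR R) :=
  (h x * bump ((al + be) / 2) ((be - al) / (2 * r)) n x)%:E.
have mf n : measurable_fun [set: measurableTypeR R] (f_ n).
  apply/measurable_EFinP; apply: measurable_funM => //.
  by apply: continuous_measurable_fun; exact: bump_cont.
have fh n x : (`|f_ n x| <= `|h x|%:E)%E.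
  rewrite /f_ /= lee_fin normrM.
  have /andP[b0 b1] := bump_ge0 ((al + be) / 2) ((be - al) / (2 * r)) n x.
  by rewrite (ger0_norm b0) ler_piMr.
have mI : measurable (I : set (measurableTypeR R)) by exact: measurable_itv.
have mg : measurable_fun [set: measurableTypeR R] (fun x => (h x * \1_I x)%:E).
  by apply/measurable_EFinP; apply: measurable_funM => //; exact: measurable_indic.
have hn : mu.-integrable [set: measurableTypeR R] (fun x => (`|h x|)%:E).
  exact: (integrable_norm hi).
have [|||_ _] := @dominated_convergence _ _ R mu _ measurableT f_
  (fun x => (h x * \1_I x)%:E) (fun x => (`|h x|)%:E) mf mg.
- apply: (filterS _ (arc_ae_itv r0)) => x Jx _; apply: cvg_EFin; first by apply: nearW.
  by apply: cvgM; [exact: cvg_cst|exact: bump_cvg].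
- exact: hn.
- by apply: (filterS _ filterT) => x _ n _; exact: fh.
have -> : [sequence (\int[mu]_(x in [set: measurableTypeR R]) f_ n x)%E]_n = fun=> 0%E.
  apply/funext => n.
  have := h0 _ (@bump_cont ((al + be) / 2) ((be - al) / (2 * r)) n) (bump_per _ _ _).
  rewrite /Rintegral => hz; rewrite -[LHS]fineK; first by congr (_%:E); exact: hz.
  apply: integrable_fin_num => //; apply: (le_integrable measurableT (mf n) _ hn).
  by move=> x _; rewrite (le_trans (fh n x)) //= lee_fin normr_id.
move=> /(cvg_lim (@ereal_hausdorff R)); rewrite lim_cst // => E0.
rewrite integral_mkcond [RHS]E0.
by apply: eq_integral => x _; rewrite epatch_indic.
Qed.

Lemma arc_ae_zero (h : R -> R) : mu.-integrable [set: measurableTypeR R] (EFin \o h) ->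
  (forall phi : R -> R, continuous phi -> (forall x, phi (x + per) = phi x) ->
    \int[mu]_x (h x * phi x) = 0) ->
  \forall x \ae mu, h x = 0.
Proof.
move=> hi h0; have A := h_itv_zero hi h0.
have mJ : measurable (J : set (measurableTypeR R)) by exact: measurable_itv.
have iS (B : set (measurableTypeR R)) : measurable B -> mu.-integrable B (EFin \o h).
  by move=> mB; apply: (@integrableS _ _ R mu [set: measurableTypeR R] B).
have li : leb.-integrable [set: R] (EFin \o (h \_ J)).
  rewrite -restrict_EFin; apply/(integrable_mkcond _ mJ).
  by apply: arc_integrable_sub => //; exact: iS.
have null (B : set (measurableTypeR R)) : measurable B -> leb B = 0%E ->
    \forall x \ae mu, ~ B x.
  move=> mB B0; exists B; split => //; last by move=> x /= /contrapT.
  rewrite arc_measureE // (@subset_measure0 _ _ _ _ (B `&` J) B) ?mule0 //.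
  by apply: measurableI.
have [|N [mN N0 hN]] := @ae_zero_itv_integral R (h \_ J) (- (pi * r)) (pi * r) li.
  move=> x y ax; rewrite le_eqVlt => /orP[/eqP<- _|xy yb].
    by rewrite set_itvoc0 Rintegral_set0.
  have xyJ : `]x, y[%classic `<=` J.
    by move=> z /=; rewrite !in_itv /= => /andP[]; move: ax yb; lra.
  rewrite -Rintegral_itv_bndo_bndc; last first.
    apply: (@integrableS _ _ R leb [set: R]) => //.
  rewrite /Rintegral (_ : (\int[leb]_(z in `]x, y[) _)%E = 0%E) //.
  transitivity (\int[leb]_(z in `]x, y[%classic) (h z)%:E)%E.
    by apply: eq_integral => z; rewrite inE => /xyJ Jz; rewrite patchE mem_set.
  by apply: (@arc_integral_eq0 `]x, y[%classic) => //; [apply: iS; exact: measurable_itv|exact: A].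
apply: (filterS3 _ _ (arc_ae_itv r0) (null _ mN N0)
  (filterI (null [set - (pi * r)] (measurable_set1 _) (lebesgue_measure_set1 _))
           (null [set pi * r] (measurable_set1 _) (lebesgue_measure_set1 _)))).
move=> x Jx Nx [/= xa xb]; apply: contrapT => hx; apply: Nx; apply: hN => /= H.
apply: hx; rewrite -(H _) ?patchE ?mem_set //.
move: Jx; rewrite /= in_itv /= !lt_neqAle => /andP[-> ->]; rewrite !andbT.
by apply/andP; split; apply/eqP => // /esym.
Qed.

Lemma circle_fun_sum (I : Type) (s : seq I) (a : I -> R[i]) (f : I -> R -> R[i]) :
  (forall i, circle_fun r (f i)) -> circle_fun r (fun x => \sum_(i <- s) a i * f i x).
Proof.
move=> fC; elim: s => [|i s IH].
  by under eq_fun do rewrite big_nil; exact: circle_fun_cst.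
under eq_fun do rewrite big_cons.
by apply: circle_funD => //; apply: circle_funM => //; exact: circle_fun_cst.
Qed.

Lemma cl_sum (I : Type) (s : seq I) (a : I -> R[i]) (f : I -> R -> R[i]) :
  (forall i, circle_fun r (f i)) ->
  cl r (fun x => \sum_(i <- s) a i * f i x) = \sum_(i <- s) a i *: cl r (f i).
Proof.
move=> fC; elim: s => [|i s IH].
  rewrite big_nil; under eq_fun do rewrite big_nil.
  have := @clZ R r r0 (fun=> 1) 0 (@CX_cst _ _ _ 1).
  by rewrite scale0r => <-; congr cl; apply/funext => x; rewrite mul0r.
rewrite big_cons -IH -(clD r0 _ (fC i).1 (circle_fun_sum _ _ fC).1).
by congr cl; apply/funext => x; rewrite big_cons.
Qed.

Lemma vnorm_exp_mode l : vnorm (exp_mode r l : LL) = 1.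
Proof. by rewrite /vnorm exp_mode_orthonormal // eqxx sqrtr1. Qed.

Lemma vnorm_cl (g : R -> R[i]) (C : R) : CX [set: R] g -> 0 <= C ->
  (forall x, cmod (g x) <= C) -> vnorm (cl r g : LL) <= C.
Proof.
move=> gc C0 gC; have -> : cl r g = amul g (exp_mode r 0).
  rewrite exp_modeE (amul_cl r0 gc (emode_circle r0 0).1).
  by congr cl; apply/funext => x; rewrite emode0 mulr1.
by rewrite (le_trans (amul_norm r0 _ gc C0 gC)) // vnorm_exp_mode mulr1.
Qed.

Lemma circle_approx g : circle_fun r g -> forall e : R, 0 < e ->
  exists (s : seq int) (a : int -> R[i]), forall x,
    cmod (g x - \sum_(l <- s) a l * emode r l x) < e.
Proof.
move=> [gc gp] e e0; have [n [q hq]] := trig_weierstrass r0 gc gp e0.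
exists [seq j%:Z - n%:Z | j <- iota 0 (size q)], (fun l => q`_(absz (l + n%:Z))) => x.
rewrite [X in cmod (_ - X)](_ : _ = expi (- (n%:R * x / r)) * q.[expi (x / r)]) //.
rewrite big_map horner_coef mulr_sumr -(big_mkord xpredT
  (fun j => expi (- (n%:R * x / r)) * (q`_j * expi (x / r) ^+ j))).
rewrite /index_iota subn0; apply: eq_bigr => j _.
rewrite subrK absz_nat mulrCA; congr (_ * _); rewrite emodeD emodeN mulrC expiN.
rewrite /emode -!pmulrn; congr (_ * _); rewrite -expiMn; congr expi.
by rewrite -[RHS]mulr_natl mulrA.
Qed.

(** Orthogonality passes from the exponentials to all continuous periodic functions by uniform
    approximation; real test functions then separate the real from the imaginary part, and
    [arc_ae_zero] applies to each. *)
Lemma arc_total (xi : L2type mu) : (forall l, dot LL xi (exp_mode r l) = 0) -> xi = 0.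
Proof.
move=> xi0.
have cl0 g : circle_fun r g -> dot LL xi (cl r g) = 0.
  move=> gC; apply/eqP; rewrite -cmod_eq0 eq_le cmod_ge0 andbT.
  apply/ler_addgt0Pl => e e0; rewrite addr0.
  pose e' := e / (vnorm (xi : LL) + 1).
  have e'0 : 0 < e' by rewrite divr_gt0 // ltr_wpDl ?vnorm_ge0.
  have [s [a hs]] := circle_approx gC e'0.
  set p := (fun x => \sum_(l <- s) a l * emode r l x) in hs.
  have pC : circle_fun r p by apply: circle_fun_sum => l; exact: emode_circle.
  have p0 : dot LL xi (cl r p) = 0.
    rewrite (cl_sum s a (fun l => emode_circle r0 l)) dot_sumr big1_seq // => l _.
    by rewrite dotZr -exp_modeE xi0 mulr0.
  rewrite -[dot _ _ _]subr0 -p0 -dotBr -(clB r0 gC.1 pC.1).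
  rewrite (le_trans (cauchy_schwarz _ _)) //.
  apply: (@le_trans _ _ (vnorm (xi : LL) * e')).
    rewrite ler_wpM2l ?vnorm_ge0 // vnorm_cl ?(ltW e'0) //.
      by case: (circle_funB gC pC).
    by move=> x; exact/ltW/hs.
  rewrite /e' mulrCA -[leRHS]mulr1 ler_pM2l // ler_pdivrMr ?mul1r ?lerDl //.
  by rewrite ltr_wpDl ?vnorm_ge0.
have oneC := circle_fun_cst r (1 : R[i]).
(* Pairing with the class of 1 writes [xi] as a product of two square integrable functions, which
   makes its real and imaginary parts integrable. *)
set one := cl r (fun=> 1).
have [hR hI] := cint_integrable xi one.
set f := fun x => repr xi x * conjc (repr one x) in hR hI.
have fm : cmeas f by apply: cmeasM; [exact: cmeas_repr|apply: cmeasJ; exact: cmeas_repr].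
have fxi : \forall x \ae mu, repr xi x = f x.
  apply: (filterS _ (repr_cl r0 oneC.1)) => x; rewrite /f => ->.
  by rewrite conjc1 mulr1.
have key (phi : R -> R) : continuous phi -> (forall x, phi (x + per) = phi x) ->
    \int[mu]_x (Re (f x) * phi x) = 0 /\ \int[mu]_x (Im (f x) * phi x) = 0.
  move=> phic phip; pose g x := ((phi x)%:C)%C.
  have gC : circle_fun r g.
    split; last by move=> x; rewrite /g phip.
    by apply: CXT_ReIm => x; [exact: phic|exact: cvg_cst].
  have := cl0 g gC; rewrite (dot_ae fm (CXT_cmeas gC.1) fxi (repr_cl r0 gC.1)) /cint.
  move=> -[h1 h2]; rewrite -[RHS]h1 -[X in _ /\ _ = X]h2.
  split; congr (\int[mu]_x _); apply/funext => x.
    by rewrite /g; case: (f x) => u w /=; ring.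
  by rewrite /g; case: (f x) => u w /=; ring.
have zR := arc_ae_zero hR (fun phi h1 h2 => (key phi h1 h2).1).
have zI := arc_ae_zero hI (fun phi h1 h2 => (key phi h1 h2).2).
apply: L2_eqae; apply: (filterS3 _ _ (filterI zR zI) fxi (reprZ 0 xi)).
move=> x [h1 h2] h3; rewrite scale0r => ->; rewrite mul0r h3.
by move: h1 h2; rewrite -/(f x); case: (f x) => u w /= -> ->.
Qed.

Lemma arc_complete : hilbert_complete LL.
Proof. by apply: L2_complete; exact: arc_measureT. Qed.

End totality.

(** * Commutators on the circle *)

Section trigonometric_sums.
Variables (R : realType) (I : Type) (s : seq I) (c : I -> R[i]) (w : I -> R).

(** [P' = i Q]. The mean value theorem concerns real functions, so [P] is multiplied by a constant
    [u] of modulus 1 and the real part [F u] is differentiated. *)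
Let P t := \sum_(k <- s) c k * expi (w k * t).
Let Q t := \sum_(k <- s) c k * ((w k)%:C)%C * expi (w k * t).

Let F u t := \sum_(k <- s) Re (u * c k * expi (w k * t)).
Let dF u t := \sum_(k <- s) Re (u * 'i%C * (c k * ((w k)%:C)%C * expi (w k * t))).

Let FE u t : F u t = Re (u * P t).
Proof. by rewrite mulr_sumr raddf_sum; apply: eq_bigr => k _; rewrite mulrA. Qed.

Let dFE u t : dF u t = Re (u * 'i%C * Q t).
Proof. by rewrite mulr_sumr raddf_sum. Qed.

Let F_derive (u : R[i]) (t : R) : is_derive t (1 : R) (F u : R -> R) (dF u t).
Proof.
rewrite /F /dF; elim: s => [|k r IH].
  under [X in is_derive _ _ X]eq_fun do rewrite big_nil.
  by rewrite big_nil; exact: is_derive_cst.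
under [X in is_derive _ _ X]eq_fun do rewrite big_cons.
rewrite big_cons; apply: is_deriveD IH.
set z := u * c k.
have -> : (fun x => Re (z * expi (w k * x))) =
    (fun x => Re z * (cos (w k * x)) + (- Im z) * (sin (w k * x))).
  by apply/funext => x; case: z => a b /=; ring.
have -> : Re (u * 'i%C * (c k * ((w k)%:C)%C * expi (w k * t))) =
    Re z * (- sin (w k * t) * w k) + (- Im z) * (cos (w k * t) * w k).
  rewrite (_ : _ * _ = z * ('i%C * ((w k)%:C)%C * expi (w k * t))); last by rewrite /z; ring.
  by case: z => a b /=; ring.
have dl : is_derive t 1 (fun x => w k * x) (w k).
  have -> : (fun x : R => w k * x) = w k \*: id by [].
  by apply: is_derive_eq; rewrite /GRing.scale /= mulr1.
have dc : is_derive t 1 (fun x => cos (w k * x)) (- sin (w k * t) * w k).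
  exact: (@is_derive1_comp R cos (fun x => w k * x)).
have ds : is_derive t 1 (fun x => sin (w k * x)) (cos (w k * t) * w k).
  exact: (@is_derive1_comp R sin (fun x => w k * x)).
have e1 := is_deriveZ (Re z) dc; have e2 := is_deriveZ (- Im z) ds.
exact: (is_deriveD e1 e2).
Qed.

Let phase (z : R[i]) : exists2 u : R[i], cmod u = 1 & Re (u * z) = cmod z.
Proof.
have [->|z0] := eqVneq z 0; first by exists 1; rewrite ?cmod1 // mulr0 cmod0.
have m0 : cmod z != 0 by rewrite cmod_eq0.
exists (((cmod z)^-1%:C)%C * conjc z).
  by rewrite cmodM cmodJ cmod_real ger0_norm ?invr_ge0 ?cmod_ge0 // mulVf.
rewrite -mulrA [conjc z * z]mulrC mulJc -real_complexM /=.
by rewrite expr2 mulrA mulVf // mul1r.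
Qed.

Lemma trig_sum_mvt (M : R) : (forall t, cmod (Q t) <= M) ->
  forall t, cmod (P t - P 0) <= M * `|t|.
Proof.
move=> QM t; have [u u1 <-] := phase (P t - P 0).
rewrite mulrBr raddfB /= -!FE.
have main (a b : R) : a <= b -> `|F u b - F u a| <= M * (b - a).
  move=> ab; have [||x _ ->] := @MVT_segment R (F u) (dF u) a b ab.
  - by move=> x _; exact: F_derive.
  - apply: derivable_within_continuous => x _.
    by have [] := F_derive u x.
  rewrite normrM [`|b - a|]ger0_norm ?subr_ge0 // ler_wpM2r ?subr_ge0 //.
  rewrite dFE (le_trans (ler_norm _)) ?normr_id // -cmod_real.
  have := Re_le_cmod (u * 'i%C * Q x).
  rewrite !cmodM u1 mul1r => h; rewrite cmod_real (le_trans h) //.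
  have -> : cmod ('i%C : R[i]) = 1 by rewrite cmod_sqrt /= expr0n expr1n add0r sqrtr1.
  by rewrite mul1r.
have [t0|t0] := leP 0 t.
  rewrite (le_trans (ler_norm _)) // (le_trans (main 0 t t0)) //.
  by rewrite subr0 ger0_norm.
rewrite (le_trans (ler_norm _)) // distrC (le_trans (main t 0 (ltW t0))) //.
by rewrite sub0r ltr0_norm.
Qed.

Lemma trig_sum_derivative (M : R) : 0 <= M -> (forall t, cmod (P t - P 0) <= M * `|t|) ->
  cmod (\sum_(k <- s) c k * ((w k)%:C)%C) <= M.
Proof.
move=> M0 PM; have -> : \sum_(k <- s) c k * ((w k)%:C)%C = Q 0.
  by apply: eq_bigr => k _; rewrite mulr0 expi0 mulr1.
have ci : cmod ('i%C : R[i]) = 1 by rewrite cmod_sqrt /= expr0n expr1n add0r sqrtr1.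
have [u u1 uE] := phase ('i%C * Q 0).
have <- : cmod ('i%C * Q 0) = cmod (Q 0) by rewrite cmodM ci mul1r.
rewrite -uE mulrA -dFE; have [d1 <-] := F_derive u 0.
apply: limr_le => //; apply: nearW => h.
rewrite /= addr0 [h *: _]mulr1 /GRing.scale /=.
rewrite (le_trans (ler_norm _)) // normrM normfV.
have [->|h0] := eqVneq h 0; first by rewrite normr0 invr0 mul0r.
rewrite mulrC ler_pdivrMr ?normr_gt0 // !FE -raddfB -mulrBr (le_trans (Re_le_cmod _)) //.
by rewrite cmodM u1 mul1r.
Qed.

End trigonometric_sums.

Section real_bounds.
Variable R : realType.

(** This is [(a + b)^2 <= 2 a^2 + 2 b^2], with the constants of the concentration argument in
    [lip_K]. *)
Lemma two_term_sqr (p q d C : R) : 0 <= p -> 0 <= q -> 0 <= d -> 0 <= C ->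
  p <= d / 2 + 2 * C * q -> p ^+ 2 <= d ^+ 2 / 2 + 8 * C ^+ 2 * q ^+ 2.
Proof.
move=> p0 q0 d0 C0 pb.
have h1 : p ^+ 2 <= (d / 2 + 2 * C * q) ^+ 2.
  by rewrite ler_pXn2r ?nnegrE // addr_ge0 ?mulr_ge0 // divr_ge0.
have h2 : 0 <= (d / 2 - 2 * C * q) ^+ 2 by exact: sqr_ge0.
apply: (le_trans h1); rewrite -subr_ge0 (le_trans h2) // le_eqVlt; apply/orP; left.
by apply/eqP; field.
Qed.

Lemma four_term_le (c d n q : R) : 0 <= c -> q <= 4 -> 64 * c <= d * n ->
  d / 2 * n + 8 * c * q <= d * n.
Proof.
move=> c0 q4 h; have := ler_wpM2l (mulr_ge0 (ler0n R 8) c0) q4.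
have -> : d / 2 * n = d * n / 2 by field.
by move: (d * n) h (8 * c * q) => u h w; lra.
Qed.

Lemma le_of_sqr (p q : R) : 0 <= q -> p ^+ 2 <= q ^+ 2 -> p <= q.
Proof.
move=> q0; have [p0|/ltW p0] := leP 0 p; first by rewrite ler_pXn2r ?nnegrE.
by move=> _; exact: le_trans q0.
Qed.

Lemma eq_of_sqr (p q : R) : 0 <= p -> 0 <= q -> p ^+ 2 = q ^+ 2 -> p = q.
Proof.
move=> p0 q0 h; apply/eqP; rewrite eq_le (le_of_sqr q0) ?(le_of_sqr p0) //; by rewrite h.
Qed.

Lemma le_of_sqr_le (p q m : R) : 0 <= m -> 0 <= q -> q ^+ 2 <= m * q -> q ^+ 2 <= m ^+ 2.
Proof.
move=> m0; rewrite le_eqVlt => /predU1P[<-|q0]; first by rewrite expr0n sqr_ge0.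
by rewrite expr2 ler_pM2r // => qm; rewrite -expr2 ler_pXn2r ?nnegrE // ltW.
Qed.

End real_bounds.

Section circle_commutator.
Variables (R : realType) (r : R).
Hypothesis r0 : 0 < r.
Local Notation per := (2 * pi * r).
Local Notation mu := (arc_measure r).
Local Notation LL := (L2 mu).
Definition mode (l : int) : LL := exp_mode r l.
Local Notation e := mode.

Definition circle_lam (l : int) : R := (l%:~R + 2^-1) / r.
Local Notation lam := circle_lam.

Let e_on k l : dot LL (e k) (e l) = (k == l)%:R.
Proof. exact: exp_mode_orthonormal. Qed.

Lemma amul_sum g (I : Type) (s : seq I) (c : I -> R[i]) (x : I -> LL) : CX [set: R] g ->
  amul g (\sum_(i <- s) c i *: x i) = \sum_(i <- s) c i *: (amul g (x i) : LL).
Proof.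
move=> gc; elim: s => [|i s IH].
  rewrite !big_nil; have := amul_lin r0 (-1) 0 0 gc.
  by rewrite scaler0 addr0 scaleN1r addNr.
by rewrite !big_cons amul_lin // IH.
Qed.

Section fixed_function.
Variable g : R -> R[i].
Hypothesis gC : circle_fun r g.

Let gs t x := g (x + t).
Let gsC t : circle_fun r (gs t). Proof. exact: circle_fun_shift. Qed.
Let G l m := dot LL (amul g (e l)) (e m).
Let W (p : int * int) : R := (p.2%:~R - p.1%:~R) / r.

(** The core of the commutator estimate: translating [g] multiplies its matrix coefficients by
    exponentials in [t]. The frequency [W (l, m)] equals [lam m - lam l], the factor that the
    commutator with [D] introduces. *)
Let G_shift l m t : dot LL (amul (gs t) (e l)) (e m) = expi (W (l, m) * t) * G l m.
Proof.
have lC := emode_circle r0 l; have mC := emode_circle r0 m.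
have glC := circle_funM gC lC.
have := dot_cl_shift r0 t glC mC.
have -> : (fun x => emode r m (x + t)) = (fun x => emode r m t * emode r m x).
  by apply/funext => x; rewrite emode_shift.
have -> : (fun x => g (x + t) * emode r l (x + t)) =
    (fun x => emode r l t * (gs t x * emode r l x)).
  by apply/funext => x; rewrite emode_shift mulrCA.
rewrite (clZ r0 _ (circle_funM (gsC t) lC).1) (clZ r0 _ mC.1) dotZl dotZr.
rewrite /G /mode !exp_modeE (amul_cl r0 (gsC t).1 lC.1) (amul_cl r0 gC.1 lC.1) => <-.
rewrite !mulrA !emodeE -expiN -!expiD (_ : _ + _ = 0) ?expi0 ?mul1r //.
by rewrite /W /=; ring.
Qed.

Let prs (s s' : seq int) := [seq (l, m) | l <- s, m <- s'].

Let dot_amul_psum (h : R -> R[i]) a b s s' : CX [set: R] h ->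
  dot LL (amul h (psum e a s)) (psum e b s') =
  \sum_(p <- prs s s') a p.1 * conjc (b p.2) * dot LL (amul h (e p.1)) (e p.2).
Proof.
move=> hc; rewrite /prs big_allpairs /psum amul_sum // dot_suml; apply: eq_bigr => l _.
by rewrite dot_sumr; apply: eq_bigr => m _; rewrite dotZl dotZr mulrA.
Qed.

(** The sesquilinear form of the commutator on finite combinations of exponentials ([KE]), and up to
    the factor i the derivative at 0 of the form of [gs t] ([PhiE]). *)
Let K a b s s' := \sum_(p <- prs s s')
  a p.1 * conjc (b p.2) * G p.1 p.2 * ((W p)%:C)%C.

Let PhiE a b s s' t : dot LL (amul (gs t) (psum e a s)) (psum e b s') =
  \sum_(p <- prs s s') a p.1 * conjc (b p.2) * G p.1 p.2 * expi (W p * t).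
Proof.
rewrite dot_amul_psum; last exact: (gsC t).1.
by apply: eq_bigr => -[l m] _; rewrite G_shift mulrCA mulrA /=; ring.
Qed.

Let vnorm_rot a s (u : int -> R[i]) : uniq s -> (forall l, cmod (u l) = 1) ->
  vnorm (psum e (fun l => a l * u l) s) = vnorm (psum e a s).
Proof.
move=> us u1; apply: eq_of_sqr; [exact: vnorm_ge0|exact: vnorm_ge0|].
rewrite (vnorm_psum e_on (fun l => a l * u l) us) (vnorm_psum e_on a us); apply: eq_bigr => l _.
by rewrite cmodM u1 mulr1.
Qed.

Let gs0 : gs 0 = g.
Proof. by apply/funext => x; rewrite /gs addr0. Qed.

Let dot_diff t x y : dot LL (amul (fun x => gs t x - g x) x) y =
  dot LL (amul (gs t) x) y - dot LL (amul g x) y.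
Proof.
rewrite (_ : (fun x => gs t x - g x) = (fun x => (-1) * g x + gs t x)); last first.
  by apply/funext => z; rewrite mulN1r addrC.
by rewrite amul_linl //; [rewrite scaleN1r dotDl dotNl addrC|exact: gC.1|exact: (gsC t).1].
Qed.

Let K_lip (L : R) : 0 <= L -> (forall x y, cmod (g x - g y) <= L * `|x - y|) ->
  forall a b s s', cmod (K a b s s') <= L * vnorm (psum e a s) * vnorm (psum e b s').
Proof.
move=> L0 gL a b s s'; apply: trig_sum_derivative.
  by rewrite !mulr_ge0 ?vnorm_ge0.
move=> t; rewrite -!PhiE gs0 -dot_diff (le_trans (cauchy_schwarz _ _)) //.
rewrite mulrAC ler_wpM2r ?vnorm_ge0 // mulrAC.
apply: amul_norm => //; [exact: (circle_funB (gsC t) gC).1|by rewrite mulr_ge0|].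
by move=> x; rewrite (le_trans (gL _ _)) // (_ : x + t - x = t) //; ring.
Qed.

(** Since a translation only rotates coefficients, the hypothesis bounds the derivative of the form
    of [gs t] at every [t]. Integrated, it bounds multiplication by the function [h], the increment
    [gs t - g], by [M |t|]; vectors concentrated at [x] then bound the value [h x]. *)
Let lip_K (M : R) : 0 <= M -> (forall a b s s', uniq s -> uniq s' ->
    cmod (K a b s s') <= M * vnorm (psum e a s) * vnorm (psum e b s')) ->
  forall x t, cmod (g (x + t) - g x) <= M * `|t|.
Proof.
move=> M0 KM x t.
have dM a b s s' : uniq s -> uniq s' ->
    cmod (dot LL (amul (fun x => gs t x - g x) (psum e a s)) (psum e b s')) <=
    M * vnorm (psum e a s) * vnorm (psum e b s') * `|t|.
  move=> us us'; rewrite dot_diff -{1}gs0 !PhiE; apply: trig_sum_mvt => {}t.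
  have rot m : cmod (conjc (emode r m t)) = 1 by rewrite cmodJ cmod_emode.
  have := KM (fun l => a l * conjc (emode r l t)) (fun l => b l * conjc (emode r l t)) s s' us us'.
  rewrite !vnorm_rot //; congr (_ <= _); congr cmod; apply: eq_bigr => -[l m] _.
  rewrite -[(l, m).1]/l -[(l, m).2]/m !conjcM !conjcK.
  have -> : expi (W (l, m) * t) = conjc (emode r l t) * emode r m t.
    by rewrite !emodeE -expiN -expiD /W /=; congr expi; ring.
  by ring.
set h := (fun x => gs t x - g x) in dM.
have hC : circle_fun r h by exact: circle_funB.
have nM a s : uniq s -> vnorm (amul h (psum e a s) : LL) <= M * `|t| * vnorm (psum e a s).
  move=> us; apply: (vnorm_le_sumsq e_on (arc_complete r0) (arc_total r0)).
    by rewrite !mulr_ge0 ?vnorm_ge0.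
  (* [q] is a truncation of the image [y], so [<y, q> = |q|^2], and the bound of the form at [q]
     becomes a bound of [|q|]. *)
  move=> s' us'; set y := amul h _; set q := psum e (coord e y) s'.
  have qE : vnorm q ^+ 2 = sumsq (coord e y) s' by rewrite (vnorm_psum e_on).
  have := dM a (coord e y) s s' us us'; rewrite -/y -/q.
  have -> : dot LL y q = ((vnorm q ^+ 2)%:C)%C.
    rewrite qE dotC /q dot_psum -[RHS]conjc_real; congr conjc; rewrite /sumsq rmorph_sum.
    by apply: eq_bigr => l _; rewrite mulJc.
  rewrite cmod_real ger0_norm ?sqr_ge0 // -qE => h2.
  move: h2 (vnorm_ge0 q) (vnorm_ge0 (psum e a s)); set q1 := vnorm q.
  set p1 := vnorm (psum _ a s) => h2 q10 p10; apply: le_of_sqr_le => //.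
    by rewrite !mulr_ge0.
  rewrite (_ : M * `|t| * p1 * q1 = M * p1 * q1 * `|t|) //.
  by clearbody p1 q1; ring.
rewrite -/(h x); apply/ler_addgt0Pr => d d0; set M' := M * `|t|.
have M'0 : 0 <= M' by rewrite mulr_ge0.
pose z0 := emode r 1 x; pose w y := emode r 1 y - z0.
have zz : z0 * conjc z0 = 1 by exact: expi_mulJ.
have z1 : cmod z0 = 1 by exact: cmod_emode.
have wC : circle_fun r w.
  by apply: circle_funB; [exact: emode_circle|exact: circle_fun_cst].
(* V n concentrates at x as n grows *)
pose V n := psum e (fun l => conjc z0 ^+ absz l) [seq k%:Z | k <- iota 0 n].
have Vu n : uniq [seq k%:Z | k <- iota 0 n].
  by rewrite map_inj_uniq ?iota_uniq // => i j [].
have VS n : V n.+1 = V n + conjc z0 ^+ n *: e n%:Z.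
  by rewrite /V /psum -addn1 iotaD map_cat big_cat big_seq1.
have Vn n : vnorm (V n) ^+ 2 = n%:R.
  rewrite (vnorm_psum e_on) // /sumsq big_map (eq_bigr (fun=> 1)) => [|k _].
    by rewrite big_const_seq count_predT size_iota iter_addr_0.
  by rewrite cmodX cmodJ z1 !expr1n.
have we (n : nat) : (amul w (e n%:Z) : LL) = e (n%:Z + 1) - z0 *: e n%:Z.
  have nC := emode_circle r0 n; have n1C := emode_circle r0 (n%:Z + 1).
  rewrite /mode !exp_modeE (amul_cl r0 wC.1 nC.1) -(clZ r0 _ nC.1).
  rewrite -(clB r0 n1C.1 (circle_funM (circle_fun_cst r z0) nC).1); congr cl.
  by apply/funext => y; rewrite /w emodeD mulrBl [emode r 1 y * _]mulrC.
(* [w V_n] telescopes: its norm stays at most 2 while [|V_n|^2 = n]. *)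
have wV (n : nat) : (amul w (V n) : LL) = z0 *: (conjc z0 ^+ n *: e n%:Z - e 0).
  elim: n => [|n IH].
    rewrite expr0 scale1r subrr scaler0 /V /psum big_nil.
    by have := amul_sum [::] (fun=> 0) (fun i : int => e i) wC.1; rewrite !big_nil.
  have := amul_lin r0 (conjc z0 ^+ n) (e n%:Z) (V n) wC.1.
  rewrite [_ *: _ + _]addrC -VS => ->; rewrite we IH.
  rewrite (_ : (n%:Z + 1 = n.+1%:Z)); last by rewrite -[n.+1]addn1 PoszD.
  rewrite !scalerBr !scalerA exprS.
  rewrite [z0 * (_ * _)]mulrA zz mul1r [z0 * conjc z0 ^+ n]mulrC.
  by rewrite addrA subrK.
have d2 : 0 < d / 2 by rewrite divr_gt0.
have [C C0 hm] := periodic_modulus r0 hC.1 hC.2 d2.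
pose k y := h y - h x.
have kC : circle_fun r k by apply: circle_funB => //; exact: circle_fun_cst.
(* The modulus of continuity [d / 2 + C |w|^2] is made linear with [|w| <= 2] and then squared, to
   be compared with norms of [w V_n]. *)
have kw y : cmod (k y) ^+ 2 <= d ^+ 2 / 2 + 8 * C ^+ 2 * cmod (w y) ^+ 2.
  have w2 : cmod (w y) <= 2 by rewrite (le_trans (cmodD _ _)) // cmodN cmod_emode z1.
  have kb : cmod (k y) <= d / 2 + 2 * C * cmod (w y).
    rewrite (le_trans (hm x y)) // lerD2l.
    have -> : cmod (expi (y / r) - expi (x / r)) = cmod (w y).
      by rewrite /w /z0 /emode mul1r mul1r.
    by rewrite [2 * C]mulrC -mulrA ler_wpM2l // expr2 ler_wpM2r ?cmod_ge0.
  by apply: two_term_sqr => //; rewrite ?cmod_ge0 // ltW.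
(* [8 C^2 |w V_n|^2 <= 32 C^2] has to be at most half of [d^2 n]. *)
have [n n0 nb] : exists2 n : nat, (0 < n)%N & 64 * C ^+ 2 <= d ^+ 2 * n%:R.
  exists (Num.truncn (64 * C ^+ 2 / d ^+ 2)).+1 => //.
  by rewrite [leRHS]mulrC -ler_pdivrMr ?exprn_gt0 // ltW // truncnS_gt.
have Vpos : 0 < vnorm (V n).
  by rewrite lt_def vnorm_ge0 andbT -sqrf_eq0 Vn pnatr_eq0 -lt0n.
have wVn : vnorm (amul w (V n) : LL) <= 2.
  rewrite wV vnormZ z1 mul1r (le_trans (vnorm_triB _ 0 _)) // subr0 sub0r vnormN vnormZ.
  by rewrite cmodX cmodJ z1 expr1n mul1r !(vnorm_on e_on).
have kVn : vnorm (amul k (V n) : LL) <= d * vnorm (V n).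
  apply: (le_of_sqr (mulr_ge0 (ltW d0) (vnorm_ge0 _))); rewrite exprMn [X in _ <= _ * X](Vn n).
  apply: (le_trans (@amul_bound _ _ r0 _ _ (V n) _ _ kC.1 wC.1 _ _ kw)).
  - by rewrite divr_ge0 ?sqr_ge0.
  - by rewrite mulr_ge0 ?sqr_ge0.
  have : vnorm (amul w (V n) : LL) ^+ 2 <= 4.
    by rewrite (_ : 4 = 2 ^+ 2); [rewrite ler_pXn2r ?nnegrE ?vnorm_ge0|ring].
  move=> q4; rewrite [X in _ * X + _](Vn n); exact: (four_term_le (sqr_ge0 C) q4 nb).
rewrite -(ler_pM2r Vpos) -vnormZ.
have -> : h x *: V n = amul h (V n) - amul k (V n).
  have := amul_linl r0 (-1) (V n) kC.1 hC.1; rewrite scaleN1r [- _ + _]addrC => <-.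
  have := amul_linl r0 (h x) (V n) (@CX_cst _ _ _ 1) (@CX_cst _ _ _ 0).
  have z0' : amul (fun=> 0) (V n) = 0.
    have := amul_linl r0 (-1) (V n) (@CX_cst _ _ _ 0) (@CX_cst _ _ _ 0).
    by rewrite scaleN1r addNr => <-; congr amul; apply/funext => y; rewrite mulr0 addr0.
  rewrite (amul1 r0) z0' [X in _ = X -> _]addr0 => <-; congr amul; apply/funext => y.
  by rewrite /k mulr1 addr0 mulN1r opprB subrK.
rewrite (le_trans (vnorm_triB _ 0 _)) // subr0 sub0r vnormN mulrDl lerD //.
exact: nM.
Qed.

Let coord_amul a s m : coord e (amul g (psum e a s)) m = \sum_(l <- s) a l * G l m.
Proof.
by rewrite /coord /psum (amul_sum _ _ _ gC.1) dot_suml; apply: eq_bigr => l _; rewrite dotZl.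
Qed.

Let dot_psumr y b s : dot LL y (psum e b s) = \sum_(m <- s) conjc (b m) * coord e y m.
Proof. by rewrite /psum dot_sumr; apply: eq_bigr => m _; rewrite dotZr. Qed.

Let KE a b s s' : K a b s s' = \sum_(m <- s') conjc (b m) *
  (((lam m)%:C)%C * coord e (amul g (psum e a s)) m -
   coord e (amul g (psum e (fun l => ((lam l)%:C)%C * a l) s)) m).
Proof.
rewrite /K /prs big_allpairs exchange_big; apply: eq_bigr => m _.
rewrite !coord_amul mulr_sumr -sumrB mulr_sumr; apply: eq_bigr => l _.
rewrite -[(l, m).1]/l -[(l, m).2]/m.
have -> : ((W (l, m))%:C)%C = ((lam m)%:C)%C - ((lam l)%:C)%C :> R[i].
  by rewrite -real_complexB; congr (_%:C)%C; rewrite /W /lam /=; ring.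
by ring.
Qed.

Lemma commutator_lipschitz (M : R) : 0 <= M ->
  (forall xi eta : LL, (forall l, coord e eta l = ((lam l)%:C)%C * coord e xi l) ->
     exists2 zeta : LL, (forall l, coord e zeta l = ((lam l)%:C)%C * coord e (amul g xi) l)
       & vnorm (zeta - amul g eta) <= M * vnorm xi) ->
  forall x t, cmod (g (x + t) - g x) <= M * `|t|.
Proof.
move=> M0 h; apply: lip_K => // a b s s' us us'.
have [|zeta zE zM] := h (psum e a s) (psum e (fun l => ((lam l)%:C)%C * a l) s).
  move=> l; rewrite !(coord_psum e_on _ _ us).
  by case: ifP => _ //; rewrite mulr0.
rewrite KE (_ : \sum_(m <- s') _ = dot LL (zeta - amul g (psum e (fun l => ((lam l)%:C)%C * a l) s))
    (psum e b s')).
  apply: (le_trans (cauchy_schwarz _ _)).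
  exact: (ler_wpM2r (vnorm_ge0 _) zM).
by rewrite dot_psumr; apply: eq_bigr => m _; rewrite coordB zE.
Qed.

Let telescope (l x x1 y y1 : R[i]) : l * x1 - y1 + (l * (x - x1) - (y - y1)) = l * x - y.
Proof. by ring. Qed.

Let sumD (s : seq int) (F H : int -> R[i]) :
  \sum_(m <- s) F m + \sum_(m <- s) H m = \sum_(m <- s) (F m + H m).
Proof. by rewrite big_split. Qed.

(** The formal coordinates [d m] of the commutator applied to [xi] must be square summable with norm
    at most [L |xi|]. On finite combinations this is [K_lip]; in general [xi] and [eta = D xi] are
    truncated to one finite set, and for finitely many output coordinates the error is
    negligible. *)
Lemma lipschitz_commutator (L : R) : 0 <= L ->
  (forall x y, cmod (g x - g y) <= L * `|x - y|) ->
  forall xi eta : LL, (forall l, coord e eta l = ((lam l)%:C)%C * coord e xi l) ->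
  exists2 zeta : LL, (forall l, coord e zeta l = ((lam l)%:C)%C * coord e (amul g xi) l)
    & vnorm (zeta - amul g eta) <= L * vnorm xi.
Proof.
move=> L0 gL xi eta De.
have [C C0 gbd] := circle_fun_bounded r0 gC.
have cb (x : LL) m : cmod (coord e (amul g x) m) <= C * vnorm x.
  apply: (le_trans (cauchy_schwarz _ _)); rewrite (vnorm_on e_on) mulr1.
  exact: (amul_norm r0 x gC.1 C0 gbd).
have cB (x y : LL) m : coord e (amul g (x - y)) m = coord e (amul g x) m - coord e (amul g y) m.
  have := amul_lin r0 (-1) y x gC.1; rewrite scaleN1r addrC => ->.
  by rewrite scaleN1r addrC coordB.
pose d m := ((lam m)%:C)%C * coord e (amul g xi) m - coord e (amul g eta) m.
have dS s' : uniq s' -> sumsq d s' <= (L * vnorm xi) ^+ 2.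
  move=> us'; set q := psum e d s'.
  have qE : vnorm q ^+ 2 = sumsq d s' by rewrite (vnorm_psum e_on).
  suff : vnorm q ^+ 2 <= L * vnorm xi * vnorm q.
    move: (vnorm_ge0 q) (vnorm_ge0 xi); rewrite -qE; set q1 := vnorm q; set x1 := vnorm xi.
    by move=> q10 x10; apply: le_of_sqr_le => //; exact: mulr_ge0.
  (* [B] is the cost of an error 1 in both [xi] and [eta], seen through the output coordinates in
     [s']. As [lam] is unbounded, [s'] has to be fixed before the truncation. *)
  pose B := \sum_(m <- s') cmod (d m) * (`|lam m| * C + C).
  have B0 : 0 <= B.
    by apply: sumr_ge0 => m _; rewrite mulr_ge0 ?cmod_ge0 // addr_ge0 // mulr_ge0.
  apply/ler_addgt0Pr => e0 e00; pose e1 := e0 / (B + 1).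
  have e10 : 0 < e1 by rewrite divr_gt0 // ltr_wpDl.
  have [s1 us1 h1] := coord_approx e_on (arc_complete r0) (arc_total r0) xi e10.
  have [s2 us2 h2] := coord_approx e_on (arc_complete r0) (arc_total r0) eta e10.
  pose s := undup (s1 ++ s2).
  have us : uniq s by exact: undup_uniq.
  have {h1} h1 : vnorm (xi - psum e (coord e xi) s) < e1.
    by apply: h1 => // l ls; rewrite mem_undup mem_cat ls.
  have {h2} h2 : vnorm (eta - psum e (coord e eta) s) < e1.
    by apply: h2 => // l ls; rewrite mem_undup mem_cat ls orbT.
  have etaE : psum e (fun l => ((lam l)%:C)%C * coord e xi l) s = psum e (coord e eta) s.
    by apply: eq_bigr => l _; rewrite De.
  have xile : vnorm (psum e (coord e xi) s) <= vnorm xi.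
    by apply: le_of_sqr; [exact: vnorm_ge0|rewrite (vnorm_psum e_on _ us); exact: bessel].
  have qK : ((vnorm q ^+ 2)%:C)%C = K (coord e xi) d s s' +
     \sum_(m <- s') conjc (d m) * (((lam m)%:C)%C * coord e (amul g (xi - psum e (coord e xi) s)) m
       - coord e (amul g (eta - psum e (coord e eta) s)) m).
    rewrite KE etaE sumD qE /sumsq rmorph_sum; apply: eq_bigr => m _.
    rewrite (cB xi _ m) (cB eta _ m) -mulrDr telescope -[X in _ = _ * X]/(d m) [RHS]mulrC.
    exact: (esym (mulJc (d m))).
  rewrite -[X in X <= _]ger0_norm ?sqr_ge0 // -cmod_real qK.
  rewrite (le_trans (cmodD _ _)) // lerD //.
    apply: (le_trans (K_lip L0 gL _ _ _ _)).
    by rewrite ler_wpM2r ?vnorm_ge0 // ler_wpM2l.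
  apply: (@le_trans _ _ (B * e1)).
    rewrite (le_trans (cmod_sum _ _ _)) // mulr_suml; apply: ler_sum => m _.
    rewrite cmodM cmodJ -mulrA ler_wpM2l ?cmod_ge0 //.
    rewrite (le_trans (cmodD _ _)) // cmodN mulrDl lerD //.
      rewrite cmodM cmod_real -mulrA; apply: (ler_wpM2l (normr_ge0 _)).
      apply: (le_trans (cb _ _)).
      exact: (ler_wpM2l C0 (ltW h1)).
    apply: (le_trans (cb _ _)); exact: (ler_wpM2l C0 (ltW h2)).
  rewrite /e1 mulrCA -[leRHS]mulr1 ler_pM2l // ler_pdivrMr ?mul1r ?lerDl //.
  by rewrite ltr_wpDl.
have [y [yc yle _]] := riesz_fischer e_on (arc_complete r0) dS.
exists ((amul g eta : LL) + y).
  by move=> l; rewrite coordD yc /d addrC subrK.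
rewrite [_ + y]addrC addrK; apply: le_of_sqr yle.
by rewrite mulr_ge0 ?vnorm_ge0.
Qed.

End fixed_function.
End circle_commutator.

(** * Toeplitz operators on the circle *)

Section neumann.
Variables (R : realType) (H : preHilbert R) (S : set H) (A : H -> H) (q : R).
Hypotheses (Hc : hilbert_complete H) (S0 : S 0) (SD : forall x y, S x -> S y -> S (x + y))
  (S_closed : forall x, (forall e : R, 0 < e -> exists2 y, S y & vnorm (x - y) < e) -> S x)
  (AS : forall x, S x -> S (A x)) (AB : forall x y, A x - A y = A (x - y))
  (q1 : 0 <= q < 1) (Aq : forall x, vnorm (A x) <= q * vnorm x).

Lemma neumann_le x : (1 - q) * vnorm x <= vnorm (x - A x).
Proof. by have := ler_vnormB x (A x); have := Aq x; lra. Qed.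

(** The iteration [u (n + 1) = y + A (u n)] stays in [S], contracts by [q], and has its limit in [S]
    because [S] is closed. *)
Lemma neumann y : S y -> exists2 x, S x & x - A x = y.
Proof.
move=> Sy; have /andP[q0 q_lt1] := q1; have q1' : 0 < 1 - q by rewrite subr_gt0.
pose u := fix u n := if n is n'.+1 then y + A (u n') else 0.
have uS n : S (u n) by elim: n => //= n IH; apply: SD => //; exact: AS.
pose B := vnorm y / (1 - q).
have B0 : 0 <= B by rewrite divr_ge0 ?vnorm_ge0 ?ltW.
have uB n : vnorm (u n) <= B.
  elim: n => [|n IH]; first by rewrite vnorm0.
  rewrite (le_trans (vnormD _ _)) // -[leRHS](subrK (q * B)) lerD //.
    by rewrite -[X in _ <= X - _]mul1r -mulrBl /B mulrCA divff ?mulr1 // gt_eqF.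
  by rewrite (le_trans (Aq _)) // ler_wpM2l.
have uk n k : vnorm (u (n + k)%N - u n) <= q ^+ n * B.
  elim: n => [|n IH]; first by rewrite expr0 mul1r add0n subr0.
  rewrite addSn /= opprD addrACA subrr add0r AB (le_trans (Aq _)) // exprS -mulrA.
  by rewrite ler_wpM2l.
have qn (e : R) : 0 < e -> exists N, forall n, (N <= n)%N -> q ^+ n * B < e.
  move=> e0; have e0' : 0 < e / (B + 1) by rewrite divr_gt0 // ltr_wpDl.
  have : `|q| < 1 by rewrite ger0_norm.
  move=> /cvg_expr /cvgrPdist_lt /(_ _ e0')[N _ hN]; exists N => n /hN.
  rewrite /= sub0r normrN ger0_norm ?exprn_ge0 // ltr_pdivlMr ?ltr_wpDl // => h.
  by rewrite (le_lt_trans _ h) // ler_wpM2l ?exprn_ge0 // lerDl.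
have [x ux] : exists l, vnorm (u n - l) @[n --> \oo] --> (0 : R).
  apply: Hc => e e0; have [N hN] := qn _ e0; exists N => m n Nm Nn.
  wlog mn : m n Nm Nn / (n <= m)%N.
    move=> W; have [/W|/ltnW/W] := leqP n m; first exact.
    by rewrite -vnormN opprB; apply.
  by rewrite -(subnKC mn) (le_lt_trans (uk _ _)) // hN.
have ux' (e : R) : 0 < e -> exists n, vnorm (u n - x) < e /\ vnorm (u n.+1 - x) < e.
  move=> e0; move/cvgrPdist_lt : ux => /(_ _ e0)[N _ hN]; exists N.
  by split; [have := hN N|have := hN N.+1]; rewrite /= sub0r normrN ger0_norm ?vnorm_ge0 //;
    apply; rewrite //= leqnSn.
exists x.
  by apply: S_closed => e /ux'[n [h _]]; exists (u n) => //; rewrite -vnormN opprB.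
apply/eqP; rewrite -subr_eq0; apply/eqP/vnorm_le0 => e e0.
have [n [h1 h2]] := ux' _ (divr_gt0 e0 (ltr0Sn R 1)).
have -> : x - A x - y = (x - u n.+1) + (A (u n) - A x).
  by rewrite /= opprD !addrA subrK addrAC.
rewrite AB (le_trans (vnormD _ _)) // (splitr e) lerD //.
  by rewrite -vnormN opprB ltW.
rewrite (le_trans (Aq _)) // -[leRHS]mul1r ler_pM ?vnorm_ge0 //; exact: ltW.
Qed.

End neumann.

Section toeplitz_circle.
Variables (R : realType) (r : R).
Hypothesis r0 : 0 < r.
Local Notation mu := (arc_measure r).
Local Notation LL := (L2 mu).
Local Notation e := (mode r).

Lemma mode_on k l : dot LL (e k) (e l) = (k == l)%:R.
Proof. exact: exp_mode_orthonormal. Qed.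

Lemma mode_total (x : LL) : (forall l, coord e x l = 0) -> x = 0.
Proof. exact: arc_total. Qed.

Definition hardy : set LL := [set x | forall l, l < 0 -> coord e x l = 0].

(** The spectral projection of [D] for [[0, +oo[]. The eigenvalues are [(l + 1/2) / r], so it is the
    projection onto the frequencies [l >= 0] ([circle_lam_ge0]). *)
Definition hproj (x : LL) : LL := spectral_proj e (circle_lam r) `[0, +oo[%classic x.

Lemma circle_lam_ge0 l : (0 <= circle_lam r l) = (0 <= l).
Proof.
rewrite /circle_lam pmulr_lge0 ?invr_gt0 //.
case: l => n; first by rewrite -pmulrn addr_ge0.
have E : (Negz n)%:~R = - (n.+1%:R) :> R by [].
rewrite (_ : (0 <= Negz n) = false) //; apply/negbTE; rewrite -ltNge E -natr1.
by have := ler0n R n; lra.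
Qed.

Lemma hprojE x l : coord e (hproj x) l = if 0 <= l then coord e x l else 0.
Proof.
rewrite /hproj spectral_projE; [|exact: mode_on|exact: arc_complete|exact: mode_total].
rewrite indicE mem_setE in_itv /= andbT circle_lam_ge0.
by case: ifP; rewrite ?mul1r ?mul0r.
Qed.

Lemma coord_eq (x y : LL) : (forall l, coord e x l = coord e y l) -> x = y.
Proof. exact: (coord_inj mode_total). Qed.

Lemma hproj_hardy x : hardy (hproj x).
Proof. by move=> l l0; rewrite hprojE leNgt l0. Qed.

Lemma hproj_id x : hardy x -> hproj x = x.
Proof.
by move=> hx; apply: coord_eq => l; rewrite hprojE; case: leP => // /hx ->.
Qed.

Lemma hproj_lin c x y : hproj (c *: x + y) = c *: hproj x + hproj y.
Proof.
apply: coord_eq => l; rewrite coordD coordZ !hprojE coordD coordZ.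
by case: ifP; rewrite ?mulr0 ?addr0.
Qed.

Lemma hprojB x y : hproj (x - y) = hproj x - hproj y.
Proof. by rewrite -scaleN1r addrC hproj_lin scaleN1r addrC. Qed.

Lemma hproj_le x : vnorm (hproj x) <= vnorm x.
Proof.
rewrite -[leRHS]mul1r; apply: (le_vnorm_coord mode_on (arc_complete r0) mode_total) => // l.
by rewrite mul1r hprojE; case: ifP => // _; rewrite cmod0 cmod_ge0.
Qed.

Lemma hardy0 : hardy 0. Proof. by move=> l _; rewrite /coord dot0l. Qed.

Lemma hardy_lin c x y : hardy x -> hardy y -> hardy (c *: x + y).
Proof. by move=> hx hy l l0; rewrite coordD coordZ hx // hy // mulr0 addr0. Qed.

Lemma hardyD x y : hardy x -> hardy y -> hardy (x + y).
Proof. by move=> hx hy; rewrite -[x]scale1r; exact: hardy_lin. Qed.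

Lemma hardyB x y : hardy x -> hardy y -> hardy (x - y).
Proof. by move=> hx hy; rewrite addrC -scaleN1r; exact: hardy_lin. Qed.

Lemma hardy_mode l : 0 <= l -> hardy (e l).
Proof. by move=> l0 m m0; rewrite /coord mode_on; case: eqVneq => // lm; move: l0; rewrite lm leNgt m0. Qed.

Lemma hardy_closed (x : LL) :
  (forall d : R, 0 < d -> exists2 y : LL, hardy y & vnorm (x - y) < d) -> hardy x.
Proof.
move=> h l l0; apply/eqP; rewrite -cmod_eq0 eq_le cmod_ge0 andbT.
apply/ler_addgt0Pr => d d0; rewrite add0r; have [y hy xy] := h d d0.
rewrite -[coord e x l]subr0 -(hy l l0) -coordB (le_trans (cauchy_schwarz _ _)) //.
by rewrite (vnorm_on mode_on) mulr1 ltW.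
Qed.

Definition htoep g (x : LL) : LL := hproj (amul g x).

Lemma htoepB g x y : circle_fun r g -> htoep g (x - y) = htoep g x - htoep g y.
Proof.
move=> gC; rewrite /htoep -hprojB; congr hproj.
have := amul_lin r0 (-1) y x gC.1; rewrite scaleN1r addrC => ->.
by rewrite scaleN1r addrC.
Qed.

Lemma htoep_hardy g x : hardy (htoep g x). Proof. exact: hproj_hardy. Qed.

(* Multiplication by g compresses to an isomorphism of the Hardy space. *)
Definition toep_inv g (C : R) := [/\ circle_fun r g, 0 <= C,
  forall x, hardy x -> htoep g x = 0 -> x = 0 &
  forall y, hardy y -> exists x, [/\ hardy x, htoep g x = y & vnorm x <= C * vnorm y]].

(** On the Hardy space [T_g = I - A], where [A] is the compression of [1 - g] and has norm at most
    [q]. *)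
Lemma toep_inv_near1 g (q : R) : circle_fun r g -> 0 <= q < 1 ->
  (forall x, cmod (1 - g x) <= q) -> toep_inv g (1 - q)^-1.
Proof.
move=> gC q1 gq; have /andP[q0 q_lt1] := q1.
have oC := circle_fun_cst r (1 : R[i]); have hC := circle_funB oC gC.
pose A := htoep (fun x => 1 - g x).
have A1 x : hardy x -> x - A x = htoep g x.
  move=> hx; rewrite -{1}(hproj_id hx) /A /htoep -hprojB; congr hproj.
  have := amul_linl r0 (-1) x gC.1 oC.1.
  rewrite (_ : (fun y => _) = fun y => 1 - g y); last by apply/funext => y; rewrite mulN1r addrC.
  by move=> ->; rewrite (amul1 r0) scaleN1r opprD opprK addrC subrK.
have Aq (x : LL) : vnorm (A x) <= q * vnorm x.
  by rewrite (le_trans (hproj_le _)) //; exact: (amul_norm r0 x hC.1 q0 gq).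
have q10 : 0 < 1 - q by rewrite subr_gt0.
have low x : hardy x -> vnorm x <= (1 - q)^-1 * vnorm (htoep g x).
  by move=> hx; rewrite mulrC ler_pdivlMr // mulrC -A1 //; exact: neumann_le.
split => //; first by rewrite invr_ge0 ltW.
  move=> x hx Tx; apply: vnorm_eq0; apply/eqP; rewrite eq_le vnorm_ge0 andbT.
  by rewrite (le_trans (low x hx)) // Tx vnorm0 mulr0.
move=> y hy.
have AS (x : LL) : hardy x -> hardy (A x) by move=> _; exact: htoep_hardy.
have AB (x z : LL) : A x - A z = A (x - z) by rewrite -htoepB.
have [x hx xy] := neumann (arc_complete r0) hardy0 hardyD hardy_closed AS AB q1 Aq hy.
by exists x; rewrite -A1 // xy; split => //; rewrite -xy A1 //; exact: low.
Qed.

Lemma amul_cst (c : R[i]) (x : LL) : amul (fun=> c) x = c *: x.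
Proof.
have ae : Filter (nbhs (almost_everywhere mu)) by exact: ae_filter_ringOfSetsType.
apply: L2_eqae; apply: (filterS2 _ _ (amulE r0 x (@CX_cst _ _ _ c)) (reprZ c x)).
by move=> y -> ->.
Qed.

Lemma hprojZ c (x : LL) : hproj (c *: x) = c *: hproj x.
Proof. by apply: coord_eq => l; rewrite coordZ !hprojE coordZ; case: ifP; rewrite ?mulr0. Qed.

Lemma hardyZ c x : hardy x -> hardy (c *: x).
Proof. by move=> hx l l0; rewrite coordZ hx // mulr0. Qed.

Lemma htoepZ c g (x : LL) : circle_fun r g -> htoep (fun x => c * g x) x = c *: htoep g x.
Proof.
move=> gC; have := amulM r0 x (circle_fun_cst r c).1 gC.1.
by rewrite /htoep => ->; rewrite amul_cst hprojZ.
Qed.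

Lemma htoepZr c g (x : LL) : circle_fun r g -> htoep g (c *: x) = c *: htoep g x.
Proof.
move=> gC; have h1 := amulM r0 x gC.1 (circle_fun_cst r c).1.
have h2 := amulM r0 x (circle_fun_cst r c).1 gC.1; rewrite !amul_cst in h1 h2.
have E : amul (fun x => g x * c) x = amul (fun x => c * g x) x.
  by congr amul; apply/funext => y; rewrite mulrC.
have h3 := congr1 hproj (etrans (esym h1) (etrans E h2)).
by rewrite /htoep h3 hprojZ.
Qed.

Lemma dot_hproj (z y : LL) : hardy y -> dot LL (hproj z) y = dot LL z y.
Proof.
move=> hy; apply: (parseval_dot mode_on (arc_complete r0) mode_total) => l.
by rewrite hprojE; case: leP => // /hy ->; rewrite conjc0 !mulr0.
Qed.

Lemma toep_inv_scale g C (c : R[i]) : c != 0 -> toep_inv g C ->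
  toep_inv (fun x => c * g x) (cmod c^-1 * C).
Proof.
move=> c0 [gC C0 gi gs]; split.
- by apply: circle_funM => //; exact: circle_fun_cst.
- by rewrite mulr_ge0 ?cmod_ge0.
- move=> x hx; rewrite htoepZ // => /eqP; rewrite scaler_eq0 (negbTE c0) /= => /eqP.
  exact: gi.
move=> y hy; have [x [hx xy xC]] := gs y hy; exists (c^-1 *: x); split.
- exact: hardyZ.
- by rewrite htoepZ // htoepZr // xy scalerA divff // scale1r.
by rewrite vnormZ -mulrA ler_wpM2l ?cmod_ge0.
Qed.

(* f is analytic: multiplication by f preserves the Hardy space. *)
Let analytic f := forall x : LL, hardy x -> hardy (amul f x).

(** If [f] preserves the Hardy space, nothing is projected away between the factors:
    [T_(g f) = T_g T_f]. *)
Lemma toep_inv_analytic f g C C' : analytic f -> toep_inv f C -> toep_inv g C' ->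
  toep_inv (fun x => g x * f x) (C * C').
Proof.
move=> fa [fC C0 fi fs] [gC C'0 gi gs].
have E x : hardy x -> htoep (fun x => g x * f x) x = htoep g (htoep f x).
  move=> hx; by rewrite /htoep (amulM r0 x gC.1 fC.1) (hproj_id (fa x hx)).
split; [exact: circle_funM|exact: mulr_ge0|move=> x hx|move=> y hy].
  rewrite E // => /(gi _ (htoep_hardy _ _)); exact: fi.
have [z [hz zy zC]] := gs y hy; have [x [hx xz xC]] := fs z hz.
exists x; split; [exact: hx|by rewrite (E x hx) xz|].
by apply: (le_trans xC); rewrite -mulrA; exact: (ler_wpM2l C0 zC).
Qed.

(** The adjoint situation: [T_(f g) = T_f T_g], because multiplication by [f] preserves the
    orthogonal complement of the Hardy space, which is [P0]. *)
Lemma toep_inv_coanalytic f g C C' : analytic (fun x => conjc (f x)) ->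
  toep_inv f C -> toep_inv g C' -> toep_inv (fun x => f x * g x) (C' * C).
Proof.
move=> fa [fC C0 fi fs] [gC C'0 gi gs].
have P0 (z : LL) : hproj z = 0 -> htoep f z = 0.
  move=> z0; apply: coord_eq => l; rewrite hprojE /coord dot0l; case: ifP => // l0.
  rewrite amulJ //; last exact: fC.1.
  by rewrite -(dot_hproj _ (fa _ (hardy_mode l0))) z0 dot0l.
have E x : hardy x -> htoep (fun x => f x * g x) x = htoep f (htoep g x).
  move=> hx; rewrite {1}/htoep (amulM r0 x fC.1 gC.1) -/(htoep f _).
  apply/eqP; rewrite -subr_eq0 -htoepB // P0 //.
  by rewrite hprojB -/(htoep g x) (hproj_id (htoep_hardy g x)) subrr.
split; [exact: circle_funM|exact: mulr_ge0|move=> x hx|move=> y hy].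
  by rewrite E // => /(fi _ (htoep_hardy _ _)); exact: gi.
have [z [hz zy zC]] := fs y hy; have [x [hx xz xC]] := gs z hz.
exists x; split; [exact: hx|by rewrite (E x hx) xz|].
by apply: (le_trans xC); rewrite -mulrA; exact: (ler_wpM2l C'0 zC).
Qed.

Lemma amul_mode k l : amul (emode r k) (e l) = e (k + l).
Proof.
have [kC lC] := (emode_circle r0 k, emode_circle r0 l).
rewrite /mode !exp_modeE (amul_cl r0 kC.1 lC.1); congr cl.
by apply/funext => x; rewrite emodeD.
Qed.

Lemma coord_amul_mode k (x : LL) l : coord e (amul (emode r k) x) l = coord e x (l - k).
Proof.
rewrite /coord (amulJ r0 _ _ (emode_circle r0 k).1).
rewrite (_ : (fun x => conjc (emode r k x)) = emode r (- k)).
  by rewrite amul_mode addrC.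
by apply/funext => y; rewrite emodeN.
Qed.

Lemma hardy_amul_mode k (x : LL) : 0 <= k -> hardy x -> hardy (amul (emode r k) x).
Proof.
move=> k0 hx l l0; rewrite coord_amul_mode hx // (le_lt_trans _ l0) // gerBl //.
Qed.

Let affine b k x := 1 - b * emode r k x.

Let affine_circle b k : circle_fun r (affine b k).
Proof.
apply: circle_funB; first exact: circle_fun_cst.
by apply: circle_funM; [exact: circle_fun_cst|exact: emode_circle].
Qed.

Let amul_affine b k (x : LL) : amul (affine b k) x = x - b *: amul (emode r k) x.
Proof.
have := amul_linl r0 (- b) x (emode_circle r0 k).1 (circle_fun_cst r 1).1.
rewrite (amul1 r0) scaleNr addrC => <-; congr amul; apply/funext => y.
by rewrite /affine mulNr addrC.
Qed.

Let analytic_affine b : analytic (affine b 1).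
Proof.
move=> x hx; rewrite amul_affine; apply: hardyB => //.
by apply: hardyZ; apply: hardy_amul_mode.
Qed.

Let inv_affine b k : cmod b < 1 -> toep_inv (affine b k) (1 - cmod b)^-1.
Proof.
move=> b1; apply: toep_inv_near1.
- exact: affine_circle.
- by rewrite cmod_ge0.
by move=> x; rewrite /affine opprB addrC subrK cmodM cmod_emode mulr1.
Qed.

(** A root [1 / b] outside the disc gives the analytic factor [1 - b z], to be placed on the right;
    a root [b] inside gives the coanalytic [1 - b / z] of the next lemma, on the left. *)
Lemma toep_inv_zero_out b g C : cmod b < 1 -> toep_inv g C ->
  exists C', toep_inv (fun x => g x * (1 - b * emode r 1 x)) C'.
Proof.
by move=> b1 gQ; eexists; exact: (toep_inv_analytic (@analytic_affine b) (inv_affine 1 b1) gQ).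
Qed.

Lemma toep_inv_zero_in b g C : cmod b < 1 -> toep_inv g C ->
  exists C', toep_inv (fun x => (1 - b * emode r (- 1) x) * g x) C'.
Proof.
move=> b1 gQ; eexists; apply: (toep_inv_coanalytic _ (inv_affine (- 1) b1) gQ).
rewrite (_ : (fun x => _) = affine (conjc b) 1); first exact: analytic_affine.
by apply/funext => x; rewrite /affine conjcB conjcM conjc1 -emodeN opprK.
Qed.

End toeplitz_circle.

(** * Continuous arguments and factorization of unimodular functions *)

Section logarithm.
Variables (R : realType) (r : R).
Hypothesis r0 : 0 < r.
Local Notation per := (2 * pi * r).
Implicit Types g h k : R -> R[i].

(** Periodicity of [theta] is the point: where [g] has no zeros, it says that the winding number is
    0. *)
Definition has_arg g := exists theta : R -> R, [/\ continuous theta,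
  forall x, theta (x + per) = theta x & forall x, g x = ((cmod (g x))%:C)%C * expi (theta x)].

Lemma polar_atan (z : R[i]) : 0 < Re z ->
  z = ((cmod z)%:C)%C * expi (atan (Im z / Re z)).
Proof.
case: z => a b /= a0; set t := b / a.
have bE : b = a * t by rewrite /t mulrCA divff ?mulr1 ?gt_eqF.
have c0 : 0 < cos (atan t) by rewrite cos_gt0_pihalf ?atan_gtNpi2 ?atan_ltpi2.
have sE : sin (atan t) = t * cos (atan t).
  by rewrite -{2}(atanK t) /tan divfK ?gt_eqF.
have zE : (a +i* b)%C = ((a / cos (atan t))%:C)%C * expi (atan t).
  apply/eqP; rewrite eq_complex; apply/andP; split; apply/eqP; rewrite /=.
    by rewrite mul0r subr0 divfK ?gt_eqF.
  by rewrite mul0r addr0 sE mulrCA divfK ?gt_eqF // mulrC.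
rewrite {1}zE; congr (_%:C%C * _).
by rewrite zE cmodM cmod_expi mulr1 cmod_real ger0_norm // divr_ge0 ?ltW.
Qed.

Lemma polar (z : R[i]) : exists t, z = ((cmod z)%:C)%C * expi t.
Proof.
have [z0|z0|z0] := ltgtP 0 (Re z).
- by exists (atan (Im z / Re z)); exact: polar_atan.
- exists (atan (Im (- z) / Re (- z)) + pi).
  have {}z0 : 0 < Re (- z) by case: z z0 => a b /=; rewrite oppr_gt0.
  rewrite -cmodN expiD mulrA -(polar_atan z0) /expi cospi sinpi.
  by apply/eqP; rewrite eq_complex; case: z {z0} => a b /=; apply/andP; split; apply/eqP; ring.
case: z z0 => a b /= <-; have [b0|b0] := leP 0 b.
  exists (pi / 2); rewrite /expi cos_pihalf sin_pihalf cmod_sqrt /= expr0n add0r sqrtr_sqr.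
  by rewrite ger0_norm //; apply/eqP; rewrite eq_complex /=; apply/andP; split; apply/eqP; ring.
exists (- (pi / 2)); rewrite /expi cosN sinN cos_pihalf sin_pihalf.
rewrite cmod_sqrt /= expr0n add0r sqrtr_sqr ltr0_norm //.
by apply/eqP; rewrite eq_complex /=; apply/andP; split; apply/eqP; ring.
Qed.

Lemma has_arg_cst (c : R[i]) : has_arg (fun=> c).
Proof. by have [t cE] := polar c; exists (fun=> t); split => // x; exact: cvg_cst. Qed.

Lemma has_argM g h : has_arg g -> has_arg h -> has_arg (fun x => g x * h x).
Proof.
move=> [t [tc tp tE]] [u [uc up uE]]; exists (fun x => t x + u x); split.
- by move=> x; apply: cvgD; [exact: tc|exact: uc].
- by move=> x; rewrite tp up.
by move=> x; rewrite cmodM real_complexM expiD {1}tE {1}uE mulrACA.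
Qed.

Lemma has_arg_right g : circle_fun r g -> (forall x, 0 < Re (g x)) -> has_arg g.
Proof.
move=> [gc gp] g0; exists (fun x => atan (Im (g x) / Re (g x))); split.
- move=> x; apply: (@continuous_comp _ _ _ (fun x => Im (g x) / Re (g x))).
    apply: cvgM; first exact: CXT_Im.
    by apply: cvgV; [rewrite gt_eqF|exact: CXT_Re].
  exact: continuous_atan.
- by move=> x; rewrite gp.
by move=> x; exact: polar_atan.
Qed.

Lemma has_arg_near1 g (q : R) : circle_fun r g -> q < 1 ->
  (forall x, cmod (1 - g x) <= q) -> has_arg g.
Proof.
move=> gC q1 gq; apply: has_arg_right => // x.
have := le_trans (Re_le_cmod (1 - g x)) (gq x); rewrite ler_norml => /andP[_].
by case: (g x) => a b /=; lra.
Qed.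

Lemma circle_funV g : circle_fun r g -> (forall x, g x != 0) ->
  circle_fun r (fun x => (g x)^-1).
Proof.
move=> gC g0.
have -> : (fun x => (g x)^-1) = (fun x => (((cmod (g x) ^+ 2)^-1)%:C)%C * conjc (g x)).
  apply/funext => x; apply: (mulfI (g0 x)); rewrite divff // mulrCA mulJc -real_complexM.
  by rewrite mulVf // expf_eq0 /= cmod_eq0.
apply: circle_funM; last exact: circle_funJ.
split; last by move=> x; rewrite gC.2.
have sc : continuous (fun x => cmod (g x) ^+ 2).
  have -> : (fun x => cmod (g x) ^+ 2) = (fun x => Re (g x) * Re (g x) + Im (g x) * Im (g x)).
    by apply/funext => x; rewrite cmod_sqr !expr2.
  move=> x; apply: cvgD.
    by apply: cvgM; exact: (CXT_Re gC.1).
  by apply: cvgM; exact: (CXT_Im gC.1).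
apply: CXT_ReIm => x /=; last exact: cvg_cst.
by apply: cvgV; [rewrite expf_eq0 /= cmod_eq0|exact: sc].
Qed.

Local Notation e1 := (emode r 1).

(** The condition for the index and the one for the winding number are kept together, so that both
    can be read off from one factorization. *)
Definition toep_good g := (exists C, toep_inv r g C) /\ has_arg g.

Lemma toep_good_near1 g (q : R) : circle_fun r g -> 0 <= q < 1 ->
  (forall x, cmod (1 - g x) <= q) -> toep_good g.
Proof.
move=> gC q1 gq; split; first by eexists; exact: (toep_inv_near1 r0 gC q1 gq).
by apply: (has_arg_near1 gC _ gq); case/andP: q1.
Qed.

Lemma toep_goodZ c g : c != 0 -> toep_good g -> toep_good (fun x => c * g x).
Proof.
move=> c0 [[C gQ] ga]; split; first by eexists; exact: (toep_inv_scale r0 c0 gQ).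
by apply: has_argM => //; exact: has_arg_cst.
Qed.

Let has_arg_affine (b : R[i]) (m : int) : cmod b < 1 ->
  has_arg (fun x => 1 - b * emode r m x).
Proof.
move=> b1; apply: (has_arg_near1 _ b1) => [|x].
  apply: circle_funB; first exact: circle_fun_cst.
  by apply: circle_funM; [exact: circle_fun_cst|exact: emode_circle].
by rewrite opprB addrC subrK cmodM cmod_emode mulr1.
Qed.

(** [w] counts the roots inside the disc: [z - b = z (1 - b / z)] for these, and
    [z - b = - b (1 - z / b)] for the others. The factors are absorbed into [k] one at a time, each
    on the side on which its Toeplitz operator multiplies. *)
Lemma factor_roots (s : seq R[i]) k : (forall z, z \in s -> cmod z != 1) -> toep_good k ->
  exists (w : nat) h, toep_good h /\
    forall x, k x * \prod_(z <- s) (e1 x - z) = emode r w x * h x.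
Proof.
elim: s k => [|z s IH] k s1 kg.
  by exists 0%N, k; split => // x; rewrite big_nil emode0 mulr1 mul1r.
have s1' y : y \in s -> cmod y != 1 by move=> ys; apply: s1; rewrite inE ys orbT.
have [kQ ka] := kg; case: kQ => C kQ.
have := s1 z; rewrite inE eqxx => /(_ isT); rewrite neq_lt => /orP[z1|z1].
  have [C' hQ] := toep_inv_zero_in r0 z1 kQ.
  have [|w [h [hg hE]]] := IH (fun x => (1 - z * emode r (- 1) x) * k x) s1'.
    by split; [exists C'|apply: has_argM => //; exact: has_arg_affine].
  exists w.+1, h; split => // x; rewrite big_cons -[w.+1]addn1 PoszD emodeD mulrAC -hE.
  have e1' : e1 x * emode r (- 1) x = 1 by rewrite emodeN expi_mulJ.
  rewrite -[X in (X - z)]mulr1.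
  rewrite (_ : e1 x * 1 - z = e1 x * (1 - z * emode r (- 1) x)).
    by ring.
  by rewrite mulrBr mulrCA e1' !mulr1.
have z0 : z != 0 by rewrite -cmod_eq0 gt_eqF // (lt_trans ltr01).
have zi : cmod z^-1 < 1 by rewrite cmodV invf_lt1 // (lt_trans ltr01).
have [C' hQ] := toep_inv_zero_out r0 zi kQ.
have [|w [h [hg hE]]] := IH (fun x => - z * (k x * (1 - z^-1 * e1 x))) s1'.
  apply: toep_goodZ; first by rewrite oppr_eq0.
  by split; [exists C'|apply: has_argM => //; exact: has_arg_affine].
exists w, h; split => // x; rewrite -hE big_cons.
by field.
Qed.

(* u is close to a trigonometric polynomial, which splits into linear factors in z;
   a root inside the unit disc contributes a factor z and an antianalytic 1 - b zbar, a
   root outside contributes an analytic 1 - z / b. *)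
Lemma circle_factor u : circle_fun r u -> (forall x, cmod (u x) = 1) ->
  exists (w : int) h, toep_good h /\ forall x, u x = emode r w x * h x.
Proof.
move=> uC u1.
(* With error [1/4], [|p| >= 3/4] and [|1 - u / p| <= 1/3], so [u / p] falls under the Neumann
   series. *)
have e40 : 0 < 4^-1 :> R by rewrite invr_gt0.
have [n [q hq]] := trig_weierstrass r0 uC.1 uC.2 e40.
pose p x := emode r (- n%:Z) x * q.[e1 x].
have pE x : p x = expi (- (n%:R * x / r)) * q.[expi (x / r)].
  by rewrite /p /emode mul1r rmorphN /= -pmulrn !mulNr.
have up x : cmod (u x - p x) < 4^-1 by rewrite pE.
have pb x : 3 / 4 <= cmod (p x).
  have : cmod (u x) <= cmod (u x - p x) + cmod (p x) by rewrite -{1}[u x](subrK (p x)) cmodD.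
  by have := up x; rewrite u1; lra.
have p0 x : p x != 0 by rewrite -cmod_eq0 gt_eqF // (lt_le_trans _ (pb x)) // divr_gt0.
have q0 x : q.[e1 x] != 0 by have := p0 x; rewrite /p mulf_eq0 negb_or => /andP[].
have qn0 : q != 0 by apply/eqP => q00; have := q0 0; rewrite q00 horner0 eqxx.
have [s qE] := closed_field_poly_normal q.
have lc0 : lead_coef q != 0 by rewrite lead_coef_eq0.
have qE' x : q.[e1 x] = lead_coef q * \prod_(z <- s) (e1 x - z).
  by rewrite {1}qE hornerZ horner_prod; congr (_ * _); apply: eq_bigr => z _; rewrite hornerXsubC.
(* A root on the circle would be a zero of [p], against its lower bound. *)
have s1 z : z \in s -> cmod z != 1.
  move=> zs; apply/eqP => z1; have [t zE] := polar z; rewrite z1 mul1r in zE.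
  have e1t : e1 (t * r) = z by rewrite zE /emode mul1r mulfK ?gt_eqF.
  by have := q0 (t * r); rewrite qE' (big_rem z zs) /= e1t subrr mul0r mulr0 eqxx.
have pC : circle_fun r p.
  apply: circle_funM; first exact: emode_circle.
  rewrite (_ : (fun x => _) = fun x => \sum_(i <- iota 0 (size q)) q`_i * emode r i x).
    by apply: (circle_fun_sum _ _) => // i; exact: emode_circle.
  apply/funext => x; rewrite horner_coef -(big_mkord xpredT (fun i => q`_i * e1 x ^+ i)).
  rewrite /index_iota subn0; apply: eq_bigr => i _; congr (_ * _).
  by rewrite /emode -expiMn mul1r -pmulrn -mulrA mulr_natl.
pose k x := u x * (p x)^-1.
have kC : circle_fun r k by apply: circle_funM => //; exact: circle_funV.
have kg : toep_good k.
  apply: (@toep_good_near1 k 3^-1) => //.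
    by rewrite invr_ge0 ler0n invf_lt1 // ltr1n.
  move=> x; rewrite -(divff (p0 x)) /k -mulrBl cmodM cmodV.
  rewrite ler_pdivrMr ?(lt_le_trans _ (pb x)) ?divr_gt0 // cmodB.
  by have := pb x; have := up x; lra.
have [w [h [hg hE]]] := factor_roots s1 kg.
exists (w%:Z - n%:Z), (fun x => lead_coef q * h x); split; first exact: toep_goodZ.
move=> x; have -> : u x = k x * p x by rewrite /k mulfVK.
have := hE x; move: (k x) => kx; rewrite /p qE' emodeD.
move: (\prod_(z <- s) _) (emode r w x) (emode r (- n%:Z) x) (h x) (lead_coef q) => P A B hx lc kP.
by transitivity (B * lc * (kx * P)); [ring|rewrite kP; ring].
Qed.

(** The compression of multiplication by [z^w] is a shift: injective with cokernel of dimension [w]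
    if [w >= 0], surjective with kernel of dimension [- w] if [w < 0]. *)
Definition ker_dim (w : int) := if w < 0 then absz w else 0%N.
Definition coker_dim (w : int) := if w < 0 then 0%N else absz w.

Lemma ker_coker_dim w : (ker_dim w)%:Z - (coker_dim w)%:Z = - w.
Proof. by rewrite /ker_dim /coker_dim; case: w => n /=; rewrite ?sub0r ?subr0. Qed.

Local Notation LL := (L2 (arc_measure r)).
Local Notation e := (mode r).

Let sum_mode_coord n (c : 'I_n -> R[i]) l :
  coord e (\sum_j c j *: e (j : nat)%:Z) l = if insub (absz l) is Some j then
    if 0 <= l then c j else 0 else 0.
Proof.
rewrite /coord dot_suml; under eq_bigr do rewrite dotZl (mode_on r0).
case: insubP => [j ln jE|ln].
  case: l jE ln => m /= jE ln; last first.
    by rewrite big1 // => i _; rewrite mulr0.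
  rewrite (bigD1 j) //= jE eqxx mulr1 big1 ?addr0 // => i ij.
  rewrite eqz_nat -jE; case: eqP => [/val_inj ijE|]; last by rewrite mulr0.
  by rewrite ijE eqxx in ij.
rewrite big1 // => i _; case: eqP => [il|]; last by rewrite mulr0.
by rewrite -il /= ltn_ord in ln.
Qed.

Let sum_mode_in n (c : 'I_n -> R[i]) (j : 'I_n) :
  coord e (\sum_j c j *: e (j : nat)%:Z) (j : nat)%:Z = c j.
Proof.
by rewrite sum_mode_coord /=; case: insubP => [i _ /val_inj ->//|]; rewrite ltn_ord.
Qed.

Let sum_mode_out n (c : 'I_n -> R[i]) l : (l < 0) || (n%:Z <= l) ->
  coord e (\sum_j c j *: e (j : nat)%:Z) l = 0.
Proof.
rewrite sum_mode_coord; case: insubP => // j jn _; case: l jn => // m /= mn.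
by rewrite lez_nat leqNgt mn.
Qed.

Let hardy_sum (I : finType) (c : I -> R[i]) (x : I -> LL) :
  (forall i, hardy (x i)) -> hardy (\sum_i c i *: x i).
Proof.
by move=> hx; elim/big_rec: _ => [|i y _ hy]; [exact: hardy0|exact: hardy_lin].
Qed.

Let htoep_sum h (I : finType) (c : I -> R[i]) (x : I -> LL) : circle_fun r h ->
  htoep h (\sum_i c i *: x i) = \sum_i c i *: htoep h (x i).
Proof.
move=> hC; rewrite /htoep (amul_sum r0 _ _ _ hC.1).
elim/big_rec2: _ => [|i y z _ <-]; first by rewrite (hproj_id r0) //; exact: hardy0.
exact: hproj_lin.
Qed.

Let htoepD h (x y : LL) : circle_fun r h -> htoep h (x + y) = htoep h x + htoep h y.
Proof.
move=> hC; have := amul_lin r0 1 x y hC.1; rewrite !scale1r /htoep => ->.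
by have := hproj_lin r0 1 (amul h x) (amul h y); rewrite !scale1r.
Qed.

Let norm_mode (k : int) (x : LL) : vnorm (amul (emode r k) x : LL) <= vnorm x.
Proof.
rewrite -[leRHS]mul1r; apply: (amul_norm r0 x (emode_circle r0 k).1 ler01) => y.
by rewrite cmod_emode.
Qed.

Section factored.
Variables (w : int) (h : R -> R[i]) (C : R).
Hypothesis hQ : toep_inv r h C.
Local Notation u := (fun x => h x * emode r w x).

Let hC : circle_fun r h. Proof. by case: hQ. Qed.
Let C0 : 0 <= C. Proof. by case: hQ. Qed.
Let hi (x : LL) : hardy x -> htoep h x = 0 -> x = 0. Proof. by case: hQ => _ _ hi _; exact: hi. Qed.
Let hs (y : LL) : hardy y -> exists x : LL, [/\ hardy x, htoep h x = y & vnorm x <= C * vnorm y].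
Proof. by case: hQ => _ _ _; exact. Qed.
Let wC := emode_circle r0 w.

Let hi2 (x y : LL) : hardy x -> hardy y -> htoep h x = htoep h y -> x = y.
Proof.
move=> hx hy xy; apply/eqP; rewrite -subr_eq0; apply/eqP; apply: hi; first exact: hardyB.
by rewrite (htoepB r0 _ _ hC) xy subrr.
Qed.

(** Here [T_u] is the shift by [w] followed by [T_h]; the cokernel is represented by the images
    under [T_h] of the first [w] exponentials. *)
Lemma Fred_ge0 : 0 <= w -> Fred (hardy (r := r)) (htoep (r := r) u) C 'I_0 'I_(absz w).
Proof.
move=> w0; have wE : w = (absz w)%:Z by rewrite gez0_abs.
have E (x : LL) : htoep u x = htoep h (amul (emode r w) x).
  by rewrite /htoep (amulM r0 x hC.1 wC.1).
exists (fun _ : 'I_0 => 0 : LL), (fun j : 'I_(absz w) => htoep h (e (j : nat)%:Z : LL)); split.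
- by split => [[]//|j]; exact: htoep_hardy.
- by move=> c _ [].
- move=> c x hx; rewrite E -(htoep_sum _ _ hC) => /hi2 Tx j.
  have /(congr1 (fun y => coord e y (j : nat)%:Z)) : amul (emode r w) x = \sum_j c j *: e (j : nat)%:Z.
    apply: Tx; first exact: hardy_amul_mode.
    by apply: hardy_sum => i; exact: hardy_mode.
  rewrite sum_mode_in coord_amul_mode // => <-; apply: hx.
  by rewrite [X in _ - X]wE subr_lt0 ltz_nat ltn_ord.
- move=> x hx; rewrite E => /(hi (hardy_amul_mode r0 w0 hx)) x0.
  exists (fun=> 0); rewrite big_ord0; apply: (coord_eq r0) => l.
  have := congr1 (fun y => coord e y (l + w)) x0.
  by rewrite (coord_amul_mode r0) addrK /coord !dot0l.
move=> y /hs[x' [hx' <- x'C]].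
(* The solution is the backward shift of [x'], the preimage of [y] under [T_h]; the first [w]
   coordinates that it loses are the coefficients of the cokernel part. *)
exists (hproj (amul (emode r (- w)) x')), (fun j : 'I_(absz w) => coord e x' (j : nat)%:Z); split.
- exact: hproj_hardy.
- rewrite E -(htoep_sum _ _ hC); set x := hproj _; set z := \sum_j _.
  have -> : htoep h (amul (emode r w) x) + htoep h z = htoep h ((amul (emode r w) x : LL) + z).
    by rewrite (htoepD _ _ hC).
  congr htoep; apply: (coord_eq r0) => l.
  rewrite coordD coord_amul_mode // hprojE // coord_amul_mode // opprK subrK subr_ge0.
  have [wl|lw] := leP w l; first by rewrite sum_mode_out ?addr0 // -wE wl orbT.
  rewrite add0r; have [l0|l0] := ltP l 0; first by rewrite hx' // sum_mode_out ?l0.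
  have lE : l = (absz l)%:Z by rewrite gez0_abs.
  have lw' : (absz l < absz w)%N by rewrite -ltz_nat -wE -lE.
  by rewrite lE (sum_mode_in _ (Ordinal lw')).
apply: (le_trans (hproj_le r0 _)); apply: le_trans x'C; exact: norm_mode.
Qed.

(** Here [T_u] is [T_h] followed by the backward shift by [- w], so its kernel is the preimage under
    [T_h] of the span of the first [- w] exponentials. *)
Lemma Fred_lt0 : w < 0 -> Fred (hardy (r := r)) (htoep (r := r) u) C 'I_(absz w) 'I_0.
Proof.
move=> w0; have wE : - w = (absz w)%:Z by rewrite ltz0_abs.
have E (x : LL) l : 0 <= l -> coord e (htoep u x) l = coord e (htoep h x) (l - w).
  move=> l0; have lw : 0 <= l - w by rewrite subr_ge0 (le_trans (ltW w0)).
  have -> : u = fun x => emode r w x * h x by apply/funext => y; rewrite mulrC.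
  rewrite /htoep (amulM r0 x wC.1 hC.1).
  have h1 := hprojE r0 (amul (emode r w) (amul h x)) l; rewrite l0 in h1.
  have h2 := hprojE r0 (amul h x) (l - w); rewrite lw in h2.
  exact: (etrans h1 (etrans (coord_amul_mode r0 w (amul h x) l) (esym h2))).
have /choice[kb hkb] : forall j : 'I_(absz w), exists x : LL, hardy x /\ htoep h x = e (j : nat)%:Z.
  by move=> j; have [//|x [hx xE _]] := hs (@hardy_mode R r r0 (j : nat)%:Z _); exists x.
have Tkb c : htoep h (\sum_j c j *: kb j) = \sum_j c j *: e (j : nat)%:Z.
  by rewrite (htoep_sum _ _ hC); apply: eq_bigr => j _; rewrite (hkb j).2.
exists kb, (fun=> 0); split.
- split => [j|[]//]; split; first exact: (hkb j).1.
  apply: (coord_eq r0) => l; have [l0|l0] := ltP l 0.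
    by rewrite /coord dot0l; exact: htoep_hardy.
  rewrite (E _ _ l0) (hkb j).2 /coord dot0l (mode_on r0) eq_sym.
  case: eqP => // lj; have := ltn_ord j; rewrite -ltz_nat -wE -lj -subr_gt0.
  by rewrite opprB addrA addNr sub0r oppr_gt0 ltNge l0.
- move=> c c0 j; have := Tkb c; rewrite c0 => T0.
  have := htoepB r0 0 0 hC; rewrite subrr T0 subrr => /(congr1 (fun y => coord e y (j : nat)%:Z)).
  by rewrite sum_mode_in /coord dot0l.
- by move=> c x _ _ [].
- move=> x hx Tx; exists (fun j : 'I_(absz w) => coord e (htoep h x) (j : nat)%:Z).
  apply: (hi2 hx); first by apply: hardy_sum => j; exact: (hkb j).1.
  rewrite Tkb; apply: (coord_eq r0) => l.
  have [l0|l0] := ltP l 0.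
    by rewrite sum_mode_out ?l0 //; exact: htoep_hardy.
  have [lw|wl] := ltP l (absz w)%:Z.
    have lE : l = (absz l)%:Z by rewrite gez0_abs.
    have lw' : (absz l < absz w)%N by rewrite -ltz_nat -lE.
    by rewrite [in RHS]lE (sum_mode_in _ (Ordinal lw')) -lE.
  have lw0 : 0 <= l + w by rewrite -[X in l + X]opprK wE subr_ge0.
  rewrite sum_mode_out ?wl ?orbT // -[l](addrK w) -(E _ _ lw0) Tx.
  by rewrite /coord dot0l.
move=> y hy; have [|x [hx xE xC]] := hs (y := amul (emode r (- w)) y).
  by apply: hardy_amul_mode => //; rewrite oppr_ge0 ltW.
exists x, (fun=> 0); split => //.
  rewrite big_ord0 addr0; apply: (coord_eq r0) => l.
  have [l0|l0] := ltP l 0; first by rewrite hy // htoep_hardy.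
  by rewrite (E _ _ l0) xE (coord_amul_mode r0) opprK subrK.
apply: (le_trans xC); apply: (ler_wpM2l C0); exact: norm_mode.
Qed.

Lemma circle_Fred : Fred (hardy (r := r)) (htoep (r := r) u) C 'I_(ker_dim w) 'I_(coker_dim w).
Proof. by rewrite /ker_dim /coker_dim; case: ltP => w0; [exact: Fred_lt0|exact: Fred_ge0]. Qed.

End factored.

End logarithm.

(** * The module of a closed curve *)

Section lifts.
Variable R : realType.

Lemma within_continuousB (A : set R) (f g : R -> R) : {within A, continuous f} ->
  {within A, continuous g} -> {within A, continuous (fun x => f x - g x)}.
Proof. by move=> cf cg x; apply: cvgB; [exact: cf|exact: cg]. Qed.

(** The difference [h] of two lifts takes values in [2 pi Z]. If its values at the ends differed, it
    would take the intermediate value [h a + pi] or [h b + pi], whose exponential is -1. *)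
Lemma lift_unique (a b : R) (f g : R -> R) : a <= b ->
  {within `[a, b], continuous f} -> {within `[a, b], continuous g} ->
  (forall t, t \in `[a, b] -> expi (f t) = expi (g t)) -> f b - f a = g b - g a.
Proof.
move=> ab cf cg fg; pose h x := f x - g x.
have ch : {within `[a, b], continuous h} by exact: within_continuousB.
have h1 t : t \in `[a, b] -> expi (h t) = 1.
  by move=> tab; rewrite /h expiD expiN fg // expi_mulJ.
have aI : a \in `[a, b] by rewrite in_itv /= lexx ab.
have bI : b \in `[a, b] by rewrite in_itv /= ab lexx.
suff hab : h a = h b by move: hab; rewrite /h; lra.
have hb1 : expi (h b - h a) = 1 by rewrite expiD expiN !h1 // conjc1 mulr1.
have pi0 := pi_gt0 R.
have no (v : R) : expi v = 1 -> expi (v + pi) = 1 -> False.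
  move=> v1; rewrite expiD v1 mul1r /expi cospi => -[hm _].
  by lra.
have IV (v : R) : Num.min (h a) (h b) <= v <= Num.max (h a) (h b) -> expi v = 1.
  by move=> /(IVT ab ch)[c cab <-]; exact: h1.
have [hlt|hlt|//] := ltgtP (h a) (h b).
  have dlt : 2 * pi <= h b - h a.
    rewrite leNgt; apply/negP => lt2.
    by move/eqP: hb1; rewrite (negbTE (expi_eq1 _)) // subr_gt0 hlt.
  exfalso; apply: (no (h a) (h1 _ aI)); apply: IV.
  by rewrite ge_min le_max; apply/andP; split; apply/orP; [left|right]; lra.
have dlt : 2 * pi <= h a - h b.
  rewrite leNgt; apply/negP => lt2; have : expi (h a - h b) = 1.
    by rewrite expiD expiN !h1 // conjc1 mulr1.
  by move/eqP; rewrite (negbTE (expi_eq1 _)) // subr_gt0 hlt.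
exfalso; apply: (no (h b) (h1 _ bI)); apply: IV.
by rewrite ge_min le_max; apply/andP; split; apply/orP; [right|left]; lra.
Qed.

(** Any one lift determines [winding]: by uniqueness of lifts the choice in its definition is
    immaterial. *)
Lemma winding_lift (u : 'rV[R]_3 -> R[i]) T (n : int) (f : R -> R) : 0 <= perimeter T ->
  {within `[0, perimeter T], continuous f} ->
  (forall t, t \in `[0, perimeter T] -> u (arclength T t) = expi (f t)) ->
  f (perimeter T) - f 0 = 2 * pi * n%:~R -> winding u T = n.
Proof.
move=> p0 cf uf fn; rewrite /winding; case: xgetP => [m -> [g [cg ug gm]]|/(_ n)[]].
  have := lift_unique p0 cf cg (fun t tI => etrans (esym (uf t tI)) (ug t tI)).
  rewrite fn gm => /eqP; rewrite -subr_eq0 -mulrBr -rmorphB mulf_eq0.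
  by rewrite gt_eqF ?mulr_gt0 ?pi_gt0 //= intr_eq0 subr_eq0 => /eqP.
by exists f.
Qed.

End lifts.

Section circle_modules.
Variables (R : realType) (E : topologicalType) (X : set E) (r : R) (rho : R -> E).
Hypotheses (r0 : 0 < r) (rho_cont : continuous rho) (rho_X : forall t, X (rho t))
  (rho_per : forall t, rho (t + 2 * pi * r) = rho t).
Local Notation M := (circle_module r rho).

Lemma rho_circle a : CX X a -> circle_fun r (fun t => a (rho t)).
Proof.
move=> /CXP aX; split; last by move=> x; rewrite rho_per.
apply/CXP => t _ d d0; have := rho_cont (aX _ (rho_X t) _ d0).
by rewrite nbhs_simpl /=; apply: filterS => x h _; exact: (h (rho_X x)).
Qed.

Lemma circle_dirac (x y : hilb M) : dirac M x y <->
  forall l : int, coord (mode r) y l = ((circle_lam r l)%:C)%C * coord (mode r) x l.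
Proof. by []. Qed.

Definition circle_eigenbasis : eigenbasis M :=
  @Eigenbasis R E M int (mode r) (circle_lam r) (arc_complete r0) (mode_on r0)
    (mode_total r0) circle_dirac.

Lemma circle_rep a x : rep M a x = amul (fun t => a (rho t)) x.
Proof. by []. Qed.

Lemma circle_good_rep : good_rep X M.
Proof.
split; last first.
  move=> a C aX C0 aC xi; apply: (amul_norm r0 xi (rho_circle aX).1 C0) => t.
  exact: aC.
split.
- move=> a b aX bX ab; apply/funext => xi; rewrite !circle_rep.
  by congr amul; apply/funext => t; exact: ab.
- move=> a aX; split.
    by move=> c x y; exact: (amul_lin r0 c x y (rho_circle aX).1).
  have [C C0 aC] := circle_fun_bounded r0 (rho_circle aX).
  by exists C => x; exact: (amul_norm r0 x (rho_circle aX).1 C0 aC).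
- by move=> a b c xi aX bX; exact: (amul_linl r0 c xi (rho_circle aX).1 (rho_circle bX).1).
- by move=> a b xi aX bX; exact: (amulM r0 xi (rho_circle aX).1 (rho_circle bX).1).
- split; last by move=> xi; exact: (amul1 r0).
  by move=> a xi eta aX; exact: (amulJ r0 xi eta (rho_circle aX).1).
Qed.

Lemma circle_commutator_le a (L : R) : CX X a -> 0 <= L ->
  (forall s t, cmod (a (rho s) - a (rho t)) <= L * `|s - t|) -> commutator_le M a L.
Proof.
move=> aX L0 aL xi eta De.
by have [zeta z1 z2] := lipschitz_commutator r0 (rho_circle aX) L0 aL De; exists zeta.
Qed.

Lemma circle_commutator_lip a (L : R) : CX X a -> 0 <= L -> commutator_le M a L ->
  forall s t, cmod (a (rho s) - a (rho t)) <= L * `|s - t|.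
Proof.
move=> aX L0 h s t.
have := commutator_lipschitz r0 (rho_circle aX) L0 h t (s - t).
by rewrite [t + _]addrC subrK.
Qed.

(** A function that acts as 0 has commutator 0 with [D], so it is constant along the curve, and a
    constant is detected by a single exponential. *)
Lemma circle_faithful a : CX X a -> (forall xi, rep M a xi = 0) -> forall t, a (rho t) = 0.
Proof.
move=> aX a0 t.
have D0 : commutator_le M a 0.
  move=> xi eta De; exists (rep M a xi); last by rewrite !a0 subrr vnorm0 mul0r.
  by rewrite a0 => l; rewrite /coord !dot0l mulr0.
have cst s : a (rho s) = a (rho t).
  apply/eqP; rewrite -subr_eq0 -cmod_eq0 eq_le cmod_ge0 andbT.
  by have := circle_commutator_lip aX (lexx 0) D0 s t; rewrite mul0r.
have := a0 (mode r 0); rewrite circle_rep.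
have -> : (fun s => a (rho s)) = fun=> a (rho t) by apply/funext => s; exact: cst.
have e00 : coord (mode r) (mode r 0) 0 = 1 by rewrite /coord (mode_on r0).
rewrite (amul_cst r0) => /(congr1 (fun x => coord (mode r) x 0)).
by rewrite coordZ (etrans (congr1 _ e00) (mulr1 _)) /coord dot0l.
Qed.

Lemma circle_pos_space : pos_space circle_eigenbasis = hardy (r := r).
Proof.
apply/seteqP; split => x hx l l0; apply: hx.
  by rewrite /= ltNge circle_lam_ge0 // -ltNge.
by move: l0; rewrite /= ltNge circle_lam_ge0 // -ltNge.
Qed.

Lemma circle_module_Fred u : CX X u -> (forall x, X x -> cmod (u x) = 1) ->
  exists (w : int) (theta : R -> R) (C : R), [/\ 0 <= C, continuous theta,
    forall t, theta (t + 2 * pi * r) = theta t,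
    forall t, u (rho t) = expi (w%:~R * t / r + theta t) &
    Fred (pos_space circle_eigenbasis) (toeplitz circle_eigenbasis u) C
      'I_(ker_dim w) 'I_(coker_dim w)].
Proof.
move=> uX u1; have uC := rho_circle uX.
have [w [h [[[C hQ] [theta [tc tp tE]]] hE]]] := circle_factor r0 uC (fun t => u1 _ (rho_X t)).
have h1 t : cmod (h t) = 1.
  by have := u1 _ (rho_X t); rewrite hE cmodM cmod_emode mul1r.
exists w, theta, C; split => //; first by case: hQ.
  by move=> t; rewrite hE tE h1 mul1r expiD.
rewrite circle_pos_space.
have uE : (fun t => u (rho t)) = (fun t => h t * emode r w t).
  by apply/funext => t; rewrite hE mulrC.
have -> : toeplitz circle_eigenbasis u = htoep (r := r) (fun t => h t * emode r w t).
  by apply/funext => x; exact: (congr1 (fun g => htoep g x) uE).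
exact: circle_Fred.
Qed.

(** The constant 2 is [1 / (1 - 1/2)], the same for all curves: this is the uniform bound for the
    small triangles. *)
Lemma circle_module_Fred_near_cst u (c : R[i]) : CX X u -> (forall x, X x -> cmod (u x) = 1) ->
  cmod c = 1 -> (forall t, cmod (u (rho t) - c) <= 2^-1) ->
  exists theta : R -> R, [/\ continuous theta,
    forall t, theta (t + 2 * pi * r) = theta t,
    forall t, u (rho t) = expi (theta t) &
    Fred (pos_space circle_eigenbasis) (toeplitz circle_eigenbasis u) 2 'I_0 'I_0].
Proof.
move=> uX u1 c1 uc; have uC := rho_circle uX.
have c0 : c != 0 by rewrite -cmod_eq0 c1 oner_eq0.
pose k t := c^-1 * u (rho t).
have kC : circle_fun r k by apply: circle_funM => //; exact: circle_fun_cst.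
have k1 t : cmod (1 - k t) <= 2^-1.
  by rewrite -(mulVf c0) -mulrBr cmodM cmodV c1 invr1 mul1r cmodB.
have half : 0 <= (2^-1 : R) < 1 by rewrite invr_ge0 ler0n invf_lt1 // ltr1n.
have kQ := toep_inv_near1 r0 kC half k1.
have uE : (fun t => u (rho t)) = (fun t => c * k t).
  by apply/funext => t; rewrite /k mulrA divff // mul1r.
have uQ : toep_inv r (fun t => u (rho t)) 2.
  rewrite uE; have := toep_inv_scale r0 c0 kQ; rewrite cmodV c1 invr1 mul1r.
  by rewrite (_ : (1 - 2^-1)^-1 = 2) //; field.
have [theta [tc tp tE]] : has_arg r (fun t => u (rho t)).
  rewrite uE; apply: has_argM; first exact: has_arg_cst.
  by apply: (has_arg_near1 kC _ k1); case/andP: half.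
exists theta; split => //; first by move=> t; rewrite tE (u1 _ (rho_X t)) mul1r.
rewrite circle_pos_space; have uE0 : (fun t => u (rho t)) = (fun t => u (rho t) * emode r 0 t).
  by apply/funext => t; rewrite emode0 mulr1.
have -> : toeplitz circle_eigenbasis u = htoep (r := r) (fun t => u (rho t) * emode r 0 t).
  by apply/funext => x; exact: (congr1 (fun g => htoep g x) uE0).
exact: (circle_Fred r0 0 uQ).
Qed.

End circle_modules.

(** * Regular tetrahedra and the pyramid *)

Section euclid.
Variable R : realType.
Local Notation E := 'rV[R]_3.
Implicit Types x y z u w : E.

Definition dotp u w : R := \sum_i u 0 i * w 0 i.
Definition nrm u : R := Num.sqrt (dotp u u).

Lemma dotpC u w : dotp u w = dotp w u.
Proof. by apply: eq_bigr => i _; rewrite mulrC. Qed.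

Lemma dotpDl u u' w : dotp (u + u') w = dotp u w + dotp u' w.
Proof. by rewrite -big_split; apply: eq_bigr => i _; rewrite mxE mulrDl. Qed.

Lemma dotpDr u w w' : dotp u (w + w') = dotp u w + dotp u w'.
Proof. by rewrite ![dotp u _]dotpC dotpDl. Qed.

Lemma dotpZl a u w : dotp (a *: u) w = a * dotp u w.
Proof. by rewrite mulr_sumr; apply: eq_bigr => i _; rewrite mxE mulrA. Qed.

Lemma dotpZr a u w : dotp u (a *: w) = a * dotp u w.
Proof. by rewrite dotpC dotpZl dotpC. Qed.

Lemma dotpBl u u' w : dotp (u - u') w = dotp u w - dotp u' w.
Proof. by rewrite -scaleN1r dotpDl dotpZl mulN1r. Qed.

Lemma dotpBr u w w' : dotp u (w - w') = dotp u w - dotp u w'.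
Proof. by rewrite ![dotp u _]dotpC dotpBl. Qed.

Lemma dotp_ge0 u : 0 <= dotp u u.
Proof. by apply: sumr_ge0 => i _; rewrite -expr2 sqr_ge0. Qed.

Lemma nrm_ge0 u : 0 <= nrm u. Proof. exact: sqrtr_ge0. Qed.

Lemma nrm_sqr u : nrm u ^+ 2 = dotp u u.
Proof. by rewrite /nrm sqr_sqrtr ?dotp_ge0. Qed.

(** By Lagrange's identity the defect is a sum of three squares. *)
Lemma dotp_sqr_le u w : dotp u w ^+ 2 <= dotp u u * dotp w w.
Proof.
rewrite /dotp !big_ord_recl !big_ord0 /=.
move: (u 0 _) (u 0 _) (u 0 _) (w 0 _) (w 0 _) (w 0 _) => c b a c' b' a'.
rewrite -subr_ge0 !addr0.
have -> : (a * a + (b * b + c * c)) * (a' * a' + (b' * b' + c' * c')) -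
  (a * a' + (b * b' + c * c')) ^+ 2 =
  (a * b' - b * a') ^+ 2 + (a * c' - c * a') ^+ 2 + (b * c' - c * b') ^+ 2 by ring.
by rewrite !addr_ge0 ?sqr_ge0.
Qed.

Lemma dotp_le u w : dotp u w <= nrm u * nrm w.
Proof.
rewrite (le_trans (ler_norm _)) // -(@ler_pXn2r _ 2) ?nnegrE ?mulr_ge0 ?nrm_ge0 //.
by rewrite exprMn !nrm_sqr real_normK ?num_real // dotp_sqr_le.
Qed.

Lemma nrmZ a u : nrm (a *: u) = `|a| * nrm u.
Proof. by rewrite /nrm dotpZl dotpZr mulrA -expr2 sqrtrM ?sqr_ge0 // sqrtr_sqr. Qed.

Lemma nrmN u : nrm (- u) = nrm u.
Proof. by rewrite -scaleN1r nrmZ normrN1 mul1r. Qed.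

Lemma nrmD u w : nrm (u + w) <= nrm u + nrm w.
Proof.
rewrite -(@ler_pXn2r _ 2) ?nnegrE ?addr_ge0 ?nrm_ge0 // sqrrD !nrm_sqr.
by rewrite dotpDl !dotpDr (dotpC w u); have := dotp_le u w; lra.
Qed.

Lemma nrm0 : nrm 0 = 0.
Proof. by rewrite -(scale0r (0 : E)) nrmZ normr0 mul0r. Qed.

Lemma nrm_sum (I : Type) (s : seq I) (P : pred I) (f : I -> E) :
  nrm (\sum_(i <- s | P i) f i) <= \sum_(i <- s | P i) nrm (f i).
Proof.
elim/big_rec2: _ => [|i a b _ h]; first by rewrite nrm0.
by rewrite (le_trans (nrmD _ _)) // lerD2l.
Qed.

Lemma nrm_coord u i : `|u 0 i| <= nrm u.
Proof.
rewrite -(@ler_pXn2r _ 2) ?nnegrE ?nrm_ge0 // nrm_sqr real_normK ?num_real //.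
rewrite /dotp (bigD1 i) //= -expr2 lerDl; apply: sumr_ge0 => j _.
by rewrite -expr2 sqr_ge0.
Qed.

Lemma nrm_eq0 u : nrm u = 0 -> u = 0.
Proof.
move=> u0; apply/rowP => i; rewrite !mxE; apply/eqP; rewrite -normr_eq0 eq_le normr_ge0 andbT.
by rewrite -u0 nrm_coord.
Qed.

Lemma nrm_le_coord u (d : R) : 0 <= d -> (forall i, `|u 0 i| <= d) -> nrm u <= 2 * d.
Proof.
move=> d0 ud; rewrite -(@ler_pXn2r _ 2) ?nnegrE ?mulr_ge0 ?nrm_ge0 // nrm_sqr.
have : dotp u u <= \sum_(i < 3) d ^+ 2.
  apply: ler_sum => i _; rewrite -expr2 -real_normK ?num_real //.
  by rewrite ler_pXn2r ?nnegrE.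
rewrite sumr_const card_ord exprMn => /le_trans; apply.
by have := sqr_ge0 d; rewrite -[_ *+ 3]mulr_natl; lra.
Qed.

Lemma edistE x y : edist x y = nrm (x - y).
Proof.
by rewrite /edist /nrm /dotp; congr Num.sqrt; apply: eq_bigr => i _; rewrite !mxE expr2.
Qed.

Lemma edist_ge0 x y : 0 <= edist x y. Proof. by rewrite edistE nrm_ge0. Qed.

Lemma edistC x y : edist x y = edist y x.
Proof. by rewrite !edistE -nrmN opprB. Qed.

Lemma edistxx x : edist x x = 0. Proof. by rewrite edistE subrr nrm0. Qed.

Lemma edist_eq0 x y : edist x y = 0 -> x = y.
Proof. by rewrite edistE => /nrm_eq0/eqP; rewrite subr_eq0 => /eqP. Qed.

Lemma edist_tri y x z : edist x z <= edist x y + edist y z.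
Proof. by rewrite !edistE (le_trans _ (nrmD _ _)) // addrA subrK. Qed.

Lemma edist_affine x y (s t : R) :
  edist (x + s *: (y - x)) (x + t *: (y - x)) = `|s - t| * edist x y.
Proof.
by rewrite !edistE opprD addrACA subrr add0r -scalerBl nrmZ -[x - y]opprB nrmN.
Qed.

(** The topology of row vectors is that of the maximum norm, which in dimension 3 is within a factor
    2 of the Euclidean norm ([nrm_le_coord]). *)
Lemma nbhs_edist x (P : set E) : nbhs x P <->
  exists2 d : R, 0 < d & forall y, edist x y < d -> P y.
Proof.
split => [/nbhs_ballP[d /= d0 dP]|[d d0 dP]].
  exists d => // y xy; apply: dP; split => // i j; rewrite /ball /= ord1.
  have := nrm_coord (x - y) j; rewrite !mxE -edistE => /le_lt_trans; exact.
have d4 : 0 < d / 4 by rewrite divr_gt0.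
apply/nbhs_ballP; exists (d / 4) => // y xy; apply: dP; rewrite edistE.
apply: (@le_lt_trans _ _ (2 * (d / 4))); last by lra.
apply: nrm_le_coord; first exact: ltW.
by case: xy => _ xy i; have := xy 0 i; rewrite /ball /= !mxE => /ltW.
Qed.

Lemma ball_edist x y (d : R) : edist x y < d -> ball x d y.
Proof.
move=> xy; split => [|i j]; first exact: le_lt_trans (edist_ge0 x y) xy.
rewrite /ball /= ord1.
by have := nrm_coord (x - y) j; rewrite !mxE -edistE => /le_lt_trans; exact.
Qed.

Lemma continuous_edist (T : topologicalType) (g : T -> E) t :
  (forall e : R, 0 < e -> \forall s \near t, edist (g t) (g s) < e) -> {for t, continuous g}.
Proof.
move=> h P /nbhs_edist[d d0 dP]; apply: filterS (h d d0) => s; exact: dP.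
Qed.

Lemma CX_edist (X : set E) a : CX X a <-> forall x, X x -> forall e : R, 0 < e ->
  exists2 d : R, 0 < d & forall y, X y -> edist x y < d -> cmod (a y - a x) < e.
Proof.
split => [/CXP h x Xx e e0|h].
  have /nbhs_edist[d d0 hd] := h x Xx e e0; exists d => // y Xy xy; exact: hd.
apply/CXP => x Xx e e0; have [d d0 hd] := h x Xx e e0.
by apply/nbhs_edist; exists d => // y xy Xy; exact: hd.
Qed.

Lemma compact_modulus (X : set E) a : compact X -> CX X a -> forall e : R, 0 < e ->
  exists2 C : R, 0 <= C & forall x y, X x -> X y -> cmod (a y - a x) <= e + C * edist x y.
Proof.
move=> cX aX e e0; have [d d0 hd] := compact_unif_continuous cX aX e0.
have [B B0 hB] := compact_bounded_cmod cX aX.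
exists (2 * B / d); first by rewrite divr_ge0 ?mulr_ge0 // ltW.
move=> x y Xx Xy; have [xy|xy] := ltP (edist x y) d.
  rewrite (le_trans (ltW (hd x y Xx Xy (ball_edist xy)))) // lerDl.
  by rewrite mulr_ge0 ?edist_ge0 // divr_ge0 ?mulr_ge0 // ltW.
apply: (@le_trans _ _ (2 * B)).
  by rewrite (le_trans (cmodD _ _)) // cmodN; have := hB x Xx; have := hB y Xy; lra.
rewrite -[leLHS]add0r lerD ?(ltW e0) // -mulrA ler_peMr ?mulr_ge0 //.
by rewrite mulrC ler_pdivlMr // mul1r.
Qed.

End euclid.

(** * Barycentric coordinates and cells *)

Section regular_tetrahedra.
Variable R : realType.
Local Notation E := 'rV[R]_3.
Implicit Types (x y : E) (t v : tetra R) (l : R) (w : seq 'I_4).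

Definition regular t l := 0 < l /\ forall i j, i != j -> edist (t i) (t j) = l.

(* Barycentric coordinate, extended to all of space by an affine function. *)
Definition bary l t i x : R := 1 - (2 * l ^+ 2)^-1 * \sum_k dotp (x - t i) (t k - t i).

(** Polarization: the edge lengths determine the Gram matrix. *)
Lemma regular_dotp t l i j k : regular t l ->
  dotp (t j - t i) (t k - t i) =
  l ^+ 2 * ((j != i)%:R + (k != i)%:R - (j != k)%:R) / 2.
Proof.
move=> [l0 tl]; have sq a b : dotp (t a - t b) (t a - t b) = l ^+ 2 * (a != b)%:R.
  rewrite -nrm_sqr -edistE; have [->|ab] := eqVneq a b.
    by rewrite edistxx expr0n mulr0.
  by rewrite tl // mulr1.
have := sq j k; rewrite (_ : t j - t k = (t j - t i) - (t k - t i)); last first.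
  by rewrite opprB addrA subrK.
have E (u w : 'rV[R]_3) : dotp (u - w) (u - w) = dotp u u + dotp w w - 2 * dotp u w.
  by rewrite dotpBl !dotpBr (dotpC w u); ring.
by rewrite E !sq; move: (dotp _ _) => d; lra.
Qed.

Lemma baryD l t i x y (a b : R) : a + b = 1 ->
  bary l t i (a *: x + b *: y) = a * bary l t i x + b * bary l t i y.
Proof.
move=> ab; have E0 k : dotp (a *: x + b *: y - t i) (t k - t i) =
    a * dotp (x - t i) (t k - t i) + b * dotp (y - t i) (t k - t i).
  rewrite -!dotpZl -dotpDl; congr dotp; rewrite !scalerBr addrACA -opprD -scalerDl ab.
  by rewrite scale1r.
rewrite /bary; under eq_bigr do rewrite E0.
rewrite big_split /= -!mulr_sumr; have -> : b = 1 - a by lra.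
ring.
Qed.

Lemma dotp_suml (I : finType) (c : I -> R) (x : I -> E) (u : E) :
  dotp (\sum_j c j *: x j) u = \sum_j c j * dotp (x j) u.
Proof.
elim/big_rec2: _ => [|j a b _ <-]; last by rewrite dotpDl dotpZl.
by rewrite /dotp big1 // => i _; rewrite mxE mul0r.
Qed.

Lemma bary_comb l t i (I : finType) (c : I -> R) (x : I -> E) : \sum_j c j = 1 ->
  bary l t i (\sum_j c j *: x j) = \sum_j c j * bary l t i (x j).
Proof.
move=> c1; rewrite /bary.
have -> : \sum_j c j * (1 - (2 * l ^+ 2)^-1 * \sum_k dotp (x j - t i) (t k - t i)) =
   1 - (2 * l ^+ 2)^-1 * \sum_j c j * \sum_k dotp (x j - t i) (t k - t i).
  under eq_bigr do rewrite mulrBr mulr1 mulrCA.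
  by rewrite sumrB c1 -mulr_sumr.
congr (1 - _ * _); under [RHS]eq_bigr do rewrite mulr_sumr.
rewrite [RHS]exchange_big; apply: eq_bigr => k _ /=.
have -> : \sum_j c j *: x j - t i = \sum_j c j *: (x j - t i).
  under [RHS]eq_bigr do rewrite scalerBr.
  by rewrite sumrB -scaler_suml c1 scale1r.
by rewrite -dotp_suml.
Qed.

Lemma bary_vertex t l i j : regular t l -> bary l t i (t j) = (i == j)%:R.
Proof.
move=> tl; have [l0 _] := tl; rewrite /bary.
under eq_bigr do rewrite (regular_dotp _ _ _ tl).
have [->|ij] := eqVneq i j.
  rewrite big1 ?mulr0 ?subr0 // => k _.
  by rewrite add0r [k == j]eq_sym subrr mulr0 mul0r.
rewrite (eq_bigr (fun k => l ^+ 2 / 2 * (1 - (k == i)%:R + (k == j)%:R))); last first.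
  move=> k _; rewrite [j == k]eq_sym.
  by case: (k == i); case: (k == j) => /=; field.
rewrite -mulr_sumr !big_split /= sumrN sumr_const card_ord.
have S (m : 'I_4) : \sum_k (k == m)%:R = 1 :> R.
  by rewrite (bigD1 m) //= eqxx big1 ?addr0 // => k /negbTE ->.
by rewrite !S; field; rewrite gt_eqF.
Qed.

Lemma bary_weights t l (c : 'I_4 -> R) i : regular t l -> \sum_j c j = 1 ->
  bary l t i (\sum_j c j *: t j) = c i.
Proof.
move=> tl c1; rewrite bary_comb // (bigD1 i) //= (bary_vertex _ _ tl) eqxx mulr1 big1 ?addr0 //.
by move=> j ji; rewrite (bary_vertex _ _ tl) eq_sym (negbTE ji) mulr0.
Qed.

Lemma solid_bary t l x : regular t l -> solid t x ->
  [/\ forall i, 0 <= bary l t i x, \sum_i bary l t i x = 1 & x = \sum_i bary l t i x *: t i].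
Proof.
move=> tl [c [c0 c1 xE]].
have cE i : bary l t i x = c i by rewrite xE bary_weights.
split => [i||]; first by rewrite cE.
  by rewrite -c1; apply: eq_bigr => i _.
by rewrite {1}xE; apply: eq_bigr => i _; rewrite cE.
Qed.

Lemma vertex_solid t i : solid t (t i).
Proof.
exists (fun j => (j == i)%:R); split => [j||]; first exact: ler0n.
  by rewrite (bigD1 i) //= eqxx big1 ?addr0 // => j /negbTE ->.
rewrite (bigD1 i) //= eqxx scale1r big1 ?addr0 // => j /negbTE ->.
by rewrite scale0r.
Qed.

Lemma bary_lipschitz t l i : exists2 C : R, 0 <= C &
  forall x y, `|bary l t i x - bary l t i y| <= C * edist x y.
Proof.
exists (`|(2 * l ^+ 2)^-1| * \sum_k nrm (t k - t i)).
  by rewrite mulr_ge0 // sumr_ge0 // => k _; exact: nrm_ge0.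
move=> x y; rewrite /bary opprB addrC addrA subrK -mulrBr normrM -mulrA ler_wpM2l //.
rewrite -sumrB mulr_suml (le_trans (ler_norm_sum _ _ _)) //; apply: ler_sum => k _.
rewrite -dotpBl opprB addrA subrK mulrC ler_norml edistC edistE dotp_le andbT.
by rewrite lerNl -mulN1r -dotpZl scaleN1r (le_trans (dotp_le _ _)) // nrmN.
Qed.

(** Barycentric coordinates are Lipschitz, so the three conditions of [solid] pass to limits. *)
Lemma solid_closed t l x : regular t l ->
  (forall d : R, 0 < d -> exists2 y, solid t y & edist x y < d) -> solid t x.
Proof.
move=> tl h.
have /choice[C hC] i : exists C : R, 0 <= C /\
    forall x y, `|bary l t i x - bary l t i y| <= C * edist x y.
  by have [C C0 hC] := @bary_lipschitz t l i; exists C.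
have lim (z : R) (B : R) : 0 <= B -> (forall d, 0 < d -> z <= B * d) -> z <= 0.
  move=> B0 hz; apply/ler_addgt0Pr => e e0; rewrite add0r.
  have B1 : 0 < B + 1 by rewrite ltr_wpDl.
  rewrite (le_trans (hz (e / (B + 1)) _)) ?divr_gt0 //.
  by rewrite mulrCA ler_piMr ?(ltW e0) // ler_pdivrMr // mul1r lerDl.
have near d : 0 < d -> exists y, [/\ solid t y, edist x y < d &
    forall i, `|bary l t i x - bary l t i y| <= C i * d].
  move=> /h[y ty xy]; exists y; split => // i.
  by rewrite (le_trans ((hC i).2 _ _)) // ler_wpM2l ?(hC i).1 // ltW.
exists (fun i => bary l t i x); split => [i||].
- rewrite -oppr_le0; apply: (lim _ (C i)); first exact: (hC i).1.
  move=> d /near[y [/(solid_bary tl)[b0 _ _] _ /(_ i)]].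
  by rewrite ler_norml => /andP[h1 _]; have := b0 i; lra.
- apply/eqP; rewrite -subr_eq0 -normr_eq0 eq_le normr_ge0 andbT.
  apply: (lim _ (\sum_i C i)); first by apply: sumr_ge0 => i _; exact: (hC i).1.
  move=> d /near[y [/(solid_bary tl)[_ <- _] _ hy]]; rewrite -sumrB.
  by rewrite (le_trans (ler_norm_sum _ _ _)) // mulr_suml ler_sum.
apply/eqP; rewrite -subr_eq0; apply/eqP/nrm_eq0/eqP.
rewrite eq_le nrm_ge0 andbT; apply: (lim _ (1 + \sum_i C i * nrm (t i))).
  by rewrite addr_ge0 // sumr_ge0 // => i _; rewrite mulr_ge0 ?nrm_ge0 ?(hC i).1.
move=> d /near[y [/(solid_bary tl)[_ _ yE] xy hy]].
have -> : x - \sum_i bary l t i x *: t i =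
    (x - y) + \sum_i (bary l t i y - bary l t i x) *: t i.
  by under [in RHS]eq_bigr do rewrite scalerBl; rewrite sumrB -yE addrA subrK.
rewrite (le_trans (nrmD _ _)) // mulrDl mul1r lerD -?edistE ?(ltW xy) //.
rewrite (le_trans (nrm_sum _ _ _)) // mulr_suml; apply: ler_sum => i _.
by rewrite nrmZ mulrAC ler_wpM2r ?nrm_ge0 // distrC.
Qed.

Lemma solid_diam t l x y : regular t l -> solid t x -> solid t y -> edist x y <= l.
Proof.
move=> [l0 tl]; have cvx (z : E) (c : 'I_4 -> R) : (forall i, 0 <= c i) -> \sum_i c i = 1 ->
    (forall i, edist (t i) z <= l) -> edist (\sum_i c i *: t i) z <= l.
  move=> c0 c1 hz; rewrite edistE -{1}(scale1r z) -c1 scaler_suml -sumrB.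
  rewrite (le_trans (nrm_sum _ _ _)) // -[leRHS]mul1r -c1 mulr_suml; apply: ler_sum => i _.
  by rewrite -scalerBr nrmZ ger0_norm // ler_wpM2l // -edistE.
move=> [c [c0 c1 ->]] [d [d0 d1 ->]]; apply: (@cvx) => // i; rewrite edistC; apply: (@cvx) => // j.
by have [->|ji] := eqVneq j i; [rewrite edistxx ltW|rewrite tl].
Qed.

Lemma edist_corner t j a b : edist (corner t j a) (corner t j b) = edist (t a) (t b) / 2.
Proof.
rewrite !edistE /corner /midpoint -scalerBr opprD addrACA subrr add0r nrmZ.
by rewrite ger0_norm ?invr_ge0 // mulrC.
Qed.

Lemma regular_corner t l j : regular t l -> regular (corner t j) (l / 2).
Proof.
by move=> [l0 tl]; split => [|a b ab]; [rewrite divr_gt0|rewrite edist_corner tl].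
Qed.

Lemma regular_sub t l w : regular t l -> regular (subtetra t w) (l / 2 ^+ size w).
Proof.
elim: w t l => [|j w IH] t l tl /=; first by rewrite expr0 divr1.
by have := IH _ _ (regular_corner j tl); rewrite -mulrA -invfM exprS.
Qed.

Lemma corner_self t i : corner t i i = t i.
Proof. by apply/rowP => k; rewrite !mxE; field. Qed.

Lemma corner_solid t j x : solid (corner t j) x -> solid t x.
Proof.
move=> [c [c0 c1 xE]]; exists (fun i => 2^-1 * ((i == j)%:R + c i)); split => [i||].
- by rewrite mulr_ge0 ?invr_ge0 // addr_ge0 // ler0n.
- rewrite -mulr_sumr big_split /= c1 (bigD1 j) //= eqxx big1 ?addr0 => [|i /negbTE ->//].
  by rewrite -[true%:R]/(1 : R); field.
rewrite xE /corner /midpoint; under eq_bigr do rewrite scalerA mulrC -scalerA.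
under [RHS]eq_bigr do rewrite -scalerA scalerDl.
rewrite -!scaler_sumr; congr (_ *: _); under eq_bigr do rewrite scalerDr.
rewrite !big_split /= -scaler_suml c1 scale1r; congr (_ + _).
by rewrite (bigD1 j) //= eqxx scale1r big1 ?addr0 // => i /negbTE ->; rewrite scale0r.
Qed.

Lemma corner_bary t l j x : regular t l -> solid (corner t j) x -> 2^-1 <= bary l t j x.
Proof.
move=> tl [c [c0 c1 ->]]; rewrite bary_comb //.
rewrite (eq_bigr (fun i => 2^-1 * (c i + c i * (j == i)%:R))) => [|i _].
  rewrite -mulr_sumr big_split /= c1 ler_peMr ?invr_ge0 // lerDl.
  by apply: sumr_ge0 => i _; rewrite mulr_ge0.
rewrite /corner /midpoint scalerDr baryD; last by field.
by rewrite !(bary_vertex _ _ tl) eqxx -[true%:R]/(1 : R); ring.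
Qed.

Lemma sub_solid t w x : solid (subtetra t w) x -> solid t x.
Proof. by elim: w t => //= j w IH t /IH; exact: corner_solid. Qed.

Lemma subtetra_rcons t w j : subtetra t (rcons w j) = corner (subtetra t w) j.
Proof. by rewrite /subtetra foldl_rcons. Qed.

(** The vertex [i] has barycentric coordinate 0 at every other label, so by [corner_bary] each
    letter of [w] is [i]; and the corner [i] keeps the vertex [i]. *)
Lemma vertex_in_sub t l w i : regular t l -> solid (subtetra t w) (t i) ->
  subtetra t w i = t i.
Proof.
elim: w t l => [//|j w IH] t l tl /= hi.
have : 2^-1 <= bary l t j (t i) by apply: corner_bary => //; exact: sub_solid hi.
rewrite (bary_vertex _ _ tl); case: eqVneq => [ji _|_]; last first.
  by rewrite leNgt invr_gt0 ltr0n.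
by subst j; rewrite (IH (corner t i) (l / 2)) ?corner_self //; exact: regular_corner.
Qed.

(** At the first letters [a] and [b] that differ, both coordinates of [x] are at least 1/2, hence
    equal to 1/2, and [x] is the midpoint of that edge, which is the vertex [b] of the corner [a]. A
    deeper cell that contains it still has it as a vertex. *)
Lemma cells_meet t l w w' x : regular t l -> size w = size w' -> w != w' ->
  solid (subtetra t w) x -> solid (subtetra t w') x -> exists i, x = subtetra t w i.
Proof.
elim: w w' t l => [|a w IH] [|b w'] t l tl //= [sw]; rewrite eqseq_cons.
have [->|ab] := eqVneq a b; first by move=> /= ww'; apply: (IH w' _ (l / 2)) => //; exact: regular_corner.
move=> _ xa xb; have xa' := sub_solid xa; have xb' := sub_solid xb.
have [c0 c1 xE] := solid_bary tl (corner_solid xa').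
have ha := corner_bary tl xa'; have hb := corner_bary tl xb'.
have ba : b != a by rewrite eq_sym.
have rest_ge0 : 0 <= \sum_(i | (i != a) && (i != b)) bary l t i x by apply: sumr_ge0 => i _.
have := c1; rewrite (bigD1 a) //= (bigD1 b) //= => c1'.
have [ea eb er] : [/\ bary l t a x = 2^-1, bary l t b x = 2^-1 &
    \sum_(i | (i != a) && (i != b)) bary l t i x = 0] by split; lra.
have xm : x = corner t a b.
  rewrite xE (bigD1 a) //= (bigD1 b) //= ea eb big1 ?addr0.
    by rewrite /corner /midpoint scalerDr.
  move=> i iab; suff -> : bary l t i x = 0 by rewrite scale0r.
  by apply/eqP; move: er => /eqP; rewrite psumr_eq0 // => /allP/(_ i (mem_index_enum i));
    rewrite iab.
exists b; rewrite xm; apply/esym/(vertex_in_sub (l := l / 2)); first exact: regular_corner.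
by rewrite -xm.
Qed.

End regular_tetrahedra.

(** * The pyramid: compactness and edges *)

Section pyramids.
Variable R : realType.
Local Notation E := 'rV[R]_3.
Variables (v : tetra R) (l : R).
Hypothesis vl : regular v l.
Implicit Types (x y : E) (w : seq 'I_4).

Local Notation cell w := (solid (subtetra v w)).

Lemma SP_solid x : SP v x -> solid v x.
Proof. by move=> /(_ 0%N I)[w _]; exact: sub_solid. Qed.

Lemma cell_prefix w w' x : cell (w ++ w') x -> cell w x.
Proof. by rewrite /subtetra foldl_cat; exact: sub_solid. Qed.

Lemma SP_cell x n : SP v x -> exists w, size w = n /\ cell w x.
Proof. by move=> /(_ n I)[w sw xw]; exists w. Qed.

(** The cell of the next level provided by [SP] may lie in another cell [w0]. Then [x] is a vertex
    of [w], and it remains a vertex of the corner with its own label. *)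
Lemma SP_extend w x : SP v x -> cell w x -> exists k, cell (rcons w k) x.
Proof.
move=> /(SP_cell (size w).+1)[w' [sw']]; case: (lastP w') sw' => // w0 k.
rewrite size_rcons => -[sw0] xw0 xw.
have [ww0|ww0] := eqVneq w w0; first by exists k; rewrite ww0.
have xw0' : cell w0 x by move: xw0; rewrite -cats1; exact: cell_prefix.
have [i xi] := cells_meet vl (esym sw0) ww0 xw xw0'; exists i.
by rewrite subtetra_rcons xi -(corner_self (subtetra v w) i); exact: vertex_solid.
Qed.

(** Each level has finitely many cells and they are closed, so those that avoid [x] avoid a
    neighbourhood. *)
Lemma near_cell x n : \forall y \near x, forall w : n.-tuple 'I_4, cell w y -> cell w x.
Proof.
have nf : Filter (nbhs x) by exact: nbhs_filter.
have H (w : n.-tuple 'I_4) : nbhs x [set y | cell w y -> cell w x].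
  have [xw|xw] := pselect (cell w x); first by apply/nbhs_edist; exists 1 => // y _ _.
  apply: contrapT => h; apply: xw; apply: (solid_closed (regular_sub w vl)) => d d0.
  apply: contrapT => h'; apply: h; apply/nbhs_edist; exists d => // y xy yw.
  by exfalso; apply: h'; exists y.
exact: (filter_forall nf H).
Qed.

Lemma SP_closed : closed (SP v).
Proof.
move=> x clx n _; have [y [/(SP_cell n)[w [sw yw]] h]] := clx _ (near_cell x n).
by exists w => //; move/eqP in sw; exact: (h (Tuple sw)).
Qed.

Lemma SP_compact : compact (SP v).
Proof.
pose B := nrm (v ord0) + l.
have cB : compact [set y : E | forall i, [set z : R | `[- B, B]%classic z] (y ord0 i)].
  have sc (i : 'I_3) : compact `[- B, B]%classic by exact: segment_compact.
  exact: (@rV_compact R 3 (fun=> `[- B, B]%classic) sc).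
apply: (subclosed_compact SP_closed cB) => x /SP_solid xs i /=.
rewrite in_itv /= -ler_norml (le_trans (nrm_coord _ _)) // /B.
rewrite -[x](subrK (v ord0)) addrC (le_trans (nrmD _ _)) // lerD2l -edistE.
by rewrite (solid_diam vl xs) //; exact: vertex_solid.
Qed.

Lemma edge_split (t : tetra R) i j (s : R) : 0 <= s <= 1 ->
  exists k s', 0 <= s' <= 1 /\
    t i + s *: (t j - t i) = corner t k i + s' *: (corner t k j - corner t k i).
Proof.
move=> /andP[s0 s1]; have [s2|s2] := leP s 2^-1.
  exists i, (2 * s); split; first by apply/andP; split; lra.
  by apply/rowP => m; rewrite !mxE; field.
exists j, (2 * s - 1); split; first by apply/andP; split; lra.
by apply/rowP => m; rewrite !mxE; field.
Qed.

Lemma edge_solid (t : tetra R) i j (s : R) : 0 <= s <= 1 -> solid t (t i + s *: (t j - t i)).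
Proof.
move=> /andP[s0 s1]; exists (fun k => (1 - s) * (k == i)%:R + s * (k == j)%:R).
have S (m : 'I_4) : \sum_k (k == m)%:R = 1 :> R.
  by rewrite (bigD1 m) //= eqxx big1 ?addr0 // => k /negbTE ->.
have T (m : 'I_4) : \sum_k (k == m)%:R *: t k = t m.
  rewrite (bigD1 m) //= eqxx scale1r big1 ?addr0 // => k /negbTE ->.
  by rewrite scale0r.
split => [k||].
- by rewrite addr_ge0 // mulr_ge0 // ?subr_ge0 // ler0n.
- by rewrite big_split /= -!mulr_sumr !S; ring.
under eq_bigr do rewrite scalerDl -!scalerA.
by rewrite big_split /= -!scaler_sumr !T; apply/rowP => m; rewrite !mxE; ring.
Qed.

(** Each half of an edge is an edge of a corner, so a point of an edge lies on edges of all later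
    levels. *)
Lemma edge_SP w i j (s : R) : 0 <= s <= 1 ->
  SP v (subtetra v w i + s *: (subtetra v w j - subtetra v w i)).
Proof.
move=> s01 n _; have [nw|wn] := leqP n (size w).
  exists (take n w); first by rewrite /= size_takel.
  apply: (@cell_prefix _ (drop n w)); rewrite cat_take_drop; exact: edge_solid.
rewrite -(subnKC (ltnW wn)); move: (n - size w)%N => m {n wn}.
elim: m w s s01 => [|m IH] w s s01.
  by exists w; rewrite /= ?addn0 //; exact: edge_solid.
have [k [s' [s'01 ->]]] := edge_split (subtetra v w) i j s01.
rewrite -subtetra_rcons; have [w' /= sw' h] := IH (rcons w k) s' s'01; exists w' => //=.
by rewrite sw' size_rcons addSnnS.
Qed.

Lemma vertex_SP w i : SP v (subtetra v w i).
Proof.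
have := @edge_SP w i i 0; rewrite scale0r addr0; apply.
by rewrite lexx ler01.
Qed.

End pyramids.

(** * Triangles and winding numbers *)

Section equilateral.
Variable R : realType.
Local Notation E := 'rV[R]_3.
Implicit Types (x y : E) (T : triangle R) (d : R).

Definition equilateral T d := [/\ 0 < d, edist (vtx1 T) (vtx2 T) = d,
  edist (vtx2 T) (vtx3 T) = d & edist (vtx3 T) (vtx1 T) = d].

Section arc.
Variables (T : triangle R) (d : R).
Hypothesis Td : equilateral T d.
Let d0 : 0 < d. Proof. by case: Td. Qed.
Let e12 : edist (vtx1 T) (vtx2 T) = d. Proof. by case: Td. Qed.
Let e23 : edist (vtx2 T) (vtx3 T) = d. Proof. by case: Td. Qed.
Let e31 : edist (vtx3 T) (vtx1 T) = d. Proof. by case: Td. Qed.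

Lemma perimeter_equilateral : perimeter T = 3 * d.
Proof. by rewrite /perimeter e12 e23 e31; ring. Qed.

Let p0 : 0 < 3 * d. Proof. by rewrite mulr_gt0. Qed.

(** [arclength] on one period [[0, 3 d]]. The branches agree at the corners, which is why [base1],
    [base2] and [base3] hold on closed ranges. *)
Let base (u : R) : E := if u <= d then vtx1 T + (u / d) *: (vtx2 T - vtx1 T)
  else if u <= d + d then vtx2 T + ((u - d) / d) *: (vtx3 T - vtx2 T)
  else vtx3 T + ((u - d - d) / d) *: (vtx1 T - vtx3 T).

Let arcE t : arclength T t = base (t - 3 * d * (Num.floor (t / (3 * d)))%:~R).
Proof. by rewrite /arclength /segment_at perimeter_equilateral e12 e23 e31. Qed.

Let base1 u : u <= d -> base u = vtx1 T + (u / d) *: (vtx2 T - vtx1 T).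
Proof. by rewrite /base => ->. Qed.

Let base2 u : d <= u <= d + d -> base u = vtx2 T + ((u - d) / d) *: (vtx3 T - vtx2 T).
Proof.
rewrite /base => /andP[du ->]; case: ifP => // ud.
have -> : u = d by apply/eqP; rewrite eq_le du ud.
by rewrite subrr mul0r scale0r addr0 divff ?gt_eqF // scale1r addrC subrK.
Qed.

Let base3 u : d + d <= u -> base u = vtx3 T + ((u - d - d) / d) *: (vtx1 T - vtx3 T).
Proof.
have dp := d0; move=> du; have d1 : d < u by lra.
rewrite /base leNgt d1 /=; case: ifP => // ud.
have -> : u = d + d by apply/eqP; rewrite eq_le du ud.
by rewrite addrK subrr mul0r scale0r addr0 divff ?gt_eqF // scale1r addrC subrK.
Qed.

Let floor_bound t : 0 <= t - 3 * d * (Num.floor (t / (3 * d)))%:~R < 3 * d.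
Proof.
move: p0; move: (3 * d) => P P0; have := floor_itv (t / P) => /andP[].
rewrite ler_pdivlMr // ltr_pdivrMr // rmorphD /= mulrDl mul1r.
by move: (Num.floor _)%:~R => f; rewrite [f * _]mulrC => h1 h2; apply/andP; split; lra.
Qed.

Let floorE (q : int) u : 0 <= u < 3 * d -> Num.floor ((3 * d * q%:~R + u) / (3 * d)) = q.
Proof.
move: p0; move: (3 * d) => P P0 /andP[u0 u1]; apply: floor_def.
rewrite ler_pdivlMr // ltr_pdivrMr // rmorphD /= mulrDl mul1r [q%:~R * _]mulrC.
by set f := P * _; apply/andP; split; lra.
Qed.

Lemma arclength_per t : arclength T (t + 3 * d) = arclength T t.
Proof.
have /andP[b0 b1] := floor_bound t; rewrite !arcE; set q := Num.floor (t / _) in b0 b1 *.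
rewrite (_ : t + 3 * d = 3 * d * (q + 1)%:~R + (t - 3 * d * q%:~R)); last first.
  by rewrite rmorphD /=; ring.
rewrite floorE ?b0 //; congr base; ring.
Qed.

Let arc_base u : 0 <= u <= 3 * d -> arclength T u = base u.
Proof.
move=> /andP[u0]; rewrite le_eqVlt => /predU1P[->|u1].
  rewrite -[3 * d]add0r arclength_per arcE mul0r floor0 mulr0 subr0 base1 ?(ltW d0) //.
  rewrite base3; last by have dp := d0; rewrite add0r; lra.
  rewrite mul0r scale0r addr0 (_ : 0 + 3 * d - d - d = d); last by ring.
  by rewrite divff ?gt_eqF // scale1r addrC subrK.
have := @floorE 0 u; rewrite mulr0 add0r u0 u1 => /(_ isT) fE.
by rewrite arcE fE mulr0 subr0.
Qed.

Lemma arclength_edge1 s : 0 <= s <= 1 ->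
  arclength T (s * d) = vtx1 T + s *: (vtx2 T - vtx1 T).
Proof.
move=> /andP[s0 s1]; have sd : s * d <= d by rewrite ler_piMl // ltW.
have sd0 : 0 <= s * d by rewrite mulr_ge0 // ltW.
by rewrite arc_base ?base1 ?mulfK ?gt_eqF // sd0 /=; lra.
Qed.

Lemma arclength_edge2 s : 0 <= s <= 1 ->
  arclength T (d + s * d) = vtx2 T + s *: (vtx3 T - vtx2 T).
Proof.
move=> /andP[s0 s1]; have sd : s * d <= d by rewrite ler_piMl // ltW.
have sd0 : 0 <= s * d by rewrite mulr_ge0 // ltW.
rewrite arc_base; last by have dp := d0; apply/andP; split; lra.
rewrite base2; last by have dp := d0; apply/andP; split; lra.
by rewrite [d + _]addrC addrK mulfK ?gt_eqF.
Qed.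

Lemma arclength_edge3 s : 0 <= s <= 1 ->
  arclength T (d + d + s * d) = vtx3 T + s *: (vtx1 T - vtx3 T).
Proof.
move=> /andP[s0 s1]; have sd : s * d <= d by rewrite ler_piMl // ltW.
have sd0 : 0 <= s * d by rewrite mulr_ge0 // ltW.
rewrite arc_base; last by have dp := d0; apply/andP; split; lra.
rewrite base3; last by have dp := d0; lra.
rewrite (_ : d + d + s * d - d - d = s * d); last by ring.
by rewrite mulfK ?gt_eqF.
Qed.

Lemma arclength_cases t : exists s, 0 <= s <= 1 /\
  [\/ arclength T t = vtx1 T + s *: (vtx2 T - vtx1 T),
      arclength T t = vtx2 T + s *: (vtx3 T - vtx2 T) |
      arclength T t = vtx3 T + s *: (vtx1 T - vtx3 T)].
Proof.
have /andP[b0 b1] := floor_bound t; rewrite arcE; set u := t - _ in b0 b1 *.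
have [ud|du] := leP u d.
  exists (u / d); split; last by constructor 1; rewrite base1.
  by rewrite divr_ge0 ?(ltW d0) // ler_pdivrMr // mul1r.
have [udd|ddu] := leP u (d + d).
  exists ((u - d) / d); split; last by constructor 2; rewrite base2 // (ltW du) udd.
  by rewrite divr_ge0 ?(ltW d0) ?subr_ge0 ?(ltW du) // ler_pdivrMr // mul1r; lra.
exists ((u - d - d) / d); split; last by constructor 3; rewrite base3 // ltW.
rewrite divr_ge0 ?(ltW d0) ?ler_pdivrMr //=; [by rewrite mul1r; lra|by lra].
Qed.

Let seg x y s t : edist x y = d -> s <= t ->
  edist (x + (s / d) *: (y - x)) (x + (t / d) *: (y - x)) = t - s.
Proof.
move=> xy st; rewrite edist_affine xy -mulrBl normrM distrC.
by rewrite [`|d^-1|]ger0_norm ?invr_ge0 ?(ltW d0) // divfK ?gt_eqF // ger0_norm ?subr_ge0.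
Qed.

Let lip12 s t : 0 <= s -> s <= t -> t <= d -> edist (base s) (base t) <= t - s.
Proof. by move=> s0 st td; rewrite !base1 ?seg //; lra. Qed.

Let lip23 s t : d <= s -> s <= t -> t <= d + d -> edist (base s) (base t) <= t - s.
Proof.
move=> s0 st td; rewrite !base2; try by have dp := d0; apply/andP; split; lra.
by rewrite seg //; lra.
Qed.

Let lip31 s t : d + d <= s -> s <= t -> edist (base s) (base t) <= t - s.
Proof.
move=> s0 st; rewrite !base3 //; last by have dp := d0; lra.
by rewrite seg //; lra.
Qed.

Let base_lip s t : 0 <= s -> s <= t -> t <= 3 * d -> edist (base s) (base t) <= t - s.
Proof.
move=> s0 st t3; have [td|dt] := leP t d; first exact: lip12.
have [sd|ds] := leP s d.
  rewrite (le_trans (edist_tri (base d) _ _)) //.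
  have h1 := lip12 s0 sd (lexx d).
  have [tdd|ddt] := leP t (d + d).
    by have := lip23 (lexx d) (ltW dt) tdd; lra.
  have := edist_tri (base (d + d)) (base d) (base t).
  have dp := d0; have dd : d <= d + d by lra.
  have := lip23 (lexx d) dd (lexx _).
  by have := lip31 (lexx _) (ltW ddt); lra.
have [tdd|ddt] := leP t (d + d); first by apply: lip23 => //; exact: ltW.
have [sdd|dds] := leP s (d + d); last by apply: lip31 => //; exact: ltW.
have := edist_tri (base (d + d)) (base s) (base t).
have := lip23 (ltW ds) sdd (lexx _).
by have := lip31 (lexx _) (ltW ddt); lra.
Qed.

Lemma arclength_lip s t : edist (arclength T s) (arclength T t) <= `|s - t|.
Proof.
wlog st : s t / s <= t.
  move=> W; have [/W//|/ltW/W] := leP s t.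
  by rewrite edistC distrC.
rewrite distrC ger0_norm ?subr_ge0 // !arcE.
have /andP[s0 s1] := floor_bound s; have /andP[t0 t1] := floor_bound t.
set p := Num.floor (s / _) in s0 s1 *; set q := Num.floor (t / _) in t0 t1 *.
have pq : p <= q by apply: le_floor; rewrite ler_pM2r // invr_gt0.
move: pq; rewrite le_eqVlt => /predU1P[pq|pq].
  rewrite pq in s0 s1 *.
  by rewrite (le_trans (base_lip s0 _ (ltW t1))) //; lra.
have pq1 : p%:~R + 1 <= q%:~R :> R.
  by rewrite -[1]/(1%:~R) -rmorphD /= ler_int -lezD1 in pq *.
have := ler_wpM2l (ltW p0) pq1; rewrite mulrDr mulr1.
(* Parameters in different periods are compared through the first vertex, where one period ends and
   the next begins. *)
have b3 : base (3 * d) = base 0.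
  rewrite base3; last by have dp := d0; lra.
  rewrite base1 ?(ltW d0) // mul0r scale0r addr0 (_ : 3 * d - d - d = d); last by ring.
  by rewrite divff ?gt_eqF // scale1r addrC subrK.
have h1 := base_lip s0 (ltW s1) (lexx _); rewrite b3 in h1.
have h2 := base_lip (lexx 0) t0 (ltW t1).
have := edist_tri (base 0) (base (s - 3 * d * p%:~R)) (base (t - 3 * d * q%:~R)).
by move: h1 h2; set X := edist _ _; set Y := edist _ _; set Z := edist _ _; lra.
Qed.

End arc.

End equilateral.

(** * Increments of the argument along segments *)

Section increments.
Variable R : realType.
Local Notation E := 'rV[R]_3.
Implicit Types (x y a b : E) (T : triangle R) (d : R) (u : E -> R[i]).

(* c is the increase of the argument of u along the segment from a to b. *)
Definition has_inc u a b (c : R) := exists f : R -> R, [/\ {within `[0, 1], continuous f},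
  forall s, s \in `[0, 1] -> u (a + s *: (b - a)) = expi (f s) & f 1 - f 0 = c].

Definition inc u a b : R := xget 0 [set c | has_inc u a b c].

Lemma has_inc_unique u a b c c' : has_inc u a b c -> has_inc u a b c' -> c = c'.
Proof.
move=> [f [cf uf <-]] [g [cg ug <-]]; apply: (lift_unique ler01 cf cg) => s s01.
by rewrite -uf // -ug.
Qed.

Lemma incE u a b c : has_inc u a b c -> inc u a b = c.
Proof.
move=> h; rewrite /inc; case: xgetP => [c' -> h'|/(_ c)//].
exact: has_inc_unique h' h.
Qed.

Lemma has_inc_rev u a b c : has_inc u a b c -> has_inc u b a (- c).
Proof.
move=> [f [cf uf fc]]; exists (fun s => f (1 - s)); split.
- apply/subspace_continuousP => s /=; rewrite in_itv /= => /andP[s0 s1].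
  have s01' : `[0, 1]%classic (1 - s) by rewrite /= in_itv /=; apply/andP; split; lra.
  move/subspace_continuousP : cf => /(_ _ s01') cf.
  apply/cvgrPdist_lt => e e0; move/cvgrPdist_lt : cf => /(_ _ e0).
  rewrite !near_withinE => /nbhs_ballP[d /= d0 hd].
  apply/nbhs_ballP; exists d => // y; rewrite /ball /= => sy; rewrite in_itv /= => /andP[y0 y1].
  apply: hd; last by rewrite /= in_itv /=; apply/andP; split; lra.
  by rewrite /ball /= opprB addrC addrA subrK distrC.
- move=> s; rewrite in_itv /= => /andP[s0 s1]; rewrite -uf.
    by congr u; apply/rowP => k; rewrite !mxE; ring.
  by rewrite in_itv /=; apply/andP; split; lra.
by rewrite subrr subr0 -fc opprB.
Qed.

Lemma inc_rev u a b c : has_inc u a b c -> inc u b a = - inc u a b.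
Proof. by move=> h; rewrite (incE h) (incE (has_inc_rev h)). Qed.

(** One lift along the whole triangle, taken from the factorization of [u], restricts to lifts along
    the edges. Hence [inc] is a genuine increment there, and it is antisymmetric. *)
Lemma triangle_winding u T d : equilateral T d ->
  CX [set: R] (fun t => u (arclength T t)) -> (forall t, cmod (u (arclength T t)) = 1) ->
  [/\ 2 * pi * (winding u T)%:~R =
        inc u (vtx1 T) (vtx2 T) + inc u (vtx2 T) (vtx3 T) + inc u (vtx3 T) (vtx1 T),
      inc u (vtx2 T) (vtx1 T) = - inc u (vtx1 T) (vtx2 T),
      inc u (vtx3 T) (vtx2 T) = - inc u (vtx2 T) (vtx3 T) &
      inc u (vtx1 T) (vtx3 T) = - inc u (vtx3 T) (vtx1 T)].
Proof.
move=> Td uc u1; have [d0 _ _ _] := Td.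
pose r := 3 * d / (2 * pi).
have pi20 : 0 < 2 * pi :> R by rewrite mulr_gt0 // pi_gt0.
have r0 : 0 < r by rewrite divr_gt0 // mulr_gt0.
have perE : 2 * pi * r = 3 * d by rewrite /r mulrC divfK // gt_eqF.
have uC : circle_fun r (fun t => u (arclength T t)).
  by split => // t; rewrite perE (arclength_per Td).
have [w [h [[_ [th [thc thp thE]]] hE]]] := circle_factor r0 uC u1.
pose f t := w%:~R * t / r + th t.
have uf t : u (arclength T t) = expi (f t).
  have h1 : cmod (h t) = 1 by have := u1 t; rewrite hE cmodM cmod_emode mul1r.
  by rewrite hE thE h1 mul1r expiD.
have fc : continuous f.
  move=> t; apply: cvgD; last exact: thc.
  by apply: cvgM; [apply: cvgM; [exact: cvg_cst|exact: cvg_id]|exact: cvg_cst].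
have f3 : f (3 * d) - f 0 = 2 * pi * w%:~R.
  rewrite /f -{2}[3 * d]add0r -{2}perE thp -perE.
  by field; rewrite gt_eqF.
have seg (g : R -> R) a b : continuous g ->
    (forall s, 0 <= s <= 1 -> u (a + s *: (b - a)) = expi (f (g s))) ->
    has_inc u a b (f (g 1) - f (g 0)).
  move=> gc gE; exists (f \o g); split => //.
    by apply: continuous_subspaceT => s; apply: continuous_comp; [exact: gc|exact: fc].
have lc (c0 : R) : continuous (fun s : R => c0 + s * d).
  move=> s; apply: cvgD; first exact: cvg_cst.
  by apply: cvgM; [exact: cvg_id|exact: cvg_cst].
have h12 : has_inc u (vtx1 T) (vtx2 T) (f (0 + 1 * d) - f (0 + 0 * d)).
  by apply: (seg _ _ _ (lc 0)) => s s01; rewrite -(arclength_edge1 Td s01) uf add0r.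
have h23 : has_inc u (vtx2 T) (vtx3 T) (f (d + 1 * d) - f (d + 0 * d)).
  by apply: (seg _ _ _ (lc d)) => s s01; rewrite -(arclength_edge2 Td s01) uf.
have h31 : has_inc u (vtx3 T) (vtx1 T) (f (d + d + 1 * d) - f (d + d + 0 * d)).
  by apply: (seg _ _ _ (lc (d + d))) => s s01; rewrite -(arclength_edge3 Td s01) uf.
split; [|exact: inc_rev h12|exact: inc_rev h23|exact: inc_rev h31].
have -> : winding u T = w.
  have p0 : 0 <= perimeter T by rewrite (perimeter_equilateral Td) mulr_ge0 // ltW.
  apply: (winding_lift (f := f) p0); rewrite ?(perimeter_equilateral Td) //.
  exact: continuous_subspaceT.
rewrite (incE h12) (incE h23) (incE h31) -f3 !mul1r !mul0r !addr0 add0r.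
rewrite (_ : d + d + d = 3 * d); last by ring.
by move: (f 0) (f d) (f (d + d)) (f (3 * d)) => *; ring.
Qed.

End increments.

(** * Orientation of faces and cancellation of circulations *)

Section determinants.
Variable R : realType.
Local Notation E := 'rV[R]_3.
Implicit Types (a b c : E) (t : tetra R).

Let j0 : 'I_3 := @Ordinal 3 0 isT.
Let j1 : 'I_3 := @Ordinal 3 1 isT.
Let j2 : 'I_3 := @Ordinal 3 2 isT.
Let o0 : 'I_4 := @Ordinal 4 0 isT.
Let o1 : 'I_4 := @Ordinal 4 1 isT.
Let o2 : 'I_4 := @Ordinal 4 2 isT.
Let o3 : 'I_4 := @Ordinal 4 3 isT.

Definition det3 a b c : R :=
  a 0 j0 * (b 0 j1 * c 0 j2 - b 0 j2 * c 0 j1)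
  - a 0 j1 * (b 0 j0 * c 0 j2 - b 0 j2 * c 0 j0)
  + a 0 j2 * (b 0 j0 * c 0 j1 - b 0 j1 * c 0 j0).

Lemma sum3 (F : 'I_3 -> R) : \sum_i F i = F j0 + F j1 + F j2.
Proof.
rewrite !big_ord_recl big_ord0 addr0 addrA.
by congr (F _ + F _ + F _); apply: val_inj.
Qed.

Lemma sum4 (F : 'I_4 -> R) : \sum_i F i = F o0 + F o1 + F o2 + F o3.
Proof.
rewrite !big_ord_recl big_ord0 addr0 !addrA.
by congr (F _ + F _ + F _ + F _); apply: val_inj.
Qed.

Lemma det_mx22 (M : 'M[R]_2) : \det M = M 0 0 * M 1 1 - M 0 1 * M 1 0.
Proof.
rewrite (expand_det_row _ 0) !big_ord_recl big_ord0 addr0 /cofactor !det_mx11 !mxE.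
rewrite /= expr0 expr1 mul1r mulN1r mulrN.
by congr (_ * M _ _ - M _ _ * M _ _); apply: val_inj.
Qed.

Lemma det_col_mx3 a b c : \det (col_mx a (col_mx b c) : 'M[R]_3) = det3 a b c.
Proof.
set M : 'M[R]_3 := col_mx a (col_mx b c).
have Ma j : M j0 j = a 0 j.
  by rewrite /M mxE; case: splitP => [i _|i] //=; rewrite ord1.
have Mb j : M j1 j = b 0 j.
  rewrite /M mxE; case: splitP => [i|i /=]; first by rewrite ord1.
  move=> /eqP; rewrite eqSS => /eqP i0; rewrite mxE; case: splitP => [i' _|i' /= i1].
    by rewrite ord1.
  by rewrite -i0 in i1.
have Mc j : M j2 j = c 0 j.
  rewrite /M mxE; case: splitP => [i|i /=]; first by rewrite ord1.
  move=> /eqP; rewrite eqSS => /eqP i0; rewrite mxE; case: splitP => [i' /= i1|i' _].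
    by move: i1; rewrite ord1 -i0.
  by rewrite ord1.
clearbody M; rewrite (expand_det_row _ j0) sum3 /cofactor !det_mx22 !mxE.
have l00 : lift j0 0 = j1 by apply: val_inj.
have l01 : lift j0 1 = j2 by apply: val_inj.
have l10 : lift j1 0 = j0 by apply: val_inj.
have l11 : lift j1 1 = j2 by apply: val_inj.
have l20 : lift j2 0 = j0 by apply: val_inj.
have l21 : lift j2 1 = j1 by apply: val_inj.
rewrite l00 l01 l10 l11 l20 l21.
by rewrite !Ma !Mb !Mc /det3 /=; ring.
Qed.

Lemma lift4 (t : tetra R) :
  [/\ [/\ t (lift o0 (inord 0)) = t o1, t (lift o0 (inord 1)) = t o2 & t (lift o0 (inord 2)) = t o3],
      [/\ t (lift o1 (inord 0)) = t o0, t (lift o1 (inord 1)) = t o2 & t (lift o1 (inord 2)) = t o3],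
      [/\ t (lift o2 (inord 0)) = t o0, t (lift o2 (inord 1)) = t o1 & t (lift o2 (inord 2)) = t o3] &
      [/\ t (lift o3 (inord 0)) = t o0, t (lift o3 (inord 1)) = t o1 & t (lift o3 (inord 2)) = t o2]].
Proof.
have H (k : 'I_4) (i : nat) (m : 'I_4) : (i < 3)%N -> bump k i = m -> t (lift k (inord i)) = t m.
  by move=> i3 km; congr t; apply: val_inj; rewrite /= inordK.
by split; split; apply: H.
Qed.

Definition volume t : R := det3 (t o1 - t o0) (t o2 - t o0) (t o3 - t o0).

Definition face_det (c : E) (T : triangle R) : R :=
  det3 (vtx2 T - vtx1 T) (vtx3 T - vtx1 T) (vtx1 T - c).

Lemma outwardE c T : outward c T = if 0 < face_det c T then T else reverse T.
Proof. by rewrite /outward det_col_mx3. Qed.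

Definition face0 t (k : 'I_4) : triangle R := let a i := t (lift k (inord i)) in
  Triangle (a 0%N) (a 1%N) (a 2%N).
Definition octa_face0 t (k : 'I_4 + 'I_4) : triangle R :=
  match k with
  | inl k => let a i := t (lift k (inord i)) in
      Triangle (midpoint (a 0%N) (a 1%N)) (midpoint (a 1%N) (a 2%N))
               (midpoint (a 2%N) (a 0%N))
  | inr k => let a i := t (lift k (inord i)) in
      Triangle (midpoint (t k) (a 0%N)) (midpoint (t k) (a 1%N))
               (midpoint (t k) (a 2%N))
  end.

Lemma faceE t k : face t k = outward (barycenter t) (face0 t k). Proof. by []. Qed.
Lemma octa_faceE t k : octa_face t k = outward (barycenter t) (octa_face0 t k).
Proof. by case: k. Qed.

Let bary4 t : barycenter t = 4^-1 *: (t o0 + t o1 + t o2 + t o3).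
Proof.
rewrite /barycenter; congr (_ *: _); apply/rowP => j; rewrite !mxE summxE.
by rewrite sum4.
Qed.

(** All determinants are the same multiple of the volume up to a sign that alternates with the
    label. Hence reversing the sign of the volume reverses all orientations together, and the
    cancellation below does not depend on it. *)
Lemma face_dets t :
  [/\ face_det (barycenter t) (face0 t o0) = volume t / 4,
      face_det (barycenter t) (face0 t o1) = - (volume t / 4),
      face_det (barycenter t) (face0 t o2) = volume t / 4 &
      face_det (barycenter t) (face0 t o3) = - (volume t / 4)].
Proof.
have [[a b c] [d e f] [g h i] [j k m]] := lift4 t.
rewrite /face_det /face0 /= a b c d e f g h i j k m bary4.
by split; rewrite /volume /det3 !mxE; field.
Qed.

Lemma octa_dets t :
  [/\ face_det (barycenter t) (octa_face0 t (inl o0)) = volume t / 16,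
      face_det (barycenter t) (octa_face0 t (inl o1)) = - (volume t / 16),
      face_det (barycenter t) (octa_face0 t (inl o2)) = volume t / 16 &
      face_det (barycenter t) (octa_face0 t (inl o3)) = - (volume t / 16)] /\
  [/\ face_det (barycenter t) (octa_face0 t (inr o0)) = - (volume t / 16),
      face_det (barycenter t) (octa_face0 t (inr o1)) = volume t / 16,
      face_det (barycenter t) (octa_face0 t (inr o2)) = - (volume t / 16) &
      face_det (barycenter t) (octa_face0 t (inr o3)) = volume t / 16].
Proof.
have [[a b c] [d e f] [g h i] [j k m]] := lift4 t.
rewrite /face_det /octa_face0 /= a b c d e f g h i j k m bary4 /midpoint.
by split; split; rewrite /volume /det3 !mxE; field.
Qed.

(** The square of the volume is the Gram determinant of the edge vectors, here [l^6 / 2]. *)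
Lemma volume_neq0 t l : regular t l -> volume t != 0.
Proof.
move=> tl; have [l0 _] := tl.
have gram a b c : det3 a b c ^+ 2 = dotp a a * (dotp b b * dotp c c - dotp b c ^+ 2)
   - dotp a b * (dotp a b * dotp c c - dotp b c * dotp a c)
   + dotp a c * (dotp a b * dotp b c - dotp b b * dotp a c).
  by rewrite /dotp !sum3 /det3; ring.
apply/eqP => v0; have := gram (t o1 - t o0) (t o2 - t o0) (t o3 - t o0).
rewrite -/(volume t) v0 !(regular_dotp _ _ _ tl) /= expr0n /= => /eqP.
rewrite eq_sym (_ : _ - _ + _ = l ^+ 6 / 2).
  by rewrite mulf_eq0 expf_eq0 /= gt_eqF //= gt_eqF // invr_gt0.
by field.
Qed.

Section cancellation.
Variable I : E -> E -> R.

Definition circulation (T : triangle R) : R :=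
  I (vtx1 T) (vtx2 T) + I (vtx2 T) (vtx3 T) + I (vtx3 T) (vtx1 T).

Definition edge_antisym (T : triangle R) := [/\ I (vtx2 T) (vtx1 T) = - I (vtx1 T) (vtx2 T),
  I (vtx3 T) (vtx2 T) = - I (vtx2 T) (vtx3 T) & I (vtx1 T) (vtx3 T) = - I (vtx3 T) (vtx1 T)].

Definition signed_circulation c T :=
  if 0 < face_det c T then circulation T else - circulation T.

Let sgnE c T (x : R) : face_det c T = x -> x != 0 ->
  signed_circulation c T = Num.sg x * circulation T.
Proof.
rewrite /signed_circulation => -> x0; have [h|h|h] := ltgtP 0 x.
- by rewrite gtr0_sg // mul1r.
- by rewrite ltr0_sg // mulN1r.
- by rewrite -h eqxx in x0.
Qed.

(** Each edge lies in two faces, and their outward orientations traverse it in opposite directions;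
    this is algebra for any edge function [I] that is antisymmetric on these edges. *)
Lemma face_cancel t : volume t != 0 -> (forall k, edge_antisym (face0 t k)) ->
  \sum_k signed_circulation (barycenter t) (face0 t k) = 0.
Proof.
move=> v0 anti; have [f0 f1 f2 f3] := face_dets t.
have v4 : volume t / 4 != 0 by rewrite mulf_neq0 // invr_eq0.
have v4N : - (volume t / 4) != 0 by rewrite oppr_eq0.
rewrite sum4 (sgnE f0 v4) (sgnE f1 v4N) (sgnE f2 v4) (sgnE f3 v4N) sgrN.
have := anti o0; have := anti o1; have := anti o2; have := anti o3.
have [[a b c] [d e f] [g h i] [j k m]] := lift4 t.
rewrite /edge_antisym /circulation /face0 /= a b c d e f g h i j k m.
move=> [x1 x2 x3] [y1 y2 y3] [z1 z2 z3] [w1 w2 w3].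
set s := Num.sg _; transitivity (s * 0); last by rewrite mulr0.
rewrite !mulNr -!mulrN -!mulrDr; congr (_ * _); lra.
Qed.

Lemma octa_cancel t : volume t != 0 -> (forall k, edge_antisym (octa_face0 t k)) ->
  \sum_k signed_circulation (barycenter t) (octa_face0 t (inl k)) +
  \sum_k signed_circulation (barycenter t) (octa_face0 t (inr k)) = 0.
Proof.
move=> v0 anti; have [[f0 f1 f2 f3] [g0 g1 g2 g3]] := octa_dets t.
have v4 : volume t / 16 != 0 by rewrite mulf_neq0 // invr_eq0.
have v4N : - (volume t / 16) != 0 by rewrite oppr_eq0.
rewrite !sum4 (sgnE f0 v4) (sgnE f1 v4N) (sgnE f2 v4) (sgnE f3 v4N).
rewrite (sgnE g0 v4N) (sgnE g1 v4) (sgnE g2 v4N) (sgnE g3 v4) sgrN.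
have := anti (inl o0); have := anti (inl o1); have := anti (inl o2); have := anti (inl o3).
have [[a b c] [d e f] [g h i] [j k m]] := lift4 t.
have mC (x y : E) : midpoint x y = midpoint y x by rewrite /midpoint addrC.
rewrite /edge_antisym /circulation /octa_face0 /= a b c d e f g h i j k m.
(* A vertex of the octahedron occurs as a midpoint written in both orders; one spelling is fixed so
   that the edges match. *)
rewrite (mC (t o3) (t o0)) (mC (t o3) (t o1)) (mC (t o3) (t o2)) (mC (t o2) (t o0)).
rewrite (mC (t o2) (t o1)) (mC (t o1) (t o0)).
move=> [x1 x2 x3] [y1 y2 y3] [z1 z2 z3] [w1 w2 w3].
set s := Num.sg _; transitivity (s * 0); last by rewrite mulr0.
rewrite !mulNr -!mulrN -!mulrDr; congr (_ * _); lra.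
Qed.

End cancellation.

End determinants.

(** * Edges of all levels *)

Section edges.
Variable R : realType.
Local Notation E := 'rV[R]_3.
Variables (v : tetra R) (l : R).
Hypothesis vl : regular v l.
Implicit Types (a b : E) (T : triangle R) (w : seq 'I_4) (n : nat).

Definition edge n a b := exists w i j,
  [/\ size w = n, i != j, a = subtetra v w i & b = subtetra v w j].

Lemma edge_sym n a b : edge n a b -> edge n b a.
Proof. by move=> [w [i [j [sw ij -> ->]]]]; exists w, j, i; rewrite eq_sym. Qed.

Definition edge_triangle n T :=
  [/\ edge n (vtx1 T) (vtx2 T), edge n (vtx2 T) (vtx3 T) & edge n (vtx3 T) (vtx1 T)].

Lemma edge_triangle_reverse n T : edge_triangle n T -> edge_triangle n (reverse T).
Proof. by move=> [h1 h2 h3]; split; apply: edge_sym. Qed.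

Lemma edge_triangle_outward n c T : edge_triangle n T -> edge_triangle n (outward c T).
Proof. by move=> h; rewrite outwardE; case: ifP => // _; exact: edge_triangle_reverse. Qed.

Lemma edge_length n a b : edge n a b -> edist a b = l / 2 ^+ n.
Proof. by move=> [w [i [j [<- ij -> ->]]]]; have [_] := regular_sub w vl; apply. Qed.

Lemma edge_triangle_equilateral n T : edge_triangle n T -> equilateral T (l / 2 ^+ n).
Proof.
move=> [h1 h2 h3]; have [l0 _] := vl.
by split; [rewrite divr_gt0 // exprn_gt0|exact: edge_length..].
Qed.

Lemma edge_in_SP n a b (s : R) : edge n a b -> 0 <= s <= 1 -> SP v (a + s *: (b - a)).
Proof. by move=> [w [i [j [_ _ -> ->]]]] s01; exact: (@edge_SP _ v w i j s s01). Qed.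

Lemma edge_triangle_SP n T t : edge_triangle n T -> SP v (arclength T t).
Proof.
move=> Tn; have [h1 h2 h3] := Tn.
have [s [s01 h]] := arclength_cases (edge_triangle_equilateral Tn) t.
by case: h => ->; apply: edge_in_SP s01; eassumption.
Qed.

Let lift_neq (k : 'I_4) (i j : nat) : (i < 3)%N -> (j < 3)%N -> i != j ->
  lift k (inord i) != lift k (inord j) :> 'I_4.
Proof.
move=> i3 j3 ij; rewrite (inj_eq lift_inj) -val_eqE /= !inordK //.
Qed.

Lemma edge_triangle_face w k : edge_triangle (size w) (face0 (subtetra v w) k).
Proof.
by split; rewrite /face0 /=; [exists w, (lift k (inord 0)), (lift k (inord 1))
  |exists w, (lift k (inord 1)), (lift k (inord 2))
  |exists w, (lift k (inord 2)), (lift k (inord 0))]; split => //; exact: lift_neq.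
Qed.

Lemma edge_triangle_octa w k : edge_triangle (size w).+1 (octa_face0 (subtetra v w) k).
Proof.
have mC (x y : E) : midpoint x y = midpoint y x by rewrite /midpoint addrC.
have H c i j : i != j -> edge (size w).+1 (midpoint (subtetra v w c) (subtetra v w i))
    (midpoint (subtetra v w c) (subtetra v w j)).
  by move=> ij; exists (rcons w c), i, j; rewrite size_rcons subtetra_rcons.
case: k => k; split; rewrite /octa_face0 /=; [rewrite (mC (subtetra v w (lift k (inord 0))))
  |rewrite (mC (subtetra v w (lift k (inord 1))))|rewrite (mC (subtetra v w (lift k (inord 2))))
  |idtac..]; by apply: H; apply: lift_neq.
Qed.

Definition level (d : ZPT_index) : nat := if d is inr (w, _) then (size w).+1 else 0.

Lemma Delta_edge_triangle d : edge_triangle (level d) (Delta v d).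
Proof.
case: d => [k|[w k]] /=.
  by rewrite faceE; apply: edge_triangle_outward; exact: (edge_triangle_face [::]).
by rewrite octa_faceE; apply: edge_triangle_outward; exact: edge_triangle_octa.
Qed.

Section windings.
Variable u : E -> R[i].
Hypotheses (uX : CX (SP v) u) (u1 : forall x, SP v x -> cmod (u x) = 1).

Lemma edge_triangle_CX n T : edge_triangle n T -> CX [set: R] (fun t => u (arclength T t)).
Proof.
move=> Tn; apply/CXP => t _ e e0; move/CX_edist : uX => /(_ _ (edge_triangle_SP t Tn) _ e0).
move=> [d d0 hd]; apply/nbhs_ballP; exists d => //= s; rewrite /ball /= => ts _.
apply: hd; first exact: edge_triangle_SP Tn.
exact: le_lt_trans (arclength_lip (edge_triangle_equilateral Tn) t s) ts.
Qed.

Lemma edge_triangle_winding n T : edge_triangle n T ->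
  2 * pi * (winding u T)%:~R = circulation (inc u) T /\ edge_antisym (inc u) T.
Proof.
move=> Tn; have [] := triangle_winding (edge_triangle_equilateral Tn) (edge_triangle_CX Tn).
  by move=> t; apply: u1; exact: edge_triangle_SP Tn.
by move=> -> h1 h2 h3; split.
Qed.

Let pi2 : 2 * pi != 0 :> R.
Proof. by rewrite mulf_neq0 // gt_eqF // pi_gt0. Qed.

Lemma winding_reverse n T : edge_triangle n T -> winding u (reverse T) = - winding u T.
Proof.
move=> Tn; have [h [h1 h2 h3]] := edge_triangle_winding Tn.
have [h' _] := edge_triangle_winding (edge_triangle_reverse Tn).
apply/eqP; rewrite -(eqr_int R); apply/eqP/(mulfI pi2); rewrite h' rmorphN mulrN h.
by move: h1 h2 h3; rewrite /circulation /=; lra.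
Qed.

Lemma winding_outward n c T : edge_triangle n T ->
  2 * pi * (winding u (outward c T))%:~R = signed_circulation (inc u) c T.
Proof.
move=> Tn; have [h _] := edge_triangle_winding Tn.
rewrite outwardE /signed_circulation; case: ifP => // _.
by rewrite (winding_reverse Tn) rmorphN mulrN h.
Qed.

Let volume_sub w : volume (subtetra v w) != 0.
Proof. exact: volume_neq0 (regular_sub w vl). Qed.

Lemma winding_faces : \sum_k winding u (face v k) = 0.
Proof.
apply/eqP; rewrite -(eqr_int R) raddf_sum; apply/eqP/(mulfI pi2); rewrite mulr0 mulr_sumr.
rewrite -[RHS](@face_cancel R (inc u) v) //.
- by apply: eq_bigr => k _; rewrite faceE; exact: (winding_outward _ (edge_triangle_face [::] k)).
- exact: (volume_sub [::]).
- by move=> k; have [] := edge_triangle_winding (edge_triangle_face [::] k).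
Qed.

Lemma winding_octa_faces w :
  \sum_k winding u (octa_face (subtetra v w) (inl k)) +
  \sum_k winding u (octa_face (subtetra v w) (inr k)) = 0.
Proof.
apply/eqP; rewrite -(eqr_int R) raddfD !raddf_sum; apply/eqP/(mulfI pi2).
rewrite mulr0 mulrDr !mulr_sumr -[RHS](@octa_cancel R (inc u) (subtetra v w)) //.
- congr (_ + _); apply: eq_bigr => k _.
    exact: (winding_outward _ (edge_triangle_octa w (inl k))).
  exact: (winding_outward _ (edge_triangle_octa w (inr k))).
- by move=> k; have [] := edge_triangle_winding (edge_triangle_octa w k).
Qed.

End windings.

Section edge_lipschitz.
Variable a : E -> R[i].

Definition lip_edge (x y : E) := forall s t : R, 0 <= s <= 1 -> 0 <= t <= 1 ->
  cmod (a (x + s *: (y - x)) - a (x + t *: (y - x))) <= `|s - t| * edist x y.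

Lemma lip_edge_sym x y : lip_edge x y -> lip_edge y x.
Proof.
move=> h s t /andP[s0 s1] /andP[t0 t1].
have E (z : R) : y + z *: (x - y) = x + (1 - z) *: (y - x).
  by apply/rowP => i; rewrite !mxE; ring.
rewrite !E edistC (_ : s - t = - ((1 - s) - (1 - t))); last by ring.
by rewrite normrN; apply: h; apply/andP; split; lra.
Qed.

Lemma lip_edge_mid x y : lip_edge x y -> lip_edge x (midpoint x y).
Proof.
move=> h s t /andP[s0 s1] /andP[t0 t1].
have E (z : R) : x + z *: (midpoint x y - x) = x + (z / 2) *: (y - x).
  by apply/rowP => i; rewrite /midpoint !mxE; field.
have E' : edist x (midpoint x y) = 2^-1 * edist x y.
  have := edist_affine x y 0 2^-1; rewrite scale0r addr0 sub0r normrN ger0_norm ?invr_ge0 // => <-.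
  by congr edist; have := E 1; rewrite scale1r addrC subrK mul1r.
rewrite !E E' mulrA (_ : `|s - t| * 2^-1 = `|s / 2 - t / 2|).
  by apply: h; apply/andP; split; lra.
by rewrite -mulrBl normrM [`|2^-1|]ger0_norm ?invr_ge0.
Qed.

Lemma lip_edge_triangle T d : equilateral T d ->
  (forall s t, cmod (a (arclength T s) - a (arclength T t)) <= `|s - t|) ->
  [/\ lip_edge (vtx1 T) (vtx2 T), lip_edge (vtx2 T) (vtx3 T) & lip_edge (vtx3 T) (vtx1 T)].
Proof.
move=> Td aT; have [d0 d1 d2 d3] := Td.
have n (s t : R) : `|s - t| * d = `|s * d - t * d|.
  by rewrite -mulrBl normrM [`|d|]gtr0_norm.
split => s t s01 t01.
- by rewrite -!(arclength_edge1 Td) // d1 n; exact: aT.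
- rewrite -!(arclength_edge2 Td) // d2 n (_ : s * d - t * d = (d + s * d) - (d + t * d)); last by ring.
  exact: aT.
- rewrite -!(arclength_edge3 Td) // d3 n.
  rewrite (_ : s * d - t * d = (d + d + s * d) - (d + d + t * d)); last by ring.
  exact: aT.
Qed.

Hypothesis aD : forall d s t,
  cmod (a (arclength (Delta v d) s) - a (arclength (Delta v d) t)) <= `|s - t|.

Let lip_outward c d T : Delta v d = outward c T -> [/\ lip_edge (vtx1 T) (vtx2 T),
  lip_edge (vtx2 T) (vtx3 T) & lip_edge (vtx3 T) (vtx1 T)].
Proof.
move=> dT; have := lip_edge_triangle (edge_triangle_equilateral (Delta_edge_triangle d)) (@aD d).
rewrite dT outwardE; case: ifP => _ //= -[h1 h2 h3].
by split; apply: lip_edge_sym.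
Qed.

Let three (P : 'I_4 -> 'I_4 -> Prop) (k i j : 'I_4) : (forall i j, P i j -> P j i) ->
  P (lift k (inord 0)) (lift k (inord 1)) -> P (lift k (inord 1)) (lift k (inord 2)) ->
  P (lift k (inord 2)) (lift k (inord 0)) -> k != i -> k != j -> i != j -> P i j.
Proof.
move=> Ps P01 P12 P20 /unlift_some[i' -> _] /unlift_some[j' -> _].
have E (m : 'I_3) : [\/ m = inord 0, m = inord 1 | m = inord 2].
  by case: m => -[|[|[|//]]] h; [apply: Or31|apply: Or32|apply: Or33]; apply: val_inj; rewrite /= inordK.
by case: (E i') => ->; case: (E j') => ->; rewrite ?eqxx // => _; by [|apply: Ps].
Qed.

(** In the corner [c], the edges at the vertex [c] are halves of edges of the parent, and the other
    three bound the octahedron face [inr c]. At level 0 the edge lies on the face opposite to a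
    third vertex [k]. *)
Lemma lip_edge_sub w i j : i != j -> lip_edge (subtetra v w i) (subtetra v w j).
Proof.
elim/last_ind: w i j => [|w c IH] i j ij.
  have [k [ki kj]] : exists k : 'I_4, k != i /\ k != j.
    have := leq_card_setU [set i] [set j]; rewrite !cards1 => h.
    have /card_gt0P[k] : (0 < #|~: ([set i] :|: [set j])|)%N.
      by rewrite cardsCs finset.setCK card_ord subn_gt0 (leq_ltn_trans h).
    by rewrite !inE negb_or => /andP[ki kj]; exists k.
  have [h1 h2 h3] := lip_outward (erefl : Delta v (inl k) = outward (barycenter v) (face0 v k)).
  by apply: (@three (fun i j => lip_edge (v i) (v j)) k) => // ? ?; exact: lip_edge_sym.
rewrite subtetra_rcons; have [ci|ci] := eqVneq c i.
  by subst c; rewrite corner_self; apply: lip_edge_mid; exact: IH.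
have [cj|cj] := eqVneq c j.
  by subst c; rewrite corner_self; apply/lip_edge_sym/lip_edge_mid; apply: IH; rewrite eq_sym.
have [h1 h2 h3] := lip_outward (octa_faceE (subtetra v w) (inr c) :
  Delta v (inr (w, inr c)) = outward (barycenter (subtetra v w)) (octa_face0 (subtetra v w) (inr c))).
by apply: (@three (fun i j => lip_edge (corner _ c i) (corner _ c j)) c) => // ? ?; exact: lip_edge_sym.
Qed.

End edge_lipschitz.
End edges.

(** * The geodesic distance *)

Section curves.
Variable R : realType.
Local Notation E := 'rV[R]_3.

(** At the supremum of the good parameters, the first half of the local hypothesis shows that it is
    itself good and the second half passes beyond it. *)
Lemma interval_induction (S : R -> Prop) : S 0 ->
  (forall t, 0 <= t <= 1 -> exists2 d : R, 0 < d & forall s, 0 <= s <= 1 -> `|s - t| < d ->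
     (s <= t -> S s -> S t) /\ (t <= s -> S t -> S s)) -> S 1.
Proof.
move=> S0 h; pose A := [set s : R | 0 <= s <= 1 /\ S s].
have A0 : A 0 by split => //; rewrite lexx ler01.
have ubA : ubound A 1 by move=> s [/andP[]].
have supA : has_sup A by split; [exists 0|exists 1].
have T01 : 0 <= sup A <= 1.
  by rewrite (ub_le_sup (proj2 supA) A0) /= ge_sup //; exists 0.
have [d d0 hd] := h _ T01; have [s [s01 Ss] sT] := sup_adherent d0 supA.
have sle : s <= sup A by exact: (ub_le_sup (proj2 supA)).
have ST : S (sup A).
  have [] := hd s s01 _; last by move=> + _; apply.
  by rewrite distrC ger0_norm ?subr_ge0 //; lra.
have [T1|T1] := leP 1 (sup A).
  by move: ST; have -> : sup A = 1 by apply/eqP; rewrite eq_le T1; case/andP: T01 => _ ->.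
case/andP: T01 => T0 _.
pose t := Num.min 1 (sup A + d / 2).
have d2 : 0 < d / 2 by rewrite divr_gt0.
have Tt : sup A < t by rewrite lt_min T1 ltrDl.
have t01 : 0 <= t <= 1 by rewrite (le_trans T0 (ltW Tt)) ge_min lexx.
have td : `|t - sup A| < d.
  rewrite gtr0_norm ?subr_gt0 // ltrBlDl gt_min; apply/orP; right; lra.
have [_ /(_ (ltW Tt) ST) St] := hd t t01 td.
have : t <= sup A by apply: (ub_le_sup (proj2 supA)).
by rewrite leNgt Tt.
Qed.

(** McShane's formula; over finitely many points the infimum is a minimum. *)
Lemma lipschitz_extension n (p : 'I_n.+1 -> E) (al : 'I_n.+1 -> R) :
  (forall i j, `|al i - al j| <= edist (p i) (p j)) ->
  exists b : E -> R, (forall i, b (p i) = al i) /\ forall x y, `|b x - b y| <= edist x y.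
Proof.
move=> h; pose F x i := al i + edist x (p i).
pose m x := [arg min_(i < ord0) F x i]%O.
have mP x j : F x (m x) <= F x j by rewrite /m; case: arg_minP => // i _; apply.
have L x y : F x (m x) <= F y (m y) + edist x y.
  by rewrite (le_trans (mP x (m y))) // /F -addrA lerD2l addrC; exact: edist_tri.
exists (fun x => F x (m x)); split => [i|x y].
  apply/eqP; rewrite eq_le (le_trans (mP _ i)) ?{1}/F ?edistxx ?addr0 //=.
  by have := ler_norm (al i - al (m (p i))); have := h i (m (p i)); rewrite /F; lra.
by rewrite ler_norml; have := L x y; have := L y x; rewrite (edistC y x); lra.
Qed.

Variables (v : tetra R) (l : R).
Hypothesis vl : regular v l.
Local Notation cell w := (solid (subtetra v w)).

Lemma curve_length_bound (al : E -> R) n (g : R -> E) :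
  (forall w i j, size w = n ->
     `|al (subtetra v w i) - al (subtetra v w j)| <= edist (subtetra v w i) (subtetra v w j)) ->
  {within `[0, 1], continuous g} -> g @` `[0, 1] `<=` SP v ->
  exists b : E -> R, (`|b (g 1) - b (g 0)|%:E <= curve_length g)%E /\
    forall w x, size w = n -> SP v x -> cell w x -> `|b x - al (subtetra v w ord0)| <= l / 2 ^+ n.
Proof.
move=> al1 cg gSP.
have /choice[B hB] (w : seq 'I_4) : exists b : E -> R, size w = n ->
    (forall i, b (subtetra v w i) = al (subtetra v w i)) /\ forall x y, `|b x - b y| <= edist x y.
  have [sw|sw] := pselect (size w = n); last by exists (fun=> 0).
  have [b [b1 b2]] := @lipschitz_extension 3 (subtetra v w) (al \o subtetra v w) (fun i j => al1 w i j sw).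
  by exists b.
pose W x := xget [::] [set w | size w = n /\ cell w x].
pose b x := B (W x) x.
(* The value does not depend on the cell chosen by [W]: two different cells through [x] share it as
   a vertex, where both extensions take the value [al]. *)
have bE w x : size w = n -> cell w x -> b x = B w x.
  move=> sw xw; have [sw' xw'] : size (W x) = n /\ cell (W x) x by exact: (@xgetPex _ [::] [set w | size w = n /\ cell w x] (ex_intro _ w (conj sw xw))).
  rewrite /b; move: (W x) sw' xw' => w' sw' xw'.
  have [->//|ww'] := eqVneq w' w.
  have [i xi] := cells_meet vl (etrans sw' (esym sw)) ww' xw' xw.
  have w'w : w != w' by rewrite eq_sym.
  have [j xj] := cells_meet vl (etrans sw (esym sw')) w'w xw xw'.
  by rewrite {1}xi xj (hB _ sw').1 (hB _ sw).1 -xi -xj.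
exists b; split; last first.
  move=> w x sw xS xw; rewrite (bE w x sw xw) -(hB w sw).1.
  rewrite (le_trans ((hB w sw).2 _ _)) // -sw.
  exact: solid_diam (regular_sub w vl) xw (vertex_solid _ _).
have g01 t : 0 <= t <= 1 -> SP v (g t) by move=> t01; apply: gSP; exists t => //=; rewrite in_itv.
(* [S t] says that the increase of [b] from 0 to [t] is at most the length of some polygon inscribed
   in the curve; [step] extends such a polygon by one node. *)
pose S t := exists k (p : nat -> R), [/\ forall i, 0 <= p i <= t,
  {homo p : i j / (i <= j)%N >-> i <= j}, p k = t &
  `|b (g t) - b (g 0)| <= \sum_(i < k) edist (g (p i)) (g (p i.+1))].
have step s t : 0 <= s -> s <= t -> `|b (g t) - b (g s)| <= edist (g s) (g t) -> S s -> S t.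
  move=> s0 st hst [k [p [p0 pm pk hp]]].
  exists k.+1, (fun i => if (i <= k)%N then p i else t); split.
  - move=> i; case: ifP => _; last by rewrite (le_trans s0 st) lexx.
    by have /andP[-> h] := p0 i; exact: le_trans h st.
  - move=> i j ij; case: (leqP j k) => jk; first by rewrite (leq_trans ij jk); exact: pm.
    by case: (leqP i k) => // _; have /andP[_ h] := p0 i; exact: le_trans h st.
  - by rewrite ltnn.
  - rewrite big_ord_recr /= leqnn ltnn pk.
    under eq_bigr => i _ do rewrite (ltnW (ltn_ord i)) (ltn_ord i).
    rewrite (le_trans _ (lerD hp hst)) //.
    rewrite [leRHS]addrC (le_trans _ (ler_normD _ _)) //.
    by rewrite addrA subrK.
have [k [p [p0 pm _ hp]]] : S 1.
  apply: interval_induction.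
    exists 0, (fun=> 0); split => // [i|]; first by rewrite lexx.
    by rewrite subrr normr0 big_ord0.
  move=> t t01; have near_t := near_cell vl (g t) n.
  move/subspace_continuousP : cg => /(_ t); rewrite /= in_itv /= t01 => /(_ isT).
  move=> /(_ _ near_t); rewrite nbhs_simpl /= => /nbhs_ballP[d /= d0 hd].
  exists d => // s s01 sd; have common x y w : size w = n -> cell w x -> cell w y ->
      `|b x - b y| <= edist x y.
    by move=> sw xw yw; rewrite (bE w x) // (bE w y) //; exact: (hB w sw).2.
  (* For [s] near [t] a cell of [g s] also contains [g t], so that [b] is 1-Lipschitz between these
     two points. *)
  have [w [sw gsw]] := SP_cell n (g01 s s01).
  have gtw : cell w (g t).
    have ts : ball t d s by rewrite /ball /= distrC.
    by move/eqP in sw; have := hd s ts; rewrite /= in_itv /= s01 => /(_ isT (Tuple sw)); apply.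
  case/andP: t01 => t0 _; case/andP: s01 => s0 _.
  split => st; apply: step => //; rewrite distrC; first by rewrite distrC edistC; exact: common gtw gsw.
  by rewrite distrC edistC; exact: common gsw gtw.
apply: (@le_trans _ _ (\sum_(i < k) edist (g (p i)) (g (p i.+1)))%:E); first by rewrite lee_fin.
by apply: ereal_sup_ubound; exists (k, p).
Qed.

Lemma small_cells (e : R) : 0 < e -> exists n, l / 2 ^+ n < e.
Proof.
move=> e0; have [l0 _] := vl.
have le0 : 0 <= l / e by rewrite divr_ge0 // ltW.
exists (Num.bound (l / e)); rewrite ltr_pdivrMr ?exprn_gt0 // -ltr_pdivrMl // mulrC.
apply: (lt_le_trans (archi_boundP le0)); rewrite -natrX ler_nat ltnW //; exact: ltn_expl.
Qed.

Lemma SP_unif_cell a (e : R) : CX (SP v) a -> 0 < e -> exists n, forall w x y, (n <= size w)%N ->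
  SP v x -> SP v y -> cell w x -> cell w y -> cmod (a x - a y) <= e.
Proof.
move=> aX e0; have [d d0 hd] := compact_unif_continuous (SP_compact vl) aX e0.
have [n hn] := small_cells d0; have [l0 _] := vl.
exists n => w x y nw xS yS xw yw; apply/ltW/hd => //; apply: ball_edist.
apply: le_lt_trans (solid_diam (regular_sub w vl) yw xw) _.
apply: le_lt_trans hn; rewrite ler_pM2l // lef_pV2 ?posrE ?exprn_gt0 //.
by rewrite ler_weXn2l // ler1n.
Qed.

Lemma lipschitz_le_length a (g : R -> E) : CX (SP v) a ->
  (forall w i j, cmod (a (subtetra v w i) - a (subtetra v w j)) <=
     edist (subtetra v w i) (subtetra v w j)) ->
  {within `[0, 1], continuous g} -> g @` `[0, 1] `<=` SP v ->
  ((cmod (a (g 0) - a (g 1)))%:E <= curve_length g)%E.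
Proof.
move=> aX a1 cg gSP; have [l0 _] := vl.
have gS t : 0 <= t <= 1 -> SP v (g t) by move=> t01; apply: gSP; exists t => //=; rewrite in_itv.
have [g0 g1] : SP v (g 0) /\ SP v (g 1) by split; apply: gS; rewrite lexx ler01.
(* Both the oscillation of [a] on a cell and the diameter of the cell are at most [e / 4], so [b]
   and [al] differ by at most [e / 2] at each end. *)
apply/lee_addgt0Pr => e e0; have e4 : 0 < e / 4 by rewrite divr_gt0.
have [n1 h1] := SP_unif_cell aX e4; have [n2 h2] := small_cells e4.
pose n := maxn n1 n2.
have hn2 : l / 2 ^+ n < e / 4.
  apply: le_lt_trans h2; rewrite ler_pM2l // lef_pV2 ?posrE ?exprn_gt0 //.
  by rewrite ler_weXn2l ?ler1n // leq_maxr.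
(* a is replaced by the real part of a rotation of it *)
have [c c1 hc] : exists2 c : R[i], cmod c = 1 &
    cmod (a (g 1) - a (g 0)) = Re (c * (a (g 1) - a (g 0))).
  move: (a (g 1) - a (g 0)) => z; have [z0|z0] := eqVneq (cmod z) 0.
    by exists 1; [exact: cmod1|rewrite mul1r; move/eqP: (z0); rewrite cmod_eq0 => /eqP ->; rewrite cmod0].
  exists (conjc z * ((cmod z)^-1)%:C%C).
    by rewrite cmodM cmodJ cmod_real ger0_norm ?invr_ge0 ?cmod_ge0 // mulfV.
  rewrite mulrAC (mulrC (conjc z)) mulJc.
  rewrite -real_complexM /= expr2 mulfK //.
pose al x := Re (c * a x).
have al1 x y : `|al x - al y| <= cmod (a x - a y).
  by rewrite /al -raddfB -mulrBr (le_trans (Re_le_cmod _)) // cmodM c1 mul1r.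
have [b [b1 b2]] := @curve_length_bound al n g (fun w i j _ => le_trans (al1 _ _) (a1 w i j)) cg gSP.
have near x : SP v x -> `|b x - al x| <= e / 2.
  move=> xS; have [w [sw xw]] := SP_cell n xS.
  have := b2 w x sw xS xw; have := al1 (subtetra v w ord0) x.
  have nw : (n1 <= size w)%N by rewrite sw leq_maxl.
  have := h1 w _ x nw (vertex_SP v w ord0) xS (vertex_solid (subtetra v w) ord0) xw.
  have := ler_normD (b x - al (subtetra v w ord0)) (al (subtetra v w ord0) - al x).
  by rewrite addrA subrK; lra.
apply: le_trans (leeD2r _ b1); rewrite -EFinD lee_fin cmodB hc.
have := near _ g0; have := near _ g1; have := ler_norm (b (g 1) - b (g 0)).
rewrite mulrBr raddfB -/(al _) -/(al _) => h3; rewrite !ler_norml => /andP[h4 h5] /andP[h6 h7].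
by lra.
Qed.
End curves.

Lemma clamp_lip (R : realType) (a b : R) :
  `|Num.max 0 (Num.min 1 a) - Num.max 0 (Num.min 1 b)| <= `|a - b|.
Proof.
wlog ab : a b / a <= b.
  move=> W; have [/W//|/ltW/W] := leP a b.
  by rewrite distrC (distrC b).
have [m1 m2] : Num.min 1 a <= Num.min 1 b /\ Num.min 1 b - Num.min 1 a <= b - a.
  by rewrite /Num.min; case: ltP => ?; case: ltP => ?; split; lra.
rewrite distrC (distrC a) [leRHS]ger0_norm ?subr_ge0 // (le_trans _ m2) //.
move: (Num.min 1 a) (Num.min 1 b) m1 {m2} => c d cd.
rewrite ger0_norm; rewrite /Num.max; case: ltP => ?; case: ltP => ?; lra.
Qed.

(** * The intrinsic distance by Lipschitz curves *)

Section lipschitz_curves.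
Variable R : realType.
Local Notation E := 'rV[R]_3.
Variables (v : tetra R) (l : R).
Hypothesis vl : regular v l.
Implicit Types (x y z : E) (K L : R) (w : seq 'I_4).
Local Notation cell w := (solid (subtetra v w)).

(** A path of length at most [K], as a 1-Lipschitz map of the whole line, so that reversal,
    concatenation and pointwise limits stay in the same class. *)
Definition lip_curve x y K := 0 <= K /\ exists g : R -> E,
  [/\ forall s t : R, edist (g s) (g t) <= `|s - t|, forall t, SP v (g t), g 0 = x & g K = y].

Lemma lip_curve_refl x K : 0 <= K -> SP v x -> lip_curve x x K.
Proof. by move=> K0 xS; split => //; exists (fun=> x); split => // s t; rewrite edistxx. Qed.

Lemma lip_curve_sym x y K : lip_curve x y K -> lip_curve y x K.
Proof.
move=> [K0 [g [g1 gS <- <-]]]; split => //; exists (fun t => g (K - t)).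
split => [s t|t||]; rewrite ?subr0 ?subrr //.
by rewrite (le_trans (g1 _ _)) // opprB addrC addrA subrK distrC.
Qed.

Lemma lip_curve_trans y x z K L : lip_curve x y K -> lip_curve y z L -> lip_curve x z (K + L).
Proof.
move=> [K0 [g [g1 gS gx gy]]] [L0 [h [h1 hS hy hz]]].
split; first exact: addr_ge0.
exists (fun t => if t <= K then g t else h (t - K)); split.
- move=> s t; wlog st : s t / s <= t.
    move=> W; have [/W//|/ltW/W] := leP s t.
    by rewrite edistC distrC.
  case: (leP t K) => tK; first by rewrite (le_trans st tK); exact: g1.
  case: (leP s K) => sK; last by rewrite (le_trans (h1 _ _)) // opprB addrA subrK.
  rewrite (le_trans (edist_tri y _ _)) // distrC ger0_norm ?subr_ge0 //.
  have := g1 s K; have := h1 0 (t - K); rewrite hy gy sub0r normrN.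
  rewrite (ger0_norm (x := t - K)) ?subr_ge0 ?(ltW tK) // distrC ger0_norm ?subr_ge0 //.
  by lra.
- by move=> t; case: ifP.
- by rewrite K0.
- case: ifP => [|_]; last by rewrite addrC addKr.
  rewrite gerDl => L00.
  have L0' : L = 0 by apply/eqP; rewrite eq_le L00.
  by rewrite -hz L0' addr0 hy gy.
Qed.

Lemma lip_curve_le x y K L : K <= L -> lip_curve x y K -> lip_curve x y L.
Proof.
move=> KL h; have [_ [g [_ gS _ gy]]] := h.
rewrite -(subrK K L) addrC; apply: lip_curve_trans h _.
by apply: lip_curve_refl; rewrite ?subr_ge0 // -gy.
Qed.

(* The limit curve is taken along an ultrafilter, as in Arzela-Ascoli. *)
Lemma lip_curve_closed x y K : 0 <= K ->
  (forall e : R, 0 < e -> exists2 y', edist y y' < e & lip_curve x y' K) -> lip_curve x y K.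
Proof.
move=> K0 h; split => //.
have /choice[g hg] (n : nat) : exists g : R -> E,
    [/\ forall s t : R, edist (g s) (g t) <= `|s - t|, forall t, SP v (g t), g 0 = x &
      edist y (g K) < n.+1%:R^-1].
  have n0 : 0 < n.+1%:R^-1 :> R by rewrite invr_gt0.
  by have [y' yy [_ [g [g1 gS gx gy]]]] := h _ n0; exists g; split => //; rewrite gy.
have [U [UU ooU]] := ultraFilterLemma (eventually_filter : ProperFilter \oo).
have PU : ProperFilter U by exact: ultra_proper.
(* The values lie in the compact set [SP v], and along an ultrafilter a cluster point is a limit;
   hence [g n t] converges for all [t] at once. *)
have /choice[G hG] (t : R) : exists p, SP v p /\
    forall e : R, 0 < e -> U [set n | edist p (g n t) < e].
  have [|p [pS cp]] := @SP_compact R v l vl ((fun n => g n t) @ U) _.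
    by rewrite nbhs_simpl /=; apply: filterS filterT => n _; have [_ + _ _] := hg n; apply.
  exists p; split => // e e0; have [//|hU] := in_ultra_setVsetC [set n | edist p (g n t) < e] UU.
  have [q [/= [n hn <-]]] : ([set q | exists2 n, ~ edist p (g n t) < e & g n t = q] `&`
      [set q | edist p q < e]) !=set0.
    apply: cp; last by apply/nbhs_edist; exists e.
    by rewrite nbhs_simpl /=; apply: filterS hU => n hn; exists n.
  by move/hn.
have lim t p : (forall e : R, 0 < e -> U [set n | edist p (g n t) < e]) -> G t = p.
  move=> hp; apply/edist_eq0/eqP; rewrite eq_le edist_ge0 andbT; apply/ler_addgt0Pr => e e0.
  have e2 : 0 < e / 2 by rewrite divr_gt0.
  have [n [/= h1 h2]] := filter_ex (filterI (hp _ e2) ((hG t).2 _ e2)).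
  rewrite (le_trans (edist_tri (g n t) _ _)) // (edistC (g n t) p) add0r.
  by rewrite [leRHS](splitr e) lerD // ltW.
exists G; split.
- move=> s t; apply/ler_addgt0Pr => e e0; have e2 : 0 < e / 2 by rewrite divr_gt0.
  have [n [/= h1 h2]] := filter_ex (filterI ((hG s).2 _ e2) ((hG t).2 _ e2)).
  have [g1 _ _ _] := hg n; have h3 := g1 s t.
  rewrite (le_trans (edist_tri (g n s) _ _)) // (le_trans (lerD (lexx _) (edist_tri (g n t) _ _))) //.
  rewrite (edistC (g n t) (G t)).
  move: (edist _ _) (edist _ _) (edist _ _) h1 h2 h3 => d1 d2 d3 h1 h2 h3; lra.
- by move=> t; exact: (hG t).1.
- apply: lim => e e0; apply: filterS filterT => n _ /=.
  by have [_ _ -> _] := hg n; rewrite edistxx.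
- apply: lim => e e0; apply: ooU.
  have : \forall n \near \oo, n.+1%:R^-1 < e by exact: near_infty_natSinv_lt (PosNum e0).
  by apply: filterS => n ne; have [_ _ _ h3] := hg n; exact: lt_trans ne.
Qed.

Lemma lip_curve_geodesic x y K : lip_curve x y K -> (geodesic_dist (SP v) x y <= K%:E)%E.
Proof.
move=> [K0 [g [g1 gS gx gy]]].
have len : (curve_length (fun t : R => g (K * t)%R) <= K%:E)%E.
  apply: ge_ereal_sup => _ [[k p] [/= p01 pm] <-]; rewrite lee_fin.
  apply: (@le_trans _ _ (\sum_(0 <= i < k) (K * p i.+1 - K * p i))).
    rewrite big_mkord; apply: ler_sum => i _; rewrite (le_trans (g1 _ _)) // distrC.
    by rewrite ger0_norm // subr_ge0 ler_wpM2l // pm.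
  rewrite (telescope_sumr (fun i => K * p i)) //.
  have /andP[p00 _] := p01 0; have /andP[_ pk1] := p01 k.
  have := ler_wpM2l K0 pk1; have := mulr_ge0 K0 p00; rewrite mulr1; lra.
apply: (le_trans _ len); apply: ereal_inf_lbound; exists (fun t : R => g (K * t)) => //.
split => //.
- apply: continuous_subspaceT => t; apply: continuous_edist => e e0.
  have Ke : 0 < e / (K + 1) by rewrite divr_gt0 // ltr_wpDl.
  apply/nbhs_ballP; exists (e / (K + 1)) => //= s; rewrite /ball /= => ts.
  apply: le_lt_trans (g1 _ _) _; rewrite -mulrBr normrM ger0_norm //.
  apply: (@le_lt_trans _ _ ((K + 1) * `|t - s|)); first by rewrite ler_wpM2r // lerDl.
  by rewrite mulrC -ltr_pdivlMr // ltr_wpDl.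
- by move=> _ [t _ <-]; exact: gS.
- by rewrite mulr0.
- by rewrite mulr1.
- by apply: le_lt_trans len _; exact: ltry.
Qed.

Lemma lip_curve_edge w i j (s : R) : 0 <= s <= 1 ->
  let p := subtetra v w i in let q := subtetra v w j in
  lip_curve p (p + s *: (q - p)) (s * edist p q).
Proof.
move=> /andP[s0 s1] p q; set d := edist p q.
have d0 : 0 <= d by exact: edist_ge0.
split; first exact: mulr_ge0.
have [dz|dz] := eqVneq d 0.
  have pq : p = q by exact: edist_eq0.
  exists (fun=> p); split => // [? ?|_|]; first by rewrite edistxx.
    exact: vertex_SP.
  by rewrite -pq subrr scaler0 addr0.
have dp : 0 < d by rewrite lt_neqAle eq_sym dz.
pose c (t : R) := Num.max 0 (Num.min 1 (t / d)).
exists (fun t => p + c t *: (q - p)); split.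
- move=> r t; rewrite edist_affine -/d -ler_pdivlMr //.
  rewrite -[X in _ <= X](_ : `|r / d - t / d| = _); last first.
    by rewrite -mulrBl normrM [`|d^-1|]gtr0_norm ?invr_gt0.
  rewrite /c; move: (r / d) (t / d) => a b.
  exact: clamp_lip.
- move=> t; apply: edge_SP; rewrite /c le_max lexx ge_max ler01 ge_min lexx //.
- by rewrite /c mul0r /Num.min ltNge ler01 /= maxxx scale0r addr0.
- rewrite /c mulfK // min_r // max_r //.
Qed.

Let len w := l / 2 ^+ size w.

(** The vertex [i] moves to the vertex [i] of each successive corner along half an edge; the halves
    form a geometric series with sum at most [len w]. *)
Lemma lip_curve_vertices w u i : lip_curve (subtetra v w i) (subtetra v (w ++ u) i) (len w).
Proof.
have [l0 _] := vl; have len0 w' : 0 <= len w' by rewrite divr_ge0 ?exprn_ge0 // ltW.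
elim: u w => [|k u IH] w; first by rewrite cats0; apply: lip_curve_refl => //; exact: vertex_SP.
have := IH (rcons w k); rewrite cat_rcons => IHk.
have lenE : len w = len w / 2 + len (rcons w k).
  rewrite /len size_rcons exprS invfM [_ * (2^-1 * _)]mulrCA; lra.
rewrite lenE; apply: lip_curve_trans IHk.
have h2 : 0 <= (2^-1 : R) <= 1 by apply/andP; split; lra.
have := @lip_curve_edge w i k _ h2; rewrite subtetra_rcons /corner /midpoint.
set p := subtetra v w i; set q := subtetra v w k.
have -> : p + 2^-1 *: (q - p) = 2^-1 *: (q + p).
  by apply/rowP => j; rewrite !mxE; field.
apply: lip_curve_le; rewrite mulrC ler_pM2r ?invr_gt0 //.
exact: solid_diam (regular_sub w vl) (vertex_solid _ _) (vertex_solid _ _).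
Qed.

(** The nested cells around [x] shrink to it, and their vertices with label [i] are all reached by
    curves of length at most [len w]; [lip_curve_closed] passes to the limit. *)
Lemma lip_curve_cell w i x : SP v x -> cell w x -> lip_curve (subtetra v w i) x (len w).
Proof.
move=> xS xw; have [l0 _] := vl.
apply: lip_curve_closed => [|e e0]; first by rewrite divr_ge0 ?exprn_ge0 // ltW.
have [n hn] := small_cells vl e0.
have [u [su xu]] : exists u, size u = n /\ cell (w ++ u) x.
  elim: n {hn} => [|n [u [su xu]]]; first by exists [::]; rewrite cats0.
  have [k hk] := SP_extend vl xS xu; exists (rcons u k).
  by rewrite size_rcons su -rcons_cat.
exists (subtetra v (w ++ u) i); last exact: lip_curve_vertices.
apply: le_lt_trans (solid_diam (regular_sub _ vl) xu (vertex_solid _ _)) _.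
apply: le_lt_trans hn; rewrite ler_pM2l // lef_pV2 ?posrE ?exprn_gt0 //.
by rewrite ler_weXn2l ?ler1n // size_cat su leq_addl.
Qed.

(** A real valued upper bound of [geodesic_dist], to serve as a test function in [spectral_dist]. *)
Definition lip_dist x y : R := inf [set K | lip_curve x y K].

Lemma lip_dist_le x y K : lip_curve x y K -> lip_dist x y <= K.
Proof. by move=> h; apply: ge_inf => //; exists 0 => L []. Qed.

Lemma lip_dist_self x : SP v x -> lip_dist x x = 0.
Proof.
move=> xS; apply/eqP; rewrite eq_le; apply/andP; split.
  by apply: lip_dist_le; apply: lip_curve_refl.
by apply: lb_le_inf => [|K []//]; exists 0; apply: lip_curve_refl.
Qed.

Let connected_SP x y : SP v x -> SP v y -> [set K | lip_curve x y K] !=set0.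
Proof.
move=> xS yS; exists (len [::] + len [::]); rewrite /=; apply: (@lip_curve_trans (subtetra v [::] ord0)).
  by apply: lip_curve_sym; apply: lip_curve_cell => //; exact: SP_solid.
by apply: lip_curve_cell => //; exact: SP_solid.
Qed.

Lemma lip_dist_tri x y z K : SP v x -> SP v y -> lip_curve y z K ->
  lip_dist x z <= lip_dist x y + K.
Proof.
move=> xS yS yz; rewrite -lerBlDr; apply: lb_le_inf; first exact: connected_SP.
by move=> L xy; rewrite lerBlDr; apply: lip_dist_le; exact: lip_curve_trans yz.
Qed.

Lemma lip_dist_lip x y z K : SP v x -> SP v y -> SP v z -> lip_curve y z K ->
  `|lip_dist x y - lip_dist x z| <= K.
Proof.
move=> xS yS zS yz; have h1 := lip_dist_tri xS yS yz.
by have h2 := lip_dist_tri xS zS (lip_curve_sym yz); rewrite ler_norml; lra.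
Qed.

Lemma geodesic_le_lip_dist x y : SP v x -> SP v y ->
  (geodesic_dist (SP v) x y <= (lip_dist x y)%:E)%E.
Proof.
move=> xS yS; apply/lee_addgt0Pr => e e0.
have hi : has_inf [set K | lip_curve x y K].
  by split; [exact: connected_SP|exists 0 => L []].
have [K hK Ke] := inf_adherent e0 hi.
by apply: le_trans (lip_curve_geodesic hK) _; rewrite -EFinD lee_fin ltW.
Qed.

(** Continuity for the ambient topology: nearby points of the pyramid share a cell of level [n] and
    are joined through one of its vertices. *)
Lemma CX_lip_dist x : SP v x -> CX (SP v) (fun y => ((lip_dist x y)%:C)%C).
Proof.
move=> xS; apply/CX_edist => y yS e e0; have e3 : 0 < e / 3 by rewrite divr_gt0.
have [n hn] := small_cells vl e3.
have /nbhs_edist[d d0 hd] := near_cell vl y n; exists d => // z zS yz.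
have [w [sw zw]] := SP_cell n zS.
have yw : cell w y by move/eqP in sw; exact: (hd z yz (Tuple sw)).
rewrite -real_complexB cmod_real.
have hy := lip_curve_cell ord0 yS yw; have hz := lip_curve_cell ord0 zS zw.
apply: le_lt_trans (lip_dist_lip xS zS yS (lip_curve_trans (lip_curve_sym hz) hy)) _.
by rewrite /len sw; lra.
Qed.

Lemma lip_curve_arclength n T (s t : R) : s <= t -> edge_triangle v n T ->
  lip_curve (arclength T s) (arclength T t) (t - s).
Proof.
move=> st Tn; split; first by rewrite subr_ge0.
exists (fun r : R => arclength T (s + r)); split => [r r'|r||].
- rewrite (le_trans (arclength_lip (edge_triangle_equilateral vl Tn) _ _)) //.
  by rewrite opprD addrACA subrr add0r.
- exact: (edge_triangle_SP vl) Tn.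
- by rewrite addr0.
- by rewrite addrC subrK.
Qed.

Lemma lip_dist_arclength x n T (s t : R) : SP v x -> edge_triangle v n T ->
  `|lip_dist x (arclength T s) - lip_dist x (arclength T t)| <= `|s - t|.
Proof.
move=> xS Tn; wlog st : s t / s <= t.
  move=> W; have [/W//|/ltW/W] := leP s t.
  by rewrite distrC (distrC t s).
rewrite (distrC s t) [`|t - s|]ger0_norm ?subr_ge0 //.
by apply: lip_dist_lip (lip_curve_arclength st Tn) => //; exact: (edge_triangle_SP vl) Tn.
Qed.

End lipschitz_curves.

(** * The spectral triple *)

Arguments ev {R E M} _ _.
Arguments elam {R E M} _ _.

Section triangle_modules.
Variable R : realType.
Local Notation E := 'rV[R]_3.
Variables (v : tetra R) (l : R).
Hypothesis vl : regular v l.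

Section one_triangle.
Variables (s : R) (n : nat) (T : triangle R).
Hypothesis Tn : edge_triangle v n T.
Let r := perimeter T / (2 * pi).
Let rho x := arclength T (s + x).

Let pi20 : 0 < 2 * pi :> R.
Proof. by rewrite mulr_gt0 // pi_gt0. Qed.

Let Td := edge_triangle_equilateral vl Tn.

Let rE : r = 3 * (l / 2 ^+ n) / (2 * pi).
Proof. by rewrite /r (perimeter_equilateral Td). Qed.

Let r0 : 0 < r.
Proof. by have [d0 _ _ _] := Td; rewrite rE divr_gt0 // mulr_gt0. Qed.

Let rho_lip x y : edist (rho x) (rho y) <= `|x - y|.
Proof. by rewrite (le_trans (arclength_lip Td _ _)) // opprD addrACA subrr add0r. Qed.

Let rho_cont : continuous rho.
Proof.
move=> x; apply: continuous_edist => e e0; apply/nbhs_ballP; exists e => //= y.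
by rewrite /ball /=; apply: le_lt_trans; exact: rho_lip.
Qed.

Let rho_SP x : SP v (rho x).
Proof. exact: (edge_triangle_SP vl) Tn. Qed.

Let rho_per x : rho (x + 2 * pi * r) = rho x.
Proof.
rewrite /rho addrA -[RHS](arclength_per Td); congr (arclength T (_ + _)).
by rewrite rE mulrC divfK // gt_eqF.
Qed.

Definition UFM_eigenbasis : eigenbasis (UFM s T) := circle_eigenbasis rho r0.

Lemma UFM_good_rep : good_rep (SP v) (UFM s T).
Proof. exact: (circle_good_rep r0 rho_cont rho_SP rho_per). Qed.

Lemma UFM_commutator_le a (L : R) : CX (SP v) a -> 0 <= L ->
  (forall x y, cmod (a (arclength T x) - a (arclength T y)) <= L * `|x - y|) ->
  commutator_le (UFM s T) a L.
Proof.
move=> aX L0 aL; apply: (circle_commutator_le r0 rho_cont rho_SP rho_per aX L0) => x y.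
by rewrite (le_trans (aL _ _)) // opprD addrACA subrr add0r.
Qed.

Lemma UFM_commutator_lip a (L : R) : CX (SP v) a -> 0 <= L -> commutator_le (UFM s T) a L ->
  forall x y, cmod (a (arclength T x) - a (arclength T y)) <= L * `|x - y|.
Proof.
move=> aX L0 aL x y.
have := circle_commutator_lip r0 rho_cont rho_SP rho_per aX L0 aL (x - s) (y - s).
by rewrite /rho ![s + (_ - s)]addrC !subrK opprB addrA subrK.
Qed.

Lemma UFM_faithful a : CX (SP v) a -> (forall xi, rep (UFM s T) a xi = 0) ->
  forall x, a (arclength T x) = 0.
Proof.
move=> aX a0 x; have := circle_faithful r0 rho_cont rho_SP rho_per aX a0 (x - s).
by rewrite /rho addrC subrK.
Qed.

(** [|i + 1/2| >= 1/2], and the radius is proportional to [2^-n]. Deep levels have only large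
    eigenvalues, which makes the resolvent of the infinite sum compact. *)
Lemma UFM_lam_ge i : 2 ^+ n * (pi / (3 * l)) <= `|elam UFM_eigenbasis i|.
Proof.
rewrite /= /circle_lam normrM normfV (gtr0_norm r0) -/r rE.
have [l0 _] := vl; have p0 := pi_gt0 R; have n0 : 0 < (2 : R) ^+ n by exact: exprn_gt0.
have -> : 2 ^+ n * (pi / (3 * l)) = 2^-1 / (3 * (l / 2 ^+ n) / (2 * pi)).
  move: (@pi R) p0 => p p0; field.
  by rewrite (gt_eqF l0) (gt_eqF p0) (gt_eqF n0).
rewrite ler_pM2r ?invr_gt0 ?divr_gt0 ?mulr_gt0 //; case: i => i.
  by rewrite -pmulrn ger0_norm ?lerDr ?ler0n // addr_ge0.
rewrite NegzE mulrNz -pmulrn -[i.+1]addn1 natrD -normrN opprD opprK.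
rewrite ger0_norm; have := ler0n R i; lra.
Qed.

Lemma UFM_lam_finite (K : R) : finite_set [set i | `|elam UFM_eigenbasis i| <= K].
Proof.
have [N hN] : exists N : nat, K * r + 1 < N%:R.
  by exists (Num.bound `|K * r + 1|); apply: (le_lt_trans (ler_norm _)); apply: archi_boundP.
apply: (@sub_finite_set _ _ [set` [seq Posz i | i <- iota 0 N] ++ [seq Negz i | i <- iota 0 N]]).
  move=> i /=; rewrite /circle_lam normrM normfV (gtr0_norm r0) ler_pdivrMr // mem_cat => h.
  apply/orP; case: i h => i h; [left|right]; apply: map_f; rewrite mem_iota add0n leq0n /=.
    rewrite -(ltr_nat R); move: h; rewrite -pmulrn ger0_norm ?addr_ge0 //; lra.
  rewrite -(ltr_nat R); move: h; rewrite NegzE mulrNz -pmulrn -[i.+1]addn1 natrD -normrN opprD opprK.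
  rewrite ger0_norm; have := ler0n R i; lra.
exact: finite_seq.
Qed.

Lemma UFM_Fred u : CX (SP v) u -> (forall x, SP v x -> cmod (u x) = 1) ->
  exists2 C : R, 0 <= C & Fred (pos_space UFM_eigenbasis) (toeplitz UFM_eigenbasis u) C
    'I_(ker_dim (winding u T)) 'I_(coker_dim (winding u T)).
Proof.
move=> uX u1.
have [w [th [C [C0 thc thp uE F]]]] := circle_module_Fred r0 rho_cont rho_SP rho_per uX u1.
suff -> : winding u T = w by exists C.
have P : perimeter T = 2 * pi * r by rewrite /r mulrC divfK // gt_eqF.
(* The parametrization of the module starts at position [s] and that of [winding] at 0; the lift is
   shifted accordingly. *)
apply: (@winding_lift _ u T w (fun t => w%:~R * (t - s) / r + th (t - s))).
- by rewrite P mulr_ge0 // ltW.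
- apply: continuous_subspaceT => t; apply: cvgD.
    by apply: cvgM; [apply: cvgM; [exact: cvg_cst|apply: cvgB => //; exact: cvg_cst]|exact: cvg_cst].
  apply: (@continuous_comp _ _ _ (fun t => t - s) th); last exact: thc.
  by apply: cvgB => //; exact: cvg_cst.
- by move=> t _; rewrite -uE /rho addrC subrK.
- rewrite P (addrC _ (- s)) thp sub0r; field.
  by rewrite gt_eqF.
Qed.

Lemma UFM_Fred_near_cst u c : CX (SP v) u -> (forall x, SP v x -> cmod (u x) = 1) ->
  cmod c = 1 -> (forall x, cmod (u (arclength T x) - c) <= 2^-1) -> winding u T = 0 /\
  Fred (pos_space UFM_eigenbasis) (toeplitz UFM_eigenbasis u) 2 'I_0 'I_0.
Proof.
move=> uX u1 c1 uc.
have [th [thc thp uE F]] := circle_module_Fred_near_cst r0 rho_cont rho_SP rho_per uX u1 c1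
  (fun t => uc (s + t)).
split => //; have P : perimeter T = 2 * pi * r by rewrite /r mulrC divfK // gt_eqF.
apply: (@winding_lift _ u T 0 (fun t => th (t - s))).
- by rewrite P mulr_ge0 // ltW.
- apply: continuous_subspaceT => t; apply: (@continuous_comp _ _ _ (fun t => t - s) th); last exact: thc.
  by apply: cvgB => //; exact: cvg_cst.
- by move=> t _; rewrite -uE /rho addrC subrK.
- by rewrite P (addrC _ (- s)) thp sub0r subrr mulr0.
Qed.

End one_triangle.

Lemma arclength_near T d (x : R) : equilateral T d -> edist (vtx1 T) (arclength T x) <= 2 * d.
Proof.
move=> Td; have [d0 d1 d2 d3] := Td.
have H (a b : E) (z : R) : edist a b = d -> 0 <= z <= 1 -> edist a (a + z *: (b - a)) <= d.
  move=> ab /andP[z0 z1]; have := edist_affine a b 0 z; rewrite scale0r addr0 ab => ->.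
  by rewrite sub0r normrN ger0_norm // ler_piMl // ltW.
have [z [z01 [] ->]] := arclength_cases Td x.
- by apply: (le_trans (H _ _ _ d1 z01)); lra.
- apply: (le_trans (edist_tri (vtx2 T) _ _)); have := H _ _ _ d2 z01; rewrite d1; lra.
- apply: (le_trans (edist_tri (vtx3 T) _ _)); have := H _ _ _ d3 z01; rewrite (edistC (vtx1 T)) d3; lra.
Qed.

End triangle_modules.

Section sums.
Variables (R : realType) (E : topologicalType).

Definition lam_finite (M : moduleData R E) (B : eigenbasis M) :=
  forall K : R, finite_set [set i | `|elam B i| <= K].

Lemma sum_lam_finite (K : countType) (M : K -> moduleData R E) (B : forall k, eigenbasis (M k)) :
  (forall k, lam_finite (B k)) ->
  (forall C : R, finite_set [set k | exists i, `|elam (B k) i| <= C]) ->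
  lam_finite (sum_eigenbasis B).
Proof.
move=> h1 h2 C; pose F k := [set Tagged (fun k => eI (B k)) i | i in [set i | `|elam (B k) i| <= C]].
apply: (@sub_finite_set _ _ (\bigcup_(k in [set k | exists i, `|elam (B k) i| <= C]) F k)).
  by move=> [k i] /= h; exists k; [exists i|exists i].
by apply: bigcup_finite => // k _; apply: finite_image; exact: h1.
Qed.

Lemma eigenbasis_dirac0 (M : moduleData R E) (B : eigenbasis M) : dirac M 0 0.
Proof. by apply/(e_dirac B) => i; rewrite /coord dot0l mulr0. Qed.

Section fredholm_module.
Variables (X : set E) (M : moduleData R E) (B : eigenbasis M).
Hypothesis B_finite : lam_finite B.

Let B_seq (K : R) : exists s : seq (eI B), forall i, `|elam B i| <= K -> i \in s.
Proof.
have /finite_seqP[s hs] := B_finite K; exists s => i hi.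
by have : [set` s] i by rewrite -hs.
Qed.

Lemma eigenbasis_fredholm_module : good_rep X M ->
  (forall a (e : R), CX X a -> 0 < e -> exists b, [/\ CX X b,
    exists K, commutator_le M b K & forall x, X x -> cmod (a x - b x) <= e]) ->
  unbounded_fredholm_module X M.
Proof.
move=> [Mrep _] dense; split => //.
- exact: e_complete B.
- exact: (diag_selfadjoint (@e_on _ _ _ B) (@e_complete _ _ _ B) (@e_total _ _ _ B) (@e_dirac _ _ _ B)).
- exact: (diag_compact_resolvent (@e_on _ _ _ B) (@e_complete _ _ _ B) (@e_total _ _ _ B) (@e_dirac _ _ _ B)).
move=> a e aX e0; have [b [bX bK ab]] := dense a e aX e0; exists b; split => // x xX.
by rewrite -cmodE lecR; exact: ab.
Qed.

Lemma eigenbasis_spectral_resolution :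
  spectral_resolution (dirac M) (spectral_proj (ev B) (elam B)).
Proof.
exact: (diag_spectral_resolution (@e_on _ _ _ B) (@e_complete _ _ _ B) (@e_total _ _ _ B) (@e_dirac _ _ _ B)).
Qed.

End fredholm_module.
End sums.

(** * Lipschitz approximation on a compact set *)

Section lipschitz_approximation.
Variable R : realType.
Local Notation E := 'rV[R]_3.

(** McShane's formula with slope [C], for a function that is Lipschitz only up to the error [e];
    each value decreases by at most [e]. *)
Lemma real_lipschitz_approx (X : set E) (al : E -> R) (C e : R) : 0 <= C ->
  (forall x y, X x -> X y -> `|al y - al x| <= e + C * edist x y) ->
  exists b : E -> R, forall x, X x -> `|al x - b x| <= e /\
    forall y, X y -> `|b x - b y| <= C * edist x y.
Proof.
move=> C0 h; pose S x := [set al y + C * edist x y | y in X].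
have lb x : X x -> has_inf (S x).
  move=> xX; split; first by exists (al x + C * edist x x); exists x.
  exists (al x - e) => _ [y yX <-]; have := h y x yX xX; rewrite edistC.
  by rewrite ler_norml => /andP[_]; lra.
have L x y : X x -> X y -> inf (S x) <= inf (S y) + C * edist x y.
  move=> xX yX; rewrite -lerBlDr; apply: lb_le_inf; first exact: (lb _ yX).1.
  move=> _ [z zX <-]; rewrite lerBlDr; apply: (@le_trans _ _ (al z + C * edist x z)).
    by apply: ge_inf; [exact: (lb _ xX).2|exists z].
  by rewrite -addrA lerD2l -mulrDr ler_wpM2l // addrC; exact: edist_tri.
exists (fun x => inf (S x)) => x xX; split.
  have i1 : inf (S x) <= al x.
    by apply: ge_inf; [exact: (lb _ xX).2|exists x => //; rewrite edistxx mulr0 addr0].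
  have i2 : al x - e <= inf (S x).
    apply: lb_le_inf; first exact: (lb _ xX).1.
    move=> _ [y yX <-]; have := h y x yX xX; rewrite edistC.
    by rewrite ler_norml => /andP[_]; lra.
  by rewrite ger0_norm ?subr_ge0 //; lra.
by move=> y yX; have := L x y xX yX; have := L y x yX xX; rewrite (edistC y x) ler_norml; lra.
Qed.

Lemma lipschitz_approx (X : set E) a (e : R) : compact X -> CX X a -> 0 < e ->
  exists (b : E -> R[i]) (C : R), [/\ 0 <= C,
    forall x y, X x -> X y -> cmod (b x - b y) <= C * edist x y &
    forall x, X x -> cmod (a x - b x) <= e].
Proof.
move=> cX aX e0; have e2 : 0 < e / 2 by rewrite divr_gt0.
have [C C0 hC] := compact_modulus cX aX e2.
have [|p hp] := @real_lipschitz_approx X (fun x => Re (a x)) C (e / 2) C0.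
  by move=> x y xX yX; rewrite -raddfB (le_trans (Re_le_cmod _)) // hC.
have [|q hq] := @real_lipschitz_approx X (fun x => Im (a x)) C (e / 2) C0.
  by move=> x y xX yX; rewrite -raddfB (le_trans (Im_le_cmod _)) // hC.
exists (fun x => (p x +i* q x)%C), (2 * C); split; first exact: mulr_ge0.
- move=> x y xX yX; rewrite (le_trans (cmod_le _)) //=.
  by have := (hp x xX).2 y yX; have := (hq x xX).2 y yX; lra.
- move=> x xX; rewrite (le_trans (cmod_le _)) // [leRHS]splitr.
  have /= := hp x xX; have /= := hq x xX; case: (a x) => ? ? /= [h1 _] [h2 _].
  exact: lerD.
Qed.

Lemma CX_lipschitz (X : set E) (b : E -> R[i]) (C : R) : 0 <= C ->
  (forall x y, X x -> X y -> cmod (b x - b y) <= C * edist x y) -> CX X b.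
Proof.
move=> C0 hb; apply/CX_edist => x xX e e0; have C1 : 0 < C + 1 by rewrite ltr_wpDl.
exists (e / (C + 1)); first by rewrite divr_gt0.
move=> y yX xy; rewrite cmodB; apply: le_lt_trans (hb x y xX yX) _.
apply: (@le_lt_trans _ _ ((C + 1) * edist x y)).
  by rewrite ler_wpM2r ?edist_ge0 // lerDl.
by rewrite mulrC -ltr_pdivlMr.
Qed.

End lipschitz_approximation.

Lemma words_finite (T : finType) N : finite_set [set w : seq T | (size w < N)%N].
Proof.
apply: (@sub_finite_set _ _ (\bigcup_(n in `I_N) [set val w | w in [set: n.-tuple T]])).
  by move=> w /= wN; exists (size w) => //; exists (in_tuple w).
by apply: bigcup_finite => // n _; apply: finite_image; exact: finite_finset.
Qed.

(** * The module [ST]: spectral triple and metric *)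

Section spectral_triple.
Variable R : realType.
Local Notation E := 'rV[R]_3.
Variables (v : tetra R) (l : R) (s : ZPT_index -> R) (f : HSP -> int).
Hypothesis vl : regular v l.

Lemma SP_bounded a : CX (SP v) a -> exists2 C : R, 0 <= C & forall x, SP v x -> cmod (a x) <= C.
Proof. by move=> aX; exact: (compact_bounded_cmod (SP_compact vl) aX). Qed.

Definition UFMf_triangle h := if 0 < f h then DeltaH v h else reverse (DeltaH v h).

Lemma UFMf_edge_triangle h : edge_triangle v (size h.1).+1 (UFMf_triangle h).
Proof.
rewrite /UFMf_triangle; have H := Delta_edge_triangle v (HSP_index h).
by case: ifP => _ //; exact: edge_triangle_reverse.
Qed.

Definition ZPT_eigenbasis : eigenbasis (ZPT v s) :=
  sum_eigenbasis (fun d => UFM_eigenbasis vl (s d) (Delta_edge_triangle v d)).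

Definition UFMf_eigenbasis : eigenbasis (UFMf v s f) :=
  sum_eigenbasis (fun p : {h : HSP & 'I_`|f h|%N} =>
    UFM_eigenbasis vl (s (HSP_index (tag p))) (UFMf_edge_triangle (tag p))).

(** The [return] clause follows the boolean family inside [module_add], so that [sum_eigenbasis]
    applies to it. *)
Definition ST_parts (b : bool) : eigenbasis (if b then ZPT v s else UFMf v s f) :=
  if b return eigenbasis (if b then ZPT v s else UFMf v s f) then ZPT_eigenbasis else UFMf_eigenbasis.

Definition ST_eigenbasis : eigenbasis (ST v s f) := sum_eigenbasis ST_parts.

Lemma ZPT_good_rep : good_rep (SP v) (ZPT v s).
Proof. by apply: (sum_good_rep SP_bounded) => d; exact: (UFM_good_rep vl _ (Delta_edge_triangle v d)). Qed.

Lemma UFMf_good_rep : good_rep (SP v) (UFMf v s f).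
Proof. by apply: (sum_good_rep SP_bounded) => p; exact: (UFM_good_rep vl _ (UFMf_edge_triangle (tag p))). Qed.

Lemma ST_parts_good_rep (b : bool) : good_rep (SP v) (if b then ZPT v s else UFMf v s f).
Proof. by case: b; [exact: ZPT_good_rep|exact: UFMf_good_rep]. Qed.

Lemma ST_good_rep : good_rep (SP v) (ST v s f).
Proof. by apply: (sum_good_rep SP_bounded); exact: ST_parts_good_rep. Qed.

Let level_finite (C : R) : exists N, forall n, 2 ^+ n * (pi / (3 * l)) <= C -> (n < N)%N.
Proof.
have [l0 _] := vl; pose c := pi / (3 * l).
have c0 : 0 < c by rewrite divr_gt0 ?pi_gt0 // mulr_gt0.
exists (Num.bound `|C / c|) => n; rewrite -/c -ler_pdivlMr // => h.
rewrite -(ltr_nat R); apply: (@le_lt_trans _ _ (2 ^+ n)).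
  by rewrite -natrX ler_nat ltnW // ltn_expl.
by apply: (le_lt_trans h); apply: (le_lt_trans (ler_norm _)); apply: archi_boundP.
Qed.

Lemma ST_lam_finite : lam_finite ST_eigenbasis.
Proof.
apply: sum_lam_finite => [|C]; last exact: finite_finset.
case; apply: sum_lam_finite => [k|C].
- exact: UFM_lam_finite.
- have [N hN] := level_finite C.
  apply: (@sub_finite_set _ _ ([set inl k | k in [set: 'I_4]] `|`
    \bigcup_(w in [set w : seq 'I_4 | (size w < N)%N]) [set inr (w, k) | k in [set: 'I_4 + 'I_4]])).
    move=> [k|[w k]] /= [i hi]; [left; exists k => //|right].
    exists w; last by exists k.
    have h := le_trans (@UFM_lam_ge _ _ _ vl (s (inr (w, k))) _ _ (Delta_edge_triangle v (inr (w, k))) i) hi.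
    exact: ltnW (hN _ h).
  rewrite finite_setU; split; first by apply: finite_image; exact: finite_finset.
  apply: bigcup_finite => [|w _]; first exact: words_finite.
  by apply: finite_image; exact: finite_finset.
- exact: UFM_lam_finite.
- have [N hN] := level_finite C.
  apply: (@sub_finite_set _ _ (\bigcup_(w in [set w : seq 'I_4 | (size w < N)%N])
    \bigcup_(k in [set: 'I_3]) [set Tagged (fun h : HSP => 'I_`|f h|%N) i |
       i in [set: 'I_`|f (w, k)|%N]])).
    move=> [[w k] j] /= [i hi]; exists w; last by exists k => //; exists j.
    have h := le_trans (@UFM_lam_ge _ _ _ vl (s (HSP_index (w, k))) _ _ (UFMf_edge_triangle (w, k)) i) hi.
    exact: ltnW (hN _ h).
  apply: bigcup_finite => [|w _]; first exact: words_finite.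
  apply: bigcup_finite => [|k _]; first exact: finite_finset.
  by apply: finite_image; exact: finite_finset.
Qed.

Lemma ST_commutator_le a (L : R) : CX (SP v) a -> 0 <= L ->
  (forall n T, edge_triangle v n T -> forall x y,
     cmod (a (arclength T x) - a (arclength T y)) <= L * `|x - y|) ->
  commutator_le (ST v s f) a L.
Proof.
move=> aX L0 aL; apply: (sum_commutator_le SP_bounded ST_parts_good_rep) => //.
case.
  apply: (sum_commutator_le SP_bounded) => // d.
    exact: (UFM_good_rep vl _ (Delta_edge_triangle v d)).
  by apply: (UFM_commutator_le vl (Delta_edge_triangle v d)) => //; exact: aL (Delta_edge_triangle v d).
apply: (sum_commutator_le SP_bounded) => // p.
  exact: (UFM_good_rep vl _ (UFMf_edge_triangle (tag p))).
by apply: (UFM_commutator_le vl (UFMf_edge_triangle (tag p))) => //; exact: aL (UFMf_edge_triangle (tag p)).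
Qed.

Lemma ST_commutator_lip a (L : R) : CX (SP v) a -> 0 <= L -> commutator_le (ST v s f) a L ->
  forall d x y, cmod (a (arclength (Delta v d) x) - a (arclength (Delta v d) y)) <= L * `|x - y|.
Proof.
move=> aX L0 h d; apply: (UFM_commutator_lip vl (s := s d) (Delta_edge_triangle v d)) => //.
have D0 b : dirac (if b then ZPT v s else UFMf v s f) 0 0 by exact: eigenbasis_dirac0 (ST_parts b).
have hZ := commutator_le_sum SP_bounded ST_parts_good_rep D0 aX h (k := true).
apply: (commutator_le_sum SP_bounded _ _ aX hZ) => {}d.
  exact: (UFM_good_rep vl _ (Delta_edge_triangle v d)).
exact: eigenbasis_dirac0 (UFM_eigenbasis vl (s d) (Delta_edge_triangle v d)).
Qed.

Lemma ST_fredholm_module : unbounded_fredholm_module (SP v) (ST v s f).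
Proof.
apply: (eigenbasis_fredholm_module ST_lam_finite ST_good_rep) => a e aX e0.
have [b [C [C0 bL ab]]] := lipschitz_approx (SP_compact vl) aX e0.
have bX := CX_lipschitz C0 bL; exists b; split => //; exists C.
apply: ST_commutator_le => // n T Tn x y.
have TS z : SP v (arclength T z) by exact: (edge_triangle_SP vl) Tn.
rewrite (le_trans (bL _ _ (TS x) (TS y))) // ler_wpM2l //.
exact: (arclength_lip (edge_triangle_equilateral vl Tn)).
Qed.

Lemma cmod_le_geodesic a x y : CX (SP v) a ->
  (forall d r t, cmod (a (arclength (Delta v d) r) - a (arclength (Delta v d) t)) <= `|r - t|) ->
  ((cmod (a x - a y))%:E <= geodesic_dist (SP v) x y)%E.
Proof.
move=> aX aD; apply: le_ereal_inf_tmp => _ [g [cg gS gx gy _] <-]; rewrite -gx -gy.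
apply: (lipschitz_le_length vl) => // w i j.
have [->|ij] := eqVneq i j; first by rewrite subrr cmod0 edist_ge0.
have := lip_edge_sub vl aD w ij; move=> /(_ 0 1).
rewrite !lexx ler01 => /(_ isT isT).
by rewrite scale0r addr0 scale1r [_ + (_ - _)]addrC subrK sub0r normrN normr1 mul1r.
Qed.

(** The inequalities close up: [geodesic_dist <= lip_dist <= spectral_dist <= geodesic_dist], the
    middle one by testing with the distance from [x]. *)
Lemma ST_spectral_dist x y : SP v x -> SP v y ->
  spectral_dist (SP v) (ST v s f) x y = geodesic_dist (SP v) x y.
Proof.
move=> xS yS; apply/eqP; rewrite eq_le; apply/andP; split.
  apply: ge_ereal_sup => _ [a [aX a1] <-]; rewrite -cmodE /=.
  apply: cmod_le_geodesic => // d r t.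
  by have := ST_commutator_lip aX ler01 a1 d r t; rewrite mul1r.
apply: le_trans (geodesic_le_lip_dist vl xS yS) _.
pose a z := ((lip_dist v x z)%:C : R[i])%C.
have aX : CX (SP v) a by exact: (CX_lip_dist vl).
apply: (@le_trans _ _ ((Re `|a x - a y|)%:E)).
  rewrite lee_fin -cmodE /= -real_complexB cmod_real (lip_dist_self xS) sub0r normrN.
  exact: ler_norm.
apply: ereal_sup_ubound; exists a => //; split => //.
apply: ST_commutator_le => // n T Tn r t.
by rewrite mul1r -real_complexB cmod_real (lip_dist_arclength vl r t xS Tn).
Qed.

(** Such an [a] vanishes along all triangles, and so do its multiples. The bound of
    [cmod_le_geodesic] then holds for every multiple, against the finite distance from [x] to a
    point [y] of a triangle. *)
Lemma ST_faithful : faithful (SP v) (ST v s f).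
Proof.
move=> a aX a0 x xS.
have Za0 (xi : hilb (ZPT v s)) : rep (ZPT v s) a xi = 0.
  exact: (@sum_rep_embed _ _ _ SP_bounded _ _ ST_parts_good_rep a true xi aX (a0 _)).
have aD d r : a (arclength (Delta v d) r) = 0.
  apply: (UFM_faithful vl (s := s d) (Delta_edge_triangle v d) aX) => xi.
  apply: (@sum_rep_embed _ _ _ SP_bounded _ _ _ a d xi aX (Za0 _)).
  by move=> k; exact: (UFM_good_rep vl _ (Delta_edge_triangle v k)).
set y := arclength (Delta v (inl ord0)) 0.
have yS : SP v y by apply: (edge_triangle_SP vl); exact: (Delta_edge_triangle v (inl ord0)).
apply/eqP; rewrite -cmod_eq0 eq_le cmod_ge0 andbT leNgt; apply/negP => ax.
(* With this factor [|c a(x)|] exceeds [lip_dist v x y] by 1. *)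
pose c := (lip_dist v x y + 1) / cmod (a x).
have c0 : 0 <= c.
  rewrite divr_ge0 ?cmod_ge0 // addr_ge0 //; rewrite -lee_fin.
  apply: le_trans (geodesic_le_lip_dist vl xS yS).
  have aX0 := @CX_cst R _ (SP v) 0.
  by have := cmod_le_geodesic x y aX0; rewrite subrr cmod0; apply.
have := @cmod_le_geodesic (fun z => c%:C%C * a z) x y (CX_mul (@CX_cst _ _ _ _) aX).
rewrite /= !aD !mulr0 subr0 cmodM cmod_real (ger0_norm c0) divfK ?gt_eqF // => h.
have : ((lip_dist v x y + 1)%:E <= (lip_dist v x y)%:E)%E.
  apply: le_trans (geodesic_le_lip_dist vl xS yS); apply: h => d r t.
  by rewrite !aD subrr cmod0.
by rewrite lee_fin gerDl ler10.
Qed.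

End spectral_triple.

(** * The index map *)

Lemma big_seq_sub (V : nmodType) (K : choiceType) (s : seq K) (F : K -> V) : uniq s ->
  \sum_(k : seq_sub s) F (val k) = \sum_(k <- s) F k.
Proof.
move=> us; rewrite -[in RHS](val_seq_sub_enum us) big_map; apply: perm_big.
apply: uniq_perm; first exact: index_enum_uniq.
  by rewrite -(map_inj_uniq val_inj) val_seq_sub_enum.
by move=> k; rewrite mem_index_enum mem_seq_sub_enum.
Qed.

Lemma card_seq_sub_tagged (K : choiceType) (s : seq K) (m : K -> nat) : uniq s ->
  #|{: {k : seq_sub s & 'I_(m (val k))}}| = (\sum_(k <- s) m k)%N.
Proof.
move=> us; rewrite card_tagged sumnE big_map big_enum /= -(big_seq_sub _ us).
by apply: eq_bigr => k _; rewrite card_ord.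
Qed.

(** The finitely many members of [s] may need constants of their own; all the others share [C0]. *)
Lemma uniform_bound (R : realType) (K : eqType) (s : seq K) (P : K -> R -> Prop) (C0 : R) :
  (forall k C C', P k C -> C <= C' -> P k C') ->
  (forall k, exists2 C : R, 0 <= C & P k C) -> (forall k, k \notin s -> P k C0) ->
  exists2 C : R, 0 <= C & forall k, P k C.
Proof.
move=> mono h out.
have [C C1 hC] : exists2 C : R, 0 <= C & forall k, k \in s -> P k C.
  elim: s {out} => [|k s [C C1 hC]]; first by exists 0.
  have [D D1 hD] := h k; exists (C + D); first exact: addr_ge0.
  move=> j; rewrite inE => /predU1P[->|js]; first by apply: mono hD _; rewrite lerDr.
  by apply: mono (hC _ js) _; rewrite lerDl.
exists (C + `|C0|); first by rewrite addr_ge0.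
move=> k; have [ks|ks] := boolP (k \in s); first by apply: mono (hC _ ks) _; rewrite lerDl.
by apply: mono (out _ ks) _; rewrite (le_trans (ler_norm _)) // lerDr.
Qed.

Section index_of_sum.
Variables (R : realType) (E : topologicalType) (X : set E).
Hypothesis X_bounded : forall a, CX X a ->
  exists2 C : R, 0 <= C & forall x, X x -> cmod (a x) <= C.

Definition toeplitz_index (M : moduleData R E) (B : eigenbasis M) a (z : int) := exists C m n,
  [/\ 0 <= C, Fred (pos_space B) (toeplitz B a) C 'I_m 'I_n & m%:Z - n%:Z = z].

Lemma toeplitz_fredholm_index (M : moduleData R E) (B : eigenbasis M) a z : CX X a -> good_rep X M ->
  toeplitz_index B a z -> fredholm_index (pos_space B) (toeplitz B a) z.
Proof.
move=> aX [[_ rb _ _ _] _] [C [m [n [C0 F <-]]]].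
apply: (Fred_index (@pos_space0 _ _ _ B) (@pos_space_lin _ _ _ B) _ F).
by move=> c x y; rewrite /toeplitz (rb _ aX).1 pos_proj_linear.
Qed.

Lemma sum_toeplitz_index (K : countType) (M : K -> moduleData R E)
    (B : forall k, eigenbasis (M k)) a (C : R) (m n : K -> nat) (s : seq K) :
  (forall k, good_rep X (M k)) -> CX X a -> 0 <= C -> uniq s ->
  (forall k, k \notin s -> m k = 0%N /\ n k = 0%N) ->
  (forall k, Fred (pos_space (B k)) (toeplitz (B k) a) C 'I_(m k) 'I_(n k)) ->
  toeplitz_index (sum_eigenbasis B) a (\sum_(k <- s) ((m k)%:Z - (n k)%:Z)).
Proof.
move=> Mg aX C0 us mn F; have := Fred_ord (sum_Fred X_bounded Mg aX C0 mn F).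
rewrite !card_seq_sub_tagged // => {}F.
by exists C, (\sum_(k <- s) m k)%N, (\sum_(k <- s) n k)%N; split => //; rewrite sumrB -!(big_morph Posz PoszD (erefl _)).
Qed.

Lemma sum2_toeplitz_index (M : bool -> moduleData R E) (B : forall b, eigenbasis (M b)) a z1 z2 :
  (forall b, good_rep X (M b)) -> CX X a ->
  toeplitz_index (B true) a z1 -> toeplitz_index (B false) a z2 ->
  toeplitz_index (sum_eigenbasis B) a (z1 + z2).
Proof.
move=> Mg aX [C1 [m1 [n1 [C10 F1 <-]]]] [C2 [m2 [n2 [C20 F2 <-]]]].
have := @sum_toeplitz_index _ M B a (C1 + C2) (fun b => if b then m1 else m2)
  (fun b => if b then n1 else n2) [:: true; false] Mg aX (addr_ge0 C10 C20) isT.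
rewrite !big_cons big_nil addr0; apply; first by case.
by case; [apply: FredW F1; rewrite lerDl|apply: FredW F2; rewrite lerDr].
Qed.

End index_of_sum.

(** * The index of [ST] as a sum of winding numbers *)

Section winding_pairing.
Variable R : realType.
Local Notation E := 'rV[R]_3.
Variables (v : tetra R) (l : R) (s : ZPT_index -> R) (f : HSP -> int).
Hypothesis vl : regular v l.
Variable u : E -> R[i].
Hypotheses (uX : CX (SP v) u) (u1 : forall x, SP v x -> cmod (u x) = 1).

Let vtx1_SP n T : edge_triangle v n T -> SP v (vtx1 T).
Proof.
move=> Tn; have := edge_triangle_SP vl 0 Tn.
have := @arclength_edge1 _ _ _ (edge_triangle_equilateral vl Tn) 0.
by rewrite lexx ler01 mul0r scale0r addr0 => ->.
Qed.

(** A triangle of level [n] stays within [2 l / 2^n] of its first vertex; [1/2] is the tolerance of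
    [UFM_Fred_near_cst]. *)
Lemma small_triangles : exists N, forall n T, edge_triangle v n T -> (N <= n)%N ->
  forall x, cmod (u (arclength T x) - u (vtx1 T)) <= 2^-1.
Proof.
have h2 : 0 < (2^-1 : R) by rewrite invr_gt0.
have [d d0 hd] := compact_unif_continuous (SP_compact vl) uX h2.
have d2 : 0 < d / 2 by rewrite divr_gt0.
have [N hN] := small_cells vl d2; have [l0 _] := vl.
exists N => n T Tn Nn x; have Td := edge_triangle_equilateral vl Tn.
apply/ltW/hd; [exact: vtx1_SP Tn|exact: (edge_triangle_SP vl) Tn|].
apply: ball_edist; apply: le_lt_trans (arclength_near x Td) _.
rewrite mulrC -ltr_pdivlMr //; apply: le_lt_trans hN.
by rewrite ler_pM2l // lef_pV2 ?posrE ?exprn_gt0 // ler_weXn2l // ler1n.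
Qed.

Section families.
Variables (N : nat) (ws : seq (seq 'I_4)).
Hypothesis N_small : forall n T, edge_triangle v n T -> (N <= n)%N ->
  forall x, cmod (u (arclength T x) - u (vtx1 T)) <= 2^-1.
Hypotheses (ws_uniq : uniq ws) (ws_all : forall w, (size w < N)%N -> w \in ws).

Let small_winding n T (r : R) (Tn : edge_triangle v n T) : (N <= n)%N -> winding u T = 0 /\
  Fred (pos_space (UFM_eigenbasis vl r Tn)) (toeplitz (UFM_eigenbasis vl r Tn) u) 2 'I_0 'I_0.
Proof.
move=> Nn; apply: (@UFM_Fred_near_cst _ _ _ vl r n T Tn u (u (vtx1 T))) => //; first exact: u1 (vtx1_SP Tn).
exact: N_small Tn Nn.
Qed.

Lemma winding_deep h : (N <= (size h.1).+1)%N -> winding u (DeltaH v h) = 0.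
Proof. by move=> Nh; have [] := small_winding 0 (Delta_edge_triangle v (HSP_index h)) Nh. Qed.

(** Outside [ks] the triangles are small: their constant is 2 and they have neither kernel nor
    cokernel. The finitely many others complete the common constant, and their indices are minus
    their winding numbers. *)
Lemma family_toeplitz_index (K : countType) (n : K -> nat) (T : K -> triangle R)
    (Tn : forall k, edge_triangle v (n k) (T k)) (r : K -> R) (ks : seq K) :
  uniq ks -> (forall k, k \notin ks -> (N <= n k)%N) ->
  toeplitz_index (sum_eigenbasis (fun k => UFM_eigenbasis vl (r k) (Tn k))) u
    (- \sum_(k <- ks) winding u (T k)).
Proof.
move=> uks out; pose wd k := winding u (T k).
pose F k C := Fred (pos_space (UFM_eigenbasis vl (r k) (Tn k)))
  (toeplitz (UFM_eigenbasis vl (r k) (Tn k)) u) C 'I_(ker_dim (wd k)) 'I_(coker_dim (wd k)).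
have F2 k : k \notin ks -> F k 2.
  by move=> kn; have [w0 h] := small_winding (r k) (Tn k) (out k kn); rewrite /F /wd w0.
have [C C0 hC] := uniform_bound (P := F) (fun k C C' h CC => FredW CC h)
  (fun k => UFM_Fred vl (r k) (Tn k) uX u1) F2.
have := sum_toeplitz_index (SP_bounded vl) (fun k => UFM_good_rep vl (r k) (Tn k)) uX C0 uks _ hC.
under eq_bigr do rewrite ker_coker_dim.
rewrite sumrN; apply => k kn.
by have [w0 _] := small_winding (r k) (Tn k) (out k kn); rewrite /wd w0.
Qed.

Lemma ZPT_toeplitz_index : toeplitz_index (ZPT_eigenbasis s vl) u 0.
Proof.
pose ks : seq ZPT_index := [seq inl k | k <- enum 'I_4] ++
  [seq inr (w, k) | w <- ws, k <- enum {: 'I_4 + 'I_4}].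
have uks : uniq ks.
  rewrite cat_uniq map_inj_uniq ?enum_uniq; last by move=> i j [].
  rewrite allpairs_uniq ?enum_uniq //=; last by move=> [w k] [w' k'] _ _ [-> ->].
  by rewrite andbT; apply/hasPn => _ /allpairsP[[w k] [_ _ ->]]; apply/mapP => -[].
have out d : d \notin ks -> (N <= level d)%N.
  case: d => [k|[w k]]; rewrite mem_cat negb_or => /andP[].
    by rewrite map_f // mem_enum.
  move=> _; apply: contraR; rewrite -ltnNge => /ltnW wN.
  by apply/allpairsP; exists (w, k); rewrite mem_enum ws_all.
have := family_toeplitz_index (Delta_edge_triangle v) s uks out.
(* The list [ks] consists of the faces of [v] and of whole octahedra, so the winding numbers cancel
   over the former and for each word [w]. *)
rewrite (_ : - _ = 0) //; rewrite big_cat big_map big_enum big_allpairs_dep /= (winding_faces vl uX u1).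
rewrite big1 ?addr0 ?oppr0 // => w _; rewrite big_enum /= big_sumType.
exact: (winding_octa_faces vl uX u1).
Qed.

Lemma UFMf_toeplitz_index : toeplitz_index (UFMf_eigenbasis s f vl) u
  (- \sum_(h <- [seq (w, k) | w <- ws, k <- enum 'I_3]) f h * winding u (DeltaH v h)).
Proof.
set hs := [seq (w, k) | w <- ws, k <- enum 'I_3].
pose ps := [seq Tagged (fun h : HSP => 'I_`|f h|%N) i | h <- hs, i <- enum 'I_`|f h|%N].
have uhs : uniq hs by apply: allpairs_uniq; rewrite ?enum_uniq // => -[w k] [w' k'].
have ups : uniq ps.
  apply: allpairs_uniq_dep => // [h _|]; first exact: enum_uniq.
  by move=> [h i] [h' i'] _ _.
have out p : p \notin ps -> (N <= (size (tag p).1).+1)%N.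
  case: p => [[w k] i]; apply: contraR; rewrite -ltnNge => /ltnW wN.
  apply/allpairsPdep; exists (w, k), i; rewrite mem_enum; split => //.
  by apply/allpairsP; exists (w, k); rewrite mem_enum ws_all.
have := @family_toeplitz_index _ _ _ (fun p : {h : HSP & 'I_`|f h|%N} => UFMf_edge_triangle v f (tag p))
  (fun p => s (HSP_index (tag p))) ps ups out.
rewrite big_allpairs_dep /= (eq_bigr (fun h => f h * winding u (DeltaH v h))) // => h _.
(* The [|f h|] copies carry the sign of [f h] through their orientation, so both cases give [f h]
   times the winding number. *)
rewrite big_enum /= sumr_const card_ord /UFMf_triangle.
have [fh|fh] := ltP 0 (f h); first by rewrite -mulr_natl natz gtz0_abs.
rewrite (winding_reverse vl uX u1 (Delta_edge_triangle v (HSP_index h))).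
by rewrite -mulr_natl natz lez0_abs // mulrNN.
Qed.

End families.

Lemma ST_toeplitz_index : exists hs : seq HSP, [/\ uniq hs,
  forall h, h \notin hs -> winding u (DeltaH v h) = 0 &
  toeplitz_index (ST_eigenbasis s f vl) u (- \sum_(h <- hs) f h * winding u (DeltaH v h))].
Proof.
have [N hN] := small_triangles.
have /finite_seqP[ws0 hws] := words_finite 'I_4 N.
pose ws := undup ws0.
have wsE w : (size w < N)%N -> w \in ws.
  by move=> wN; rewrite mem_undup; have : [set` ws0] w by rewrite -hws.
exists [seq (w, k) | w <- ws, k <- enum 'I_3]; split.
- by apply: allpairs_uniq; rewrite ?enum_uniq ?undup_uniq // => -[w k] [w' k'].
- move=> [w k] wn; apply: (winding_deep hN) => /=; apply: contraR wn; rewrite -ltnNge => /ltnW wN.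
  by apply/allpairsP; exists (w, k); rewrite mem_enum wsE.
rewrite -[- _]add0r; apply: (sum2_toeplitz_index (SP_bounded vl)) => //.
- exact: (ST_parts_good_rep _ _ vl).
- exact: (ZPT_toeplitz_index hN (undup_uniq _) wsE).
- exact: (UFMf_toeplitz_index hN (undup_uniq _) wsE).
Qed.

End winding_pairing.

Lemma ST_K1_class (R : realType) (v : tetra R) (l : R) (s : ZPT_index -> R) (f : HSP -> int) :
  regular v l -> K1_class v (ST v s f) f.
Proof.
move=> vl; pose B := ST_eigenbasis s f vl.
exists (spectral_proj (ev B) (elam B)); first exact: eigenbasis_spectral_resolution.
move=> P0 u uX u1.
have {}u1 x : SP v x -> cmod (u x) = 1.
  by move=> /u1 h; have := congr1 (@Re R) (etrans (cmodE (u x)) h).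
have [hs [uhs hs0 idx]] := ST_toeplitz_index s f vl uX u1; split.
  apply: (@sub_finite_set _ _ [set` hs]); last exact: finite_seq.
  by move=> h /= wh; apply: contraNT wh => /hs0 ->.
have := toeplitz_fredholm_index uX (ST_good_rep s f vl) idx.
rewrite -(range_pos_proj B) (fsbig_seq _ _ uhs) (fsbig_widen [set` hs] setT) //.
by move=> h [_ /= hn]; rewrite hs0 ?mulr0 //; apply/negP.
Qed.

Theorem theorem6p4 (R : realType) (v : tetra R) (s : ZPT_index -> R)
  (f : HSP -> int) : pyramid v ->
  [/\ spectral_triple (SP v) (ST v s f),
      forall x y, SP v x -> SP v y ->
        spectral_dist (SP v) (ST v s f) x y = geodesic_dist (SP v) x y
    & K1_class v (ST v s f) f].
Proof.
move=> [v_edges _ _]; have vl : regular v (2 * pi / 3).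
  by split => //; rewrite divr_gt0 // mulr_gt0 // pi_gt0.
split; last exact: ST_K1_class vl.
- by split; [exact: ST_fredholm_module vl|exact: ST_faithful vl].
- by move=> x y; exact: (ST_spectral_dist s f vl).
Qed.
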